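(* Let $S := V(f_A) \subset \mathbb{RP}^3$ be a quartic spectrahedral symmetroid, and suppose that the complex symmetroid $V_{\mathbb C}(f_A) \subset \mathbb{CP}^3$ is rational. Let $a \ge 0$ denote the number of real, isolated nodes on $S$, and let $0 \le b \le a$ denote the number of these nodes that lie on the boundary of the spectrahedron. (A) If $V_{\mathbb C}(f_A)$ is of type A, then $S$ has a triple point on the boundary of the spectrahedron and $0 \le b \le a \le 6$, with $a$ even. (B) If $V_{\mathbb C}(f_A)$ is of type B, then either (B.1) $S$ has a tacnode on the boundary of the spectrahedron, or (B.2) $S$ has a tacnode disjoint from the spectrahedron. In either case, $0 \le b \le a \le b+2 \le 6$, with $a$ and $b$ both even. (C) If $V_{\mathbb C}(f_A)$ is of type C, then either (C.1) $S$ is singular along a smooth conic section with a real point that lies on the boundary of the spectrahedron, and $0 \le b \le a \le b+2 \le 4$, with $a$, $b$ both even and $a \ge 2$; or (C.2) $S$ is singular along a smooth conic section with a real point that is disjoint from the spectrahedron, and $a = b = 2$ or $a = b = 4$; or (C.3) $S$ is singular along a smooth conic section with no real points, and $a = b = 2$. (D) If $V_{\mathbb C}(f_A)$ is of type D, then $S$ has rank $2$ along a line disjoint from the boundary of the spectrahedron, and $0 \le b \le a \le b+2 \le 6$, with $a$ and $b$ both even. (F) If $V_{\mathbb C}(f_A)$ is of type F, then either (F.1) $S$ is singular of rank $3$ along two complex conjugate intersecting lines whose intersection point lies on the boundary of the spectrahedron, or (F.2) $S$ is singular of rank $3$ along two complex conjugate intersecting lines whose intersection point is disjoint from the spectrahedron.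 In either case, $0 \le a = b \le 2$, with $a=b$ even.
   Context: Let $A(x) = A_0x_0 + A_1x_1 + A_2x_2 + A_3x_3$ with each $A_i$ a real symmetric $4\times 4$ matrix, and $f_A(x) = \det A(x)$. The quartic surface $V(f_A) \subset \mathbb{RP}^3$ is called a (real, quartic) symmetroid, and $V_{\mathbb C}(f_A)\subset\mathbb{CP}^3$, defined by the same polynomial, the complex symmetroid. Complex quartic symmetroids in general are defined in the same way with complex symmetric $A_i$. The real symmetroid $V(f_A)$ is spectrahedral if $A(x_p)$ is definite for some real point $x_p$. The spectrahedron is the set of real points at which $A(x)$ is semidefinite (positive or negative, as projective points are taken up to scaling); its boundary consists of the points of $V(f_A)$ at which $A(x)$ is semidefinite. ''$S$ is singular along'' a curve, or ''has rank $k$ along'' a curve, refers to the (possibly non-real) curve in $\mathbb{CP}^3$ lying on $V_{\mathbb C}(f_A)$. A point $x_p \in V_{\mathbb C}(f_A)$ is a rank-$k$-point if $A(x_p)$ has rank $k$; the symmetroid has rank $k$ along a curve if the points of the curve are rank-$k$-points. For $y = (y_0,y_1,y_2,y_3)$ let $Q_A(x_p) \subset \mathbb{CP}^3_y$ be the quadric surface defined by $y\cdot A(x_p)\cdot y^T = 0$; the web of quadrics is $Q_A(x) = \{Q_A(x_p) \mid x_p\in\mathbb{CP}^3\}$, and a basepoint of the web is a point common to all these quadrics. A node is a quadratic (ordinary double point) singularity. An isolated node always means one that is a rank-2-point. A tacnode of a surface is an elliptic double point locally analytically of the form $w^2 = g(u,v)$ where $g$ has order $4$ with initial form having distinct roots.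 Types of complex quartic symmetroids. The types describe the general members of the families in question: the listed additional nodes are isolated rank-2-points, and surfaces that have further nodes or in which some of these singularities coincide are non-general members and are not of these types. Type A: $V_{\mathbb C}(f_A)$ has a triple point and six additional nodes. Type B: $V_{\mathbb C}(f_A)$ has a tacnode and six additional nodes, and the web $Q_A(x)$ has two basepoints. Type C: $V_{\mathbb C}(f_A)$ is singular along a (smooth) conic, of rank 2 along it, and has four additional nodes, and the web $Q_A(x)$ has four linearly independent basepoints. Type D: $V_{\mathbb C}(f_A)$ has rank $2$ along a line and has six additional nodes, and the web $Q_A(x)$ has four coplanar basepoints. Type F: $V_{\mathbb C}(f_A)$ is singular of rank $3$ along two lines intersecting in a rank-2-point, with two additional, isolated nodes. *)

(* Defs.v *)
From HB Require Import structures.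
From mathcomp Require Import all_boot all_order all_algebra.
From mathcomp Require Import complex mpoly.
From mathcomp Require Import reals.

Set Implicit Arguments.
Unset Strict Implicit.
Unset Printing Implicit Defensive.

Import Order.TTheory GRing.Theory Num.Theory.

Local Open Scope ring_scope.

(* Points of P^3(K) are nonzero row vectors 'rV[K]_4 up to scaling; two of
   them are the same point when (x == y)%MS.  The predicates on points below
   are invariant under scaling. *)

Definition nb_points (K : fieldType) (P : 'rV[K]_4 -> Prop) (n : nat) : Prop :=
  exists s : seq 'rV[K]_4,
    [/\ size s = n,
        all (fun x => x != 0) s,
        pairwise (fun x y => ~~ (x == y)%MS) s &
        forall x, x != 0 -> (P x <-> has (fun y => (x == y)%MS) s)].

(* The projective line spanned by the two rows of E. *)
Definition on_line (K : fieldType) (E : 'M[K]_(2, 4)) (x : 'rV[K]_4) : Prop :=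
  x != 0 /\ (x <= E)%MS.

(* The conic u Q u^T = 0 in the plane with coordinates u spanned by the three
   rows of E. *)
Definition on_conic (K : fieldType) (E : 'M[K]_(3, 4)) (Q : 'M[K]_3)
    (x : 'rV[K]_4) : Prop :=
  x != 0 /\ exists u : 'rV[K]_3, x = u *m E /\ u *m Q *m u^T = 0.

Definition smooth_conic (K : fieldType) (E : 'M[K]_(3, 4)) (Q : 'M[K]_3) :
    Prop :=
  [/\ row_free E, Q^T = Q & Q \in unitmx].

Definition fps (K : fieldType) (n : nat) := 'X_{1..n} -> K.

Definition fps_trunc (K : fieldType) (n N : nat) (s : fps K n) :
    {mpoly K[n]} :=
  \sum_(m : 'X_{1..n < N}) s m *: 'X_[m].

(* Congruence modulo the N-th power of the ideal (X_0, ..., X_(n-1)). *)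
Definition eq_upto (K : fieldType) (n N : nat) (p q : {mpoly K[n]}) : Prop :=
  forall m : 'X_{1..n}, (mdeg m < N)%N -> p@_m = q@_m.

Definition singular_point (K : fieldType) (f : {mpoly K[4]}) (p : 'rV[K]_4) :
    Prop :=
  [/\ p != 0, f.@[p 0] = 0 & forall k, (f^`M(k)).@[p 0] = 0].

Definition singular_along (K : fieldType) (f : {mpoly K[4]})
    (curve : 'rV[K]_4 -> Prop) : Prop :=
  forall x, curve x -> singular_point f x.

(* Equation of f = 0 in the affine chart x_i = p_i (for p_i != 0), in
   coordinates centred at p. *)
Definition local_eq (K : fieldType) (f : {mpoly K[4]}) (p : 'rV[K]_4)
    (i : 'I_4) : {mpoly K[3]} :=
  f \mPo [tuple (p 0 k)%:MP + (if unlift i k is Some j then 'X_j else 0)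
         | k < 4].

Definition mult_at0 (K : fieldType) (F : {mpoly K[3]}) (d : nat) : Prop :=
  (forall m : 'X_{1..3}, (mdeg m < d)%N -> F@_m = 0) /\
  (exists m : 'X_{1..3}, mdeg m = d /\ F@_m != 0).

Definition triple_point (K : fieldType) (f : {mpoly K[4]}) (p : 'rV[K]_4) :
    Prop :=
  exists i : 'I_4, p 0 i != 0 /\ mult_at0 (local_eq f p i) 3.

Definition node (K : fieldType) (f : {mpoly K[4]}) (p : 'rV[K]_4) : Prop :=
  exists i : 'I_4, p 0 i != 0 /\
    let F := local_eq f p i in
    mult_at0 F 2 /\
    \det (\matrix_(j < 3, k < 3) ((F^`M(j))^`M(k))@_0%MM) != 0.

(* "Locally analytically" is read as in Hartshorne I.5 (analytic isomorphism of
   points: isomorphism of complete local rings): there are formal coordinates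
   u, v, w at p and a unit e with F = e * (w^2 - g(u, v)) in K[[X_0, X_1, X_2]].
   This identity is stated modulo each power of the maximal ideal. *)
Definition tacnode (K : fieldType) (f : {mpoly K[4]}) (p : 'rV[K]_4) : Prop :=
  exists i : 'I_4, p 0 i != 0 /\
  exists (u v w e : fps K 3) (g : fps K 2),
    [/\ [/\ u 0%MM = 0, v 0%MM = 0 & w 0%MM = 0],
        \det (\matrix_(j < 3, k < 3)
               (tnth [tuple u; v; w] j) U_(k)%MM) != 0,
        e 0%MM != 0,
        (forall m : 'X_{1..2}, (mdeg m < 4)%N -> g m = 0) /\
        (exists a b : 'I_4 -> K,
          \sum_(m : 'X_{1..2 < 5} | mdeg m == 4) g m *: 'X_[m] =
            \prod_(k < 4) (a k *: 'X_ord0 + b k *: 'X_ord_max)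
            :> {mpoly K[2]} /\
          forall k l, k != l -> a k * b l - a l * b k != 0) &
        forall N : nat,
          eq_upto N (local_eq f p i)
            (fps_trunc N e *
              (fps_trunc N w ^+ 2 -
               (fps_trunc N g \mPo [tuple fps_trunc N u; fps_trunc N v])))].

Definition irreducible_mpoly (K : fieldType) (n : nat) (p : {mpoly K[n]}) :
    Prop :=
  [/\ p != 0, p \isn't a GRing.unit &
      forall q r : {mpoly K[n]}, p = q * r ->
        q \is a GRing.unit \/ r \is a GRing.unit].

Definition dvd_mpoly (K : fieldType) (n : nat) (p q : {mpoly K[n]}) : Prop :=
  exists r : {mpoly K[n]}, q = r * p.

(* The surface f = 0 is irreducible and birational to P^2: there are rational
   maps phi from P^2 to the surface and psi from the surface to P^2, given by
   forms, whose composites are defined and equal to the identity. *)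
Definition rational_surface (K : fieldType) (f : {mpoly K[4]}) : Prop :=
  irreducible_mpoly f /\
  exists (d e : nat) (phi : 4.-tuple {mpoly K[3]}) (psi : 3.-tuple {mpoly K[4]}),
    [/\ (forall k, tnth phi k \is d.-homog) /\
        (forall k, tnth psi k \is e.-homog),
        f \mPo phi = 0,
        (exists i, tnth psi i \mPo phi != 0) /\
        (forall i j, (tnth psi i \mPo phi) * 'X_j =
                     (tnth psi j \mPo phi) * 'X_i) &
        (exists i, ~ dvd_mpoly f (tnth phi i \mPo psi)) /\
        (forall i j, dvd_mpoly f ((tnth phi i \mPo psi) * 'X_j -
                                  (tnth phi j \mPo psi) * 'X_i))].

Definition web_mx (K : fieldType) (A : 'I_4 -> 'M[K]_4) (x : 'rV[K]_4) :
    'M[K]_4 :=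
  \sum_(k < 4) x 0 k *: A k.

Definition sym_poly (K : fieldType) (A : 'I_4 -> 'M[K]_4) : {mpoly K[4]} :=
  \det (\sum_(k < 4) 'X_k *: map_mx (@mpolyC 4 K) (A k)).

Definition rank_point (K : fieldType) (A : 'I_4 -> 'M[K]_4) (r : nat)
    (x : 'rV[K]_4) : Prop :=
  x != 0 /\ \rank (web_mx A x) = r.

Definition rank_along (K : fieldType) (A : 'I_4 -> 'M[K]_4) (r : nat)
    (curve : 'rV[K]_4 -> Prop) : Prop :=
  forall x, curve x -> rank_point A r x.

(* A general symmetroid that is singular of rank 3 along a line still has
   finitely many points of lower rank on that line (the symmetric 3x3 block
   complementary to the constant kernel has determinant a binary cubic on the
   line), so "rank 3 along a line" leaves out finitely many points. *)
Definition rank_generically_along (K : fieldType) (A : 'I_4 -> 'M[K]_4)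
    (r : nat) (curve : 'rV[K]_4 -> Prop) : Prop :=
  exists s : seq 'rV[K]_4,
    forall x, curve x -> rank_point A r x \/ has (fun y => (x == y)%MS) s.

Definition isolated_node (K : fieldType) (A : 'I_4 -> 'M[K]_4)
    (p : 'rV[K]_4) : Prop :=
  node (sym_poly A) p /\ rank_point A 2 p.

Definition basepoint (K : fieldType) (A : 'I_4 -> 'M[K]_4) (y : 'rV[K]_4) :
    Prop :=
  y != 0 /\ forall x : 'rV[K]_4, y *m web_mx A x *m y^T = 0.

(* The types of complex symmetroids describe general members of families: the
   listed singular points are all the singular points, and the listed
   basepoints are all the basepoints. *)

Definition typeA (K : fieldType) (A : 'I_4 -> 'M[K]_4) : Prop :=
  exists p : 'rV[K]_4,
    [/\ triple_point (sym_poly A) p,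
        nb_points (isolated_node A) 6 &
        forall x, singular_point (sym_poly A) x ->
          (x == p)%MS \/ isolated_node A x].

Definition typeB (K : fieldType) (A : 'I_4 -> 'M[K]_4) : Prop :=
  (exists p : 'rV[K]_4,
    [/\ tacnode (sym_poly A) p,
        nb_points (isolated_node A) 6 &
        forall x, singular_point (sym_poly A) x ->
          (x == p)%MS \/ isolated_node A x]) /\
  nb_points (basepoint A) 2.

Definition typeC (K : fieldType) (A : 'I_4 -> 'M[K]_4) : Prop :=
  (exists (E : 'M[K]_(3, 4)) (Q : 'M[K]_3),
    [/\ smooth_conic E Q,
        singular_along (sym_poly A) (on_conic E Q),
        rank_along A 2 (on_conic E Q),
        nb_points (isolated_node A) 4 &
        forall x, singular_point (sym_poly A) x ->
          on_conic E Q x \/ isolated_node A x]) /\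
  (exists Y : 'M[K]_4, Y \in unitmx /\
    forall y, y != 0 -> (basepoint A y <-> exists i, (y == row i Y)%MS)).

Definition typeD (K : fieldType) (A : 'I_4 -> 'M[K]_4) : Prop :=
  (exists E : 'M[K]_(2, 4),
    [/\ row_free E,
        rank_along A 2 (on_line E),
        nb_points (isolated_node A) 6 &
        forall x, singular_point (sym_poly A) x ->
          on_line E x \/ isolated_node A x]) /\
  nb_points (basepoint A) 4 /\
  (exists h : 'cV[K]_4, h != 0 /\ forall y, basepoint A y -> y *m h = 0).

Definition typeF (K : fieldType) (A : 'I_4 -> 'M[K]_4) : Prop :=
  exists (E1 E2 : 'M[K]_(2, 4)) (p : 'rV[K]_4),
    [/\ [/\ row_free E1, row_free E2 & ~~ (E1 == E2)%MS],
        [/\ on_line E1 p, on_line E2 p & rank_point A 2 p],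
        (singular_along (sym_poly A) (on_line E1) /\
         rank_generically_along A 3 (on_line E1)) /\
        (singular_along (sym_poly A) (on_line E2) /\
         rank_generically_along A 3 (on_line E2)),
        nb_points (isolated_node A) 2 &
        forall x, singular_point (sym_poly A) x ->
          [\/ on_line E1 x, on_line E2 x | isolated_node A x]].

Definition definite (R : realType) (M : 'M[R]_4) : Prop :=
  (forall y : 'rV[R]_4, y != 0 -> 0 < (y *m M *m y^T) 0 0) \/
  (forall y : 'rV[R]_4, y != 0 -> (y *m M *m y^T) 0 0 < 0).

Definition semidefinite (R : realType) (M : 'M[R]_4) : Prop :=
  (forall y : 'rV[R]_4, 0 <= (y *m M *m y^T) 0 0) \/
  (forall y : 'rV[R]_4, (y *m M *m y^T) 0 0 <= 0).

Definition spectrahedral (R : realType) (A : 'I_4 -> 'M[R]_4) : Prop :=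
  exists x : 'rV[R]_4, definite (web_mx A x).

Definition in_spectrahedron (R : realType) (A : 'I_4 -> 'M[R]_4)
    (x : 'rV[R]_4) : Prop :=
  x != 0 /\ semidefinite (web_mx A x).

Definition on_boundary (R : realType) (A : 'I_4 -> 'M[R]_4)
    (x : 'rV[R]_4) : Prop :=
  (sym_poly A).@[x 0] = 0 /\ in_spectrahedron A x.

Definition cplx (R : realType) (m n : nat) (M : 'M[R]_(m, n)) :
    'M[R[i]]_(m, n) := map_mx (real_complex R) M.

Definition cplx_web (R : realType) (A : 'I_4 -> 'M[R]_4) (k : 'I_4) :
    'M[R[i]]_4 := cplx (A k).

Definition conj_mx (R : realType) (m n : nat) (M : 'M[R[i]]_(m, n)) :
    'M[R[i]]_(m, n) := map_mx (@conjc R) M.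

Definition real_node (R : realType) (A : 'I_4 -> 'M[R]_4) (x : 'rV[R]_4) :
    Prop :=
  isolated_node (cplx_web A) (cplx x).

Definition boundary_node (R : realType) (A : 'I_4 -> 'M[R]_4)
    (x : 'rV[R]_4) : Prop :=
  real_node A x /\ on_boundary A x.

(* The lines E and its complex conjugate are distinct, S is singular of rank 3
   along both, and x is their intersection point. *)
Definition conj_double_lines (R : realType) (A : 'I_4 -> 'M[R]_4)
    (E : 'M[R[i]]_(2, 4)) (x : 'rV[R]_4) : Prop :=
  [/\ row_free E /\ ~~ (E == conj_mx E)%MS,
      singular_along (sym_poly (cplx_web A)) (on_line E) /\
      singular_along (sym_poly (cplx_web A)) (on_line (conj_mx E)),
      rank_generically_along (cplx_web A) 3 (on_line E) /\
      rank_generically_along (cplx_web A) 3 (on_line (conj_mx E)) &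
      on_line E (cplx x) /\ on_line (conj_mx E) (cplx x)].

(* Main.v *)
Require Import Defs.
From HB Require Import structures.
From mathcomp Require Import all_boot all_order all_algebra.
From mathcomp Require Import complex mpoly.
From mathcomp Require Import boolp reals.
From mathcomp Require Import zify ring lra.

(** Why the theorem holds.  Everything is expressed by the linear forms
    [wf A y z : x |-> y A(x) z^T].  Three facts relate them to the singularities.
    First, a point of rank at most two is singular, and a singular point of rank
    three has a basepoint of the web as its kernel ([singular_of_rank],
    [kernel_basepoint]).  Second, if [k1], [k2] span the kernel at a node of rank
    two, then the forms of [(k1, k1)], [(k1, k2)], [(k2, k2)] are linearly
    independent ([node_independent]), because the tangent cone is their
    discriminant; this excludes nodes from many special positions.  Third, a web
    that contains a definite quadric has no real basepoint, the basepoints come in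
    conjugate pairs [y], [y^*], and a real quadric of rank two on which
    [y A(x) y^*] does not vanish is semidefinite, while a semidefinite quadric on
    which it vanishes has [y] and [y^*] in its kernel ([semidefinite_basepoint],
    [semidefinite_isotropic]).  So [y A(x) y^* = 0] separates the nodes on the
    boundary of the spectrahedron from the other real nodes, and parity of
    complex conjugation on finite sets of nodes ([nb_real]) gives the numbers.

    A triple point is real and, by the order of the determinant in a definite
    direction, of rank one, hence semidefinite.  For a tacnode, the quadrics
    restrict to multiples of one definite form on the kernel, whose zeros are
    conjugate basepoints; in the plane [y A(x) y^* = 0], the tangent plane of the
    tacnode, there are exactly two nodes ([tacnode_two_nodes]).  For a line of rank
    two, the fourth coplanar basepoint makes a relation between the three forms of
    the others; each node is a zero of exactly one of these, each form is zero
    at at most two nodes ([nodes_line_pair]), and so [y A(x) y^* = 0] contains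
    exactly two.  For two lines of rank three, the kernel along each line is a
    constant basepoint, for otherwise all quadrics would contain a common line and
    the determinant would be a square; the lines are conjugate, since a real point
    of rank three would give a real basepoint, and no node lies in their plane.

    For a double conic, the quadrics have zero diagonal in the basis of the four
    basepoints, and the off-diagonal entries form three pairs of opposite edges of
    a tetrahedron.  Rank two along the conic forces one of these pairs to vanish on
    its plane ([conic_pairing]), and each of the other two pairs accounts for two of
    the four nodes ([double_conic_nodes]).  If the pair of the conic consists of the two
    forms [lam], [mu] of the conjugate pairs [y1], [y1^*] and [y2], [y2^*], then
    all real nodes are on the boundary and the real points of the conic are not;
    otherwise it is the other way round for the conic and for one of the pairs of
    nodes.  That the remaining numbers occur as stated depends on sign changes of
    real quadratic forms on planes of [R^4], compared with the inequality
    [(|P| + |S|)^2 < lam mu] that holds at the definite point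
    ([definite_frame], [proportional_node], [real_form_zero],
    [real_form_conic]). *)

Set Implicit Arguments.
Unset Strict Implicit.
Unset Printing Implicit Defensive.

Import Order.TTheory GRing.Theory Num.Theory.

Local Open Scope ring_scope.

(** * Restricting polynomials to arcs *)

(** The local structure of the surface is explored along arcs: Taylor
    coefficients, orders of vanishing and tangent cones in several variables
    are read off from the one-variable polynomials obtained by substituting an
    arc. *)
Definition restr (K : fieldType) n (h : 'I_n -> {poly K}) (p : {mpoly K[n]}) :
  {poly K} := mmap (@polyC K) h p.

Section Arcs.
Variables (K : fieldType) (n : nat).
Implicit Types (h : 'I_n -> {poly K}) (p q : {mpoly K[n]}).

Lemma restrD h p q : restr h (p + q) = restr h p + restr h q.
Proof. exact: mmapD. Qed.
Lemma restrM h p q : restr h (p * q) = restr h p * restr h q.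
Proof. exact: (rmorphM (mmap (@polyC K) h)). Qed.
Lemma restrC h c : restr h c%:MP = c%:P.
Proof. exact: mmapC. Qed.
Lemma restrZ h c p : restr h (c *: p) = c *: restr h p.
Proof. by rewrite /restr mmapZ mul_polyC. Qed.
Lemma restrX h i : restr h 'X_i = h i.
Proof. by rewrite /restr mmapX mmap1U. Qed.
Lemma restrB h p q : restr h (p - q) = restr h p - restr h q.
Proof. exact: mmapB. Qed.
Lemma restr_exp h p d : restr h (p ^+ d) = restr h p ^+ d.
Proof. exact: (rmorphXn (mmap (@polyC K) h)). Qed.
Lemma restr_sum h (I : Type) (r : seq I) (P : pred I) (F : I -> {mpoly K[n]}) :
  restr h (\sum_(i <- r | P i) F i) = \sum_(i <- r | P i) restr h (F i).
Proof. exact: (raddf_sum (mmap (@polyC K) h)). Qed.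
Lemma restr_prod h (I : Type) (r : seq I) (P : pred I) (F : I -> {mpoly K[n]}) :
  restr h (\prod_(i <- r | P i) F i) = \prod_(i <- r | P i) restr h (F i).
Proof. exact: (rmorph_prod (mmap (@polyC K) h)). Qed.
Lemma restr_monom h m : restr h 'X_[m] = \prod_(i < n) h i ^+ m i.
Proof. by rewrite /restr mmapX. Qed.

(** Identities between ring morphisms only need to be checked on constants and
    variables. *)
Lemma mpoly_alg_ind (P : {mpoly K[n]} -> Prop) :
  (forall c, P c%:MP) -> (forall i, P 'X_i) ->
  (forall p q, P p -> P q -> P (p + q)) ->
  (forall p q, P p -> P q -> P (p * q)) -> forall p, P p.
Proof.
move=> PC PX PD PM p; elim/mpolyind: p => [|c m p _ _ IH].
  by rewrite -mpolyC0.
apply: PD => //; rewrite -mul_mpolyC; apply: (PM) => //.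
rewrite mpolyXE_id; elim/big_ind: _ => //; first by rewrite -mpolyC1.
move=> i _; elim: (m i) => [|k IHk]; first by rewrite expr0 -mpolyC1.
by rewrite exprS; apply: (PM).
Qed.

Lemma restr_horner h p c : (restr h p).[c] = p.@[fun k => (h k).[c]].
Proof.
elim/mpoly_alg_ind: p => [a|i|p q Hp Hq|p q Hp Hq].
- by rewrite restrC hornerC mevalC.
- by rewrite restrX mevalXU.
- by rewrite restrD hornerD mevalD Hp Hq.
- by rewrite restrM hornerM mevalM Hp Hq.
Qed.

(** The chain rule; iterated, it expresses the coefficients of low order along
    an arc by the partial derivatives. *)
Lemma restr_deriv h p :
  (restr h p)^`() = \sum_(k < n) restr h (p^`M(k)) * (h k)^`().
Proof.
elim/mpoly_alg_ind: p => [a|i|p q Hp Hq|p q Hp Hq].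
- rewrite restrC derivC big1 // => k _.
  by rewrite mderivC -(mpolyC0 n K) restrC mul0r.
- rewrite restrX (bigD1 i) //= big1 ?addr0 => [|k ki]; last first.
    by rewrite mderivX mnm1E eq_sym (negbTE ki) scale0r -(mpolyC0 n K) restrC mul0r.
  rewrite mderivX mnm1E eqxx scale1r.
  have -> : (U_(i) - U_(i))%MM = 0%MM :> 'X_{1..n}.
    by apply/mnmP=> j; rewrite mnmBE subnn mnm0E.
  by rewrite mpolyX0 -mpolyC1 restrC mul1r.
- rewrite restrD derivD Hp Hq -big_split; apply: eq_bigr => k _.
  by rewrite mderivD restrD mulrDl.
- rewrite restrM derivM Hp Hq mulr_suml mulr_sumr -big_split; apply: eq_bigr => k _ /=.
  by rewrite mderivM restrD !restrM; ring.
Qed.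

Lemma meval0_coef p (x : 'I_n -> K) : x =1 (fun=> 0) -> p.@[x] = p@_0%MM.
Proof.
move=> x0; elim/mpoly_alg_ind: p => [a|i|p q Hp Hq|p q Hp Hq].
- by rewrite mevalC mcoeffC eqxx mulr1.
- rewrite mevalXU x0 mcoeffX; case: eqP => // /mnmP/(_ i).
  by rewrite mnm1E eqxx mnm0E.
- by rewrite mevalD mcoeffD Hp Hq.
- by rewrite mevalM Hp Hq rmorphM.
Qed.

Lemma restr_coef0 h p : (restr h p)`_0 = p.@[fun k => (h k)`_0].
Proof.
by rewrite -horner_coef0 restr_horner; apply: meval_eq => k; rewrite horner_coef0.
Qed.

Lemma restr_coef1 h p :
  (restr h p)`_1 = \sum_(k < n) p^`M(k).@[fun k => (h k)`_0] * (h k)`_1.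
Proof.
have -> : (restr h p)`_1 = ((restr h p)^`())`_0 by rewrite coef_deriv mulr1n.
rewrite restr_deriv coef_sum; apply: eq_bigr => k _.
by rewrite coef0M restr_coef0 coef_deriv mulr1n.
Qed.

Lemma restr_coef2 h p :
  (restr h p)`_2 *+ 2 =
  \sum_(k < n) (\sum_(j < n) p^`M(k)^`M(j).@[fun k => (h k)`_0] * (h j)`_1)
     * (h k)`_1 +
  (\sum_(k < n) p^`M(k).@[fun k => (h k)`_0] * (h k)`_2) *+ 2.
Proof.
have -> : (restr h p)`_2 *+ 2 = ((restr h p)^`())`_1 by rewrite coef_deriv.
rewrite restr_deriv coef_sum -sumrMnl -big_split; apply: eq_bigr => k _ /=.
rewrite coefM big_ord_recl big_ord1 /= addrC !coef_deriv restr_coef1 restr_coef0.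
by rewrite mulr1n mulrnAr.
Qed.

Lemma jet0 h p : (forall k, (h k)`_0 = 0) -> (restr h p)`_0 = p@_0%MM.
Proof. by move=> h0; rewrite restr_coef0 meval0_coef. Qed.

Lemma jet1 h p : (forall k, (h k)`_0 = 0) ->
  (restr h p)`_1 = \sum_(k < n) p@_U_(k) * (h k)`_1.
Proof.
move=> h0; rewrite restr_coef1; apply: eq_bigr => k _.
by rewrite meval0_coef // mcoeff_mderiv add0m mnm0E mulr1n.
Qed.

Lemma jet2 h p : (forall k, (h k)`_0 = 0) ->
  (restr h p)`_2 *+ 2 =
  \sum_(k < n) (\sum_(j < n) (p^`M(k)^`M(j))@_0%MM * (h j)`_1) * (h k)`_1 +
  (\sum_(k < n) p@_U_(k) * (h k)`_2) *+ 2.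
Proof.
move=> h0; rewrite restr_coef2; congr (_ + _ *+ _).
  apply: eq_bigr => k _; congr (_ * _); apply: eq_bigr => j _.
  by rewrite meval0_coef.
apply: eq_bigr => k _.
by rewrite meval0_coef // mcoeff_mderiv add0m mnm0E mulr1n.
Qed.

End Arcs.

Lemma restr_comp (K : fieldType) n m (h : 'I_n -> {poly K})
    (lq : m.-tuple {mpoly K[n]}) (p : {mpoly K[m]}) :
  restr h (p \mPo lq) = restr (fun k => restr h (tnth lq k)) p.
Proof.
elim/mpoly_alg_ind: p => [a|i|p q Hp Hq|p q Hp Hq].
- by rewrite comp_mpolyC !restrC.
- by rewrite comp_mpolyXU restrX (tnth_nth 0).
- by rewrite comp_mpolyD !restrD Hp Hq.
- by rewrite rmorphM !restrM Hp Hq.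
Qed.

Lemma eq_restr (K : fieldType) n (h h' : 'I_n -> {poly K}) p :
  h =1 h' -> restr h p = restr h' p.
Proof.
move=> hh; elim/mpoly_alg_ind: p => [a|i|p q Hp Hq|p q Hp Hq].
- by rewrite !restrC.
- by rewrite !restrX.
- by rewrite !restrD Hp Hq.
- by rewrite !restrM Hp Hq.
Qed.

(** Lifts an arc of the chart [x_i = p_i], centred at [p], to homogeneous
    coordinates. *)
Definition chart_arc (K : fieldType) (p : 'rV[K]_4) (i : 'I_4)
    (h : 'I_3 -> {poly K}) (k : 'I_4) : {poly K} :=
  (p 0 k)%:P + (if unlift i k is Some j then h j else 0).

Lemma restr_local (K : fieldType) (f : {mpoly K[4]}) p i h :
  restr h (local_eq f p i) = restr (chart_arc p i h) f.
Proof.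
rewrite restr_comp; apply: eq_restr => k; rewrite tnth_mktuple restrD restrC.
congr (_ + _); case: unlift => [j|]; first by rewrite restrX.
by rewrite -(mpolyC0 3 K) restrC.
Qed.

Definition web_arc (K : fieldType) (A : 'I_4 -> 'M[K]_4)
    (h : 'I_4 -> {poly K}) : 'M[{poly K}]_4 :=
  \sum_k h k *: map_mx polyC (A k).

Lemma restr_sym (K : fieldType) (A : 'I_4 -> 'M[K]_4) h :
  restr h (sym_poly A) = \det (web_arc A h).
Proof.
rewrite /sym_poly /restr -det_map_mx; congr (\det _).
apply/matrixP=> i j; rewrite mxE !summxE rmorph_sum; apply: eq_bigr => k _.
by rewrite !mxE rmorphM /= mmapC mmapX mmap1U.
Qed.

Lemma meval_sym (K : fieldType) (A : 'I_4 -> 'M[K]_4) (x : 'rV[K]_4) :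
  (sym_poly A).@[x 0] = \det (web_mx A x).
Proof.
rewrite /sym_poly -det_map_mx; congr (\det _).
apply/matrixP=> i j; rewrite mxE !summxE rmorph_sum; apply: eq_bigr => k _.
by rewrite !mxE rmorphM /= mevalC mevalXU.
Qed.

Definition line_arc (K : fieldType) (x v : 'rV[K]_4) (k : 'I_4) : {poly K} :=
  (x 0 k)%:P + v 0 k *: 'X.

Lemma web_line (K : fieldType) (A : 'I_4 -> 'M[K]_4) (x v : 'rV[K]_4) :
  web_arc A (line_arc x v) =
  map_mx polyC (web_mx A x) + 'X *: map_mx polyC (web_mx A v).
Proof.
apply/matrixP=> i j; rewrite !mxE !summxE !rmorph_sum mulr_sumr -big_split.
apply: eq_bigr => k _; rewrite !mxE !rmorphM /= mulrDl; congr (_ + _).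
by rewrite mulrA -mul_polyC; congr (_ * _); rewrite mulrC.
Qed.

Lemma line_arc0 (K : fieldType) (x v : 'rV[K]_4) k : (line_arc x v k)`_0 = x 0 k.
Proof. by rewrite coefD coefC coefZ coefX mulr0 addr0. Qed.
Lemma line_arc1 (K : fieldType) (x v : 'rV[K]_4) k : (line_arc x v k)`_1 = v 0 k.
Proof. by rewrite coefD coefC coefZ coefX mulr1 add0r. Qed.

(** * Linear algebra of symmetric matrices *)

Lemma ex_basis (K : fieldType) m n r (V : 'M[K]_(m, n)) : \rank V = r ->
  exists2 B : 'M[K]_(r, n), row_free B & (B :=: V)%MS.
Proof.
by move=> <-; exists (row_base V); [exact: row_base_free | exact: eq_row_base].
Qed.

Lemma ex_complement (K : fieldType) r m (B : 'M[K]_(r, r + m)) : row_free B ->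
  exists B' : 'M[K]_(m, r + m), col_mx B B' \in unitmx.
Proof.
move=> fB; have rC : \rank (B^C)%MS = m.
  by rewrite mxrank_compl (eqP fB) addKn.
have [B' _ eB'] := ex_basis rC; exists B'.
rewrite -row_full_unit -sub1mx -addsmxE (adds_eqmx (eqmx_refl B) eB').
by rewrite sub1mx addsmx_compl_full.
Qed.

(** In a basis that starts with rows [B] of the kernel of [M0], the first [r]
    rows of the pencil are divisible by ['X]; after division its value at 0 is
    block triangular, with blocks [B M1 B^T] and the nondegenerate part of
    [M0]. *)
Lemma det_pencil_kernel (K : fieldType) r m (M0 : 'M[K]_(r + m))
    (B : 'M[K]_(r, r + m)) :
    M0^T = M0 -> row_free B -> B *m M0 = 0 ->
  exists2 kap : K, (\rank M0 = m -> kap != 0) &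
    forall M1 : 'M[K]_(r + m), exists2 G : {poly K},
      \det (map_mx polyC M0 + 'X *: map_mx polyC M1) = 'X ^+ r * G &
      G.[0] = kap * \det (B *m M1 *m B^T).
Proof.
move=> symM0 fB BM0; have [B' gU] := ex_complement fB.
set g := col_mx B B' in gU; set C := B' *m M0 *m B'^T.
have M0B : M0 *m B^T = 0 by rewrite -symM0 -trmx_mul BM0 trmx0.
have gM0 : g *m M0 *m g^T = block_mx 0 0 0 C.
  rewrite /g tr_col_mx mul_col_mx mul_col_row BM0 !mul0mx.
  by rewrite -mulmxA M0B mulmx0.
have dg : \det g != 0 by rewrite -unitfE.
have rC : \rank C = \rank M0.
  rewrite -(mxrankMfree _ (B := g^T)) ?row_free_unit ?unitmx_tr //.
  rewrite -(eqmxMfull (M0 *m _) (A := g)) ?row_full_unit // mulmxA gM0.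
  by rewrite block_mxEv row_mx0 rank_col_0mx rank_row_0mx.
exists (\det C / (\det g ^+ 2)) => [rM0|M1].
  rewrite mulf_neq0 ?invr_neq0 ?expf_neq0 // -unitfE -unitmxE -row_free_unit.
  by rewrite /row_free rC rM0.
set P1 := map_mx polyC _; set P2 := map_mx polyC _.
pose gp := map_mx (@polyC K) g.
pose bl := block_mx (map_mx polyC (B *m M1 *m B^T)) (map_mx polyC (B *m M1 *m B'^T))
  ('X *: map_mx polyC (B' *m M1 *m B^T)) (map_mx polyC C + 'X *: map_mx polyC (B' *m M1 *m B'^T)).
have E : gp *m (P1 + 'X *: P2) *m gp^T =
    block_mx ('X%:M) 0 0 (1%:M) *m bl.
  rewrite mulmxDr mulmxDl map_trmx -!map_mxM /= gM0 -scalemxAr -scalemxAl -!map_mxM.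
  rewrite /g tr_col_mx mul_col_mx mul_col_row !map_block_mx !map_mx0 scale_block_mx.
  rewrite add_block_mx /bl mulmx_block !mul0mx !add0r !addr0 !mul1mx.
  by rewrite !mul_scalar_mx.
have Edet : (\det g)%:P ^+ 2 * \det (P1 + 'X *: P2) = 'X ^+ r * \det bl.
  have := congr1 determinant E.
  rewrite !det_mulmx det_tr det_ublock det1 mulr1 det_scalar det_map_mx /= => <-.
  by rewrite expr2; ring.
exists ((\det g ^- 2)%:P * \det bl).
  rewrite mulrCA -Edet mulrA -rmorphXn -rmorphM /= mulVf ?mul1r //.
  by rewrite expf_neq0.
rewrite hornerM hornerC -[(\det bl).[0]]/(horner_eval 0 (\det bl)) -det_map_mx.
rewrite /bl map_block_mx.
have ev n1 n2 (M : 'M[K]_(n1, n2)) : map_mx (horner_eval 0) (map_mx polyC M) = M.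
  by apply/matrixP=> i j; rewrite !mxE /horner_eval hornerC.
have evX n1 n2 (M : 'M[K]_(n1, n2)) :
    map_mx (horner_eval 0) ('X *: map_mx polyC M) = 0.
  by apply/matrixP=> i j; rewrite !mxE /horner_eval hornerM hornerX mul0r.
by rewrite map_mxD !ev !evX addr0 det_ublock; ring.
Qed.

(** * Explicit determinants *)

(** The 3x3 minor of rows 1, 2, 3 and columns [i], [j], [k]. *)
Definition d3 (R : comNzRingType) (m : nat -> nat -> R) i j k :=
  m 1%N i * (m 2%N j * m 3%N k - m 2%N k * m 3%N j)
  - m 1%N j * (m 2%N i * m 3%N k - m 2%N k * m 3%N i)
  + m 1%N k * (m 2%N i * m 3%N j - m 2%N j * m 3%N i).

Section Det.
Variable R : comNzRingType.

Lemma det2E (M : 'M[R]_2) : \det M = M 0 0 * M 1 1 - M 0 1 * M 1 0.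
Proof.
pose f i j := M (inord i) (inord j).
have ME i j : M i j = f i j by rewrite /f !inord_val.
rewrite (expand_det_row _ 0) !big_ord_recl big_ord0 /cofactor !det_mx11 !mxE.
rewrite !ME /= /bump /=; ring.
Qed.

Lemma det3E (M : 'M[R]_3) :
  let m i j := M (inord i) (inord j) in
  \det M = m 0%N 0%N * (m 1%N 1%N * m 2%N 2%N - m 1%N 2%N * m 2%N 1%N)
         - m 0%N 1%N * (m 1%N 0%N * m 2%N 2%N - m 1%N 2%N * m 2%N 0%N)
         + m 0%N 2%N * (m 1%N 0%N * m 2%N 1%N - m 1%N 1%N * m 2%N 0%N).
Proof.
move=> f; have ME i j : M i j = f i j by rewrite /f !inord_val.
rewrite (expand_det_row _ 0) !big_ord_recl big_ord0 /cofactor !det2E !mxE.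
rewrite !ME /= /bump /=; ring.
Qed.

Lemma det4E (M : 'M[R]_4) :
  let m i j := M (inord i) (inord j) in
  \det M = m 0%N 0%N * d3 m 1%N 2%N 3%N - m 0%N 1%N * d3 m 0%N 2%N 3%N
         + m 0%N 2%N * d3 m 0%N 1%N 3%N - m 0%N 3%N * d3 m 0%N 1%N 2%N.
Proof.
move=> f; have ME i j : M i j = f i j by rewrite /f !inord_val.
rewrite (expand_det_row _ 0) !big_ord_recl big_ord0 /cofactor !det3E !mxE.
rewrite !ME /d3 /= /bump /= !inordK //=; ring.
Qed.

End Det.

(** * Bilinear forms and Gram determinants *)

Definition bf (K : comNzRingType) (M : 'M[K]_4) (y z : 'rV[K]_4) : K :=
  (y *m M *m z^T) 0 0.

Section Forms.
Variable K : comNzRingType.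
Implicit Types (M : 'M[K]_4) (y z w : 'rV[K]_4).

Lemma bfDl M y z w : bf M (y + z) w = bf M y w + bf M z w.
Proof. by rewrite /bf !mulmxDl mxE. Qed.
Lemma bfDr M y z w : bf M w (y + z) = bf M w y + bf M w z.
Proof. by rewrite /bf linearD mulmxDr mxE. Qed.
Lemma bfZl M c y w : bf M (c *: y) w = c * bf M y w.
Proof. by rewrite /bf -!scalemxAl mxE. Qed.
Lemma bfZr M c y w : bf M w (c *: y) = c * bf M w y.
Proof. by rewrite /bf linearZ -scalemxAr mxE. Qed.
Lemma bfC M y z : M^T = M -> bf M y z = bf M z y.
Proof.
by move=> sM; rewrite /bf -[y *m M *m z^T]trmxK mxE !trmx_mul trmxK sM mulmxA.
Qed.
Lemma bf_ker M y z : y *m M = 0 -> bf M y z = 0.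
Proof. by rewrite /bf => ->; rewrite mul0mx mxE. Qed.
Lemma bfD M M' y z : bf (M + M') y z = bf M y z + bf M' y z.
Proof. by rewrite /bf mulmxDr mulmxDl mxE. Qed.
Lemma bfZ c M y z : bf (c *: M) y z = c * bf M y z.
Proof. by rewrite /bf -scalemxAr -scalemxAl mxE. Qed.
Lemma bfE M m n (Y : 'M[K]_(m, 4)) (Z : 'M[K]_(n, 4)) i j :
  (Y *m M *m Z^T) i j = bf M (row i Y) (row j Z).
Proof. by rewrite /bf -row_mul !mxE; apply: eq_bigr => k _; rewrite !mxE. Qed.

Definition rows n (s : seq 'rV[K]_4) : 'M[K]_(n, 4) :=
  \matrix_(i < n, j < 4) (nth 0 s i) 0 j.

Lemma row_rows n s (i : 'I_n) : row i (rows n s) = nth 0 s i.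
Proof. by apply/rowP=> j; rewrite !mxE. Qed.

Lemma gram2 M v0 v1 w0 w1 :
  \det (rows 2 [:: v0; v1] *m M *m (rows 2 [:: w0; w1])^T) =
  bf M v0 w0 * bf M v1 w1 - bf M v0 w1 * bf M v1 w0.
Proof. by rewrite det2E !bfE !row_rows. Qed.

Lemma gram3 M v0 v1 v2 w0 w1 w2 :
  \det (rows 3 [:: v0; v1; v2] *m M *m (rows 3 [:: w0; w1; w2])^T) =
  bf M v0 w0 * (bf M v1 w1 * bf M v2 w2 - bf M v1 w2 * bf M v2 w1)
  - bf M v0 w1 * (bf M v1 w0 * bf M v2 w2 - bf M v1 w2 * bf M v2 w0)
  + bf M v0 w2 * (bf M v1 w0 * bf M v2 w1 - bf M v1 w1 * bf M v2 w0).
Proof. by rewrite det3E !bfE !row_rows !inordK. Qed.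

Lemma gram4 M v0 v1 v2 v3 :
  let V := rows 4 [:: v0; v1; v2; v3] in
  let m i j := bf M (nth 0 [:: v0; v1; v2; v3] i) (nth 0 [:: v0; v1; v2; v3] j) in
  \det M * \det V ^+ 2 = m 0%N 0%N * d3 m 1%N 2%N 3%N - m 0%N 1%N * d3 m 0%N 2%N 3%N
         + m 0%N 2%N * d3 m 0%N 1%N 3%N - m 0%N 3%N * d3 m 0%N 1%N 2%N.
Proof.
move=> V m; have -> : \det M * \det V ^+ 2 = \det (V *m M *m V^T).
  by rewrite !det_mulmx det_tr; ring.
by rewrite det4E /d3 !bfE !row_rows !inordK.
Qed.
End Forms.

(** * Families of vectors and linear forms *)

Lemma ex_sub_basis (K : fieldType) m n r (V : 'M[K]_(m, n)) : (r <= \rank V)%N ->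
  exists2 B : 'M[K]_(r, n), row_free B & (B <= V)%MS.
Proof.
move=> rV; exists (pid_mx r *m row_base V).
  by rewrite /row_free mxrankMfree ?row_base_free // rank_pid_mx.
by rewrite mulmx_sub // eq_row_base.
Qed.

Lemma corank2_basis (K : fieldType) n (M : 'M[K]_n.+2) : (\rank M <= n)%N ->
  exists2 B : 'M[K]_(2, n.+2), row_free B & B *m M = 0.
Proof.
move=> rM; have : (2 <= \rank (kermx M))%N.
  by rewrite mxrank_ker; lia.
by move=> /ex_sub_basis[B fB /sub_kermxP BM]; exists B.
Qed.

(** A quadric surface that contains a plane has rank at most two. *)
Lemma isotropic3_rank (K : fieldType) (M : 'M[K]_4) (B : 'M[K]_(3, 4)) :
  row_free B -> B *m M *m B^T = 0 -> (\rank M <= 2)%N.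
Proof.
move=> /eqP rB /mulmx0_rank_max; rewrite mxrank_tr rB => h.
by have := mxrank_mul_min B M; rewrite rB; lia.
Qed.

Lemma rank_le2_minor (K : fieldType) (M : 'M[K]_4) (P : 'M[K]_(3, 4))
    (Q : 'M[K]_(4, 3)) : (\rank M <= 2)%N -> \det (P *m M *m Q) = 0.
Proof.
move=> rM; apply/eqP/negPn; rewrite -unitfE -unitmxE -row_full_unit.
apply/negP => /eqP h.
have := leq_trans (mxrankM_maxl (P *m M) Q) (leq_trans (mxrankM_maxr P M) rM).
by rewrite h.
Qed.

Lemma row_free_kerP (K : fieldType) m n (B : 'M[K]_(m, n)) :
  row_free B <-> forall u : 'rV_m, u *m B = 0 -> u = 0.
Proof.
split=> [fB u uB|inj]; first by apply/eqP; rewrite -(mulmx_free_eq0 _ fB) uB.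
rewrite -kermx_eq0; apply/eqP/row_matrixP => i; rewrite row0.
by apply: inj; rewrite -row_mul mulmx_ker row0.
Qed.

Section Rows.
Variable K : fieldType.
Implicit Types x y z t : 'rV[K]_4.

Lemma mul_rows n (s : seq 'rV[K]_4) (u : 'rV_n) :
  u *m rows n s = \sum_i u 0 i *: nth 0 s i.
Proof. by rewrite mulmx_sum_row; apply: eq_bigr => i _; rewrite row_rows. Qed.

Lemma mul_rows_inord n (s : seq 'rV[K]_4) (u : 'rV_n.+1) :
  u *m rows n.+1 s = \sum_(i < n.+1) u 0 (inord i) *: nth 0 s i.
Proof. by rewrite mul_rows; apply: eq_bigr => i _; rewrite inord_val. Qed.

Lemma rows_mul0 n (s : seq 'rV[K]_4) m (M : 'M_(4, m)) :
  (forall i, (i < n)%N -> nth 0 s i *m M = 0) -> rows n s *m M = 0.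
Proof. by move=> h; apply/row_matrixP => i; rewrite row_mul row_rows row0 h. Qed.

Lemma row_free_rows n (s : seq 'rV[K]_4) : row_free (rows n s) <->
  forall c : nat -> K, \sum_(i < n) c i *: nth 0 s i = 0 ->
    forall i, (i < n)%N -> c i = 0.
Proof.
rewrite row_free_kerP; split=> [h c e i ilt|h u].
  have /h/rowP/(_ (Ordinal ilt)) : (\row_(i < n) c i) *m rows n s = 0.
    by rewrite mul_rows -{}[RHS]e; apply: eq_bigr => k _; rewrite mxE.
  by rewrite !mxE.
rewrite mul_rows => e; apply/rowP => i; rewrite [RHS]mxE.
pose c k := if insub k is Some i then u 0 i else 0.
have cE (k : 'I_n) : c k = u 0 k by rewrite /c valK.
by rewrite -cE h //; rewrite -{}[RHS]e; apply: eq_bigr => k _; rewrite cE.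
Qed.

Lemma free2P x y : row_free (rows 2 [:: x; y]) <->
  forall a b, a *: x + b *: y = 0 -> a = 0 /\ b = 0.
Proof.
rewrite row_free_rows; split=> [h a b e|h c].
  have hc := h (fun k => nth 0 [:: a; b] k).
  rewrite !big_ord_recl big_ord0 /= addr0 in hc.
  by split; [exact: (hc e 0%N) | exact: (hc e 1%N)].
by rewrite !big_ord_recl big_ord0 addr0 => /h[c0 c1] [|[|k]].
Qed.

Lemma free3P x y z : row_free (rows 3 [:: x; y; z]) <->
  forall a b c, a *: x + b *: y + c *: z = 0 -> [/\ a = 0, b = 0 & c = 0].
Proof.
rewrite row_free_rows; split=> [h a b c e|h c].
  have hc := h (fun k => nth 0 [:: a; b; c] k).
  rewrite !big_ord_recl big_ord0 /= addr0 addrA in hc.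
  by split; [exact: (hc e 0%N) | exact: (hc e 1%N) | exact: (hc e 2%N)].
by rewrite !big_ord_recl big_ord0 addr0 addrA => /h[c0 c1 c2] [|[|[|k]]].
Qed.

Lemma free4P x y z t : row_free (rows 4 [:: x; y; z; t]) <->
  forall a b c d, a *: x + b *: y + c *: z + d *: t = 0 ->
    [/\ a = 0, b = 0, c = 0 & d = 0].
Proof.
rewrite row_free_rows; split=> [h a b c d e|h c].
  have hc := h (fun k => nth 0 [:: a; b; c; d] k).
  rewrite !big_ord_recl big_ord0 /= addr0 !addrA in hc.
  by split; [exact: (hc e 0%N) | exact: (hc e 1%N) | exact: (hc e 2%N) | exact: (hc e 3)].
by rewrite !big_ord_recl big_ord0 addr0 !addrA => /h[c0 c1 c2 c3] [|[|[|[|k]]]].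
Qed.

Definition cols n (s : seq 'cV[K]_4) : 'M[K]_(4, n) :=
  \matrix_(i < 4, j < n) (nth 0 s j) i 0.

Lemma mul_cols0 n (s : seq 'cV[K]_4) m (B : 'M_(m, 4)) : B *m cols n s = 0 ->
  forall j, (j < n)%N -> B *m nth 0 s j = 0.
Proof.
move=> e j jn; apply/matrixP => a b; rewrite ord1.
have /matrixP/(_ a (Ordinal jn)) := e; rewrite mxE [in RHS]mxE => e'.
by rewrite mxE [RHS]mxE -{}[RHS]e'; apply: eq_bigr => k _; rewrite !mxE.
Qed.

Lemma ker_vec m (C : 'M[K]_(4, m)) : (\rank C < 4)%N ->
  exists2 d : 'rV[K]_4, d != 0 & d *m C = 0.
Proof.
move=> rC; have : (1 <= \rank (kermx C))%N by rewrite mxrank_ker; lia.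
move=> /ex_sub_basis[d fd /sub_kermxP dC]; exists d => //.
by apply: contraTneq fd => ->; rewrite /row_free mxrank0.
Qed.

Lemma ker_plane m (C : 'M[K]_(4, m)) : (\rank C <= 2)%N ->
  exists x y, [/\ row_free (rows 2 [:: x; y]), x *m C = 0 & y *m C = 0].
Proof.
move=> rC; have : (2 <= \rank (kermx C))%N by rewrite mxrank_ker; lia.
move=> /ex_sub_basis[B fB /sub_kermxP BC]; exists (row 0 B), (row 1 B).
have -> : rows 2 [:: row 0 B; row 1 B] = B.
  by apply/row_matrixP => i; rewrite row_rows;
     case: i => [[|[|//]] h]; congr (row _ B); apply/val_inj.
by rewrite -!row_mul BC !row0.
Qed.

Lemma common_zero3 (f g h : 'cV[K]_4) : exists2 d : 'rV[K]_4, d != 0 &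
  [/\ d *m f = 0, d *m g = 0 & d *m h = 0].
Proof.
have [|d d0 e] := @ker_vec 3 (cols 3 [:: f; g; h]).
  exact: leq_ltn_trans (rank_leq_col _) _.
exists d => //; have h' := mul_cols0 e.
by split; [exact: (h' 0%N) | exact: (h' 1%N) | exact: (h' 2%N)].
Qed.

Lemma common_zero2 (f g : 'cV[K]_4) : exists x y,
  [/\ row_free (rows 2 [:: x; y]), x *m f = 0, x *m g = 0, y *m f = 0
    & y *m g = 0].
Proof.
have [|x [y [fxy ex ey]]] := @ker_plane 2 (cols 2 [:: f; g]).
  exact: rank_leq_col.
have hx := mul_cols0 ex; have hy := mul_cols0 ey.
exists x, y; split=> //; [exact: (hx 0%N) | exact: (hx 1%N) | exact: (hy 0%N) |
  exact: (hy 1%N)].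
Qed.

(** The 4x4 matrix of the four forms is singular. *)
Lemma common_zero_dep (f g h l : 'cV[K]_4) (a b c : K) :
  a *: f + b *: g + c *: h = 0 -> [|| a != 0, b != 0 | c != 0] ->
  exists2 d : 'rV[K]_4, d != 0 &
    [/\ d *m f = 0, d *m g = 0, d *m h = 0 & d *m l = 0].
Proof.
move=> rel nz; set C := cols 4 [:: f; g; h; l].
have CU : C *m (\col_(i < 4) nth 0 [:: a; b; c; 0] i) = 0.
  apply/matrixP => i j; rewrite ord1 mxE !big_ord_recl big_ord0 /C !mxE /=.
  have /matrixP/(_ i 0) := rel; rewrite !mxE => rel_i; rewrite -[RHS]rel_i; ring.
have [|d d0 e] := @ker_vec 4 C.
  rewrite ltn_neqAle rank_leq_col andbT; apply: contraL nz => rC.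
  have : \col_(i < 4) nth 0 [:: a; b; c; 0] i = 0.
    apply: trmx_inj; rewrite trmx0; apply/eqP; rewrite -(mulmx_free_eq0 _ (B := C^T)).
      by rewrite -trmx_mul CU trmx0.
    by rewrite /row_free mxrank_tr.
  move=> /matrixP u0; move: (u0 (inord 0) 0) (u0 (inord 1) 0) (u0 (inord 2) 0).
  by rewrite !mxE !inordK //= => -> -> ->; rewrite eqxx.
exists d => //; have h' := mul_cols0 e.
by split; [exact: (h' 0%N) | exact: (h' 1%N) | exact: (h' 2%N) | exact: (h' 3%N)].
Qed.
End Rows.

(** * The web of quadrics *)

Section Web.
Variables (K : fieldType) (A : 'I_4 -> 'M[K]_4).
Hypothesis hsym : forall k, (A k)^T = A k.
Implicit Types (x y z v : 'rV[K]_4).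

Lemma webD x y : web_mx A (x + y) = web_mx A x + web_mx A y.
Proof.
by rewrite /web_mx -big_split; apply: eq_bigr => k _; rewrite mxE scalerDl.
Qed.
Lemma webZ c x : web_mx A (c *: x) = c *: web_mx A x.
Proof.
by rewrite /web_mx scaler_sumr; apply: eq_bigr => k _; rewrite mxE scalerA.
Qed.
Lemma web_sym x : (web_mx A x)^T = web_mx A x.
Proof.
rewrite /web_mx linear_sum; apply: eq_bigr => k _; by rewrite linearZ /= hsym.
Qed.

(** Evaluating the quadrics of the web on two fixed vectors gives a linear
    form on the parameter space, with coefficient vector [wcol]; all arguments
    below are carried by these forms. *)
Definition wf (y z x : 'rV[K]_4) : K := bf (web_mx A x) y z.
Definition wcol (y z : 'rV[K]_4) : 'cV[K]_4 := \col_k bf (A k) y z.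

Lemma wcolE y z x : x *m wcol y z = (wf y z x)%:M.
Proof.
apply/matrixP=> i j; rewrite !ord1 mxE [RHS]mxE mulr1n /wf /web_mx /bf.
rewrite mulmx_sumr mulmx_suml summxE; apply: eq_bigr => k _.
by rewrite mxE /bf -scalemxAr -scalemxAl [RHS]mxE.
Qed.

Lemma wfD y z x v : wf y z (x + v) = wf y z x + wf y z v.
Proof. by rewrite /wf webD bfD. Qed.
Lemma wfZ y z c x : wf y z (c *: x) = c * wf y z x.
Proof. by rewrite /wf webZ bfZ. Qed.
Lemma wfDl y y' z x : wf (y + y') z x = wf y z x + wf y' z x.
Proof. exact: bfDl. Qed.
Lemma wfDr y y' z x : wf z (y + y') x = wf z y x + wf z y' x.
Proof. exact: bfDr. Qed.
Lemma wfZl c y z x : wf (c *: y) z x = c * wf y z x.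
Proof. exact: bfZl. Qed.
Lemma wfZr c y z x : wf y (c *: z) x = c * wf y z x.
Proof. exact: bfZr. Qed.
Lemma wfC y z x : wf y z x = wf z y x.
Proof. exact/bfC/web_sym. Qed.

Lemma wf_basepoint y x : basepoint A y -> wf y y x = 0.
Proof. by case=> _ /(_ x) h; rewrite /wf /bf h mxE. Qed.

Lemma line_pencil x v : restr (line_arc x v) (sym_poly A) =
  \det (map_mx polyC (web_mx A x) + 'X *: map_mx polyC (web_mx A v)).
Proof. by rewrite restr_sym web_line. Qed.

Lemma line_coef1_delta (f : {mpoly K[4]}) x k :
  (restr (line_arc x (delta_mx 0 k)) f)`_1 = f^`M(k).@[x 0].
Proof.
rewrite restr_coef1 (bigD1 k) //= big1 ?addr0 => [|j jk]; last first.
  by rewrite line_arc1 mxE (negbTE jk) andbF mulr0.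
rewrite line_arc1 mxE !eqxx mulr1; apply: meval_eq => j.
exact: line_arc0.
Qed.

Lemma line_coef1 (f : {mpoly K[4]}) x v : singular_point f x ->
  (restr (line_arc x v) f)`_1 = 0.
Proof.
case=> _ _ df; rewrite restr_coef1 big1 // => k _.
by rewrite (meval_eq (v2 := x 0)) ?df ?mul0r // => j; rewrite line_arc0.
Qed.

(** The determinant vanishes at least to the order of the corank. *)
Lemma singular_of_rank x : x != 0 -> (\rank (web_mx A x) <= 2)%N ->
  singular_point (sym_poly A) x.
Proof.
move=> x0 rx; split=> // [|k].
  rewrite meval_sym; apply/eqP/negPn; rewrite -unitfE -unitmxE -row_free_unit.
  by apply/negP => /eqP h; rewrite h in rx.
have [B fB BM] := corank2_basis rx.
have [kap _ /(_ (web_mx A (delta_mx 0 k)))[G h _]] :=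
  @det_pencil_kernel _ 2 2 _ B (web_sym x) fB BM.
by rewrite -line_coef1_delta line_pencil h coefXnM.
Qed.

(** At a point of rank three with kernel [y], the differential of the
    determinant in direction [v] is a nonzero multiple of [y A(v) y^T]. *)
Lemma kernel_basepoint x y : singular_point (sym_poly A) x ->
  \rank (web_mx A x) = 3 -> y != 0 -> y *m web_mx A x = 0 -> basepoint A y.
Proof.
move=> sx rx y0 yM; split=> // v.
have fy : row_free y by rewrite /row_free rank_rV y0.
have [kap /(_ rx) kn0 /(_ (web_mx A v))[G h hG]] :=
  @det_pencil_kernel _ 1 3 _ y (web_sym x) fy yM.
have := line_coef1 v sx; rewrite line_pencil h coefXnM /= -horner_coef0 hG.
move/eqP; rewrite mulf_eq0 (negbTE kn0) /= => /eqP.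
by rewrite det_mx11 => h0; apply/matrixP=> i j; rewrite !ord1 h0 mxE.
Qed.

End Web.

(** * Nodes of rank two *)

(** The tangent cone at a point of corank two is given by the discriminant of
    the quadrics of the web restricted to the kernel. *)
Lemma node_expansion (K : fieldType) (A : 'I_4 -> 'M[K]_4) (p : 'rV[K]_4)
    (k1 k2 : 'rV[K]_4) :
    (forall k, (A k)^T = A k) -> row_free (rows 2 [:: k1; k2]) ->
    k1 *m web_mx A p = 0 -> k2 *m web_mx A p = 0 ->
  exists2 kap : K, (\rank (web_mx A p) = 2 -> kap != 0) & forall v,
    exists2 G : {poly K}, restr (line_arc p v) (sym_poly A) = 'X^2 * G &
      G.[0] = kap * (wf A k1 k1 v * wf A k2 k2 v - wf A k1 k2 v ^+ 2).
Proof.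
move=> hsym fk hk1 hk2.
have BM : rows 2 [:: k1; k2] *m web_mx A p = 0 by apply: rows_mul0 => -[|[|]].
have [kap kn0 hk] := @det_pencil_kernel _ 2 2 _ (rows 2 [:: k1; k2]) (web_sym hsym p) fk BM.
exists kap => // v; have [G h hG] := hk (web_mx A v).
exists G; first by rewrite line_pencil h.
rewrite hG det2E !bfE.
rewrite !row_rows /=.
by rewrite -/(wf A k1 k1 v) -/(wf A k2 k2 v) -/(wf A k1 k2 v) -/(wf A k2 k1 v)
  (wfC hsym k2 k1) expr2.
Qed.

(** Directions of the chart [x_i = p_i], as directions in [K^4]. *)
Definition ext (K : fieldType) (i : 'I_4) (e : 'rV[K]_3) : 'rV[K]_4 :=
  \row_k (if unlift i k is Some j then e 0 j else 0).

Lemma ext_i (K : fieldType) i (e : 'rV[K]_3) : ext i e 0 i = 0.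
Proof. by rewrite mxE unlift_none. Qed.

Lemma extK (K : fieldType) i (d : 'rV[K]_4) : d 0 i = 0 ->
  ext i (\row_j d 0 (lift i j)) = d.
Proof.
by move=> di; apply/rowP=> k; rewrite mxE; case: unliftP => [j|] ->; rewrite ?mxE.
Qed.

Lemma line_local (K : fieldType) (f : {mpoly K[4]}) p i (e : 'rV[K]_3) :
  restr (fun j => e 0 j *: 'X) (local_eq f p i) =
  restr (line_arc p (ext i e)) f.
Proof.
rewrite restr_local; apply: eq_restr => k; rewrite /chart_arc /line_arc mxE.
by congr (_ + _); case: unlift => //; rewrite scale0r.
Qed.

(** The Hessian form at an isolated node, restricted to any chart, is a nonzero
    multiple of the discriminant of the quadrics of the web on the kernel
    spanned by [k1] and [k2].  A linear relation between the three entries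
    would leave a tangent direction on which they all vanish, and that
    direction would be in the kernel of the Hessian. *)
Lemma node_independent (K : numFieldType) (A : 'I_4 -> 'M[K]_4)
    (p k1 k2 : 'rV[K]_4) (a b c : K) :
    (forall k, (A k)^T = A k) -> isolated_node A p ->
    row_free (rows 2 [:: k1; k2]) ->
    k1 *m web_mx A p = 0 -> k2 *m web_mx A p = 0 ->
    (forall v, a * wf A k1 k1 v + b * wf A k1 k2 v + c * wf A k2 k2 v = 0) ->
  [/\ a = 0, b = 0 & c = 0].
Proof.
move=> hsym [[i [pi [_ detH]]] [p0 rp]] fk hk1 hk2 rel.
set F := local_eq _ _ _ in detH; set H := (X in \det X) in detH.
have [/andP[/andP[/eqP-> /eqP->] /eqP->]//|abc] :=
  boolP ((a == 0) && (b == 0) && (c == 0)).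
exfalso.
have [kap /(_ rp) kap0 exp] := node_expansion hsym fk hk1 hk2.
have jetF (e : 'rV_3) : (e *m H *m e^T) 0 0 = (kap * (wf A k1 k1 (ext i e) *
    wf A k2 k2 (ext i e) - wf A k1 k2 (ext i e) ^+ 2)) *+ 2.
  have [G h <-] := exp (ext i e).
  have -> : G.[0] = (restr (line_arc p (ext i e)) (sym_poly A))`_2.
    by rewrite h coefXnM horner_coef0.
  rewrite -line_local jet2 => [|k]; last by rewrite coefZ coefX mulr0.
  rewrite [X in _ = _ + X *+ 2]big1 ?mul0rn ?addr0 => [|k _]; last first.
    by rewrite coefZ coefX !mulr0.
  rewrite mxE; apply: eq_bigr => k _; rewrite !mxE.
  rewrite mulr_suml [RHS]mulr_suml; apply: eq_bigr => j _.
  by rewrite !mxE !coefZ !coefX !mulr1 mderiv_comm -/F; ring.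
have [||d d0 [d1 d2 d3 di]] := @common_zero_dep K (wcol A k1 k1) (wcol A k1 k2)
    (wcol A k2 k2) (delta_mx i 0) a b c.
- apply/matrixP => l j; rewrite !mxE -[RHS](rel (delta_mx 0 l)).
  have E y z : wf A y z (delta_mx 0 l) = bf (A l) y z.
    have /matrixP/(_ 0 0) := wcolE A y z (delta_mx 0 l).
    by rewrite -rowE !mxE mulr1n.
  by rewrite !E.
- by rewrite -!negb_and andbA.
have W y z (x : 'rV_4) : x *m wcol A y z = 0 -> wf A y z x = 0.
  by rewrite wcolE => /matrixP/(_ 0 0); rewrite !mxE mulr1n.
have {}di : d 0 i = 0 by have /matrixP/(_ 0 0) := di; rewrite -colE !mxE.
have {}d1 := W _ _ _ d1; have {}d2 := W _ _ _ d2; have {}d3 := W _ _ _ d3.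
pose d' : 'rV_3 := \row_j d 0 (lift i j).
have Ed : ext i d' = d by exact: extK.
have symH : H^T = H by apply/matrixP => j k; rewrite !mxE mderiv_comm.
have polar (e : 'rV_3) : (e *m H *m d'^T) 0 0 = 0.
  have hs := jetF (d' + e); have hd := jetF d'; have he := jetF e.
  have EX : ext i (d' + e) = d + ext i e.
    rewrite -Ed; apply/rowP => k; rewrite !mxE; case: unlift => [j|]; rewrite ?mxE //.
    by rewrite addr0.
  rewrite EX !wfD d1 d2 d3 !add0r -{}he in hs.
  rewrite Ed d1 d2 d3 mulr0 expr0n subr0 mulr0 mul0rn in hd.
  have sym : (d' *m H *m e^T) 0 0 = (e *m H *m d'^T) 0 0.
    have <- : (d' *m H *m e^T)^T = e *m H *m d'^T.
      by rewrite !trmx_mul trmxK symH mulmxA.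
    by rewrite [RHS]mxE.
  have add (M N : 'M[K]_1) : (M + N) 0 0 = M 0 0 + N 0 0 by rewrite mxE.
  move: hs; rewrite linearD /= !mulmxDl !mulmxDr !add hd sym add0r.
  by rewrite addrA => /eqP; rewrite -subr_eq0 addrK -mulr2n mulrn_eq0 => /eqP.
have Hd : H *m d'^T = 0.
  apply/matrixP => j k; rewrite ord1 [RHS]mxE -(polar (delta_mx 0 j)).
  by rewrite -mulmxA -rowE [RHS]mxE.
have : d'^T = 0.
  by rewrite -(mulKmx (_ : H \in unitmx) d'^T) ?Hd ?mulmx0 // unitmxE unitfE.
move=> /(congr1 trmx); rewrite trmxK trmx0 => d'0.
by move: d0; rewrite -Ed d'0 => /eqP[]; apply/rowP => k; rewrite !mxE;
  case: unlift => // j; rewrite mxE.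
Qed.

(** * Counting points of projective space *)

Section Counting.
Variable K : fieldType.
Implicit Types (x y : 'rV[K]_4) (P Q : 'rV[K]_4 -> Prop) (s : seq 'rV[K]_4).

(** A normal form for projective points, so that they can be compared by
    equality. *)
Definition pt x : 'M[K]_4 := <<x>>%MS.

Lemma ptE x y : (x == y)%MS = (pt x == pt y).
Proof. by apply/genmxP/eqP. Qed.

Lemma pt_scale c x : c != 0 -> pt (c *: x) = pt x.
Proof. by move=> c0; apply/genmxP/eqmxP/eqmx_scale. Qed.

Lemma pt_eqP x y : x != 0 -> pt x = pt y -> exists2 c, c != 0 & x = c *: y.
Proof.
move=> x0 /eqP; rewrite -ptE => /andP[/sub_rVP[c xc] _].
by exists c => //; apply: contraNneq x0 => c0; rewrite xc c0 scale0r.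
Qed.

Lemma has_pt x s : has (fun y => (x == y)%MS) s = (pt x \in map pt s).
Proof.
elim: s => //= y s IH; rewrite inE -IH -ptE; exact: erefl.
Qed.

Lemma nb_pointsP P n : nb_points P n <-> exists s,
  [/\ size s = n, all (fun x => x != 0) s, uniq (map pt s) &
      forall x, x != 0 -> (P x <-> pt x \in map pt s)].
Proof.
split=> -[s [sn s0 us Ps]]; exists s; split=> //.
- rewrite uniq_pairwise pairwise_map; apply: sub_pairwise us => x y.
  by rewrite /= ptE.
- by move=> x x0; rewrite -has_pt; exact: Ps.
- move: us; rewrite uniq_pairwise pairwise_map; apply: sub_pairwise => x y.
  by rewrite /= ptE.
- by move=> x x0; rewrite has_pt; exact: Ps.
Qed.

Lemma nb_scale P n : nb_points P n ->
  forall c x, x != 0 -> c != 0 -> P x -> P (c *: x).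
Proof.
move=> /nb_pointsP[s [_ _ _ Ps]] c x x0 c0 /(Ps _ x0) px.
by apply/Ps; [rewrite scaler_eq0 negb_or c0 | rewrite pt_scale].
Qed.

Lemma nb_split P Q n : nb_points P n ->
    (forall c x, x != 0 -> c != 0 -> Q x -> Q (c *: x)) ->
  exists m k, [/\ (m + k)%N = n, nb_points (fun x => P x /\ Q x) m &
                  nb_points (fun x => P x /\ ~ Q x) k].
Proof.
move=> /nb_pointsP[s [sn s0 us Ps]] sQ.
have sub (q : pred 'rV_4) : (forall c x, x != 0 -> c != 0 -> q x -> q (c *: x)) ->
    nb_points (fun x => P x /\ q x) (count q s).
  move=> sq; apply/nb_pointsP; exists (filter q s); split=> //.
  - by rewrite size_filter.
  - by apply/allP=> x; rewrite mem_filter => /andP[_ /(allP s0)].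
  - by apply: subseq_uniq us; apply/map_subseq/filter_subseq.
  - move=> x x0; split=> [[/(Ps _ x0)/mapP[y ys e] qx]|/mapP[y]].
      rewrite e map_f // mem_filter ys andbT.
      have [c c0 xc] := pt_eqP x0 e; rewrite xc in qx.
      have := sq c^-1 _ _ _ qx; rewrite scalerA mulVf // scale1r; apply.
        by rewrite -xc.
      by rewrite invr_eq0.
    rewrite mem_filter => /andP[qy ys] e; split; first by apply/Ps; rewrite ?e ?map_f.
    have [c c0 ->] := pt_eqP x0 e; apply: sq => //; exact: (allP s0).
pose q x := `[< Q x >].
have eqnb (P1 P2 : 'rV_4 -> Prop) m : (forall x, P1 x <-> P2 x) ->
    nb_points P1 m -> nb_points P2 m.
  by move=> e [t [t1 t2 t3 t4]]; exists t; split=> // x x0; rewrite -e; exact: t4.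
have q1 c x : x != 0 -> c != 0 -> q x -> q (c *: x).
  by move=> x0 c0 /asboolP qx; apply/asboolP; exact: sQ.
have q2 c x : x != 0 -> c != 0 -> predC q x -> predC q (c *: x).
  move=> x0 c0 /asboolP qx; apply/asboolP => /(sQ c^-1) qcx; apply: qx.
  rewrite -[x]scale1r -(mulVf c0) -scalerA; apply: qcx.
    by rewrite scaler_eq0 negb_or c0.
  by rewrite invr_eq0.
exists (count q s), (count (predC q) s); split; first by rewrite count_predC.
  by apply: eqnb (sub q q1) => x; split=> -[px /asboolP].
by apply: eqnb (sub (predC q) q2) => x; rewrite /=; split=> -[px /asboolPn].
Qed.

Lemma nb_le_seq P n (t : seq 'rV[K]_4) : nb_points P n ->
  (forall x, x != 0 -> P x -> pt x \in map pt t) -> (n <= size t)%N.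
Proof.
move=> /nb_pointsP[s [<- s0 us Ps]] h; rewrite -(size_map pt s) -(size_map pt t).
apply: uniq_leq_size => // M /mapP[x xs ->].
by apply: h; [exact: (allP s0) | apply/Ps; [exact: (allP s0) | exact: map_f]].
Qed.

Lemma nb_le P Q n m : nb_points P n -> nb_points Q m ->
  (forall x, x != 0 -> P x -> Q x) -> (n <= m)%N.
Proof.
move=> nP /nb_pointsP[t [<- _ _ Qt]] PQ; apply: nb_le_seq nP _ => x x0 /PQ.
by move=> /(_ x0) /(Qt _ x0).
Qed.

Lemma nb_uniq P Q n m : nb_points P n -> nb_points Q m ->
  (forall x, x != 0 -> (P x <-> Q x)) -> n = m.
Proof.
move=> nP nQ PQ; apply/eqP; rewrite eqn_leq (nb_le nP nQ) ?(nb_le nQ nP) //.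
  by move=> x x0 /(PQ _ x0).
by move=> x x0 /(PQ _ x0).
Qed.

Lemma nb_ex P n : nb_points P n -> (0 < n)%N -> exists2 x, x != 0 & P x.
Proof.
move=> /nb_pointsP[[|x s] [<- //= /andP[x0 _] _ Ps]] _.
by exists x => //; apply/Ps => //; rewrite inE eqxx.
Qed.

Lemma nb_two P n x y : nb_points P n -> x != 0 -> y != 0 -> pt x != pt y ->
  P x -> P y -> (1 < n)%N.
Proof.
move=> /nb_pointsP[s [<- _ us Ps]] x0 y0 xy /(Ps _ x0) px /(Ps _ y0) py.
rewrite -(size_map pt s).
have : (size [:: pt x; pt y] <= size (map pt s))%N.
  apply: uniq_leq_size => [|M]; first by rewrite /= inE xy.
  by rewrite !inE => /orP[] /eqP->.
by [].
Qed.

Lemma free2_nz x y t : row_free (rows 2 [:: x; y]) -> x + t *: y != 0.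
Proof.
move=> /free2P fxy; apply/eqP => e; have [] := fxy 1 t; rewrite ?scale1r // => /eqP.
by rewrite oner_eq0.
Qed.

(** Distinct parameters give distinct points of the line, so every forbidden
    point excludes at most one parameter. *)
Lemma generic_line_seq s x y : row_free (rows 2 [:: x; y]) ->
  exists T : seq K, forall t, t \notin T -> pt (x + t *: y) \notin map pt s.
Proof.
move=> fxy0; have nz t := free2_nz t fxy0; have /free2P fxy := fxy0.
elim: s => [|z s [T hT]]; first by exists [::].
have [[t0 e0]|no] := pselect (exists t0, pt (x + t0 *: y) = pt z); last first.
  exists T => t /hT tT; rewrite /= inE negb_or tT andbT.
  by apply/eqP => e; apply: no; exists t.
exists (t0 :: T) => t; rewrite !inE negb_or => /andP[tt0 /hT tT].
rewrite /= negb_or tT andbT.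
apply: contraNneq tt0; rewrite -e0 => /(pt_eqP (nz t))[c c0].
rewrite scalerDr scalerA => /eqP; rewrite -subr_eq0 opprD addrACA -{1}[x]scale1r.
rewrite -!scalerBl => /eqP/fxy[/eqP]; rewrite subr_eq0 => /eqP <- /eqP.
by rewrite mul1r subr_eq0.
Qed.

Lemma generic_line P n x y : nb_points P n -> row_free (rows 2 [:: x; y]) ->
  exists T : seq K, forall t, t \notin T -> ~ P (x + t *: y).
Proof.
move=> /nb_pointsP[s [_ _ _ Ps]] fxy; have [T hT] := generic_line_seq s fxy.
by exists T => t /hT tT /(Ps _ (free2_nz t fxy)); rewrite (negbTE tT).
Qed.

Lemma free2_pt x y : x != 0 -> y != 0 -> pt x != pt y -> row_free (rows 2 [:: x; y]).
Proof.
move=> x0 y0 xy; apply/free2P => a b e.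
have [a0|a0] := eqVneq a 0.
  split=> //; move/eqP: e; rewrite a0 scale0r add0r scaler_eq0 (negbTE y0) orbF.
  by move/eqP.
have [b0|b0] := eqVneq b 0.
  move/eqP: e; rewrite b0 scale0r addr0 scaler_eq0 (negbTE x0) orbF.
  by move/eqP.
case/eqP: xy; rewrite -(pt_scale x a0) -(pt_scale y b0).
move/eqP: e; rewrite addr_eq0 => /eqP ->; rewrite -scaleN1r. by apply: pt_scale; rewrite oppr_eq0 oner_eq0.
Qed.

Lemma pt_free2 x y : row_free (rows 2 [:: x; y]) ->
  [/\ x != 0, y != 0 & pt x != pt y].
Proof.
move=> /free2P f.
have x0 : x != 0.
  by apply/eqP => x0; have [] := f 1 0; rewrite ?x0 ?scale0r ?scaler0 ?addr0 // => /eqP;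
    rewrite oner_eq0.
split=> //.
  by apply/eqP => y0; have [] := f 0 1; rewrite ?y0 ?scale0r ?scaler0 ?addr0 // => _ /eqP;
    rewrite oner_eq0.
apply/eqP => /(pt_eqP x0)[c c0 e]; have [] := f 1 (- c).
  by rewrite scale1r scaleNr -e subrr.
by move=> /eqP; rewrite oner_eq0.
Qed.

End Counting.

Lemma ex_notin (K : numFieldType) (T : seq K) : exists t, t \notin T.
Proof.
pose U := [seq k%:R : K | k <- iota 0 (size T).+1].
have [/allP h|/allPn[t _ tT]] := boolP (all (mem T) U); last by exists t.
have uU : uniq U by rewrite map_inj_uniq ?iota_uniq // => i j /eqP; rewrite eqr_nat => /eqP.
by have := uniq_leq_size uU h; rewrite size_map size_iota ltnn.
Qed.

Lemma ex_three (K : numFieldType) (T : seq K) : exists t1 t2 t3,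
  [/\ t1 \notin T, t2 \notin T, t3 \notin T, t1 != t2 & (t3 != t1) && (t3 != t2)].
Proof.
have [t1 h1] := ex_notin T; have [t2] := ex_notin (t1 :: T).
rewrite inE negb_or => /andP[h12 h2]; have [t3] := ex_notin [:: t1, t2 & T].
rewrite !inE !negb_or => /and3P[h13 h23 h3].
by exists t1, t2, t3; rewrite h1 h2 h3 h13 h23 eq_sym h12.
Qed.

(** The elements that are not fixed come in pairs. *)
Lemma involution_parity (T : eqType) (f : T -> T) (s : seq T) :
  uniq s -> {in s, forall x, f (f x) = x} -> {in s, forall x, f x \in s} ->
  odd (size s) = odd (count (fun x => f x == x) s).
Proof.
move=> us fK; have [n le_n] := ubnP (size s).
elim: n s le_n us fK => // n IH [//|x s] /=.
rewrite ltnS => le_n /andP[xs us] fK st.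
have fKs : {in s, forall y, f (f y) = y} by move=> y ys; rewrite fK // inE ys orbT.
have fKx : f (f x) = x by rewrite fK // inE eqxx.
have [fx|fx] := eqVneq (f x) x.
  rewrite add1n /=; congr (~~ _); apply: IH => // y ys.
  have := st y; rewrite !inE ys orbT => /(_ isT)/orP[/eqP fy|//].
  by move: xs; rewrite -fx -fy fKs // ys.
have fxs : f x \in s by have := st x; rewrite !inE eqxx (negbTE fx) => /(_ isT).
have ps := perm_to_rem fxs.
rewrite (perm_size ps) (seq.permP ps) /= fKx eq_sym (negbTE fx) !add0n negbK.
apply: IH; [|exact: rem_uniq| |].
- by move: le_n; rewrite (perm_size ps) /= => /ltnW.
- by move=> y; rewrite mem_rem_uniq // !inE => /andP[_ ys]; exact: fKs.
move=> y; rewrite !mem_rem_uniq // !inE => /andP[yfx ys].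
have := st y; rewrite !inE ys orbT => /(_ isT) /orP[/eqP fy|->].
  by move: yfx; rewrite -fy fKs // eqxx.
rewrite andbT; apply: contraNneq xs => fyx.
by rewrite -fKx -fyx fKs.
Qed.

(** * Change of base field, complex conjugation *)

Section BaseChange.
Variables (K L : fieldType) (s : {rmorphism K -> L}).

Lemma meval_map n (p : {mpoly K[n]}) (x : 'I_n -> K) :
  (map_mpoly s p).@[fun k => s (x k)] = s p.@[x].
Proof.
elim/mpoly_alg_ind: p => [a|i|p q Hp Hq|p q Hp Hq].
- by rewrite map_mpolyC !mevalC.
- by rewrite map_mpolyX !mevalXU.
- by rewrite rmorphD !mevalD rmorphD Hp Hq.
- by rewrite rmorphM !mevalM rmorphM Hp Hq.
Qed.

Lemma mderiv_map n (p : {mpoly K[n]}) k :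
  (map_mpoly s p)^`M(k) = map_mpoly s (p^`M(k)).
Proof.
by apply/mpolyP => m; rewrite mcoeff_mderiv !mcoeff_map_mpoly mcoeff_mderiv raddfMn.
Qed.

Lemma comp_map n m (p : {mpoly K[m]}) (lq : m.-tuple {mpoly K[n]}) :
  map_mpoly s (p \mPo lq) = map_mpoly s p \mPo [tuple of map (map_mpoly s) lq].
Proof.
elim/mpoly_alg_ind: p => [a|i|p q Hp Hq|p q Hp Hq].
- by rewrite comp_mpolyC !map_mpolyC comp_mpolyC.
- rewrite map_mpolyX !comp_mpolyXU.
  by rewrite -!tnth_nth tnth_map.
- by rewrite comp_mpolyD [in LHS]rmorphD [in RHS]rmorphD /= comp_mpolyD Hp Hq.
- by rewrite rmorphM [in LHS]rmorphM [in RHS]rmorphM /= rmorphM Hp Hq.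
Qed.

Lemma local_eq_map (f : {mpoly K[4]}) (p : 'rV[K]_4) i :
  local_eq (map_mpoly s f) (map_mx s p) i = map_mpoly s (local_eq f p i).
Proof.
rewrite /local_eq comp_map; congr (_ \mPo _); apply: eq_from_tnth => k.
rewrite tnth_map !tnth_mktuple rmorphD /= map_mpolyC mxE; congr (_ + _).
by case: unlift => [j|]; rewrite ?map_mpolyX ?raddf0.
Qed.

Lemma web_map (A : 'I_4 -> 'M[K]_4) (x : 'rV[K]_4) :
  web_mx (fun k => map_mx s (A k)) (map_mx s x) = map_mx s (web_mx A x).
Proof.
rewrite /web_mx map_mx_sum; apply: eq_bigr => k _.
by rewrite map_mxZ mxE.
Qed.

Lemma sym_poly_map (A : 'I_4 -> 'M[K]_4) :
  sym_poly (fun k => map_mx s (A k)) = map_mpoly s (sym_poly A).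
Proof.
rewrite /sym_poly -det_map_mx; congr (\det _); apply/matrixP => i j.
rewrite mxE !summxE rmorph_sum; apply: eq_bigr => k _.
by rewrite !mxE rmorphM /= map_mpolyX map_mpolyC.
Qed.

Lemma mult_at0_map (F : {mpoly K[3]}) d : mult_at0 F d -> mult_at0 (map_mpoly s F) d.
Proof.
case=> h0 [m [dm hm]]; split=> [m' /h0 e|]; first by rewrite mcoeff_map_mpoly e raddf0.
by exists m; rewrite mcoeff_map_mpoly fmorph_eq0.
Qed.

Lemma node_map (f : {mpoly K[4]}) p : node f p ->
  node (map_mpoly s f) (map_mx s p).
Proof.
case=> i [pi [h2 hd]]; exists i; rewrite mxE fmorph_eq0 local_eq_map; split=> //.
split; first exact: mult_at0_map.
move: hd; rewrite -(fmorph_eq0 s) -det_map_mx; congr (\det _ != 0).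
by apply/matrixP => j k; rewrite !mxE !mderiv_map mcoeff_map_mpoly.
Qed.

Lemma singular_map (f : {mpoly K[4]}) p : singular_point f p ->
  singular_point (map_mpoly s f) (map_mx s p).
Proof.
have E g : (map_mpoly s g).@[(map_mx s p) 0] = s g.@[p 0].
  by rewrite -meval_map; apply: meval_eq => k; rewrite mxE.
case=> p0 fp df; split=> [||k]; first by rewrite map_mx_eq0.
  by rewrite E fp raddf0.
by rewrite mderiv_map E df raddf0.
Qed.

Lemma wf_map (A : 'I_4 -> 'M[K]_4) y z x :
  wf (fun k => map_mx s (A k)) (map_mx s y) (map_mx s z) (map_mx s x) =
  s (wf A y z x).
Proof. by rewrite /wf web_map /bf map_trmx -!map_mxM mxE. Qed.

End BaseChange.

Section Conj.
Variable R : realType.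
Local Notation C := R[i].
Implicit Types (z : 'rV[R]_4).

Lemma conj_mxK m n : involutive (@conj_mx R m n).
Proof. by move=> M; apply/matrixP => i j; rewrite !mxE conjcK. Qed.

Lemma conj_cplx m n (M : 'M[R]_(m, n)) : conj_mx (cplx M) = cplx M.
Proof. by apply/matrixP => i j; rewrite !mxE conjc_real. Qed.

Lemma conj_eq_real m n (M : 'M[C]_(m, n)) : conj_mx M = M -> exists N, M = cplx N.
Proof.
move=> /matrixP e; exists (map_mx (@complex.Re R) M); apply/matrixP => i j.
by have := e i j; rewrite !mxE; case: (M i j) => a b [/eqP]; rewrite eqNr => /eqP->.
Qed.

Lemma cplx_eq0 z : (cplx z == 0) = (z == 0).
Proof. exact: map_mx_eq0. Qed.

Lemma conj_eq0 (x : 'rV[C]_4) : (conj_mx x == 0) = (x == 0).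
Proof. exact: map_mx_eq0. Qed.

Definition conj_pt (M : 'M[C]_4) : 'M[C]_4 := <<conj_mx M>>%MS.

Lemma pt_conj (x : 'rV[C]_4) : pt (conj_mx x) = conj_pt (pt x).
Proof.
apply/genmxP/eqmxP/(eqmx_trans (eqmx_sym (genmxE _)))/eqmx_sym.
exact: (map_genmx (@conjc R) x).
Qed.

Lemma eq_conj_pt (x y : 'rV[C]_4) : pt x = pt y -> pt (conj_mx x) = pt (conj_mx y).
Proof. by rewrite !pt_conj => ->. Qed.

Lemma eq_cplx_pt z w : (pt (cplx z) == pt (cplx w)) = (pt z == pt w).
Proof. by rewrite -!ptE !(map_submx (real_complex R)). Qed.

(** Dividing by a nonzero coordinate gives a representative that is equal to
    its own conjugate. *)
Lemma real_point (x : 'rV[C]_4) : x != 0 -> pt (conj_mx x) = pt x ->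
  exists z c, [/\ z != 0, c != 0 & x = c *: cplx z].
Proof.
move=> x0 e; have [j xj] : exists j, x 0 j != 0.
  apply/existsP; apply: contraNT x0; rewrite negb_exists => /forallP h.
  by apply/eqP/rowP => j; have := h j; rewrite negbK mxE => /eqP.
pose y := (x 0 j)^-1 *: x; have yj : y 0 j = 1 by rewrite mxE mulVf.
have y0 : y != 0 by rewrite scaler_eq0 invr_eq0 negb_or xj.
have py : pt y = pt x by rewrite pt_scale ?invr_eq0.
have : pt (conj_mx y) = pt y by rewrite py (eq_conj_pt py).
move=> /pt_eqP[|c c0 cy]; first by rewrite conj_eq0.
have c1 : c = 1.
  have := congr1 (fun M : 'rV_4 => M 0 j) cy.
  by rewrite [in RHS]mxE [LHS]mxE yj mulr1 rmorph1.
have [|z yz] := @conj_eq_real _ _ y; first by rewrite cy c1 scale1r.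
exists z, (x 0 j); split=> //; first by rewrite -cplx_eq0 -yz.
by rewrite -yz scalerA mulfV // scale1r.
Qed.

(** Conjugation permutes the [n] complex points, the real points are its fixed
    points, and the others come in pairs. *)
Lemma nb_real (P : 'rV[C]_4 -> Prop) n a : nb_points P n ->
    nb_points (fun z => P (cplx z)) a -> (forall x, P x -> P (conj_mx x)) ->
  (a <= n)%N /\ odd a = odd n.
Proof.
move=> nP nPa cP; have Pc := nb_scale nP.
move: nP nPa => /nb_pointsP[s [<- s0 us Ps]] /nb_pointsP[t [<- t0 ut Pt]].
set S := [seq pt i | i <- s] in us Ps; rewrite -(size_map (@pt _) s) -/S.
have SP M : M \in S -> exists x, [/\ x != 0, P x & M = pt x].
  move=> /mapP[x xs ->]; have x0 := allP s0 x xs.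
  by exists x; split=> //; apply/Ps => //; exact: map_f.
have stab : {in S, forall M, conj_pt M \in S}.
  move=> M /SP[x [x0 Px ->]]; rewrite -pt_conj.
  by apply/Ps; [rewrite conj_eq0 | exact: cP].
have invol : {in S, forall M, conj_pt (conj_pt M) = M}.
  by move=> M /SP[x [x0 Px ->]]; rewrite -!pt_conj conj_mxK.
have -> : size t = count (fun M => conj_pt M == M) S.
  rewrite -size_filter -(size_map (fun z => pt (cplx z)) t).
  have ut' : uniq [seq pt (cplx z) | z <- t].
    move: ut; rewrite !uniq_pairwise !pairwise_map; apply: sub_pairwise => z w.
    by rewrite /= eq_cplx_pt.
  apply/eqP; rewrite -uniq_size_uniq ?filter_uniq // => M; rewrite mem_filter.
  apply/idP/idP => [/andP[/eqP cM /SP[x [x0 Px Mx]]]|/mapP[z zt ->]].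
    have [|z [c [z0 c0 xz]]] := real_point x0; first by rewrite pt_conj -Mx.
    have pxz : pt x = pt (cplx z) by rewrite xz pt_scale.
    have : P (cplx z) by apply/Ps; rewrite ?cplx_eq0 // -pxz; exact/Ps.
    move=> /(Pt _ z0)/mapP[z' z't /eqP e]; apply/mapP; exists z' => //.
    by rewrite Mx pxz; apply/eqP; rewrite eq_cplx_pt.
  have z0 := allP t0 z zt; rewrite -pt_conj conj_cplx eqxx /=.
  by apply/Ps; rewrite ?cplx_eq0 //; apply/Pt => //; exact: map_f.
split; first exact: count_size.
by rewrite -(involution_parity us invol stab).
Qed.

Variable A : 'I_4 -> 'M[R]_4.
Local Notation AC := (cplx_web A).
Local Notation f := (sym_poly AC).

Lemma conj_webs : (fun k => map_mx (@conjc R) (AC k)) = AC.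
Proof. by apply/funext => k; exact: conj_cplx. Qed.

Lemma conj_sym_poly : map_mpoly (@conjc R) f = f.
Proof.
rewrite -[RHS](congr1 (@sym_poly _) conj_webs).
exact: esym (sym_poly_map _ AC).
Qed.

Lemma conj_web x : web_mx AC (conj_mx x) = conj_mx (web_mx AC x).
Proof.
rewrite -(congr1 (fun B => web_mx B (conj_mx x)) conj_webs).
exact: (web_map (@conjc R) AC).
Qed.

Lemma conj_singular x : singular_point f x -> singular_point f (conj_mx x).
Proof. by move=> /(singular_map (@conjc R)); rewrite conj_sym_poly. Qed.

Lemma conj_isolated_node x : isolated_node AC x -> isolated_node AC (conj_mx x).
Proof.
case=> n [x0 r]; split; first by have := node_map (@conjc R) n; rewrite conj_sym_poly.
by split; [rewrite conj_eq0 | rewrite conj_web (mxrank_map (@conjc R))].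
Qed.

Lemma conj_wf (y z x : 'rV[C]_4) :
  wf AC (conj_mx y) (conj_mx z) (conj_mx x) = conjc (wf AC y z x).
Proof. by rewrite /wf conj_web /bf map_trmx -!(map_mxM (@conjc R)) mxE. Qed.

Lemma cplx_wf (y z x : 'rV[R]_4) : wf AC (cplx y) (cplx z) (cplx x) = (wf A y z x)%:C%C.
Proof. exact: (wf_map (real_complex R)). Qed.

Lemma cplx_webE z : web_mx AC (cplx z) = cplx (web_mx A z).
Proof. exact: (web_map (real_complex R)). Qed.

Lemma conj_basepoint y : basepoint AC y -> basepoint AC (conj_mx y).
Proof.
case=> y0 hy; split=> [|x]; first by rewrite conj_eq0.
have := congr1 (@conj_mx R 1 1) (hy (conj_mx x)).
by rewrite /conj_mx map_mx0 !map_mxM -map_trmx -/(conj_mx _) conj_web -!/(conj_mx _) conj_mxK.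
Qed.

End Conj.

(** * Real quadrics *)

(** A form of rank at most [r] is recovered from a subspace of dimension [r]
    on which it is nondegenerate. *)
Lemma bf_reduce (K : fieldType) r (M : 'M[K]_4) (P : 'M[K]_(r, 4)) :
    M^T = M -> (\rank M <= r)%N -> \det (P *m M *m P^T) != 0 ->
  forall w, exists c : 'rV_r, bf M w w = (c *m (P *m M *m P^T) *m c^T) 0 0.
Proof.
move=> sM rM dP w.
have : (w *m M <= P *m M)%MS.
  apply: submx_trans (submxMl w M) _.
  have /mxrank_leqif_sup e : (P *m M <= M)%MS by exact: submxMl.
  rewrite -(geq_leqif e); apply: leq_trans rM _.
  apply: leq_trans (mxrankM_maxl _ P^T).
  by rewrite mxrank_unit // unitmxE unitfE.
move=> /submxP[c wM]; exists c.
have wP : w *m M = (c *m P) *m M by rewrite wM mulmxA.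
have Mw : M *m w^T = M *m (c *m P)^T.
  by rewrite -[M in LHS]sM -[M in RHS]sM -!trmx_mul wP.
by rewrite /bf wP -(mulmxA (c *m P)) Mw trmx_mul !mulmxA.
Qed.

Section Definite.
Variable R : realType.
Implicit Types (M N : 'M[R]_4) (y z : 'rV[R]_4).

Lemma definite_neq0 M : definite M -> forall y, y != 0 -> bf M y y != 0.
Proof. by case=> h y /h hy; [exact: lt0r_neq0 | exact: ltr0_neq0]. Qed.

Lemma semidefinite_rank1 M : M^T = M -> (\rank M <= 1)%N -> semidefinite M.
Proof.
move=> sM rM; have [h|] := pselect (forall z, bf M z z = 0).
  by left=> y; rewrite -/(bf M y y) h.
move=> /existsNP[z /eqP z0].
have dz : z *m M *m z^T = (bf M z z)%:M.
  by apply/matrixP => i j; rewrite !ord1 [RHS]mxE mulr1n.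
have red := bf_reduce sM rM (P := z); rewrite dz det_scalar1 in red.
have {}red w : exists c : 'rV[R]_1, bf M w w = bf M z z * (c 0 0) ^+ 2.
  have [c ->] := red z0 w; exists c.
  rewrite mul_mx_scalar -scalemxAl mxE; congr (_ * _).
  by rewrite mxE big_ord1 mxE expr2.
have [zp|zn] := ltP 0 (bf M z z); [left | right] => w; rewrite -/(bf M w w);
  have [c ->] := red w.
  by rewrite mulr_ge0 ?sqr_ge0 // ltW.
by rewrite mulr_le0_ge0 ?sqr_ge0.
Qed.

(** The form is a multiple of the sum of squares on the plane of [u] and [v],
    and by [bf_reduce] all its values are attained on that plane. *)
Lemma semidefinite_rank2 M u v : M^T = M -> (\rank M <= 2)%N ->
  bf M u u = bf M v v -> bf M u v = 0 -> bf M u u != 0 -> semidefinite M.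
Proof.
move=> sM rM uv0 uv nz; pose P := rows 2 [:: u; v].
have PM : P *m M *m P^T = (bf M u u)%:M.
  apply/matrixP => i j; rewrite bfE !row_rows mxE.
  case: i => [[|[|//]] hi]; case: j => [[|[|//]] hj] //=; rewrite ?mulr0n ?mulr1n //.
  by rewrite bfC.
have dP : \det (P *m M *m P^T) != 0.
  by rewrite PM det_scalar expf_neq0.
have red w : exists2 s, 0 <= s & bf M w w = bf M u u * s.
  have [c ->] := bf_reduce sM rM dP w; exists ((c *m c^T) 0 0).
    by rewrite mxE sumr_ge0 // => i _; rewrite mxE -expr2 sqr_ge0.
  by rewrite PM mul_mx_scalar -scalemxAl mxE.
have [zp|zn] := ltP 0 (bf M u u); [left | right] => w; rewrite -/(bf M w w);
  have [s s0 ->] := red w.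
  by rewrite mulr_ge0 // ltW.
by rewrite mulr_le0_ge0.
Qed.

Lemma semidefinite_ker M z : M^T = M -> semidefinite M -> bf M z z = 0 ->
  z *m M = 0.
Proof.
move=> sM hM z0.
have ex w t : bf M (t *: z + w) (t *: z + w) = t * 2 * bf M z w + bf M w w.
  rewrite bfDl !bfDr !bfZl !bfZr z0 (bfC w z sM); ring.
suff h w : bf M z w = 0.
  apply/rowP => j; rewrite [RHS]mxE -(h (delta_mx 0 j)) /bf trmx_delta.
  by rewrite -colE !mxE.
apply/eqP/negPn/negP => nz.
have := ex w (- (bf M w w + 1) / (2 * bf M z w)).
have := ex w (- (bf M w w - 1) / (2 * bf M z w)).
have -> : - (bf M w w - 1) / (2 * bf M z w) * 2 * bf M z w = 1 - bf M w w.
  by field.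
have -> : - (bf M w w + 1) / (2 * bf M z w) * 2 * bf M z w = - 1 - bf M w w.
  by field.
set a := (X in bf M X X = _ -> _); set b := (X in _ -> bf M X X = _ -> _).
rewrite !subrK => e1 e2; case: hM => hM; have := hM a; have := hM b;
  rewrite -!/(bf M _ _) e1 e2; lra.
Qed.

Lemma pencil_coef_aux r m (M0 M1 : 'M[R]_(r + m)) : M0^T = M0 ->
    \rank M0 = m ->
    (forall y : 'rV_(r + m), y != 0 -> y *m M0 = 0 -> (y *m M1 *m y^T) 0 0 != 0) ->
  (\det (map_mx polyC M0 + 'X *: map_mx polyC M1))`_r != 0.
Proof.
move=> sM rM dM; have rk : \rank (kermx M0) = r by rewrite mxrank_ker rM addnK.
have [B fB eB] := ex_basis rk.
have BM : B *m M0 = 0 by apply/sub_kermxP; rewrite eB.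
have [kap /(_ rM) kap0 h] := det_pencil_kernel sM fB BM.
have [G -> hG] := h M1; rewrite coefXnM ltnn subnn -horner_coef0 hG.
rewrite mulf_neq0 // -unitfE -unitmxE -row_free_unit; apply/row_free_kerP => u uB.
have uBM : (u *m B) *m M0 = 0 by rewrite -mulmxA BM mulmx0.
apply/eqP; have [//|u0] := eqVneq u 0.
have uB0 : u *m B != 0 by rewrite mulmx_free_eq0.
have := dM _ uB0 uBM; rewrite trmx_mul !mulmxA.
have -> : u *m B *m M1 *m B^T = u *m (B *m M1 *m B^T) by rewrite !mulmxA.
by rewrite uB mul0mx mxE eqxx.
Qed.

(** Along a line through [M0] in a definite direction the determinant vanishes
    exactly to the order given by the corank, since the kernel carries a
    definite form. *)
Lemma pencil_coef_corank M0 N c : M0^T = M0 -> definite N ->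
  (\det (map_mx polyC M0 + 'X *: map_mx polyC (N + c *: M0)))`_(4 - \rank M0) != 0.
Proof.
move=> sM dN.
have dM (y : 'rV_4) : y != 0 -> y *m M0 = 0 -> (y *m (N + c *: M0) *m y^T) 0 0 != 0.
  move=> y0 yM; rewrite mulmxDr -scalemxAr yM scaler0 addr0.
  exact: definite_neq0.
have := rank_leq_row M0; case rM : (\rank M0) => [|[|[|[|[|//]]]]] _.
- exact: (@pencil_coef_aux 4 0 M0 _ sM rM dM).
- exact: (@pencil_coef_aux 3 1 M0 _ sM rM dM).
- exact: (@pencil_coef_aux 2 2 M0 _ sM rM dM).
- exact: (@pencil_coef_aux 1 3 M0 _ sM rM dM).
- exact: (@pencil_coef_aux 0 4 M0 _ sM rM dM).
Qed.

End Definite.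

(** * Basepoints of a spectrahedral web *)

Section RealWeb.
Variables (R : realType) (A : 'I_4 -> 'M[R]_4).
Hypothesis hsym : forall k, (A k)^T = A k.
Local Notation C := R[i].
Local Notation AC := (cplx_web A).
Implicit Types (x : 'rV[R]_4) (y : 'rV[C]_4).

Lemma csym k : (AC k)^T = AC k.
Proof. by rewrite /cplx_web /cplx map_trmx hsym. Qed.

Definition re y : 'rV[R]_4 := map_mx (@complex.Re R) y.
Definition im y : 'rV[R]_4 := map_mx (@complex.Im R) y.

Lemma re_im y : y = cplx (re y) + 'i%C *: cplx (im y).
Proof. by apply/rowP => j; rewrite !mxE; case: (y 0 j) => a b /=; simpc. Qed.

Lemma conj_re_im y : conj_mx y = cplx (re y) - 'i%C *: cplx (im y).
Proof. by apply/rowP => j; rewrite !mxE; case: (y 0 j) => a b /=; simpc. Qed.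

(** Separates [y A(x) y^T = 0] into its real and imaginary parts. *)
Lemma basepoint_parts y x : basepoint AC y ->
  [/\ wf A (re y) (re y) x = wf A (im y) (im y) x, wf A (re y) (im y) x = 0 &
      wf AC y (conj_mx y) (cplx x) = (wf A (re y) (re y) x *+ 2)%:C%C].
Proof.
move=> /wf_basepoint => /(_ (cplx x)) y0.
have : wf A (re y) (re y) x = wf A (im y) (im y) x /\ wf A (re y) (im y) x = 0.
  move: y0; rewrite {1 2}(re_im y) wfDl !wfDr !wfZl !wfZr !cplx_wf.
  rewrite (wfC hsym (im y) (re y)); simpc => /eqP; rewrite eq_complex /= => /andP[].
  by move=> /eqP h1 /eqP h2; split; lra.
case=> h1 h2; split=> //; rewrite conj_re_im {1}(re_im y).
rewrite -scaleNr wfDl !wfDr !wfZl !wfZr !cplx_wf (wfC hsym (im y) (re y)) h1 h2.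
by simpc; rewrite mulr2n.
Qed.

Lemma basepoint_definite e y : definite (web_mx A e) -> basepoint AC y ->
  wf AC y (conj_mx y) (cplx e) != 0.
Proof.
move=> de by0; have [h1 h2 ->] := basepoint_parts e by0.
have y0 : y != 0 by case: by0.
apply: contraNneq y0 => -[h]; have h' : wf A (re y) (re y) e = 0 by lra.
have ru : re y = 0.
  by apply/eqP; apply: contra_eqT h' => /(definite_neq0 de).
have rv : im y = 0.
  by rewrite h' in h1; apply/eqP; apply: contra_eqT (esym h1) => /(definite_neq0 de).
by rewrite (re_im y) ru rv /cplx map_mx0 scaler0 addr0.
Qed.

(** A basepoint is isotropic for the definite quadric. *)
Lemma no_real_basepoint e y : definite (web_mx A e) -> basepoint AC y ->
  pt (conj_mx y) != pt y.
Proof.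
move=> de by0; apply/negP => /eqP /pt_eqP[|c c0 cy].
  by rewrite conj_eq0; case: by0.
by have := basepoint_definite de by0; rewrite cy wfZr wf_basepoint // mulr0 eqxx.
Qed.

(** On the real plane spanned by the real and the imaginary part of a
    basepoint a quadric of the web is a multiple of the sum of squares; if it
    is not zero there, a quadric of rank two is determined by it. *)
Lemma semidefinite_basepoint y x : basepoint AC y ->
  (\rank (web_mx A x) <= 2)%N -> wf AC y (conj_mx y) (cplx x) != 0 ->
  semidefinite (web_mx A x).
Proof.
move=> /(basepoint_parts x)[h1 h2 ->] rx nz.
apply: (semidefinite_rank2 (web_sym hsym x) rx h1 h2).
by apply: contraNneq nz => h; rewrite /wf h mul0rn.
Qed.

(** Isotropic vectors of a semidefinite form are in its kernel. *)
Lemma semidefinite_isotropic y x : basepoint AC y ->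
    semidefinite (web_mx A x) -> wf AC y (conj_mx y) (cplx x) = 0 ->
  y *m web_mx AC (cplx x) = 0 /\ conj_mx y *m web_mx AC (cplx x) = 0.
Proof.
move=> /(basepoint_parts x)[h1 h2 ->] sx [h3].
have h3' : wf A (re y) (re y) x = 0 by lra.
have k1 := semidefinite_ker (web_sym hsym x) sx h3'.
have k2 := semidefinite_ker (web_sym hsym x) sx (etrans (esym h1) h3').
have kc z : z *m web_mx A x = 0 -> cplx z *m web_mx AC (cplx x) = 0.
  by move=> h; rewrite cplx_webE /cplx -(map_mxM (real_complex R)) h map_mx0.
have c1 := kc _ _ k1; have c2 := kc _ _ k2.
split; first by rewrite (re_im y) mulmxDl -scalemxAl c1 c2 scaler0 addr0.
by rewrite conj_re_im mulmxBl -scalemxAl c1 c2 scaler0 subr0.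
Qed.

Lemma cplx_rank x : \rank (web_mx AC (cplx x)) = \rank (web_mx A x).
Proof. by rewrite cplx_webE (mxrank_map (real_complex R)). Qed.

Lemma boundaryE x : x != 0 -> (\rank (web_mx A x) < 4)%N ->
  (on_boundary A x <-> semidefinite (web_mx A x)).
Proof.
move=> x0 rx; split=> [[_ []]//|sx]; split=> //; rewrite meval_sym.
apply/eqP/negPn; rewrite -unitfE -unitmxE -row_free_unit /row_free.
by rewrite neq_ltn rx.
Qed.

Lemma restr_map (K L : fieldType) (s : {rmorphism K -> L}) n (p : {mpoly K[n]}) h :
  restr (fun k => map_poly s (h k)) (map_mpoly s p) = map_poly s (restr h p).
Proof.
elim/mpoly_alg_ind: p => [a|i|p q Hp Hq|p q Hp Hq].
- by rewrite map_mpolyC !restrC map_polyC.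
- by rewrite map_mpolyX !restrX.
- by rewrite [map_mpoly s _]rmorphD !restrD [RHS]rmorphD Hp Hq.
- by rewrite [map_mpoly s _]rmorphM !restrM [RHS]rmorphM Hp Hq.
Qed.

Lemma restr_real x v d :
  (restr (line_arc (cplx x) (cplx v)) (sym_poly AC))`_d =
  ((restr (line_arc x v) (sym_poly A))`_d)%:C%C.
Proof.
rewrite -(coef_map (real_complex R)) -(restr_map (real_complex R)).
rewrite -(sym_poly_map (real_complex R) A).
rewrite -[sym_poly (fun _ => _)]/(sym_poly AC).
rewrite (@eq_restr _ _ (fun k => map_poly (real_complex R) (line_arc x v k)) (line_arc (cplx x) (cplx v))) // => k.
by rewrite /line_arc rmorphD /= map_polyC map_polyZ map_polyX !mxE.
Qed.

(** A direction in which the determinant has order exactly the corank, moved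
    into the chart [i]. *)
Lemma corank_direction x e i : definite (web_mx A e) -> x 0 i != 0 ->
  exists v : 'rV[R]_4, v 0 i = 0 /\
    (restr (line_arc (cplx x) (cplx v)) (sym_poly AC))`_(4 - \rank (web_mx A x)) != 0.
Proof.
move=> de xi; exists (e + (- (e 0 i / x 0 i)) *: x); split.
  by rewrite !mxE; field.
rewrite restr_real line_pencil webD webZ.
have := pencil_coef_corank (- (e 0 i / x 0 i)) (web_sym hsym x) de.
by apply: contraNneq => -[->].
Qed.

End RealWeb.

(** * Tangent cones *)

Lemma restr_order (K : fieldType) n N (F : {mpoly K[n]}) (h : 'I_n -> {poly K}) :
  (forall m : 'X_{1..n}, (mdeg m < N)%N -> F@_m = 0) ->
  exists G, restr (fun k => 'X * h k) F = 'X^N * G.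
Proof.
move=> F0; rewrite [F]mpolyE big_seq.
elim/big_rec: _ => [|m p mF [G hG]].
  by exists 0; rewrite mulr0 -(mpolyC0 n K) restrC.
have Nm : (N <= mdeg m)%N.
  by rewrite leqNgt; apply: contraL mF => /F0 Fm; rewrite mcoeff_msupp Fm eqxx.
exists (F@_m *: ('X ^+ (mdeg m - N) * \prod_i h i ^+ m i) + G).
rewrite restrD hG restrZ restr_monom mulrDr; congr (_ + _).
rewrite -scalerAr mulrA -exprD subnKC //; congr (_ *: _).
rewrite mdegE -prodrXr -big_split; apply: eq_bigr => i _.
by rewrite exprMn.
Qed.

Lemma line_as_arc (K : fieldType) (f : {mpoly K[4]}) (p v : 'rV[K]_4) i : v 0 i = 0 ->
  exists h : 'I_3 -> {poly K},
    restr (line_arc p v) f = restr (fun k => 'X * h k) (local_eq f p i).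
Proof.
move=> vi; exists (fun k => (v 0 (lift i k))%:P).
rewrite -{1}(extK vi) -line_local; apply: eq_restr => k.
by rewrite mxE mulrC mul_polyC.
Qed.

Lemma forms_surj (K : fieldType) (f g h : 'cV[K]_4) :
    (forall a b c, a *: f + b *: g + c *: h = 0 -> [/\ a = 0, b = 0 & c = 0]) ->
  forall a b c : K, exists v : 'rV_4,
    [/\ (v *m f) 0 0 = a, (v *m g) 0 0 = b & (v *m h) 0 0 = c].
Proof.
move=> ind a b c.
have fr : row_free (rows 3 [:: f^T; g^T; h^T]).
  apply/free3P => x y z e; apply: ind; apply: trmx_inj.
  by rewrite !linearD !linearZ trmx0.
pose t : 'rV_3 := \row_i nth 0 [:: a; b; c] i.
have rf : row_full (rows 3 [:: f^T; g^T; h^T])^T.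
  by rewrite /row_full mxrank_tr; exact: fr.
have /submxP[v tv] := submx_full t rf.
have val (k : 'cV[K]_4) (i : 'I_3) : nth 0 [:: f^T; g^T; h^T] i = k^T ->
    (v *m k) 0 0 = nth 0 [:: a; b; c] i.
  move=> e; have := congr1 (fun M : 'rV_3 => M 0 i) tv; rewrite mxE => ->.
  by rewrite !mxE; apply: eq_bigr => j _; rewrite !mxE e mxE.
exists v; split; first exact: (val f (@Ordinal 3 0 isT) erefl).
  exact: (val g (@Ordinal 3 1 isT) erefl).
exact: (val h (@Ordinal 3 2 isT) erefl).
Qed.

Section NodeSurj.
Variables (K : numFieldType) (A : 'I_4 -> 'M[K]_4).
Hypothesis hsym : forall k, (A k)^T = A k.

Lemma node_surj (p k1 k2 : 'rV[K]_4) : isolated_node A p ->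
    row_free (rows 2 [:: k1; k2]) ->
    k1 *m web_mx A p = 0 -> k2 *m web_mx A p = 0 ->
  forall a b c, exists v,
    [/\ wf A k1 k1 v = a, wf A k1 k2 v = b & wf A k2 k2 v = c].
Proof.
move=> np fk h1 h2 a b c.
have [|v [va vb vc]] := @forms_surj K (wcol A k1 k1) (wcol A k1 k2) (wcol A k2 k2) _ a b c.
  move=> x y z e; apply: (node_independent hsym np fk h1 h2) => v.
  have := congr1 (fun M => (v *m M) 0 0) e.
  by rewrite /= !mulmxDr -!scalemxAr !wcolE mulmx0 !mxE !mulr1n.
by exists v; split; rewrite -?va -?vb -?vc wcolE mxE mulr1n.
Qed.

(** The quadratic form of [node_expansion] is the discriminant of three
    independent forms, so it is not the square of a linear form. *)
Lemma node_cone (p : 'rV[K]_4) i (c : K) (w : 'rV[K]_4 -> K) :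
    isolated_node A p -> p 0 i != 0 -> {morph w : u v / u + v} ->
    (forall v : 'rV_4, v 0 i = 0 ->
      (restr (line_arc p v) (sym_poly A))`_2 = c * w v ^+ 2) -> False.
Proof.
move=> np pi addw hw; have rp : \rank (web_mx A p) = 2 by case: np => _ [].
have [|k1 [k2 [fk h1 h2]]] := @ker_plane _ _ (web_mx A p); first by rewrite rp.
have [kap /(_ rp) kap0 exp] := node_expansion hsym fk h1 h2.
have cone (v : 'rV_4) : v 0 i = 0 ->
    kap * (wf A k1 k1 v * wf A k2 k2 v - wf A k1 k2 v ^+ 2) = c * w v ^+ 2.
  move=> vi; rewrite -hw //; have [G -> <-] := exp v.
  by rewrite coefXnM horner_coef0.
have norm a b : exists v : 'rV_4,
    [/\ v 0 i = 0, wf A k1 k1 v = a, wf A k1 k2 v = 0 & wf A k2 k2 v = b].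
  have [v [va vb vc]] := node_surj np fk h1 h2 a 0 b.
  exists (v + (- (v 0 i / p 0 i)) *: p); rewrite !wfD !wfZ va vb vc.
  by rewrite /wf !bf_ker // mulr0 !addr0; split=> //; rewrite !mxE; field.
have [v1 [v1i a1 b1 c1]] := norm 1 0; have [v2 [v2i a2 b2 c2]] := norm 0 1.
have := cone v1 v1i; have := cone v2 v2i.
have := cone (v1 + v2); rewrite !wfD a1 b1 c1 a2 b2 c2 addw.
rewrite mxE v1i v2i !(addr0, add0r, mulr1, mulr0, expr0n) /= !(subr0, mulr1, mulr0) => /(_ erefl) e.
have c0 : c != 0 by apply: contraNneq kap0 => c0; rewrite e c0 mul0r.
rewrite oppr0 mulr0. move=> /esym/eqP; rewrite mulf_eq0 (negbTE c0) sqrf_eq0 => /eqP w2.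
move=> /esym/eqP; rewrite mulf_eq0 (negbTE c0) sqrf_eq0 => /eqP w1.
by move: kap0; rewrite e w1 w2 addr0 expr0n mulr0 eqxx.
Qed.

(** The chart misses the derivative in direction [p], which vanishes because
    the determinant is homogeneous. *)
Lemma singular_of_order (p : 'rV[K]_4) i : p 0 i != 0 ->
    (forall v : 'rV_4, v 0 i = 0 ->
      (restr (line_arc p v) (sym_poly A))`_0 = 0 /\
      (restr (line_arc p v) (sym_poly A))`_1 = 0) ->
  singular_point (sym_poly A) p.
Proof.
move=> pi ord; have fp : (sym_poly A).@[p 0] = 0.
  have [|<- _] := ord 0; first by rewrite mxE.
  by rewrite restr_coef0; apply: meval_eq => k; rewrite line_arc0.
have dk k : k != i -> (sym_poly A)^`M(k).@[p 0] = 0.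
  move=> ki; have [|_] := ord (delta_mx 0 k); first by rewrite mxE eq_sym (negbTE ki) andbF.
  by rewrite line_coef1_delta.
split=> // [|k]; first by apply: contraNneq pi => ->; rewrite mxE.
have [->|] := eqVneq k i; last exact: dk.
(* The derivative in direction [p], by homogeneity. *)
have : (restr (line_arc p p) (sym_poly A))`_1 = 0.
  rewrite line_pencil -[X in X + _]scale1r -scalerDl detZ det_map_mx /=.
  by rewrite -meval_sym fp mulr0 coef0.
rewrite restr_coef1 (bigD1 i) //= big1 ?addr0 => [|j ji]; last first.
  by rewrite (meval_eq (v2 := p 0)) ?dk ?mul0r // => l; rewrite line_arc0.
rewrite line_arc1 (meval_eq (v2 := p 0)); last by move=> l; rewrite line_arc0.
by move/eqP; rewrite mulf_eq0 (negbTE pi) orbF => /eqP.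
Qed.

End NodeSurj.

(** * Rescaling a singular point *)

Section Scaling.
Variable K : fieldType.

Lemma comp_mpolyA n m l (p : {mpoly K[l]}) (lq : l.-tuple {mpoly K[m]})
    (lr : m.-tuple {mpoly K[n]}) :
  (p \mPo lq) \mPo lr = p \mPo [tuple tnth lq i \mPo lr | i < l].
Proof.
elim/mpoly_alg_ind: p => [a|i|p q Hp Hq|p q Hp Hq].
- by rewrite !comp_mpolyC.
- by rewrite !comp_mpolyXU -!tnth_nth tnth_mktuple.
- by rewrite !comp_mpolyD Hp Hq.
- by rewrite (rmorphM (comp_mpoly lq)) (rmorphM (comp_mpoly lr)) (rmorphM (comp_mpoly _)) /= Hp Hq.
Qed.

Lemma comp_sym_poly n (A : 'I_4 -> 'M[K]_4) (lq : 4.-tuple {mpoly K[n]}) :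
  sym_poly A \mPo lq = \det (\sum_k tnth lq k *: map_mx (@mpolyC n K) (A k)).
Proof.
rewrite /sym_poly /comp_mpoly -det_map_mx; congr (\det _).
apply/matrixP=> i j; rewrite mxE !summxE rmorph_sum; apply: eq_bigr => k _.
by rewrite !mxE rmorphM /= mmapC mmapX mmap1U.
Qed.

Definition scl n (a : K) (F : {mpoly K[n]}) := F \mPo [tuple a *: 'X_j | j < n].

Lemma mcoeff_scl n a (F : {mpoly K[n]}) m : (scl a F)@_m = a ^+ mdeg m * F@_m.
Proof.
elim/mpolyind: F => [|c l p _ _ IH]; first by rewrite /scl comp_mpoly0 !mcoeff0 mulr0.
rewrite /scl comp_mpolyD !mcoeffD -/(scl a p) IH comp_mpolyZ !mcoeffZ mulrDr.
congr (_ + _); rewrite comp_mpolyX.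
under eq_bigr do rewrite tnth_mktuple exprZn.
rewrite scaler_prod prodrXr -mpolyXE_id -mdegE mcoeffZ mcoeffX.
by case: eqP => [->|_]; rewrite ?mulr0 // !mulr1 mulrC.
Qed.

(** Changing the representative of a projective point rescales the local
    equation and its coordinates, so the singularity types do not depend on
    the representative. *)
Lemma local_eq_scale (A : 'I_4 -> 'M[K]_4) p i c : c != 0 ->
  local_eq (sym_poly A) (c *: p) i = c ^+ 4 *: scl c^-1 (local_eq (sym_poly A) p i).
Proof.
move=> c0; rewrite /scl /local_eq comp_mpolyA !comp_sym_poly -mul_mpolyC rmorphXn.
rewrite -detZ scaler_sumr; congr (\det _); apply: eq_bigr => k _.
rewrite scalerA; congr (_ *: _); rewrite !tnth_mktuple comp_mpolyD comp_mpolyC.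
rewrite mulrDr -rmorphM mxE; congr (_ + _).
case: unlift => [j|]; last by rewrite raddf0 mulr0.
rewrite comp_mpolyXU -tnth_nth tnth_mktuple mul_mpolyC scalerA mulfV //.
by rewrite scale1r.
Qed.

Lemma mult_at0_scale (F : {mpoly K[3]}) a c d : a != 0 -> c != 0 ->
  mult_at0 F d -> mult_at0 (a *: scl c F) d.
Proof.
move=> a0 c0 [h0 [m [dm hm]]]; split=> [m' /h0 e|].
  by rewrite mcoeffZ mcoeff_scl e !mulr0.
by exists m; rewrite mcoeffZ mcoeff_scl !mulf_neq0 ?expf_neq0.
Qed.

Lemma triple_point_scale (A : 'I_4 -> 'M[K]_4) p c : c != 0 ->
  triple_point (sym_poly A) p -> triple_point (sym_poly A) (c *: p).
Proof.
move=> c0 [i [pi h]]; exists i; rewrite mxE mulf_neq0 // local_eq_scale //.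
by split=> //; apply: mult_at0_scale; rewrite ?expf_neq0 ?invr_neq0.
Qed.

Lemma mcoeff_trunc n N (s : fps K n) m :
  (fps_trunc N s)@_m = if (mdeg m < N)%N then s m else 0.
Proof.
rewrite /fps_trunc raddf_sum /=; case: ifP => [mN|mN].
  rewrite (bigD1 (BMultinom mN)) //= big1 ?addr0 => [|l lm].
    by rewrite mcoeffZ mcoeffX eqxx mulr1.
  by rewrite mcoeffZ mcoeffX -[(bmnm l == m)]/(l == BMultinom mN) (negbTE lm) mulr0.
rewrite big1 // => l _; rewrite mcoeffZ mcoeffX; case: eqP => [lm|]; rewrite ?mulr0 //.
by have := bmdeg l; rewrite lm mN.
Qed.

Lemma scl_trunc n N c (s : fps K n) :
  scl c (fps_trunc N s) = fps_trunc N (fun m => c ^+ mdeg m * s m).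
Proof.
by apply/mpolyP => m; rewrite mcoeff_scl !mcoeff_trunc; case: ifP; rewrite ?mulr0.
Qed.

Lemma trunc_scale n N c (s : fps K n) :
  fps_trunc N (fun m => c * s m) = c *: fps_trunc N s.
Proof.
by apply/mpolyP => m; rewrite mcoeffZ !mcoeff_trunc; case: ifP; rewrite ?mulr0.
Qed.

Lemma tacnode_scale (A : 'I_4 -> 'M[K]_4) p c : c != 0 ->
  tacnode (sym_poly A) p -> tacnode (sym_poly A) (c *: p).
Proof.
move=> c0 [i [pi [u [v [w [e [g [[u0 v0 w0] hdet e0 hg hF]]]]]]]].
exists i; rewrite mxE mulf_neq0 //; split=> //.
pose sc (s : fps K 3) : fps K 3 := fun m => c^-1 ^+ mdeg m * s m.
exists (sc u), (sc v), (sc w), (fun m => c ^+ 4 * sc e m), g.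
split=> //.
- by rewrite /sc u0 v0 w0 !mulr0.
- have -> : \matrix_(j < 3, k < 3) tnth [tuple sc u; sc v; sc w] j U_(k)%MM =
      c^-1 *: \matrix_(j < 3, k < 3) tnth [tuple u; v; w] j U_(k)%MM.
    apply/matrixP => j k; rewrite !mxE.
    by case: j => [[|[|[|//]]] hj]; rewrite /tnth /= /sc mdeg1 expr1.
  by rewrite detZ mulf_neq0 // expf_neq0 // invr_neq0.
- by rewrite /sc mdeg0 expr0 mul1r mulf_neq0 // expf_neq0.
move=> N m mN; rewrite local_eq_scale // mcoeffZ mcoeff_scl (hF N m mN).
rewrite trunc_scale -!scl_trunc -mcoeff_scl -mcoeffZ; congr (_@_m).
rewrite -scalerAl; congr (_ *: _); rewrite /scl rmorphM rmorphB /= rmorphXn /=.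
rewrite comp_mpolyA; congr (_ * (_ - _)); congr (_ \mPo _).
by apply: eq_from_tnth => j; rewrite tnth_mktuple; case: j => [[|[|//]] hj].
Qed.

End Scaling.

(** * Symmetroids with a triple point *)

Section Triple.
Variables (R : realType) (A : 'I_4 -> 'M[R]_4).
Hypothesis hsym : forall k, (A k)^T = A k.
Local Notation AC := (cplx_web A).
Local Notation f := (sym_poly AC).

Lemma triple_order (K : fieldType) (h : {mpoly K[4]}) (p v : 'rV[K]_4) i :
  mult_at0 (local_eq h p i) 3 -> v 0 i = 0 ->
  exists G, restr (line_arc p v) h = 'X^3 * G.
Proof.
case=> h0 _ vi; have [g ->] := line_as_arc h p vi.
exact: restr_order.
Qed.

Lemma triple_not_node p : triple_point f p -> ~ isolated_node AC p.
Proof.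
case=> i [pi h] np.
apply: (node_cone (csym hsym) np pi (c := 0) (w := fun=> 0)) => [u v|v vi].
  by rewrite addr0.
by have [G ->] := triple_order h vi; rewrite coefXnM mul0r.
Qed.

Lemma triple_singular p : triple_point f p -> singular_point f p.
Proof.
case=> i [pi h]; apply: singular_of_order pi _ => v vi.
by have [G ->] := triple_order h vi; rewrite !coefXnM.
Qed.

(** In a definite direction the determinant vanishes exactly to the order of
    the corank. Order three forces rank at most one, and a real quadric of
    rank one is semidefinite. *)
Lemma triple_boundary x e : definite (web_mx A e) ->
  triple_point f (cplx x) -> on_boundary A x.
Proof.
move=> de [i [xi h]].
have xi' : x 0 i != 0 by move: xi; rewrite mxE fmorph_eq0.
have x0 : x != 0 by apply: contraNneq xi' => ->; rewrite mxE.
have rx : (\rank (web_mx A x) <= 1)%N.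
  have [v [vi]] := corank_direction hsym de xi'.
  have [|G ->] := triple_order h (v := cplx v); first by rewrite mxE vi.
  by rewrite coefXnM; case: ifP; rewrite ?eqxx // => /negbT; lia.
apply/boundaryE => //; first exact: leq_ltn_trans rx _.
exact: semidefinite_rank1 (web_sym hsym x) rx.
Qed.

(** The conjugate of [p] is a singular point that is not a node, hence equal
    to [p]. *)
Lemma real_special_point p : p != 0 -> singular_point f p ->
    ~ isolated_node AC p ->
    (forall x, singular_point f x -> (x == p)%MS \/ isolated_node AC x) ->
  exists z c, [/\ z != 0, c != 0 & cplx z = c *: p].
Proof.
move=> p0 sp np hp; have [|/conj_isolated_node] := hp _ (conj_singular sp).
  rewrite ptE => /eqP e; have [z [c [z0 c0 pz]]] := real_point p0 e.
  exists z, c^-1; split=> //; first by rewrite invr_eq0.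
  by rewrite pz scalerA mulVf // scale1r.
by rewrite conj_mxK.
Qed.

Lemma real_nodes_parity n a : nb_points (isolated_node AC) n ->
  nb_points (real_node A) a -> (a <= n)%N /\ odd a = odd n.
Proof. by move=> h1 h2; apply: nb_real h1 h2 _ => x; exact: conj_isolated_node. Qed.

(** The triple point is unique, hence real, and the other statements are
    parity of conjugation on the six nodes. *)
Theorem typeA_spectrahedron a b : spectrahedral A ->
    nb_points (real_node A) a -> nb_points (boundary_node A) b -> typeA AC ->
  (exists x : 'rV[R]_4, triple_point f (cplx x) /\ on_boundary A x) /\
  [/\ (b <= a)%N, (a <= 6)%N & ~~ odd a].
Proof.
move=> [e de] ha hb [p [tp h6 hp]]; split.
  have p0 : p != 0 by case: tp => i [pi _]; apply: contraNneq pi => ->; rewrite mxE.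
  have [z [c [z0 c0 zp]]] := real_special_point p0 (triple_singular tp)
    (triple_not_node tp) hp.
  have tz : triple_point f (cplx z) by rewrite zp; exact: triple_point_scale.
  by exists z; split=> //; exact: triple_boundary de tz.
have [a6 ->] := real_nodes_parity h6 ha.
by split=> //; apply: nb_le hb ha _ => x _ [].
Qed.

End Triple.

(** * Lines of singular points *)

Section Lines.
Variable K : fieldType.
Implicit Types (x y : 'rV[K]_4) (E : 'M[K]_(2, 4)).

Lemma rows2E E : rows 2 [:: row 0 E; row 1 E] = E.
Proof.
by apply/row_matrixP => i; rewrite row_rows;
   case: i => [[|[|//]] h]; congr (row _ E); apply/val_inj.
Qed.

Lemma submxN E x : (x <= E)%MS -> ((- x)%R <= E)%MS.
Proof. by move=> h; rewrite -scaleN1r scalemx_sub. Qed.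

Lemma line_through E x y t t' : t != t' ->
  ((x + t *: y)%R <= E)%MS -> ((x + t' *: y)%R <= E)%MS -> (x <= E)%MS /\ (y <= E)%MS.
Proof.
move=> tt' h h'.
have yE : (y <= E)%MS.
  have : (((t - t')^-1 *: ((x + t *: y) - (x + t' *: y)))%R <= E)%MS.
    by apply: scalemx_sub; apply: addmx_sub => //; exact: submxN.
  rewrite opprD addrACA subrr add0r -scalerBl scalerA mulVf ?scale1r //.
  by rewrite subr_eq0.
split=> //; have -> : x = (x + t *: y) - t *: y by rewrite addrK.
by apply: addmx_sub => //; apply: submxN; exact: scalemx_sub.
Qed.

Lemma rows2_sub m (E : 'M[K]_(m, 4)) x y : (rows 2 [:: x; y] <= E)%MS = (x <= E)%MS && (y <= E)%MS.
Proof.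
apply/row_subP/andP => [h|[hx hy] i].
  by have := h 0; have := h 1; rewrite !row_rows.
by rewrite row_rows; case: i => [[|[|//]] hi].
Qed.

Lemma free2_eqmx E x y : row_free (rows 2 [:: x; y]) -> (x <= E)%MS -> (y <= E)%MS ->
  (E :=: rows 2 [:: x; y])%MS.
Proof.
move=> f xE yE; apply/eqmx_sym/eqmxP.
have sub : (rows 2 [:: x; y] <= E)%MS by rewrite rows2_sub xE.
rewrite sub /= -(geq_leqif (mxrank_leqif_sup sub)) (eqP f).
exact: rank_leq_row.
Qed.

Lemma ker_complete (M : 'M[K]_4) y : (\rank M <= 2)%N -> y != 0 -> y *m M = 0 ->
  exists2 k, row_free (rows 2 [:: y; k]) & k *m M = 0.
Proof.
move=> rM y0 yM; have [k1 [k2 [f h1 h2]]] := ker_plane rM.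
have [k10 k20 k12] := pt_free2 f.
have [e|ne] := eqVneq (pt y) (pt k1); last by exists k1 => //; exact: free2_pt.
by exists k2 => //; apply: free2_pt => //; rewrite e.
Qed.

(** A line contained in a quadric surface of rank at most two meets the vertex
    line. *)
Lemma isotropic_ker (M : 'M[K]_4) (B : 'M[K]_(2, 4)) : M^T = M ->
    (\rank M <= 2)%N -> B *m M *m B^T = 0 ->
  exists2 u : 'rV_2, u != 0 & u *m B *m M = 0.
Proof.
move=> sM rM iso.
have [f|] := boolP (row_free (B *m M)); last first.
  rewrite -kermx_eq0 => /rowV0Pn[u /sub_kermxP uB u0]; exists u => //.
  by rewrite -mulmxA.
have MB : (M <= B *m M)%MS.
  have sub : (B *m M <= M)%MS by exact: submxMl.
  by rewrite -(geq_leqif (mxrank_leqif_sup sub)) (eqP f).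
have [N eN] := submxP MB.
have BM : B *m M = 0.
  by rewrite -[RHS]trmx0 -[LHS]trmxK trmx_mul sM {1}eN -mulmxA iso mulmx0.
by have := eqP f; rewrite BM mxrank0.
Qed.

Lemma form_prop (A : 'I_4 -> 'M[K]_4) y z y' z' e :
    (forall v, wf A y z v = 0 -> wf A y' z' v = 0) -> wf A y z e != 0 ->
  forall v, wf A y' z' v = wf A y' z' e / wf A y z e * wf A y z v.
Proof.
move=> h e0 v; have := h (v + (- (wf A y z v / wf A y z e)) *: e).
rewrite !wfD !wfZ mulNr divfK // subrr => /(_ erefl)/eqP.
by rewrite mulNr subr_eq0 => /eqP ->; field.
Qed.

End Lines.

(** Three points of the line avoid the finitely many nodes, and two of the
    three lie on the same line [E1] or [E2]. *)
Lemma singular_line (K : numFieldType) (E1 E2 : 'M[K]_(2, 4))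
    (sing node : 'rV[K]_4 -> Prop) n (x y : 'rV[K]_4) :
    (forall z, sing z -> [\/ on_line E1 z, on_line E2 z | node z]) ->
    nb_points node n -> row_free (rows 2 [:: x; y]) ->
    (forall t, sing (x + t *: y)) ->
  (x <= E1)%MS /\ (y <= E1)%MS \/ (x <= E2)%MS /\ (y <= E2)%MS.
Proof.
move=> cov nb fxy sg; have [T hT] := generic_line nb fxy.
have on t : t \notin T -> on_line E1 (x + t *: y) \/ on_line E2 (x + t *: y).
  by move=> /hT nt; case: (cov _ (sg t)) => h; [left|right|].
have [t1 [t2 [t3 [/on h1 /on h2 /on h3 t12 /andP[t31 t32]]]]] := ex_three T.
case: h1 => -[_ h1]; case: h2 => -[_ h2]; case: h3 => -[_ h3];
  solve [left; exact: line_through t12 h1 h2 | left; exact: line_through t31 h3 h1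
    | left; exact: line_through t32 h3 h2 | right; exact: line_through t12 h1 h2
    | right; exact: line_through t31 h3 h1 | right; exact: line_through t32 h3 h2].
Qed.

(** * Symmetroids with two double lines *)

Lemma ex_rows_complement (K : fieldType) (y1 y2 : 'rV[K]_4) :
  row_free (rows 2 [:: y1; y2]) ->
  exists z1 z2, rows 4 [:: y1; y2; z1; z2] \in unitmx.
Proof.
move=> f; have [B' gU] := @ex_complement K 2 2 (rows 2 [:: y1; y2]) f.
exists (row 0 (B' : 'M_(2, 4))), (row 1 (B' : 'M_(2, 4))).
rewrite -row_free_unit; apply/free4P => a b c d e.
move: gU; rewrite -row_free_unit => /row_free_kerP.
move=> /(_ (row_mx (\row_i nth 0 [:: a; b] i) (\row_i nth 0 [:: c; d] i))).
rewrite mul_row_col -[B'](rows2E (B' : 'M_(2, 4))) !mul_rows !big_ord_recl !big_ord0.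
rewrite !mxE /= !addr0 addrA => /(_ e)/eqP; rewrite row_mx_eq0.
move=> /andP[/eqP/rowP h /eqP/rowP h'].
by move: (h 0) (h 1) (h' 0) (h' 1); rewrite !mxE.
Qed.

(** A web that contains a fixed line has a determinant that is a perfect
    square. *)
Lemma isotropic_pair_reducible (K : fieldType) (A : 'I_4 -> 'M[K]_4) y1 y2 :
    (forall k, (A k)^T = A k) -> row_free (rows 2 [:: y1; y2]) ->
    (forall x, [/\ wf A y1 y1 x = 0, wf A y1 y2 x = 0 & wf A y2 y2 x = 0]) ->
  ~ irreducible_mpoly (sym_poly A).
Proof.
move=> hsym f iso [f0 fnu irr].
have [z1 [z2 gU]] := ex_rows_complement f.
pose M := \sum_k 'X_k *: map_mx (@mpolyC 4 K) (A k).
pose mp (y : 'rV[K]_4) := map_mx (@mpolyC 4 K) y.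
have bfM y z : (forall x, wf A y z x = 0) -> bf M (mp y) (mp z) = 0.
  move=> h; rewrite /bf /M mulmx_sumr mulmx_suml summxE big1 // => k _.
  rewrite -scalemxAr -scalemxAl mxE /mp map_trmx -!map_mxM mxE.
  have -> : (y *m A k *m z^T) 0 0 = 0.
    rewrite -[RHS](h (delta_mx 0 k)) /wf /web_mx (bigD1 k) //= big1 => [|j jk].
      by rewrite addr0 [delta_mx 0 k 0 k]mxE !eqxx scale1r.
    by rewrite mxE (negbTE jk) andbF scale0r.
  by rewrite raddf0 mulr0.
have sM : M^T = M.
  by rewrite /M linear_sum; apply: eq_bigr => k _; rewrite linearZ /= map_trmx hsym.
have h11 : bf M (mp y1) (mp y1) = 0 by apply: bfM => x; case: (iso x).
have h12 : bf M (mp y1) (mp y2) = 0 by apply: bfM => x; case: (iso x).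
have h22 : bf M (mp y2) (mp y2) = 0 by apply: bfM => x; case: (iso x).
have := gram4 M (mp y1) (mp y2) (mp z1) (mp z2).
rewrite /d3 /= (bfC (mp z1) (mp y1) sM) (bfC (mp z2) (mp y1) sM)
  (bfC (mp z1) (mp y2) sM) (bfC (mp z2) (mp y2) sM) (bfC (mp y2) (mp y1) sM)
  (bfC (mp z2) (mp z1) sM) h11 h12 h22.
have -> : rows 4 [:: mp y1; mp y2; mp z1; mp z2] =
    map_mx (@mpolyC 4 K) (rows 4 [:: y1; y2; z1; z2]).
  by apply/matrixP => i j; rewrite !mxE; case: i => [[|[|[|[|//]]]] h]; rewrite /= mxE.
rewrite det_map_mx /= -/(sym_poly A) => e.
have {gU} d0 : \det (rows 4 [:: y1; y2; z1; z2]) != 0.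
  by rewrite -unitfE -unitmxE.
set d := \det _ in e d0.
pose q := (d^-1)%:MP * (bf M (mp y1) (mp z1) * bf M (mp y2) (mp z2) -
  bf M (mp y1) (mp z2) * bf M (mp y2) (mp z1)).
have fq : sym_poly A = q * q.
  rewrite /q.
  move: (sym_poly A) (bf M (mp y1) (mp z1)) (bf M (mp y2) (mp z2))
    (bf M (mp y1) (mp z2)) (bf M (mp y2) (mp z1)) (bf M (mp z1) (mp z1))
    (bf M (mp z1) (mp z2)) (bf M (mp z2) (mp z2)) e => F b1 b2 b3 b4 b5 b6 b7 e.
  have dd : (d%:MP_[4])^+2 * ((d^-1)%:MP)^+2 = 1.
    by rewrite -exprMn -rmorphM mulfV // rmorph1 expr1n.
  rewrite -[LHS]mulr1 -dd mulrA e; ring.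
have qu : q \is a GRing.unit by case: (irr _ _ fq).
by move: fnu; rewrite fq unitrM qu.
Qed.

Section DoubleLines.
Variables (K : numFieldType) (A : 'I_4 -> 'M[K]_4).
Hypothesis hsym : forall k, (A k)^T = A k.
Implicit Types (x y e p : 'rV[K]_4).

Lemma rank3_ker (M : 'M[K]_4) : \rank M = 3 -> exists2 y : 'rV_4, y != 0 & y *m M = 0.
Proof. by move=> rM; apply: ker_vec; rewrite rM. Qed.

(** Along a double line of rank three the singularity comes from a basepoint in
    the kernel.  If the kernel moved along the line, three of these basepoints
    would span a line contained in every quadric of the web. *)
Lemma double_line_kernel x0 x1 (s : seq 'rV[K]_4) :
    irreducible_mpoly (sym_poly A) -> row_free (rows 2 [:: x0; x1]) ->
    (forall t, singular_point (sym_poly A) (x0 + t *: x1)) ->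
    (forall t, pt (x0 + t *: x1) \notin [seq pt i | i <- s] ->
       \rank (web_mx A (x0 + t *: x1)) = 3) ->
  exists y, [/\ basepoint A y, y *m web_mx A x0 = 0 & y *m web_mx A x1 = 0].
Proof.
move=> irr f sg rk; have [T hT] := generic_line_seq s f.
have [t1 [t2 [t3 [h1 h2 h3 t12 /andP[t31 t32]]]]] := ex_three T.
have key t : t \notin T -> exists y, [/\ y != 0, basepoint A y,
    y *m web_mx A (x0 + t *: x1) = 0 & \rank (web_mx A (x0 + t *: x1)) = 3].
  move=> /hT/rk r3; have [y y0 yM] := rank3_ker r3; exists y; split=> //.
  exact: kernel_basepoint (sg t) r3 y0 yM.
have [y1 [n1 b1 k1 r1]] := key _ h1; have [y2 [n2 b2 k2 _]] := key _ h2.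
have [y3 [n3 b3 k3 _]] := key _ h3.
have same (t t' : K) y y' : t != t' -> y != 0 -> y *m web_mx A (x0 + t *: x1) = 0 ->
    y' *m web_mx A (x0 + t' *: x1) = 0 -> pt y = pt y' ->
    y *m web_mx A x0 = 0 /\ y *m web_mx A x1 = 0.
  move=> tt' y0 h h' /(pt_eqP y0)[c c0 e].
  have h'' : y *m web_mx A (x0 + t' *: x1) = 0.
    by rewrite e -scalemxAl h' scaler0.
  move: h h''; rewrite !webD !webZ !mulmxDr -!scalemxAr => h h''.
  have hx1 : y *m web_mx A x1 = 0.
    have : (t - t') *: (y *m web_mx A x1) = 0.
      by rewrite scalerBl -[RHS](subrr 0) -{1}h -h'' opprD addrACA subrr add0r.
    by move/eqP; rewrite scaler_eq0 subr_eq0 (negbTE tt') => /eqP.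
  by split=> //; move: h; rewrite hx1 scaler0 addr0.
have [e12|n12] := eqVneq (pt y1) (pt y2).
  by have [] := same _ _ _ _ t12 n1 k1 k2 e12; exists y1.
have [e31|n31] := eqVneq (pt y3) (pt y1).
  by have [] := same _ _ _ _ t31 n3 k3 k1 e31; exists y3.
have [e32|n32] := eqVneq (pt y3) (pt y2).
  by have [] := same _ _ _ _ t32 n3 k3 k2 e32; exists y3.
have orth (t t' : K) y y' : t != t' -> y *m web_mx A (x0 + t *: x1) = 0 ->
    y' *m web_mx A (x0 + t' *: x1) = 0 -> wf A y y' x0 = 0 /\ wf A y y' x1 = 0.
  move=> tt' h h'.
  have e1 : wf A y y' (x0 + t *: x1) = 0 by exact: bf_ker.
  have e2 : wf A y y' (x0 + t' *: x1) = 0 by rewrite wfC //; exact: bf_ker.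
  move: e1 e2; rewrite !wfD !wfZ => e1 e2.
  have hx1 : wf A y y' x1 = 0.
    have : (t - t') * wf A y y' x1 = 0.
      by rewrite mulrBl -[RHS](subrr 0) -{1}e1 -e2 opprD addrACA subrr add0r.
    by move/eqP; rewrite mulf_eq0 subr_eq0 (negbTE tt') => /eqP.
  by split=> //; move: e1; rewrite hx1 mulr0 addr0.
have f12 : row_free (rows 2 [:: y1; y2]) by exact: free2_pt.
have : ~~ row_free (rows 3 [:: y1; y2; y3]).
  apply/negP => f3; have := isotropic3_rank (M := web_mx A (x0 + t1 *: x1)) f3.
  rewrite r1 => /(_ _)/negP; apply=> //; apply/matrixP => i j.
  have [o1 o1'] := orth _ _ _ _ t12 k1 k2.
  have [o2 o2'] := orth _ _ _ _ t31 k3 k1.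
  have [o3 o3'] := orth _ _ _ _ t32 k3 k2.
  have z y y' : wf A y y' x0 = 0 -> wf A y y' x1 = 0 -> wf A y y' (x0 + t1 *: x1) = 0.
    by move=> u v; rewrite wfD wfZ u v mulr0 addr0.
  rewrite bfE !row_rows [RHS]mxE -/(wf A _ _ _).
  case: i => [[|[|[|//]]] hi]; case: j => [[|[|[|//]]] hj] /=;
   rewrite ?(wf_basepoint _ b1) ?(wf_basepoint _ b2) ?(wf_basepoint _ b3) //;
   first [exact: z | by rewrite wfC //; exact: z].
have [[a [b e3]]|nd] := pselect (exists a b, y3 = a *: y1 + b *: y2); last first.
  move=> /negP[]; apply/free3P => a b c e.
  have [c0|c0] := eqVneq c 0.
    move: e; rewrite c0 scale0r addr0 => e.
    by have /free2P/(_ a b e)[-> ->] := f12.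
  case: nd; exists (- (a / c)), (- (b / c)).
  have -> : y3 = c^-1 *: (c *: y3) by rewrite scalerA mulVf // scale1r.
  have -> : c *: y3 = - (a *: y1 + b *: y2) by apply/eqP; rewrite -addr_eq0 addrC e.
  by rewrite scalerN scalerDr !scalerA opprD -!scaleNr ![c^-1 * _]mulrC.
move=> _; exfalso.
have a0 : a != 0.
  apply: contraNneq n32 => a0; rewrite e3 a0 scale0r add0r pt_scale //.
  by apply: contraNneq n3 => b0; rewrite e3 a0 b0 !scale0r addr0.
have b0 : b != 0.
  apply: contraNneq n31 => b0; rewrite e3 b0 scale0r addr0 pt_scale //.
have w12 x : wf A y1 y2 x = 0.
  have := wf_basepoint x b3; rewrite e3 wfDl !wfDr !wfZl !wfZr.
  rewrite (wf_basepoint _ b1) (wf_basepoint _ b2) (wfC hsym y2 y1) => h.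
  have : 2 * (a * b) * wf A y1 y2 x = 0 by rewrite -[RHS]h; ring.
  by move/eqP; rewrite !mulf_eq0 pnatr_eq0 (negbTE a0) (negbTE b0) => /eqP.
apply: isotropic_pair_reducible hsym f12 _ irr => x.
by rewrite w12 (wf_basepoint _ b1) (wf_basepoint _ b2).
Qed.

(** The plane spanned by the two double lines is cut out by the condition that
    the line joining the two kernels is isotropic; no node lies in it. *)
Lemma node_off_double_lines p e1 e2 y1 y2 x e :
    basepoint A y1 -> basepoint A y2 -> row_free (rows 2 [:: y1; y2]) ->
    y1 *m web_mx A p = 0 -> y2 *m web_mx A p = 0 ->
    y1 *m web_mx A e1 = 0 -> y2 *m web_mx A e2 = 0 ->
    row_free (rows 3 [:: p; e1; e2]) -> wf A y1 y2 e != 0 ->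
  isolated_node A x -> wf A y1 y2 x != 0.
Proof.
move=> b1 b2 f12 p1 p2 h1 h2 f3 we np; apply/eqP => wx.
have rx : (\rank (web_mx A x) <= 2)%N by case: np => _ [_ ->].
have [n1 n2 _] := pt_free2 f12.
have H v : wf A y1 y2 v = 0 -> exists a b c, v = a *: p + b *: e1 + c *: e2.
  move=> wv; have rC : \rank (wcol A y1 y2) = 1%N.
    apply/eqP; rewrite eqn_leq rank_leq_col lt0n mxrank_eq0.
    apply: contraNneq we => w0; have := wcolE A y1 y2 e.
    by rewrite w0 mulmx0 => /matrixP/(_ 0 0); rewrite !mxE mulr1n => <-.
  have kw y : wf A y1 y2 y = 0 -> y *m wcol A y1 y2 = 0.
    by move=> w0; rewrite wcolE w0 raddf0.
  have sub : (rows 3 [:: p; e1; e2] <= kermx (wcol A y1 y2))%MS.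
    apply/sub_kermxP/rows_mul0 => -[|[|[|//]]] _ /=; apply: kw.
    - exact: bf_ker.
    - exact: bf_ker.
    - by rewrite wfC //; exact: bf_ker.
  have : (v <= rows 3 [:: p; e1; e2])%MS.
    apply: submx_trans (_ : (v <= kermx (wcol A y1 y2))%MS) _.
      by apply/sub_kermxP; exact: kw.
    by rewrite -(geq_leqif (mxrank_leqif_sup sub)) (eqP f3) mxrank_ker rC.
  move=> /submxP[u ->]; exists (u 0 (inord 0)), (u 0 (inord 1)), (u 0 (inord 2)).
  by rewrite mul_rows_inord !big_ord_recl big_ord0 /= addr0 addrA.
have kernode y : y != 0 -> y *m web_mx A x = 0 -> (forall v, wf A y y v = 0) -> False.
  move=> y0 yM ay; have [k fk kM] := ker_complete rx y0 yM.
  have [|/eqP] := node_independent (a := 1) (b := 0) (c := 0) hsym np fk yM kM.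
    by move=> v; rewrite ay !(mul0r, mulr0, addr0).
  by rewrite oner_eq0.
have [al [be [ga ex]]] := H x wx.
have y1x : y1 *m web_mx A x = ga *: (y1 *m web_mx A e2).
  by rewrite ex !webD !webZ !mulmxDr -!scalemxAr p1 h1 !scaler0 !add0r.
have y2x : y2 *m web_mx A x = be *: (y2 *m web_mx A e1).
  by rewrite ex !webD !webZ !mulmxDr -!scalemxAr p2 h2 !scaler0 add0r addr0.
have [ga0|ga0] := eqVneq ga 0.
  by apply: (kernode y1) => // [|v]; rewrite ?y1x ?ga0 ?scale0r // wf_basepoint.
have [be0|be0] := eqVneq be 0.
  by apply: (kernode y2) => // [|v]; rewrite ?y2x ?be0 ?scale0r // wf_basepoint.
have [|u u0] := isotropic_ker (B := rows 2 [:: y1; y2]) (web_sym hsym x) rx.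
  apply/matrixP => i j; rewrite bfE !row_rows [RHS]mxE -/(wf A _ _ _).
  by case: i => [[|[|//]] hi]; case: j => [[|[|//]] hj] /=;
   rewrite ?(wf_basepoint _ b1) ?(wf_basepoint _ b2) // wfC.
set k := u *m _ => kM; set a := u 0 0; set b := u 0 1.
have ek : k = a *: y1 + b *: y2.
  by rewrite /k mul_rows !big_ord_recl big_ord0 addr0 /=;
   congr (u 0 _ *: _ + u 0 _ *: _); apply/val_inj.
have k0 : k != 0 by rewrite mulmx_free_eq0.
have [k' fk k'M] := ker_complete rx k0 kM.
have Mk' y : wf A y k' x = 0 by rewrite wfC //; exact: bf_ker.
have o1 : wf A y1 k' e2 = 0.
  have : ga * wf A y1 k' e2 = 0.
    by rewrite -(Mk' y1) /wf /bf y1x -scalemxAl [RHS]mxE.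
  by move/eqP; rewrite mulf_eq0 (negbTE ga0) => /eqP.
have o2 : wf A y2 k' e1 = 0.
  have : be * wf A y2 k' e1 = 0.
    by rewrite -(Mk' y2) /wf /bf y2x -scalemxAl [RHS]mxE.
  by move/eqP; rewrite mulf_eq0 (negbTE be0) => /eqP.
have wkk v : wf A k k v = 2 * (a * b) * wf A y1 y2 v.
  rewrite ek wfDl !wfDr !wfZl !wfZr (wf_basepoint _ b1) (wf_basepoint _ b2).
  by rewrite (wfC hsym y2 y1); ring.
have wkk' v : wf A y1 y2 v = 0 -> wf A k k' v = 0.
  move=> /H[a' [b' [c' ->]]]; rewrite ek wfDl !wfZl !wfD !wfZ o1 o2.
  rewrite /wf (bf_ker _ p1) (bf_ker _ p2) (bf_ker _ h1) (bf_ker _ h2).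
  by rewrite !(mulr0, addr0).
have prop := form_prop wkk' we; set s := _ / _ in prop.
have [ab0|ab0] := eqVneq (a * b) 0.
  by apply: (kernode k) => // v; rewrite wkk ab0 mulr0 mul0r.
have [|_ /eqP] := node_independent (a := s) (b := - (2 * (a * b))) (c := 0) hsym np fk kM k'M.
  by move=> v; rewrite wkk prop; ring.
by rewrite oppr_eq0 mulf_eq0 pnatr_eq0 (negbTE ab0).
Qed.

End DoubleLines.

(** * Real structure of a pair of double lines *)

Section RealLines.
Variable R : realType.
Local Notation C := R[i].
Implicit Types (E : 'M[C]_(2, 4)).

Lemma ex_notin_real (T : seq C) : exists t : R, t%:C%C \notin T.
Proof.
have [t ht] := ex_notin [seq complex.Re z | z <- T]; exists t.
by apply: contra ht => tT; apply/mapP; exists t%:C%C.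
Qed.

Lemma cplx_re (e : 'rV[C]_4) : cplx (re e) = 2^-1 *: (e + conj_mx e).
Proof.
have -> : e + conj_mx e = 2 *: cplx (re e).
  rewrite scaler_nat mulr2n; apply/rowP => j; rewrite !mxE.
  by case: (e 0 j) => a b; simpc => /=; rewrite ?subrr ?addrN ?addNr ?opprK.
by rewrite scalerA mulVf ?scale1r // pnatr_eq0.
Qed.

Lemma cplx_im (e : 'rV[C]_4) : cplx (im e) = (2 * 'i%C)^-1 *: (e - conj_mx e).
Proof.
have i0 : 'i%C != 0 :> C by rewrite eq_complex /= oner_eq0 andbF.
have -> : e - conj_mx e = (2 * 'i%C) *: cplx (im e).
  rewrite -scalerA scaler_nat mulr2n; apply/rowP => j; rewrite !mxE.
  by case: (e 0 j) => a b; simpc => /=; rewrite ?subrr ?addrN ?addNr ?opprK.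
by rewrite scalerA mulVf ?scale1r // mulf_neq0 // pnatr_eq0.
Qed.

Lemma conj_submx m (M : 'M[C]_(m, 4)) E : (conj_mx M <= E)%MS = (M <= conj_mx E)%MS.
Proof. by rewrite -[in LHS](conj_mxK E); exact: (map_submx (@conjc R)). Qed.

Lemma real_line E : row_free E -> (conj_mx E <= E)%MS ->
  exists z1 z2 : 'rV[R]_4, [/\ row_free (rows 2 [:: cplx z1; cplx z2]),
    (cplx z1 <= E)%MS & (cplx z2 <= E)%MS].
Proof.
move=> fE cE; pose r0 := row 0 E; pose r1 := row 1 E.
have rE i : (row i E <= E)%MS by exact: row_sub.
have crE i : (conj_mx (row i E) <= E)%MS.
  by apply: submx_trans cE; rewrite /conj_mx map_row row_sub.
have reE i : (cplx (re (row i E)) <= E)%MS.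
  by rewrite cplx_re scalemx_sub // addmx_sub.
have imE i : (cplx (im (row i E)) <= E)%MS.
  by rewrite cplx_im scalemx_sub // addmx_sub // submxN.
pose M := rows 4 [:: re r0; im r0; re r1; im r1].
have row_cM i : row i (cplx M) = cplx (nth 0 [:: re r0; im r0; re r1; im r1] i).
  by rewrite /cplx -map_row row_rows.
have ME : (cplx M <= E)%MS.
  by apply/row_subP => i; rewrite row_cM; case: i => [[|[|[|[|//]]]] hi] /=; rewrite ?reE ?imE.
have EM : (E <= cplx M)%MS.
  have cM k (hk : (k < 4)%N) : (cplx (nth 0 [:: re r0; im r0; re r1; im r1] k) <= cplx M)%MS.
    by rewrite -[k]/(nat_of_ord (Ordinal hk)) -row_cM row_sub.
  have sub z : (cplx (re z) <= cplx M)%MS -> (cplx (im z) <= cplx M)%MS -> (z <= cplx M)%MS.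
    by move=> h h'; rewrite (re_im z) addmx_sub // scalemx_sub.
  rewrite -{1}(rows2E E) rows2_sub; apply/andP; split.
    by apply: sub; [exact: (cM 0%N isT) | exact: (cM 1%N isT)].
  by apply: sub; [exact: (cM 2%N isT) | exact: (cM 3%N isT)].
have rM : \rank M = 2.
  rewrite -(mxrank_map (real_complex R)) -/(cplx M); apply/eqP.
  by have := mxrankS ME; have := mxrankS EM; rewrite (eqP fE) eqn_leq => -> ->.
have [B fB eB] := ex_basis rM.
exists (row 0 B), (row 1 B).
have BE i : (cplx (row i B) <= E)%MS.
  apply: submx_trans ME; rewrite /cplx (map_submx (real_complex R)).
  by rewrite -eB row_sub.
split=> //; have -> : rows 2 [:: cplx (row 0 B); cplx (row 1 B)] = cplx B.
  rewrite -[in RHS](rows2E B); apply/matrixP => i j; rewrite !mxE.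
  by case: i => [[|[|//]] hi]; rewrite /= !mxE.
by rewrite /row_free (mxrank_map (real_complex R)).
Qed.

End RealLines.

Section TypeF.
Variables (R : realType) (A : 'I_4 -> 'M[R]_4).
Hypothesis hsym : forall k, (A k)^T = A k.
Local Notation C := R[i].
Local Notation AC := (cplx_web A).
Local Notation f := (sym_poly AC).

Lemma on_line_scale (K : fieldType) (E : 'M[K]_(2, 4)) c x :
  c != 0 -> on_line E x -> on_line E (c *: x).
Proof.
by move=> c0 [x0 xE]; split; [rewrite scaler_eq0 negb_or c0 | exact: scalemx_sub].
Qed.

(** A real rank-three singular point would give a real basepoint. *)
Lemma no_real_rank3 e z : definite (web_mx A e) -> singular_point f (cplx z) ->
  \rank (web_mx AC (cplx z)) = 3 -> False.
Proof.
move=> de sz r3; have r3' : \rank (web_mx A z) = 3 by rewrite -cplx_rank.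
have [y y0 yM] := rank3_ker r3'.
have yM' : cplx y *m web_mx AC (cplx z) = 0.
  by rewrite cplx_webE /cplx -(map_mxM (real_complex R)) yM map_mx0.
have by0 : basepoint AC (cplx y).
apply: (kernel_basepoint (csym hsym) sz r3 _ yM'); by rewrite cplx_eq0.
by have := no_real_basepoint hsym de by0; rewrite conj_cplx eqxx.
Qed.

Lemma real_node_rank x : real_node A x -> x != 0 /\ \rank (web_mx A x) = 2.
Proof. by case=> _ [x0 rx]; rewrite -cplx_rank -cplx_eq0. Qed.

Lemma boundary_node_of x : real_node A x -> semidefinite (web_mx A x) ->
  boundary_node A x.
Proof.
move=> nx sx; have [x0 rx] := real_node_rank nx; split=> //.
by apply/boundaryE => //; rewrite rx.
Qed.

(** The conjugate of a double line is a double line. It is not [E1] itself,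
    since a line equal to its conjugate has real points of rank three, against
    [no_real_rank3]. *)
Lemma double_lines_conj e (E1 E2 : 'M[C]_(2, 4)) n : definite (web_mx A e) ->
    row_free E1 -> singular_along f (on_line E1) ->
    rank_generically_along AC 3 (on_line E1) -> nb_points (isolated_node AC) n ->
    (forall x, singular_point f x -> [\/ on_line E1 x, on_line E2 x | isolated_node AC x]) ->
  (conj_mx E1 <= E2)%MS.
Proof.
move=> de f1 s1 g1 hn cov.
have fc : row_free (rows 2 [:: row 0 (conj_mx E1); row 1 (conj_mx E1)]).
  by rewrite rows2E /row_free (mxrank_map (@conjc R)).
have onl x : on_line E1 (conj_mx x) -> singular_point f x.
  by move=> h; rewrite -[x]conj_mxK; apply/conj_singular/s1.
have sg t : singular_point f (row 0 (conj_mx E1) + t *: row 1 (conj_mx E1)).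
  apply: onl; split; first by rewrite conj_eq0 (free2_nz t fc).
  by rewrite conj_submx addmx_sub ?scalemx_sub ?row_sub.
have [[h h']|[h h']] := singular_line cov hn fc sg; last first.
  by rewrite -(rows2E (conj_mx E1)) rows2_sub h.
exfalso.
have cE : (conj_mx E1 <= E1)%MS.
  by rewrite -(rows2E (conj_mx E1)) rows2_sub h.
have [z1 [z2 [fz h1 h2]]] := real_line f1 cE.
have [s hs] := g1; have [T hT] := generic_line_seq s fz.
have [t tT] := ex_notin_real T.
have onE : on_line E1 (cplx z1 + t%:C%C *: cplx z2).
  by split; [exact: free2_nz | rewrite addmx_sub // scalemx_sub].
have ez : cplx z1 + t%:C%C *: cplx z2 = cplx (z1 + t *: z2).
  by apply/rowP => j; rewrite !mxE rmorphD rmorphM.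
have := hT _ tT; rewrite -has_pt; case: (hs _ onE) => [[_ r3] _|->//].
by apply: (no_real_rank3 de (z := z1 + t *: z2)); rewrite -ez; [exact: s1 | exact: r3].
Qed.

Lemma rank_generic_pts (E : 'M[C]_(2, 4)) : row_free E ->
    rank_generically_along AC 3 (on_line E) ->
  exists s : seq 'rV[C]_4, forall t,
    pt (row 0 E + t *: row 1 E) \notin [seq pt i | i <- s] ->
    \rank (web_mx AC (row 0 E + t *: row 1 E)) = 3.
Proof.
rewrite -{1}(rows2E E) => f [s hs]; exists s => t.
rewrite -has_pt; case: (hs (row 0 E + t *: row 1 E)) => [|[_ //]|->//].
by split; [exact: free2_nz | rewrite addmx_sub ?scalemx_sub ?row_sub].
Qed.

(** The two double lines are exchanged by conjugation, so they meet in a real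
    point. The kernels along them are a basepoint [y] and its conjugate, and a
    real node off the plane of the two lines is semidefinite because [y A(x)
    y^*] does not vanish there. *)
Theorem typeF_spectrahedron a b : spectrahedral A -> irreducible_mpoly f ->
    nb_points (real_node A) a -> nb_points (boundary_node A) b -> typeF AC ->
  ((exists (E : 'M[C]_(2, 4)) (x : 'rV[R]_4),
      conj_double_lines A E x /\ on_boundary A x) \/
   (exists (E : 'M[C]_(2, 4)) (x : 'rV[R]_4),
      conj_double_lines A E x /\ ~ in_spectrahedron A x)) /\
  [/\ a = b, (a <= 2)%N & ~~ odd a].
Proof.
move=> [e de] irr ha hb [E1 [E2 [p [[f1 f2 ne] [p1 p2 [p0 rp]] [[s1 g1] [s2 g2]] h2 cov]]]].
have c12 := double_lines_conj de f1 s1 g1 h2 cov.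
have c21 : (conj_mx E2 <= E1)%MS.
  apply: double_lines_conj de f2 s2 g2 h2 _ => x /cov; case; by constructor.
have c12' : (E2 <= conj_mx E1)%MS by rewrite -conj_submx.
have on12 x : on_line E1 x <-> on_line E2 (conj_mx x).
  rewrite /on_line conj_eq0 conj_submx; split=> -[x0 h]; split=> //.
    by apply: submx_trans h _; rewrite -conj_submx.
  exact: submx_trans h c21.
have onc x : on_line (conj_mx E1) x <-> on_line E2 x.
  by split=> -[x0 h]; split=> //; apply: submx_trans h _.
split.
  have pp : pt (conj_mx p) = pt p.
    apply/eqP/negPn/negP => ne'.
    have cp0 : conj_mx p != 0 by rewrite conj_eq0.
    have fr := free2_pt cp0 p0 ne'.
    have [cp2 _] := (on12 p).1 p1; have cp1 : (conj_mx p <= E1)%MS.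
      by have := (on12 (conj_mx p)).2; rewrite conj_mxK => /(_ p2)[].
    have e1 := free2_eqmx fr cp1 p1.2.
    have e2 := free2_eqmx fr ((on12 p).1 p1).2 p2.2.
    by case/negP: ne; apply/eqmxP/(eqmx_trans e1)/eqmx_sym.
  have [z [c [z0 c0 pz]]] := real_point p0 pp.
  have zp : cplx z = c^-1 *: p by rewrite pz scalerA mulVf // scale1r.
  have cv0 : c^-1 != 0 by rewrite invr_eq0.
  have cdl : conj_double_lines A E1 z.
    split; last by rewrite zp; split; [|apply/onc]; exact: on_line_scale.
    - split=> //; apply: contra ne => /eqmxP h; apply/eqmxP.
      by apply: eqmx_trans h _; apply/eqmxP; rewrite c12 c12'.
    - by split=> // x /onc; exact: s2.
    - by split=> //; have [s hs] := g2; exists s => x /onc; exact: hs.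
  have rz : \rank (web_mx A z) = 2.
    by rewrite -cplx_rank zp webZ (eqmx_scale _ cv0).
  have [sz|nsz] := pselect (semidefinite (web_mx A z)); [left | right]; exists E1, z.
    by split=> //; apply/boundaryE => //; rewrite rz.
  by split=> // -[].
have [a2 ->] := real_nodes_parity h2 ha; split=> //.
have f1' : row_free (rows 2 [:: row 0 E1; row 1 E1]) by rewrite rows2E.
have sg t : singular_point f (row 0 E1 + t *: row 1 E1).
  by apply: s1; split; [exact: free2_nz | rewrite addmx_sub ?scalemx_sub ?row_sub].
have [s hs] := rank_generic_pts f1 g1.
have [y [hy y0 y1]] := double_line_kernel (csym hsym) irr f1' sg hs.
have yE1 x : (x <= E1)%MS -> y *m web_mx AC x = 0.
  rewrite -{1}(rows2E E1) => /submxP[u ->]; rewrite mul_rows !big_ord_recl big_ord0.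
  by rewrite addr0 webD !webZ mulmxDr -!scalemxAr /= y0 y1 !scaler0 addr0.
have yE2 x : (x <= E2)%MS -> conj_mx y *m web_mx AC x = 0.
  move=> xE; apply/(can_inj (@conj_mxK R 1 4)); rewrite /conj_mx map_mx0.
  rewrite map_mxM -!/(conj_mx _) conj_mxK -conj_web yE1 //.
  by apply: submx_trans c21; rewrite conj_submx conj_mxK.
have cy := conj_basepoint hy.
have fy : row_free (rows 2 [:: y; conj_mx y]).
  apply: free2_pt; [by case: hy | by case: cy |].
  by rewrite eq_sym (no_real_basepoint hsym de).
have [e1 [fe1 e1E]] : exists e1, row_free (rows 2 [:: p; e1]) /\ (e1 <= E1)%MS.
  have [n0 n1 n01] := pt_free2 f1'.
  have [e01|ne0] := eqVneq (pt p) (pt (row 0 E1)); last first.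
    by exists (row 0 E1); rewrite row_sub; split=> //; exact: free2_pt.
  by exists (row 1 E1); rewrite row_sub; split=> //; apply: free2_pt => //; rewrite e01.
have [e2 [fe2 e2E]] : exists e2, row_free (rows 2 [:: p; e2]) /\ (e2 <= E2)%MS.
  have f2' : row_free (rows 2 [:: row 0 E2; row 1 E2]) by rewrite rows2E.
  have [n0 n1 n01] := pt_free2 f2'.
  have [e01|ne0] := eqVneq (pt p) (pt (row 0 E2)); last first.
    by exists (row 0 E2); rewrite row_sub; split=> //; exact: free2_pt.
  by exists (row 1 E2); rewrite row_sub; split=> //; apply: free2_pt => //; rewrite e01.
have fpe : row_free (rows 3 [:: p; e1; e2]).
  apply/free3P => al be ga rel; have [be0|be0] := eqVneq be 0.
    by move: rel; rewrite be0 scale0r addr0 => /((free2P _ _).1 fe2)[-> ->].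
  have e1E2 : (e1 <= E2)%MS.
    have -> : e1 = be^-1 *: (be *: e1) by rewrite scalerA mulVf // scale1r.
    have -> : be *: e1 = - (al *: p + ga *: e2).
      by apply/eqP; rewrite -addr_eq0 addrCA addrA rel.
    by rewrite scalemx_sub // submxN // addmx_sub ?scalemx_sub // p2.2.
  case/negP: ne; apply/eqmxP/(eqmx_trans (free2_eqmx fe1 p1.2 e1E))/eqmx_sym.
  exact: free2_eqmx fe1 p2.2 e1E2.
apply: nb_uniq ha hb _ => x x0; split=> [nx|[]//]; apply: boundary_node_of => //.
apply: (semidefinite_basepoint hsym hy); first by have [_ ->] := real_node_rank nx.
apply: (node_off_double_lines (csym hsym) hy cy fy (yE1 _ p1.2) (yE2 _ p2.2)
  (yE1 _ e1E) (yE2 _ e2E) fpe (basepoint_definite hsym de hy) nx).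
Qed.

End TypeF.

(** * Four coplanar basepoints *)

Lemma ker_of_orth (K : fieldType) (M : 'M[K]_4) u v n : M^T = M ->
    (\rank M <= 2)%N -> bf M u u * bf M v v - bf M u v * bf M v u != 0 ->
    bf M n u = 0 -> bf M n v = 0 -> n *m M = 0.
Proof.
move=> sM rM; rewrite -gram2 => dP nu nv; set P := rows 2 [:: u; v] in dP.
have : (n *m M <= P *m M)%MS.
  apply: submx_trans (submxMl n M) _.
  have sub : (P *m M <= M)%MS by exact: submxMl.
  rewrite -(geq_leqif (mxrank_leqif_sup sub)); apply: leq_trans rM _.
  by apply: leq_trans (mxrankM_maxl _ P^T); rewrite mxrank_unit // unitmxE unitfE.
move=> /submxP[c e]; have : c *m (P *m M *m P^T) = 0.
  rewrite mulmxA -[c *m (P *m M)]e; apply/rowP => j.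
  have := bfE M n P 0 j; rewrite row_rows => ->; rewrite [RHS]mxE.
  by rewrite row_id; case: j => [[|[|//]] hj].
move=> h; have c0 : c = 0.
  by rewrite -(mulmxK (_ : P *m M *m P^T \in unitmx) c) ?h ?mul0mx // unitmxE unitfE.
by rewrite e c0 mul0mx.
Qed.

(** Two of the three independent forms of a node cannot be proportional. *)
Lemma node_two_forms (K : numFieldType) (A : 'I_4 -> 'M[K]_4) (x k k' : 'rV[K]_4)
    (h : 'rV[K]_4 -> K) s1 s2 :
    (forall k, (A k)^T = A k) -> isolated_node A x -> row_free (rows 2 [:: k; k']) ->
    k *m web_mx A x = 0 -> k' *m web_mx A x = 0 ->
    (forall v, wf A k k v = s1 * h v) -> (forall v, wf A k k' v = s2 * h v) -> False.
Proof.
move=> hsym np f kM kM' e1 e2; have [s0|s0] := eqVneq s1 0.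
  have [|/eqP] := node_independent (a := 1) (b := 0) (c := 0) hsym np f kM kM'.
    by move=> v; rewrite e1 s0; ring.
  by rewrite oner_eq0.
have [|_ /eqP] := node_independent (a := s2) (b := - s1) (c := 0) hsym np f kM kM'.
  by move=> v; rewrite e1 e2; ring.
by rewrite oppr_eq0 (negbTE s0).
Qed.

(** One zero [(1 : 0)] of the binary form is given; the cofactor [s b + t c]
    has the zero [(- c : b)]. *)
Lemma two_zeros (K : fieldType) (P : 'rV[K]_4 -> Prop) m (x1 d : 'rV[K]_4) (b c : K) :
    nb_points P m -> (b != 0) || (c != 0) ->
    (forall x, x != 0 -> P x ->
       exists s t, x = s *: x1 + t *: d /\ s * t * b + t ^+ 2 * c = 0) ->
  (m <= 2)%N.
Proof.
move=> nb bc h; apply: (nb_le_seq (t := [:: x1; - c *: x1 + b *: d])) nb _ => x x0 Px.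
have [s [t [ex e]]] := h _ x0 Px; rewrite !inE ex.
have [t0|t0] := eqVneq t 0.
  have s0 : s != 0 by apply: contraNneq x0 => s0; rewrite ex s0 t0 !scale0r addr0.
  by rewrite t0 scale0r addr0 pt_scale // eqxx.
have e' : s * b + t * c = 0.
  have : t * (s * b + t * c) = 0 by rewrite -[RHS]e; ring.
  by move/eqP; rewrite mulf_eq0 (negbTE t0) => /eqP.
have [b0|b0] := eqVneq b 0.
  move: e' bc; rewrite b0 mulr0 add0r eqxx /= => /eqP.
  by rewrite mulf_eq0 (negbTE t0) => /= ->.
have -> : s *: x1 + t *: d = (t / b) *: (- c *: x1 + b *: d).
  rewrite scalerDr !scalerA divfK //; congr (_ *: _ + _).
  have -> : s = - (t * c) / b.
    by move/eqP: e'; rewrite addr_eq0 => /eqP <-; rewrite mulfK.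
  by rewrite mulrN mulNr mulrAC.
by rewrite pt_scale ?mulf_neq0 ?invr_eq0 // eqxx orbT.
Qed.

Lemma three_in_plane (K : fieldType) (p1 p2 p3 q1 q2 q3 : K) : exists x1 x2 x3,
  [/\ [|| x1 != 0, x2 != 0 | x3 != 0], x1 * p1 + x2 * p2 + x3 * p3 = 0 &
      x1 * q1 + x2 * q2 + x3 * q3 = 0].
Proof.
pose M : 'M[K]_(3, 2) := \matrix_(i, j) nth 0 (nth [::] [:: [:: p1; q1]; [:: p2; q2]; [:: p3; q3]] i) j.
have : kermx M != 0.
  by rewrite -mxrank_eq0 mxrank_ker subn_eq0 -ltnNge ltnS rank_leq_col.
move=> /rowV0Pn[u /sub_kermxP uM u0].
exists (u 0 (inord 0)), (u 0 (inord 1)), (u 0 (inord 2)); split.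
- apply: contraNT u0; rewrite !negb_or !negbK => /and3P[/eqP h0 /eqP h1 /eqP h2].
  by apply/eqP/rowP => i; rewrite [RHS]mxE -(inord_val i);
    case: i => [[|[|[|//]]] hi].
- have /rowP/(_ 0) := uM; rewrite !mxE !big_ord_recl big_ord0 !mxE /= addr0 addrA => <-.
  by congr (u 0 _ * _ + u 0 _ * _ + u 0 _ * _); apply/val_inj; rewrite /= inordK.
have /rowP/(_ 1) := uM; rewrite !mxE !big_ord_recl big_ord0 !mxE /= addr0 addrA => <-.
by congr (u 0 _ * _ + u 0 _ * _ + u 0 _ * _); apply/val_inj; rewrite /= inordK.
Qed.

Lemma ex_rows_complement3 (K : fieldType) (y1 y2 y3 : 'rV[K]_4) :
  row_free (rows 3 [:: y1; y2; y3]) ->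
  exists z, rows 4 [:: y1; y2; y3; z] \in unitmx.
Proof.
move=> f; have [B' gU] := @ex_complement K 3 1 (rows 3 [:: y1; y2; y3]) f.
exists (B' : 'rV_4); rewrite -row_free_unit; apply/free4P => a b c d e.
move: gU; rewrite -row_free_unit => /row_free_kerP.
move=> /(_ (row_mx (\row_i nth 0 [:: a; b; c] i) d%:M)).
rewrite mul_row_col mul_rows !big_ord_recl big_ord0 mul_scalar_mx.
rewrite !mxE /= !addr0 addrA => /(_ e)/eqP; rewrite row_mx_eq0.
move=> /andP[/eqP/rowP h /eqP/rowP h'].
by move: (h (inord 0)) (h (inord 1)) (h (inord 2)) (h' 0); rewrite !mxE !inordK.
Qed.

Lemma rows4_comb (K : fieldType) (y1 y2 y3 z k : 'rV[K]_4) :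
  rows 4 [:: y1; y2; y3; z] \in unitmx ->
  exists a b c d, k = a *: y1 + b *: y2 + c *: y3 + d *: z.
Proof.
move=> U; have [u ->] : exists u : 'rV_4, k = u *m rows 4 [:: y1; y2; y3; z].
  by exists (k *m invmx (rows 4 [:: y1; y2; y3; z])); rewrite mulmxKV.
exists (u 0 (inord 0)), (u 0 (inord 1)), (u 0 (inord 2)), (u 0 (inord 3)).
by rewrite mul_rows_inord !big_ord_recl big_ord0 /= addr0 !addrA.
Qed.

(** [e] and [e'] witness that the two linear forms are independent. *)
Lemma common_zero_span (K : fieldType) (f g : 'cV[K]_4) (x1 d x e e' : 'rV[K]_4) :
    row_free (rows 2 [:: x1; d]) -> x1 *m f = 0 -> x1 *m g = 0 -> d *m f = 0 ->
    d *m g = 0 -> e *m f = 0 -> e *m g != 0 -> e' *m f != 0 ->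
    x *m f = 0 -> x *m g = 0 ->
  exists s t, x = s *: x1 + t *: d.
Proof.
move=> fxd f1 g1 fd gd fe ge fe' fx gx; pose C := cols 2 [:: f; g].
have kC (y : 'rV_4) : y *m f = 0 -> y *m g = 0 -> (y <= kermx C)%MS.
  move=> yf yg; apply/sub_kermxP/rowP => j; rewrite [RHS]mxE mxE.
  have E h (i : 'I_2) : nth 0 [:: f; g] i = h -> y *m h = 0 -> \sum_k y 0 k * C k i = 0.
    move=> eh yh; transitivity ((y *m h) 0 0); last by rewrite yh mxE.
    by rewrite mxE; apply: eq_bigr => k _; rewrite mxE eh.
  by case: j => [[|[|//]] hj]; apply: E.
have sub : (rows 2 [:: x1; d] <= kermx C)%MS by rewrite rows2_sub !kC.
have rC : (1 < \rank C)%N.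
  rewrite -(mxrank_tr C) -[(1 < _)%N]/(2 <= _)%N; apply: leq_trans (mxrankM_maxl _ (rows 2 [:: e'; e])^T).
  rewrite -trmx_mul mxrank_tr mxrank_unit // unitmxE det2E unitfE.
  have E (y : nat -> 'rV[K]_4) (i j : 'I_2) : (rows 2 [:: e'; e] *m C) i j =
      (nth 0 [:: e'; e] i *m nth 0 [:: f; g] j) 0 0.
    by rewrite mxE [RHS]mxE; apply: eq_bigr => l _; rewrite !mxE.
  have nz (y : 'rV[K]_4) (h : 'cV[K]_4) : y *m h != 0 -> (y *m h) 0 0 != 0.
    by apply: contraNneq => h0; apply/eqP/matrixP => i j; rewrite !ord1 h0 mxE.
  rewrite !(E (fun=> 0)) /= fe [X in _ - _ * X]mxE mulr0 subr0.
  by rewrite mulf_neq0 ?nz.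
have : (x <= rows 2 [:: x1; d])%MS.
  apply: submx_trans (kC _ fx gx) _.
  rewrite -(geq_leqif (mxrank_leqif_sup sub)) (eqP fxd) mxrank_ker.
  by move: rC; lia.
move=> /submxP[u ->]; exists (u 0 0), (u 0 1).
rewrite mul_rows !big_ord_recl big_ord0 /= addr0.
by congr (u 0 _ *: _ + u 0 _ *: _); apply/val_inj.
Qed.

Lemma ker_of_unit (K : fieldType) (M : 'M[K]_4) (k y1 y2 y3 y4 : 'rV[K]_4) :
  rows 4 [:: y1; y2; y3; y4] \in unitmx ->
  bf M k y1 = 0 -> bf M k y2 = 0 -> bf M k y3 = 0 -> bf M k y4 = 0 -> k *m M = 0.
Proof.
move=> U h1 h2 h3 h4.
have h : k *m M *m (rows 4 [:: y1; y2; y3; y4])^T = 0.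
  apply/rowP => j; rewrite bfE row_id row_rows [RHS]mxE.
  by case: j => [[|[|[|[|//]]]] hj].
by rewrite -[LHS](mulmxK (_ : (rows 4 [:: y1; y2; y3; y4])^T \in unitmx)) ?unitmx_tr // h mul0mx.
Qed.

Lemma corank2_of (K : fieldType) (M : 'M[K]_4) (k w : 'rV[K]_4) :
  row_free (rows 2 [:: k; w]) -> k *m M = 0 -> w *m M = 0 -> (\rank M <= 2)%N.
Proof.
move=> f kM wM; have : rows 2 [:: k; w] *m M = 0 by apply: rows_mul0 => -[|[|]].
by move=> /mulmx0_rank_max; rewrite (eqP f).
Qed.

Section Coplanar.
Variables (K : numFieldType) (A : 'I_4 -> 'M[K]_4).
Hypothesis hsym : forall k, (A k)^T = A k.
Implicit Types (x v : 'rV[K]_4).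

(** The equation of the fourth basepoint is a linear relation between the
    three forms of the other basepoints. *)
Lemma basepoint_comb3 ya yb yc al be ga :
    basepoint A ya -> basepoint A yb -> basepoint A yc ->
    basepoint A (al *: ya + be *: yb + ga *: yc) ->
  forall x, al * be * wf A ya yb x + al * ga * wf A ya yc x + be * ga * wf A yb yc x = 0.
Proof.
move=> ha hb hc hd x; have := wf_basepoint x hd.
rewrite !wfDl !wfDr !wfZl !wfZr (wf_basepoint _ ha) (wf_basepoint _ hb) (wf_basepoint _ hc).
rewrite (wfC hsym yb ya) (wfC hsym yc ya) (wfC hsym yc yb) => h.
have : 2 * (al * be * wf A ya yb x + al * ga * wf A ya yc x + be * ga * wf A yb yc x) = 0.
  by rewrite -[RHS]h; ring.
by move/eqP; rewrite mulf_eq0 pnatr_eq0 => /eqP.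
Qed.

(** Otherwise the whole line joining the two points would consist of
    basepoints. *)
Lemma no_line_of_basepoints n y y' : nb_points (basepoint A) n ->
  basepoint A y -> basepoint A y' -> row_free (rows 2 [:: y; y']) ->
  ~ forall x, wf A y y' x = 0.
Proof.
move=> nb hy hy' f w0; have [T hT] := generic_line nb f.
have [t tT] := ex_notin T; apply: (hT _ tT); split; first exact: free2_nz.
move=> x; apply/matrixP => i j; rewrite !ord1 [RHS]mxE -/(bf _ _ _) -/(wf A _ _ x).
rewrite wfDl !wfDr !wfZl !wfZr (wf_basepoint _ hy) (wf_basepoint _ hy').
by rewrite (wfC hsym y' y) w0; ring.
Qed.

Variables (ya yb yc : 'rV[K]_4) (al be ga : K).
Hypotheses (ha : basepoint A ya) (hb : basepoint A yb) (hc : basepoint A yc).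
Hypothesis hd : basepoint A (al *: ya + be *: yb + ga *: yc).
Hypotheses (al0 : al != 0) (be0 : be != 0) (ga0 : ga != 0).
Hypothesis free3 : row_free (rows 3 [:: ya; yb; yc]).
Let rel := basepoint_comb3 ha hb hc hd.

Definition contains_plane x := [/\ wf A ya yb x = 0, wf A ya yc x = 0 & wf A yb yc x = 0].

Lemma plane_gram x : contains_plane x ->
  rows 3 [:: ya; yb; yc] *m web_mx A x *m (rows 3 [:: ya; yb; yc])^T = 0.
Proof.
case=> h1 h2 h3; apply/matrixP => i j; rewrite bfE !row_rows [RHS]mxE -/(wf A _ _ x).
case: i => [[|[|[|//]]] hi]; case: j => [[|[|[|//]]] hj] /=;
  by rewrite ?(wf_basepoint _ ha) ?(wf_basepoint _ hb) ?(wf_basepoint _ hc) //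
    ?(wfC hsym yb ya) ?(wfC hsym yc ya) ?(wfC hsym yc yb).
Qed.

Lemma contains_plane_rank x : contains_plane x -> (\rank (web_mx A x) <= 2)%N.
Proof. by move/plane_gram => h; exact: isotropic3_rank free3 h. Qed.

Lemma contains_plane2 x : wf A ya yb x = 0 -> wf A ya yc x = 0 -> contains_plane x.
Proof.
move=> h1 h2; split=> //; have := rel x; rewrite h1 h2 !mulr0 !add0r => /eqP.
by rewrite !mulf_eq0 (negbTE be0) (negbTE ga0) => /eqP.
Qed.

(** The kernel of a rank-two quadric through the plane lies in that plane, where
    the web only has a pencil of conics. *)
Lemma contains_plane_not_node x : contains_plane x -> ~ isolated_node A x.
Proof.
move=> cx np; have rx : \rank (web_mx A x) = 2 by case: np => _ [].
pose B := rows 3 [:: ya; yb; yc]; set M := web_mx A x in rx *.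
have sub (k : 'rV_4) : k *m M = 0 -> (k <= B)%MS.
  move=> kM; apply/negPn/negP => nk.
  have rk : row_full (col_mx B k).
    rewrite /row_full eqn_leq rank_leq_col -addsmxE.
    have lt : (B < B + k)%MS.
      by rewrite ltmxE addsmxSl /= addsmx_sub submx_refl.
    by move: lt; rewrite ltmxErank (eqP free3) => /andP[_].
  have BM : B *m M = 0.
    have h : B *m M *m (col_mx B k)^T = 0.
      rewrite tr_col_mx mul_mx_row (plane_gram cx) -mulmxA.
      by rewrite -[M]trmxK -trmx_mul /M web_sym // kM trmx0 mulmx0 row_mx0.
    by apply/trmx_inj; rewrite trmx0; apply: (row_full_inj rk);
      rewrite mulmx0 -[LHS]trmxK trmx_mul !trmxK h trmx0.
  have := mulmx0_rank_max BM; rewrite (eqP free3) rx.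
  by [].
have [|k1 [k2 [fk k1M k2M]]] := @ker_plane _ _ M; first by rewrite rx.
have comb (k : 'rV_4) : k *m M = 0 -> exists a b c, k = a *: ya + b *: yb + c *: yc.
  move=> /sub/submxP[u ->]; exists (u 0 (inord 0)), (u 0 (inord 1)), (u 0 (inord 2)).
  by rewrite mul_rows_inord !big_ord_recl big_ord0 /= addr0 addrA.
have [a1 [b1 [c1 e1]]] := comb _ k1M; have [a2 [b2 [c2 e2]]] := comb _ k2M.
have wbc v : wf A yb yc v = - (al / ga) * wf A ya yb v - (al / be) * wf A ya yc v.
  apply: (mulfI (mulf_neq0 be0 ga0)); apply/eqP; rewrite -subr_eq0 -(rel v).
  by apply/eqP; field; rewrite be0 ga0.
have w (a b c a' b' c' : K) v :
    wf A (a *: ya + b *: yb + c *: yc) (a' *: ya + b' *: yb + c' *: yc) v =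
    (a * b' + b * a' - (al / ga) * (b * c' + c * b')) * wf A ya yb v +
    (a * c' + c * a' - (al / be) * (b * c' + c * b')) * wf A ya yc v.
  rewrite !wfDl !wfDr !wfZl !wfZr (wf_basepoint _ ha) (wf_basepoint _ hb) (wf_basepoint _ hc).
  by rewrite (wfC hsym yb ya) (wfC hsym yc ya) (wfC hsym yc yb) wbc; ring.
have [x1 [x2 [x3 [nz r1 r2]]]] := three_in_plane
  (a1 * b1 + b1 * a1 - (al / ga) * (b1 * c1 + c1 * b1))
  (a1 * b2 + b1 * a2 - (al / ga) * (b1 * c2 + c1 * b2))
  (a2 * b2 + b2 * a2 - (al / ga) * (b2 * c2 + c2 * b2))
  (a1 * c1 + c1 * a1 - (al / be) * (b1 * c1 + c1 * b1))
  (a1 * c2 + c1 * a2 - (al / be) * (b1 * c2 + c1 * b2))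
  (a2 * c2 + c2 * a2 - (al / be) * (b2 * c2 + c2 * b2)).
have [|h1 h2 h3] := node_independent (a := x1) (b := x2) (c := x3) hsym np fk k1M k2M.
  move=> v; rewrite e1 e2 !w.
  set p1 := _ - _ in r1 *; set p2 := _ - _ in r1 *; set p3 := _ - _ in r1 *.
  set q1 := _ - _ in r2 *; set q2 := _ - _ in r2 *; set q3 := _ - _ in r2 *.
  transitivity ((x1 * p1 + x2 * p2 + x3 * p3) * wf A ya yb v +
    (x1 * q1 + x2 * q2 + x3 * q3) * wf A ya yc v); first by ring.
  by rewrite r1 r2 !mul0r addr0.
by move: nz; rewrite h1 h2 h3 eqxx.
Qed.

Variables (E0 : 'M[K]_(2, 4)) (n : nat).
Hypothesis nodes : nb_points (isolated_node A) n.
Hypothesis cover : forall x, singular_point (sym_poly A) x ->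
  on_line E0 x \/ isolated_node A x.

Lemma singular_line_E0 x y : row_free (rows 2 [:: x; y]) ->
  (forall s t, (\rank (web_mx A (s *: x + t *: y)%R) <= 2)%N) ->
  (E0 :=: rows 2 [:: x; y])%MS.
Proof.
move=> f rk.
have cov' z : singular_point (sym_poly A) z ->
    [\/ on_line E0 z, on_line E0 z | isolated_node A z].
  by move=> /cover[h|h]; [constructor 1 | constructor 3].
have sg t : singular_point (sym_poly A) (x + t *: y).
  by apply: singular_of_rank => //; [exact: free2_nz | have := rk 1 t; rewrite scale1r].
by have [[]|[]] := singular_line cov' nodes f sg; exact: free2_eqmx.
Qed.

Lemma contains_plane_line : exists l1 l2, [/\ row_free (rows 2 [:: l1; l2]),
  forall s t, contains_plane (s *: l1 + t *: l2) & (E0 :=: rows 2 [:: l1; l2])%MS].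
Proof.
have [l1 [l2 [f a1 b1 a2 b2]]] := common_zero2 (wcol A ya yb) (wcol A ya yc).
have w0 y z (l : 'rV_4) : l *m wcol A y z = 0 -> wf A y z l = 0.
  by rewrite wcolE => /matrixP/(_ 0 0); rewrite !mxE mulr1n.
have cp s t : contains_plane (s *: l1 + t *: l2).
  by apply: contains_plane2; rewrite wfD !wfZ !w0 // !mulr0 addr0.
exists l1, l2; split=> //; apply: singular_line_E0 => // s t.
exact/contains_plane_rank/cp.
Qed.

Lemma E0_contains_plane x : (x <= E0)%MS -> contains_plane x.
Proof.
have [l1 [l2 [_ cp e]]] := contains_plane_line; rewrite e => /submxP[u ->].
by rewrite mul_rows !big_ord_recl big_ord0 addr0.
Qed.

(** The quadrics that cut the plane in the line pair through [ya], [yb] and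
    [yc], [yd] form a net; rank two forces the vertex of the line pair into the
    kernel, which leaves a pencil of ternary forms, and a binary quadratic
    equation in it. *)
Lemma nodes_line_pair P m : nb_points P m ->
  (forall x, P x -> isolated_node A x /\ wf A ya yb x = 0) -> (m <= 2)%N.
Proof.
move=> nP hP; have [->//|m0] := posnP m; have [x1 x10 Px1] := nb_ex nP m0.
pose k := al *: ya + be *: yb.
have wkk v : wf A k k v = 2 * (al * be) * wf A ya yb v.
  rewrite /k wfDl !wfDr !wfZl !wfZr (wf_basepoint _ ha) (wf_basepoint _ hb).
  by rewrite (wfC hsym yb ya); ring.
have ka v : wf A k ya v = be * wf A ya yb v.
  by rewrite /k wfDl !wfZl (wf_basepoint _ ha) (wfC hsym yb ya); ring.
have kb v : wf A k yb v = al * wf A ya yb v.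
  by rewrite /k wfDl !wfZl (wf_basepoint _ hb); ring.
have kc v : wf A k yc v = - (al * be / ga) * wf A ya yb v.
  apply: (mulfI ga0); apply/eqP; rewrite -subr_eq0 -(rel v) /k wfDl !wfZl.
  by apply/eqP; field.
have ac x : isolated_node A x -> wf A ya yb x = 0 -> wf A ya yc x != 0.
  by move=> np ab; apply/eqP => ac0; apply: contains_plane_not_node np; exact: contains_plane2.
have kM x : isolated_node A x -> wf A ya yb x = 0 -> k *m web_mx A x = 0.
  move=> np ab; have rx : (\rank (web_mx A x) <= 2)%N by case: np => _ [_ ->].
  apply: (ker_of_orth (u := ya) (v := yc) (web_sym hsym x) rx); rewrite -?/(wf A _ _ x).
  - rewrite (wf_basepoint _ ha) mul0r sub0r oppr_eq0 (wfC hsym yc ya).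
    by rewrite mulf_neq0 // ac.
  - by rewrite ka ab mulr0.
  - by rewrite kc ab mulr0.
have k0 : k != 0.
  apply/eqP => k0; have /free3P/(_ al be 0) := free3.
  by rewrite scale0r addr0 => /(_ k0)[/eqP]; rewrite (negbTE al0).
have [z zU] := ex_rows_complement3 free3.
have [np1 ab1] := hP _ Px1.
have rx1 : (\rank (web_mx A x1) <= 2)%N by case: np1 => _ [_ ->].
have [e' e'0] : exists e', wf A ya yb e' != 0.
  apply: contrapT => noe; have [k' fk k'M] := ker_complete rx1 k0 (kM _ np1 ab1).
  apply: (node_two_forms (h := wf A k k') (s1 := 0) (s2 := 1) hsym np1 fk _ k'M).
  - exact: kM.
  - move=> v; rewrite wkk mul0r; apply/eqP; rewrite mulf_eq0; apply/orP; right.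
    by apply/negPn/negP => h; apply: noe; exists v.
  - by move=> v; rewrite mul1r.
have [e [abe kze]] : exists e, wf A ya yb e = 0 /\ wf A k z e != 0.
  apply: contrapT => no.
  have kz v : wf A ya yb v = 0 -> wf A k z v = 0.
    by move=> h; apply/eqP/negPn/negP => h'; apply: no; exists v.
  have [k' fk k'M] := ker_complete rx1 k0 (kM _ np1 ab1).
  have [a [b [c [d ek']]]] := rows4_comb k' zU.
  have prop := form_prop kz e'0.
  apply: (node_two_forms (h := wf A ya yb) (s1 := 2 * (al * be))
    (s2 := a * be + b * al - c * (al * be / ga) + d * (wf A k z e' / wf A ya yb e'))
    hsym np1 fk _ k'M wkk).
    exact: kM.
  by move=> v; rewrite ek' !wfDr !wfZr ka kb kc prop; ring.
have [d d0 [dab dkz dx]] : exists2 d : 'rV_4, d != 0 &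
    [/\ wf A ya yb d = 0, wf A k z d = 0 & row_free (rows 2 [:: x1; d])].
  have [l1 [l2 [f a1 b1 a2 b2]]] := common_zero2 (wcol A ya yb) (wcol A k z).
  have w0 y y' (l : 'rV_4) : l *m wcol A y y' = 0 -> wf A y y' l = 0.
    by rewrite wcolE => /matrixP/(_ 0 0); rewrite !mxE mulr1n.
  have [n1 n2 n12] := pt_free2 f.
  have [e1|ne1] := eqVneq (pt x1) (pt l1); last first.
    by exists l1 => //; rewrite !w0 //; split=> //; exact: free2_pt.
  by exists l2 => //; rewrite !w0 //; split=> //; apply: free2_pt => //; rewrite e1.
have kz1 : wf A k z x1 = 0 by apply: bf_ker; exact: kM.
pose q v := 2 * (wf A ya z v * wf A yc z v) - wf A ya yc v * wf A z z v.
have gram x : wf A ya yb x = 0 ->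
    \det (rows 3 [:: ya; yc; z] *m web_mx A x *m (rows 3 [:: ya; yc; z])^T) =
    wf A ya yc x * q x.
  rewrite gram3 -!/(wf A _ _ x) (wf_basepoint _ ha) (wf_basepoint _ hc) => h.
  by rewrite (wfC hsym yc ya) (wfC hsym z ya) (wfC hsym z yc) /q; ring.
have qnode x : isolated_node A x -> wf A ya yb x = 0 -> q x = 0.
  move=> np ab; have rx : (\rank (web_mx A x) <= 2)%N by case: np => _ [_ ->].
  have := rank_le2_minor (rows 3 [:: ya; yc; z]) (rows 3 [:: ya; yc; z])^T rx.
  by rewrite gram // => /eqP; rewrite mulf_eq0 (negbTE (ac _ np ab)) => /eqP.
have col0 y y' (l : 'rV_4) : wf A y y' l = 0 -> l *m wcol A y y' = 0.
  by move=> h; rewrite wcolE h raddf0.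
have coln y y' (l : 'rV_4) : wf A y y' l != 0 -> l *m wcol A y y' != 0.
  by apply: contraNneq; rewrite wcolE => /matrixP/(_ 0 0); rewrite !mxE mulr1n => ->.
have span x : wf A ya yb x = 0 -> wf A k z x = 0 -> exists s t, x = s *: x1 + t *: d.
  move=> h h'; apply: (common_zero_span (f := wcol A ya yb) (g := wcol A k z) (e := e) (e' := e'));
    by [|exact: col0|exact: coln].
pose B := 2 * (wf A ya z x1 * wf A yc z d + wf A ya z d * wf A yc z x1)
  - (wf A ya yc x1 * wf A z z d + wf A ya yc d * wf A z z x1).
have qst s t : q (s *: x1 + t *: d) = s * t * B + t ^+ 2 * q d.
  rewrite -[RHS]addr0 -(mulr0 (s ^+ 2)) -(qnode _ np1 ab1) /q /B !wfD !wfZ; ring.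
have [Bz|/norP[/negPn/eqP B0 /negPn/eqP q0]] := boolP ((B != 0) || (q d != 0)).
  apply: (two_zeros (x1 := x1) (d := d) nP Bz) => x x0 /hP[np ab].
  have [|s [t ex]] := span _ ab; first by apply: bf_ker; exact: kM.
  by exists s, t; split=> //; have := qst s t; rewrite -ex (qnode _ np ab) => <-.
exfalso; have E0W : (E0 :=: rows 2 [:: x1; d])%MS.
  apply: singular_line_E0 => // s t; set x := _ + _.
  have qx : q x = 0 by rewrite qst B0 q0 !mulr0 addr0.
  have ab : wf A ya yb x = 0 by rewrite wfD !wfZ ab1 dab !mulr0 addr0.
  have kz : wf A k z x = 0 by rewrite wfD !wfZ kz1 dkz !mulr0 addr0.
  have kx : k *m web_mx A x = 0.
    apply: (ker_of_unit zU); rewrite -/(wf A _ _ x) ?kz ?ka ?kb ?kc ?ab ?mulr0 //.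
  have : ~~ row_free (rows 3 [:: ya; yc; z] *m web_mx A x *m (rows 3 [:: ya; yc; z])^T).
    by rewrite row_free_unit unitmxE gram // qx mulr0 unitr0.
  rewrite -kermx_eq0 => /rowV0Pn[u /sub_kermxP uG u0].
  set w := u *m rows 3 [:: ya; yc; z].
  have wu i : (i < 3)%N -> bf (web_mx A x) w (nth 0 [:: ya; yc; z] i) = 0.
    move=> hi; have /rowP/(_ (Ordinal hi)) := uG; rewrite !mulmxA -/w bfE row_id row_rows.
    by rewrite [RHS]mxE.
  have wk : wf A w k x = 0 by rewrite wfC //; exact: bf_ker.
  have wM : w *m web_mx A x = 0.
    apply: (ker_of_unit zU); [exact: (wu 0%N) | | exact: (wu 1%N) | exact: (wu 2%N)].
    move: wk; rewrite /k wfDr !wfZr {1}/wf (wu 0%N) // mulr0 add0r => /eqP.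
    by rewrite mulf_eq0 (negbTE be0) => /eqP.
  apply: (corank2_of _ kx wM); apply/free2P => a b.
  have -> : w = u 0 (inord 0) *: ya + u 0 (inord 1) *: yc + u 0 (inord 2) *: z.
    by rewrite /w mul_rows_inord !big_ord_recl big_ord0 /= addr0 addrA.
  have /free4P fr : row_free (rows 4 [:: ya; yb; yc; z]) by rewrite row_free_unit.
  move=> e2; have [|h1 h2 h3 h4] := fr (a * al + b * u 0 (inord 0)) (a * be)
    (b * u 0 (inord 1)) (b * u 0 (inord 2)).
    rewrite -[RHS]e2 /k !scalerDr !scalerA !scalerDl -!addrA; congr (_ + _).
    by rewrite addrCA.
  have a0 : a = 0 by move/eqP: h2; rewrite mulf_eq0 (negbTE be0) orbF => /eqP.
  split=> //; apply/eqP/negPn/negP => b0; case/negP: u0; apply/eqP/rowP => i.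
  rewrite a0 mul0r add0r in h1.
  move: h1 h3 h4 => /eqP; rewrite mulf_eq0 (negbTE b0) => /= /eqP v0.
  move=> /eqP; rewrite mulf_eq0 (negbTE b0) => /= /eqP v1.
  move=> /eqP; rewrite mulf_eq0 (negbTE b0) => /= /eqP v2.
  by rewrite [RHS]mxE -(inord_val i); case: i => [[|[|[|//]]] hi].
have cx1 : contains_plane x1.
  by apply: E0_contains_plane; rewrite E0W; have := row_sub 0 (rows 2 [:: x1; d]); rewrite row_rows.
exact: contains_plane_not_node cx1 np1.
Qed.

End Coplanar.

(** * Symmetroids of rank two along a line *)

Lemma det0_three (K : numFieldType) (p q r : K) :
  0 * (0 * 0 - r * r) - p * (p * 0 - r * q) + q * (p * r - 0 * q) = 0 ->
  [\/ p = 0, q = 0 | r = 0].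
Proof.
move=> h; have /eqP : 2 * (p * q * r) = 0 by rewrite -[RHS]h; ring.
by rewrite !mulf_eq0 pnatr_eq0 /= => /orP[/orP[]|] /eqP ->; [constructor 1 | constructor 2 | constructor 3].
Qed.

Section CountBoundary.
Variables (R : realType) (A : 'I_4 -> 'M[R]_4).
Hypothesis hsym : forall k, (A k)^T = A k.
Local Notation C := R[i].
Local Notation AC := (cplx_web A).
Local Notation f := (sym_poly AC).

Lemma wf_conj_eq0 (y x : 'rV[C]_4) :
  (wf AC y (conj_mx y) (conj_mx x) == 0) = (wf AC y (conj_mx y) x == 0).
Proof. by rewrite -{1}(conj_mxK y) conj_wf wfC ?conjc_eq0 //; exact: csym. Qed.

Lemma wf_scale_eq0 (K : fieldType) (B : 'I_4 -> 'M[K]_4) y z c x : x != 0 -> c != 0 ->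
  wf B y z x = 0 -> wf B y z (c *: x) = 0.
Proof. by move=> _ _ h; rewrite wfZ h mulr0. Qed.

(** The form [y A(x) y^*] of a basepoint [y] separates the real nodes: off its
    zero plane a rank-two quadric is definite on the real line through [y] and
    its conjugate, hence semidefinite. *)
Lemma count_boundary y a b : basepoint AC y -> nb_points (isolated_node AC) 6 ->
    nb_points (fun x => isolated_node AC x /\ wf AC y (conj_mx y) x = 0) 2 ->
    (forall x, real_node A x -> wf AC y (conj_mx y) (cplx x) = 0 ->
       ~ semidefinite (web_mx A x)) ->
    nb_points (real_node A) a -> nb_points (boundary_node A) b ->
  [/\ (b <= a)%N, (a <= b + 2)%N, (b + 2 <= 6)%N, ~~ odd a & ~~ odd b].
Proof.
move=> hy h6 h2 nsd ha hb.
have [m [k [mk hm hk]]] := nb_split h6 (@wf_scale_eq0 _ AC y (conj_mx y)).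
have m2 : m = 2 by apply: nb_uniq hm h2 _.
have k4 : k = 4 by move: mk; rewrite m2; lia.
have [c x x0 c0|a0 [a1 [aa h0 h1]]] := @nb_split _ _
  (fun x => wf AC y (conj_mx y) (cplx x) = 0) _ ha.
  have -> : cplx (c *: x) = c%:C%C *: cplx x by apply/rowP => j; rewrite !mxE rmorphM.
  by apply: wf_scale_eq0; rewrite ?cplx_eq0 // fmorph_eq0.
have cn (x : 'rV[C]_4) : wf AC y (conj_mx y) (conj_mx x) = 0 <-> wf AC y (conj_mx y) x = 0.
  have := wf_conj_eq0 y x => E.
  by split=> h; apply/eqP; [rewrite -E h eqxx | rewrite E h eqxx].
have [l0 p0] : (a0 <= m)%N /\ odd a0 = odd m.
  apply: nb_real hm h0 _ => x [np w0]; split; first exact: conj_isolated_node.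
  exact/cn.
have [l1 p1] : (a1 <= k)%N /\ odd a1 = odd k.
  apply: nb_real hk h1 _ => x [np w0]; split; first exact: conj_isolated_node.
  by move/cn.
have ba : b = a1.
  apply: nb_uniq hb h1 _ => x x0; split=> [[nx [_ [_ sx]]]|[nx w0]].
    by split=> // w0; exact: nsd w0 sx.
  apply: boundary_node_of => //; apply: (semidefinite_basepoint hsym hy).
    by have [_ ->] := real_node_rank nx.
  exact/eqP.
by move: l0 l1 p0 p1 aa ba; rewrite m2 k4 => *; split; lia.
Qed.

(** A third basepoint is not real, so it comes with its conjugate. *)
Lemma second_pair e y n : definite (web_mx A e) -> nb_points (basepoint AC) n ->
    (2 < n)%N -> basepoint AC y ->
  exists z, [/\ basepoint AC z, pt z != pt y, pt z != pt (conj_mx y),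
    pt (conj_mx z) != pt y & pt (conj_mx z) != pt (conj_mx y)].
Proof.
move=> de hn n2 hy; have [z [hz n1 n2']] : exists z, [/\ basepoint AC z, pt z != pt y &
    pt z != pt (conj_mx y)].
  apply: contrapT => no; suff : (n <= 2)%N by lia.
  apply: (nb_le_seq (t := [:: y; conj_mx y])) hn _ => x x0 hx; rewrite !inE.
  by apply: contrapT => /negP; rewrite negb_or => /andP[h1 h2]; apply: no; exists x.
exists z; split=> //; apply/eqP => /eq_conj_pt/eqP; rewrite ?conj_mxK; exact/negP.
Qed.

(** The four basepoints are two conjugate pairs in a plane. The quadrics
    containing this plane form the line of rank two; a semidefinite one would
    have the three independent basepoints in its kernel. At every node exactly
    one of the three forms of the basepoints [y1], [y1^*], [y2] vanishes, and
    each class has at most two elements, so exactly two nodes lie on [y1 A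
    y1^* = 0]. *)
Theorem typeD_spectrahedron a b : spectrahedral A ->
    nb_points (real_node A) a -> nb_points (boundary_node A) b -> typeD AC ->
  (exists E : 'M[C]_(2, 4),
    [/\ row_free E, rank_along AC 2 (on_line E) &
        forall x : 'rV[R]_4, on_line E (cplx x) -> ~ on_boundary A x]) /\
  [/\ (b <= a)%N, (a <= b + 2)%N, (b + 2 <= 6)%N, ~~ odd a & ~~ odd b].
Proof.
move=> [e de] ha hb [[E0 [fE0 rk0 h6 cov]] [nb4 [h [h0 hcop]]]].
have csy := csym hsym.
have [y1 y10 hy1] := nb_ex nb4 isT.
have hc1 := conj_basepoint hy1.
have [y2 [hy2 n21 n2c1 nc21 nc2c1]] := second_pair de nb4 isT hy1.
have hc2 := conj_basepoint hy2.
have y20 : y2 != 0 by case: hy2.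
have c10 : conj_mx y1 != 0 by case: hc1.
have c20 : conj_mx y2 != 0 by case: hc2.
have n1c : pt (conj_mx y1) != pt y1 := no_real_basepoint hsym de hy1.
have n2c : pt (conj_mx y2) != pt y2 := no_real_basepoint hsym de hy2.
have noline y y' : basepoint AC y -> basepoint AC y' -> pt y != pt y' ->
    ~ forall x, wf AC y y' x = 0.
  move=> hy hy' ne; apply: (no_line_of_basepoints csy nb4 hy hy').
  by apply: free2_pt => //; [case: hy | case: hy'].
have f3 : row_free (rows 3 [:: y1; conj_mx y1; y2]).
  apply/free3P => al be ga rel; have [ga0|ga0] := eqVneq ga 0.
    move: rel; rewrite ga0 scale0r addr0.
    by move=> /((free2P _ _).1 (free2_pt y10 c10 _))[|->->]; rewrite // eq_sym.
  have ey2 : y2 = (- al / ga) *: y1 + (- be / ga) *: conj_mx y1.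
    apply: (scalerI ga0); rewrite scalerDr !scalerA ![ga * _]mulrC !divfK //.
    by apply/eqP; rewrite -subr_eq0 !scaleNr opprD !opprK addrC rel.
  have := basepoint_comb3 (al := - al / ga) (be := - be / ga) (ga := 0) csy hy1 hc1 hy2.
  rewrite scale0r addr0 -ey2 => /(_ hy2 (cplx e)); rewrite !mulr0 !mul0r !addr0.
  move=> /eqP; rewrite !mulf_eq0 (negbTE (basepoint_definite hsym de hy1)) orbF.
  rewrite !invr_eq0 (negbTE ga0) !orbF !oppr_eq0 => /orP[]/eqP z0.
    move: n2c1; rewrite ey2 z0 oppr0 mul0r scale0r add0r pt_scale ?eqxx //.
    by apply: contraNneq y20 => z1; rewrite ey2 z0 z1 oppr0 mul0r !scale0r addr0.
  move: n21; rewrite ey2 z0 oppr0 mul0r scale0r addr0 pt_scale ?eqxx //.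
  by apply: contraNneq y20 => z1; rewrite ey2 z0 z1 oppr0 mul0r !scale0r addr0.
have [al [be [ga ec2]]] : exists al be ga,
    conj_mx y2 = al *: y1 + be *: conj_mx y1 + ga *: y2.
  have kh (y : 'rV_4) : basepoint AC y -> (y <= kermx h)%MS by move=> hy; apply/sub_kermxP; exact: hcop.
  have sub : (rows 3 [:: y1; conj_mx y1; y2] <= kermx h)%MS.
    apply/sub_kermxP/rows_mul0 => -[|[|[|//]]] _ /=; exact: hcop.
  have : (conj_mx y2 <= rows 3 [:: y1; conj_mx y1; y2])%MS.
    apply: submx_trans (kh _ hc2) _; rewrite -(geq_leqif (mxrank_leqif_sup sub)).
    rewrite (eqP f3) mxrank_ker; have : (0 < \rank h)%N by rewrite lt0n mxrank_eq0.
    by move=> h1; rewrite leq_subLR; exact: (leq_add h1 (leqnn 3)).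
  move=> /submxP[u ->]; exists (u 0 (inord 0)), (u 0 (inord 1)), (u 0 (inord 2)).
  by rewrite mul_rows_inord !big_ord_recl big_ord0 /= addr0 addrA.
have hd : basepoint AC (al *: y1 + be *: conj_mx y1 + ga *: y2) by rewrite -ec2.
have rel := basepoint_comb3 csy hy1 hc1 hy2 hd.
have al0 : al != 0.
  apply/eqP => z0; apply: (noline _ _ hc1 hy2); first by rewrite eq_sym.
  move=> x; have := rel x; rewrite z0 !mul0r !add0r => /eqP.
  rewrite !mulf_eq0 => /orP[/orP[]|/eqP //] /eqP z1.
    case/negP: n2c; rewrite ec2 z0 z1 !scale0r !add0r pt_scale //.
    by apply: contraNneq c20 => z2; rewrite ec2 z0 z1 z2 !scale0r !addr0.
  case/negP: nc2c1; rewrite ec2 z0 z1 !scale0r add0r addr0 pt_scale //.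
  by apply: contraNneq c20 => z2; rewrite ec2 z0 z1 z2 !scale0r !addr0.
have be0 : be != 0.
  apply/eqP => z0; apply: (noline _ _ hy1 hy2); first by rewrite eq_sym.
  move=> x; have := rel x; rewrite z0 !(mulr0, mul0r) !(add0r, addr0) => /eqP.
  rewrite !mulf_eq0 (negbTE al0) /= => /orP[/eqP z1|/eqP //].
  case/negP: nc21; rewrite ec2 z0 z1 !scale0r !addr0 pt_scale //.
have ga0 : ga != 0.
  apply/eqP => z0; have := rel (cplx e); rewrite z0 !(mulr0, mul0r) !addr0 => /eqP.
  by rewrite !mulf_eq0 (negbTE al0) (negbTE be0) (negbTE (basepoint_definite hsym de hy1)).
have f3' : row_free (rows 3 [:: y1; y2; conj_mx y1]).
  apply/free3P => a' b' c' e'; have /free3P/(_ a' c' b') := f3.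
  by rewrite addrAC => /(_ e')[-> -> ->].
have f3'' : row_free (rows 3 [:: conj_mx y1; y2; y1]).
  apply/free3P => a' b' c' e'; have /free3P/(_ c' a' b') := f3.
  by rewrite addrC addrA addrAC in e' *; move=> /(_ e')[-> -> ->].
have hd' : basepoint AC (al *: y1 + ga *: y2 + be *: conj_mx y1) by rewrite addrAC.
have hd'' : basepoint AC (be *: conj_mx y1 + ga *: y2 + al *: y1).
  by rewrite addrC addrA.
have cls1 := nodes_line_pair csy hy1 hc1 hy2 hd al0 be0 ga0 f3 h6 cov.
have cls2 := nodes_line_pair csy hy1 hy2 hc1 hd' al0 ga0 be0 f3' h6 cov.
have cls3 := nodes_line_pair csy hc1 hy2 hy1 hd'' be0 ga0 al0 f3'' h6 cov.
pose plane := contains_plane AC y1 (conj_mx y1) y2.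
have notplane x : plane x -> ~ isolated_node AC x.
  exact: (contains_plane_not_node csy hy1 hc1 hy2 hd be0 ga0 f3).
have plane_rank x : plane x -> (\rank (web_mx AC x) <= 2)%N.
  exact: (contains_plane_rank csy hy1 hc1 hy2 f3).
split.
  have [l1 [l2 [fl cp _]]] := contains_plane_line csy hy1 hc1 hy2 hd be0 ga0 f3 h6 cov.
  have inplane x : (x <= rows 2 [:: l1; l2])%MS -> plane x.
    by move=> /submxP[u ->]; rewrite mul_rows !big_ord_recl big_ord0 addr0; exact: cp.
  have rk2 x : on_line (rows 2 [:: l1; l2]) x -> rank_point AC 2 x.
    case=> x0 /inplane/plane_rank rx; have /cov[/rk0//|[]//] := singular_of_rank csy x0 rx.
  exists (rows 2 [:: l1; l2]); split=> // x onx [_ [x0 sx]].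
  have [_ xl] := onx; have [ab ac bc] := inplane _ xl; have [_ rx] := rk2 _ onx.
  have [k1 kc1] := semidefinite_isotropic hsym hy1 sx ab.
  have w22 : wf AC y2 (conj_mx y2) (cplx x) = 0.
    rewrite ec2 !wfDr !wfZr (wf_basepoint _ hy2) (wfC csy y2 y1) (wfC csy y2 (conj_mx y1)).
    by rewrite ac bc !mulr0 !addr0.
  have [k2 _] := semidefinite_isotropic hsym hy2 sx w22.
  have : rows 3 [:: y1; conj_mx y1; y2] *m web_mx AC (cplx x) = 0.
    by apply: rows_mul0 => -[|[|[|//]]].
  by move=> /mulmx0_rank_max; rewrite (eqP f3) rx.
have [m [k [mk hm hk]]] := nb_split h6 (@wf_scale_eq0 _ AC y1 (conj_mx y1)).
have [m2 [m3 [mk' hm2 hm3]]] := nb_split hk (@wf_scale_eq0 _ AC y1 y2).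
have lm : (m <= 2)%N by apply: (cls1 _ _ hm) => x [].
have lm2 : (m2 <= 2)%N by apply: (cls2 _ _ hm2) => x [[]].
have lm3 : (m3 <= 2)%N.
  apply: (cls3 _ _ hm3) => x [[np na] np2]; split=> //.
  have rx : (\rank (web_mx AC x) <= 2)%N by case: np => _ [_ ->].
  have := rank_le2_minor (rows 3 [:: y1; conj_mx y1; y2]) (rows 3 [:: y1; conj_mx y1; y2])^T rx.
  rewrite gram3 -!/(wf AC _ _ x) (wf_basepoint _ hy1) (wf_basepoint _ hc1) (wf_basepoint _ hy2).
  rewrite (wfC csy (conj_mx y1) y1) (wfC csy y2 y1) (wfC csy y2 (conj_mx y1)) => hdet.
  by case: (det0_three hdet) => [/na|/np2|].
have em : m = 2%N by move: mk mk' lm lm2 lm3; clear; lia.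
rewrite em in hm; apply: (count_boundary hy1 h6 hm) => //.
move=> x nx w0 sx; have [k1 kc1] := semidefinite_isotropic hsym hy1 sx w0.
have cx : plane (cplx x) by split; [exact: w0 | exact: bf_ker | exact: bf_ker].
exact: (notplane _ cx nx).
Qed.

End CountBoundary.

(** * Tacnodes *)

(** The lowest coefficient of a restriction only sees the tangent of the arc. *)
Lemma restr_lead (K : fieldType) n N (F : {mpoly K[n]}) :
    (forall m : 'X_{1..n}, (mdeg m < N)%N -> F@_m = 0) ->
  exists L : ('I_n -> K) -> K, forall h : 'I_n -> {poly K},
    (restr (fun k => 'X * h k) F)`_N = L (fun k => (h k)`_0).
Proof.
move=> F0; exists (fun x => \sum_(m <- msupp F)
  (if mdeg m == N then F@_m * \prod_i x i ^+ m i else 0)) => h.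
rewrite {1}[F]mpolyE restr_sum coef_sum big_seq [RHS]big_seq.
apply: eq_bigr => m mF.
have Nm : (N <= mdeg m)%N.
  by rewrite leqNgt; apply: contraL mF => /F0 Fm; rewrite mcoeff_msupp Fm eqxx.
rewrite restrZ restr_monom coefZ.
have -> : \prod_i ('X * h i) ^+ m i = 'X ^+ mdeg m * \prod_i h i ^+ m i.
  by rewrite mdegE -prodrXr -big_split; apply: eq_bigr => i _; rewrite exprMn.
rewrite coefXnM; case: ltngtP Nm => // [_|->] _; first by rewrite mulr0.
rewrite subnn; congr (_ * _); rewrite -horner_coef0 horner_prod.
by apply: eq_bigr => i _; rewrite horner_exp horner_coef0.
Qed.

Definition arc2 (K : fieldType) (p d z : 'rV[K]_4) (k : 'I_4) : {poly K} :=
  (p 0 k)%:P + d 0 k *: 'X + z 0 k *: 'X^2.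

Lemma coef0_factor (K : fieldType) (p : {poly K}) : p`_0 = 0 -> exists q, p = 'X * q.
Proof.
rewrite -horner_coef0 => /rootP/factor_theorem[q ->]; exists q.
by rewrite subr0 mulrC.
Qed.

Section Tacnode.
Variable K : numFieldType.
Implicit Types (d z : 'rV[K]_3) (s : fps K 3).

Definition arc3 (d z : 'rV[K]_3) (k : 'I_3) : {poly K} :=
  'X * ((d 0 k)%:P + z 0 k *: 'X).

Lemma restr_arc2 (f : {mpoly K[4]}) (p : 'rV[K]_4) i d z :
  restr (arc2 p (ext i d) (ext i z)) f = restr (arc3 d z) (local_eq f p i).
Proof.
rewrite restr_local; apply: eq_restr => k; rewrite /chart_arc /arc2 !mxE -addrA.
congr (_ + _); case: unlift => [j|]; last by rewrite !scale0r addr0.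
by rewrite /arc3 mulrDr mulrC mul_polyC -scalerAr -expr2.
Qed.

Lemma arc3_coef0 d z k : (arc3 d z k)`_0 = 0.
Proof. by rewrite coefXM. Qed.
Lemma arc3_coef1 d z k : (arc3 d z k)`_1 = d 0 k.
Proof. by rewrite coefXM coefD coefC coefZ coefX mulr0 addr0. Qed.
Lemma arc3_coef2 d z k : (arc3 d z k)`_2 = z 0 k.
Proof. by rewrite coefXM coefD coefC coefZ coefX mulr1 add0r. Qed.

Variables (u v w e : fps K 3) (g : fps K 2) (F : {mpoly K[3]}).
Hypotheses (u0 : u 0%MM = 0) (v0 : v 0%MM = 0) (w0 : w 0%MM = 0).
Hypothesis huvw : \det (\matrix_(j < 3, k < 3)
  (tnth [tuple u; v; w] j) U_(k)%MM) != 0.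
Hypothesis e0 : e 0%MM != 0.
Hypothesis g0 : forall m : 'X_{1..2}, (mdeg m < 4)%N -> g m = 0.
Hypothesis hF : eq_upto 6 F (fps_trunc 6 e *
  (fps_trunc 6 w ^+ 2 - (fps_trunc 6 g \mPo [tuple fps_trunc 6 u; fps_trunc 6 v]))).

Definition lin (s : fps K 3) (d : 'rV[K]_3) : K := \sum_k s U_(k)%MM * d 0 k.

Lemma lin_trunc s d : \sum_k (fps_trunc 6 s)@_U_(k) * d 0 k = lin s d.
Proof. by apply: eq_bigr => k _; rewrite mcoeff_trunc mdeg1. Qed.

Lemma linD s : {morph lin s : x y / x + y}.
Proof. by move=> x y; rewrite /lin -big_split; apply: eq_bigr => k _; rewrite mxE mulrDr. Qed.

Lemma linN s x : lin s (- x) = - lin s x.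
Proof. by rewrite /lin -sumrN; apply: eq_bigr => k _; rewrite mxE mulrN. Qed.

(** The second coefficient of the arc enters linearly, up to a correction that
    depends only on the tangent. *)
Lemma restr_coord s d : s 0%MM = 0 -> exists c, forall z, exists r : {poly K},
  [/\ restr (arc3 d z) (fps_trunc 6 s) = 'X * r, r`_0 = lin s d &
      r`_1 = lin s z + c].
Proof.
move=> s0.
exists ((\sum_(k < 3) (\sum_(j < 3) ((fps_trunc 6 s)^`M(k)^`M(j))@_0%MM * d 0 j) * d 0 k) / 2).
move=> z; have [|S hS] := @restr_order K 3 1 (fps_trunc 6 s) (fun k => (d 0 k)%:P + z 0 k *: 'X).
  by move=> m; rewrite ltnS leqn0 mdeg_eq0 => /eqP->; rewrite mcoeff_trunc mdeg0.
exists S; rewrite -/(arc3 d z) expr1 in hS; split=> //.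
  have := jet1 (fps_trunc 6 s) (arc3_coef0 d z).
  by rewrite hS coefXM /= => ->; rewrite -lin_trunc; apply: eq_bigr => k _; rewrite arc3_coef1.
have := jet2 (fps_trunc 6 s) (arc3_coef0 d z); rewrite hS coefXM /= => h.
apply: (mulIf (_ : 2 != 0 :> K)); first by rewrite pnatr_eq0.
rewrite mulrDl divfK ?pnatr_eq0 // !mulr_natr h addrC; congr (_ *+ _ + _).
  by rewrite -lin_trunc; apply: eq_bigr => k _; rewrite arc3_coef2.
apply: eq_bigr => k _; rewrite arc3_coef1; congr (_ * _).
by apply: eq_bigr => j _; rewrite arc3_coef1.
Qed.

Lemma restr_F d z : exists Q, restr (arc3 d z) F =
  restr (arc3 d z) (fps_trunc 6 e) * (restr (arc3 d z) (fps_trunc 6 w) ^+ 2 -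
    restr (fun k => restr (arc3 d z) (tnth [tuple fps_trunc 6 u; fps_trunc 6 v] k))
      (fps_trunc 6 g)) + 'X^6 * Q.
Proof.
have hF' := hF; set T := fps_trunc 6 e * _ in hF'; have [|Q hQ] := @restr_order K 3 6 (F - T)
    (fun k => (d 0 k)%:P + z 0 k *: 'X).
  by move=> m /hF' h; rewrite mcoeffB h subrr.
exists Q; rewrite -/(arc3 d z) in hQ; apply/eqP; rewrite addrC -subr_eq; apply/eqP.
rewrite -hQ restrB /T restrM restrB restr_exp restr_comp; ring.
Qed.

Lemma restr_e d z : (restr (arc3 d z) (fps_trunc 6 e))`_0 = e 0%MM.
Proof. by rewrite jet0 ?mcoeff_trunc ?mdeg0 // => k; exact: arc3_coef0. Qed.

Variables (a b : 'I_4 -> K).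
Hypothesis gab : \sum_(m : 'X_{1..2 < 5} | mdeg m == 4) g m *: 'X_[m] =
  \prod_(k < 4) (a k *: 'X_ord0 + b k *: 'X_ord_max) :> {mpoly K[2]}.
Hypothesis hab : forall k l, k != l -> a k * b l - a l * b k != 0.

Definition uv_arc (U V : {poly K}) (k : 'I_2) : {poly K} :=
  'X * tnth [tuple U; V] k.

Lemma restr_g : exists L : K -> K -> K, forall U V, exists2 G',
  restr (uv_arc U V) (fps_trunc 6 g) =
    'X^4 * (\prod_(k < 4) (a k *: U + b k *: V) + 'X * G') & G'`_0 = L U`_0 V`_0.
Proof.
have gab' := gab; set g4 := \sum_(m | _) _ in gab'.
have g4E m : g4@_m = if mdeg m == 4 then g m else 0.
  rewrite /g4 raddf_sum /=; case: ifP => [/eqP m4|m4].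
    have m5 : (mdeg m < 5)%N by rewrite m4.
    rewrite (bigD1 (BMultinom m5)) /= ?m4 // big1 ?addr0 => [|l /andP[_ lm]].
      by rewrite mcoeffZ mcoeffX eqxx mulr1.
    by rewrite mcoeffZ mcoeffX -[(bmnm l == m)]/(l == BMultinom m5) (negbTE lm) mulr0.
  rewrite big1 // => l l4; rewrite mcoeffZ mcoeffX; case: eqP => [lm|]; rewrite ?mulr0 //.
  by move: l4; rewrite lm m4.
have r0 (m : 'X_{1..2}) : (mdeg m < 5)%N -> (fps_trunc 6 g - g4)@_m = 0.
  move=> m5; rewrite mcoeffB mcoeff_trunc g4E (ltn_trans m5) //.
  case: eqP => [_|m4]; first by rewrite subrr.
  by rewrite g0 ?subrr // ltn_neqAle -ltnS m5 andbT; apply/eqP.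
have [L hL] := restr_lead r0.
exists (fun x y => L (fun k => tnth [tuple x; y] k)) => U V.
have [G' hG'] := restr_order (tnth [tuple U; V]) r0; exists G'.
  have : restr (uv_arc U V) g4 = 'X^4 * \prod_(k < 4) (a k *: U + b k *: V).
    have -> : 'X^4 = \prod_(k < 4) 'X :> {poly K} by rewrite prodr_const card_ord.
    rewrite gab' restr_prod -big_split.
    apply: eq_bigr => k _; rewrite restrD !restrZ !restrX /uv_arc !(tnth_nth 0) /=.
    by rewrite mulrDr -!scalerAr.
  move: hG'; rewrite restrB -/(uv_arc U V) => /eqP; rewrite subr_eq => /eqP -> ->.
  by ring.
have := hL (tnth [tuple U; V]); rewrite hG' coefXnM subnn ltnn => ->.
congr L; apply/funext => k; rewrite !(tnth_nth 0).
by case: k => [[|[|//]] hk].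
Qed.

Lemma uvw_surj (x : 'I_3 -> K) : exists z,
  [/\ lin u z = x 0, lin v z = x 1 & lin w z = x (inord 2)].
Proof.
have hM := huvw; set M := \matrix_(j, k) _ in hM; have MU : M \in unitmx by rewrite unitmxE unitfE.
pose t : 'cV[K]_3 := \col_j x j; pose z := (invmx M *m t)^T; exists z.
have E j : \sum_k M j k * z 0 k = x j.
  have := mulKVmx MU t => /matrixP/(_ j 0); rewrite !mxE => <-.
  by apply: eq_bigr => k _; rewrite [z 0 k]mxE.
split; [rewrite -(E 0) | rewrite -(E 1) | rewrite -(E (inord 2))];
  by apply: eq_bigr => k _; rewrite [M _ _]mxE (tnth_nth u) /= ?inordK.
Qed.

Lemma uvw_inj d : lin u d = 0 -> lin v d = 0 -> lin w d = 0 -> d = 0.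
Proof.
move=> hu hv hw; have hM := huvw; set M := \matrix_(j, k) _ in hM.
have MU : M \in unitmx by rewrite unitmxE unitfE.
have Md : M *m d^T = 0.
  apply/matrixP => j l; rewrite ord1 [RHS]mxE mxE.
  have E s : s = tnth [tuple u; v; w] j -> lin s d = 0 -> \sum_k M j k * d^T k 0 = 0.
    by move=> es h; rewrite -[RHS]h; apply: eq_bigr => k _; rewrite !mxE es.
  by case: j E => [[|[|[|//]]] hj] E; [apply: (E u) | apply: (E v) | apply: (E w)].
by apply: trmx_inj; rewrite trmx0 -(mulKmx MU d^T) Md mulmx0.
Qed.

(** The equation has order two along general arcs and order at least four
    along arcs tangent to the plane [w = 0]. If, for such a tangent, the
    coefficient of order four is a multiple of [w(z)^2] and the one of order
    five is zero whenever [w(z) = 0], then the tangent is a double root of the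
    initial form of [g], which has simple roots. *)
Lemma restr_tacnode :
  [/\ forall d, [/\ (restr (arc3 d 0) F)`_0 = 0, (restr (arc3 d 0) F)`_1 = 0 &
        (restr (arc3 d 0) F)`_2 = e 0%MM * lin w d ^+ 2] &
    forall d kap, d != 0 -> lin w d = 0 ->
      (forall z, (restr (arc3 d z) F)`_4 = kap * lin w z ^+ 2) ->
      (forall z, lin w z = 0 -> (restr (arc3 d z) F)`_5 = 0) -> False].
Proof.
have [L hL] := restr_g.
have uvE d z U V : restr (arc3 d z) (fps_trunc 6 u) = 'X * U ->
    restr (arc3 d z) (fps_trunc 6 v) = 'X * V ->
    restr (fun k => restr (arc3 d z) (tnth [tuple fps_trunc 6 u; fps_trunc 6 v] k))
      (fps_trunc 6 g) = restr (uv_arc U V) (fps_trunc 6 g).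
  move=> hU hV; apply: eq_restr => k; rewrite /uv_arc !(tnth_nth 0).
  by case: k => [[|[|//]] hk].
split=> [d|d kap d0 wd h4 h5].
  have [cu /(_ 0)[U [hU U0 _]]] := restr_coord d u0.
  have [cv /(_ 0)[V [hV V0 _]]] := restr_coord d v0.
  have [cw /(_ 0)[W [hW W0 _]]] := restr_coord d w0.
  have [Q ->] := restr_F d 0; rewrite (uvE _ _ _ _ hU hV) hW.
  have [G' -> _] := hL U V; set We := restr _ _; set P := _ + _ * G'.
  have -> : We * (('X * W) ^+ 2 - 'X^4 * P) + 'X^6 * Q =
      'X^2 * (We * W ^+ 2 + 'X^2 * ('X^2 * Q - We * P)) by ring.
  rewrite !coefXnM /= coefD coefXnM /= addr0 expr2 !coef0M restr_e W0.
  by rewrite expr2.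
have [cu hu] := restr_coord d u0; have [cv hv] := restr_coord d v0.
have [cw hw] := restr_coord d w0.
pose l k := a k * lin u d + b k * lin v d.
(* The two leading coefficients along the arc. *)
have key z : (restr (arc3 d z) F)`_4 =
      e 0%MM * ((lin w z + cw) ^+ 2 - \prod_k l k) /\
    (forall k, lin w z + cw = 0 -> l k = 0 -> (restr (arc3 d z) F)`_5 =
      - (e 0%MM * ((a k * (lin u z + cu) + b k * (lin v z + cv)) *
          \prod_(j | j != k) l j + L (lin u d) (lin v d)))).
  have [U [hU U0 U1]] := hu z; have [V [hV V0 V1]] := hv z; have [W [hW W0 W1]] := hw z.
  have [Q ->] := restr_F d z; rewrite (uvE _ _ _ _ hU hV) hW.
  have [G' -> hG'] := hL U V.
  have [W2 eW] := coef0_factor (etrans W0 wd); rewrite eW in W1 *.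
  rewrite coefXM /= in W1.
  set We := restr _ _; set P := \prod_(k < 4) _.
  have -> : We * (('X * ('X * W2)) ^+ 2 - 'X^4 * (P + 'X * G')) + 'X^6 * Q =
      'X^4 * (We * (W2 ^+ 2 - P - 'X * G') + 'X * ('X * Q)) by ring.
  have Pk k : (a k *: U + b k *: V)`_0 = l k by rewrite coefD !coefZ U0 V0.
  have P0 (J : pred 'I_4) : (\prod_(k < 4 | J k) (a k *: U + b k *: V))`_0 = \prod_(k < 4 | J k) l k.
    rewrite -horner_coef0 horner_prod; apply: eq_bigr => k _.
    by rewrite horner_coef0 Pk.
  have S0 : (W2 ^+ 2 - P - 'X * G')`_0 = (lin w z + cw) ^+ 2 - \prod_k l k.
    by rewrite !coefB coefXM subr0 expr2 coef0M W1 -expr2 P0.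
  rewrite !coefXnM /=; split=> [|k wz lk].
    by rewrite coefD coefXM addr0 coef0M restr_e S0.
  have Pl : \prod_k l k = 0 by rewrite (bigD1 k) //= lk mul0r.
  have [|S' eS] := @coef0_factor _ (W2 ^+ 2 - P - 'X * G').
    by rewrite S0 wz Pl expr0n subrr.
  rewrite coefD !coefXM /= addr0 eS mulrCA coefXM /= coef0M restr_e.
  have -> : S'`_0 = ('X * S')`_1 by rewrite coefXM.
  rewrite -eS !coefB coefXM /= hG' U0 V0.
  have -> : (W2 ^+ 2)`_1 = 0.
    have [W3 ->] := coef0_factor (etrans W1 wz).
    by rewrite exprMn coefXnM.
  have [P' eP] := coef0_factor (etrans (Pk k) lk).
  have P'0 : P'`_0 = a k * (lin u z + cu) + b k * (lin v z + cv).
    have -> : P'`_0 = ('X * P')`_1 by rewrite coefXM.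
    by rewrite -eP coefD !coefZ U1 V1.
  rewrite /P (bigD1 k) //= eP -mulrA coefXM /= coef0M P'0 P0.
  ring.
have cw0 : cw = 0.
  have [z [_ _ wz]] := uvw_surj (fun j => (j == inord 2)%:R).
  rewrite eqxx in wz; have [e1 _] := key z; have [e2 _] := key (- z).
  have := h4 z; have := h4 (- z); rewrite e1 e2 linN wz sqrrN => <- /(mulfI e0).
  move=> /(addIr _) h; have : 4 * cw = 0.
    transitivity ((1 + cw) ^+ 2 - (- 1 + cw) ^+ 2); first by ring.
    by rewrite h subrr.
  by move/eqP; rewrite mulf_eq0 pnatr_eq0 => /eqP.
have lin0 s : lin s 0 = 0.
  by rewrite /lin big1 // => k _; rewrite mxE mulr0.
have Pl0 : \prod_k l k = 0.
  have [e1 _] := key 0; have := h4 0; rewrite e1 lin0 cw0 addr0 expr0n /= mulr0 sub0r.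
  by move/eqP; rewrite mulf_eq0 (negbTE e0) oppr_eq0 => /eqP.
have [k /eqP lk] : exists k, l k == 0.
  by have /eqP := Pl0; rewrite prodf_seq_eq0 => /hasP[k _ /andP[_ ?]]; exists k.
have lj j : j != k -> l j != 0.
  move=> jk; apply: contraNneq d0 => lj0; have det0 := hab jk.
  have hu0 : lin u d = 0.
    apply/(mulfI det0); rewrite mulr0.
    transitivity (b k * l j - b j * l k); first by rewrite /l; ring.
    by rewrite lj0 lk !mulr0 subr0.
  have hv0 : lin v d = 0.
    apply/(mulfI det0); rewrite mulr0.
    transitivity (a j * l k - a k * l j); first by rewrite /l; ring.
    by rewrite lj0 lk !mulr0 subr0.
  by apply/eqP/uvw_inj.
have Pj : \prod_(j | j != k) l j != 0 by apply/prodf_neq0.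
have ab z : lin w z = 0 -> a k * lin u z + b k * lin v z = 0.
  move=> wz; have wzc : lin w z + cw = 0 by rewrite wz cw0 addr0.
  have w0c : lin w 0 + cw = 0 by rewrite lin0 cw0 addr0.
  have := h5 z wz; have := h5 0 (lin0 w).
  rewrite ((key 0).2 k w0c lk) ((key z).2 k wzc lk) !lin0 !add0r.
  move=> h0 hz; have /oppr_inj/(mulfI e0)/addIr/(mulIf Pj) h := etrans hz (esym h0).
  transitivity ((a k * (lin u z + cu) + b k * (lin v z + cv)) - (a k * cu + b k * cv)).
    by ring.
  by rewrite h subrr.
have [z1 [uz1 vz1 wz1]] := uvw_surj (fun j => (j == 0)%:R).
have [z2 [uz2 vz2 wz2]] := uvw_surj (fun j => (j == 1)%:R).
have i2 : inord 2 = 2%:R :> 'I_3 by apply/val_inj; rewrite /= inordK.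
have ak : a k = 0.
  by have := ab z1; rewrite wz1 uz1 vz1 i2 => /(_ erefl); rewrite mulr1 mulr0 addr0.
have bk : b k = 0.
  by have := ab z2; rewrite wz2 uz2 vz2 i2 => /(_ erefl); rewrite mulr1 mulr0 add0r.
have [j jk] : exists j : 'I_4, j != k.
  by have [->|k0] := eqVneq k 0; [exists 1 | exists 0; rewrite eq_sym].
by have := hab jk; rewrite ak bk mulr0 mul0r subrr eqxx.
Qed.

End Tacnode.

Section TacnodeArcs.
Variables (K : numFieldType) (f : {mpoly K[4]}).

Lemma line_arc2 (p v : 'rV[K]_4) : restr (line_arc p v) f = restr (arc2 p v 0) f.
Proof. by apply: eq_restr => k; rewrite /line_arc /arc2 mxE scale0r addr0. Qed.

(** What the tacnode contributes to the sequel, free of formal power series: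
    the tangent cone is the double plane [w^2 = 0], and no tangent direction
    in this plane has contact of the order that a double root of the quartic
    form would give. *)
Lemma tacnode_arcs p : tacnode f p -> exists i e (w : 'rV[K]_4 -> K),
  [/\ p 0 i != 0, e != 0, {morph w : x y / x + y},
      exists2 v : 'rV_4, v 0 i = 0 & w v != 0 &
      (forall v : 'rV_4, v 0 i = 0 ->
        [/\ (restr (line_arc p v) f)`_0 = 0, (restr (line_arc p v) f)`_1 = 0 &
            (restr (line_arc p v) f)`_2 = e * w v ^+ 2]) /\
      (forall (d : 'rV_4) kap, d 0 i = 0 -> d != 0 -> w d = 0 ->
        (forall z : 'rV_4, z 0 i = 0 -> (restr (arc2 p d z) f)`_4 = kap * w z ^+ 2) ->
        (forall z : 'rV_4, z 0 i = 0 -> w z = 0 -> (restr (arc2 p d z) f)`_5 = 0) -> False)].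
Proof.
case=> i [pi [u [v [w [e [g [[u0 v0 w0] huvw e0 [g0 [a [b [gab hab]]]] hF]]]]]]].
pose co (x : 'rV[K]_4) : 'rV[K]_3 := \row_j x 0 (lift i j).
have coE (x : 'rV[K]_4) : x 0 i = 0 -> ext i (co x) = x by exact: extK.
have coD x y : co (x + y) = co x + co y by apply/rowP => j; rewrite !mxE.
have coext z : co (ext i z) = z by apply/rowP => j; rewrite !mxE liftK.
have [h1 h2] := restr_tacnode u0 v0 w0 huvw e0 g0 (hF 6) gab hab.
have ext0 : ext i (0 : 'rV[K]_3) = 0.
  by apply/rowP => k; rewrite !mxE; case: unlift => // j; rewrite mxE.
exists i, (e 0%MM), (fun x => lin w (co x)); split=> //.
- by move=> x y; rewrite coD linD.
- have [z [_ _ wz]] := uvw_surj huvw (fun j => (j == inord 2)%:R).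
  by exists (ext i z); [exact: ext_i | rewrite coext wz eqxx oner_eq0].
split=> [x xi|d kap di d0 wd h4 h5].
  by rewrite line_arc2 -(coE x xi) -ext0 restr_arc2 coext; exact: h1.
apply: (h2 (co d) kap) => // [|z|z wz].
- by apply: contraNneq d0 => e0'; rewrite -(coE d di) e0' ext0.
- by rewrite -restr_arc2 (coE d di) h4 ?ext_i // coext.
- by rewrite -restr_arc2 (coE d di) h5 ?ext_i // coext.
Qed.

End TacnodeArcs.

(** * The nodes in the tangent plane of a tacnode *)

(** [e] witnesses that the form is not zero. *)
Lemma common_zero1_span (K : fieldType) (f : 'cV[K]_4) (x1 x2 x3 x e : 'rV[K]_4) :
    row_free (rows 3 [:: x1; x2; x3]) -> x1 *m f = 0 -> x2 *m f = 0 -> x3 *m f = 0 ->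
    e *m f != 0 -> x *m f = 0 ->
  exists a b c, x = a *: x1 + b *: x2 + c *: x3.
Proof.
move=> fr f1 f2 f3 fe fx.
have rf : \rank f = 1%N.
  apply/eqP; rewrite eqn_leq rank_leq_col lt0n mxrank_eq0.
  by apply: contraNneq fe => ->; rewrite mulmx0.
have sub : (rows 3 [:: x1; x2; x3] <= kermx f)%MS.
  by apply/sub_kermxP/rows_mul0 => -[|[|[|//]]] _.
have : (x <= rows 3 [:: x1; x2; x3])%MS.
  apply: submx_trans (_ : (x <= kermx f)%MS) _; first exact/sub_kermxP.
  by rewrite -(geq_leqif (mxrank_leqif_sup sub)) (eqP fr) mxrank_ker rf.
move=> /submxP[u ->]; exists (u 0 (inord 0)), (u 0 (inord 1)), (u 0 (inord 2)).
by rewrite mul_rows_inord !big_ord_recl big_ord0 /= addr0 addrA.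
Qed.

Lemma right_kernel (K : fieldType) (p q r s : K) : p * s - q * r = 0 ->
  exists c1 c2, [/\ (c1 != 0) || (c2 != 0), p * c1 + q * c2 = 0 & r * c1 + s * c2 = 0].
Proof.
move=> d; have d' : p * s = q * r by apply/eqP; rewrite -subr_eq0 d.
have [q0|q0] := eqVneq q 0; last first.
  exists (- q), p; rewrite oppr_eq0 q0; split=> //; first by rewrite mulrN mulrC addNr.
  by rewrite mulrN addrC mulrC d' mulrC subrr.
have [s0|s0] := eqVneq s 0; last first.
  exists (- s), r; rewrite oppr_eq0 s0; split=> //; last by rewrite mulrN mulrC addNr.
  by rewrite mulrN d' q0 !mul0r addr0 oppr0.
by exists 0, 1; rewrite oner_eq0 orbT q0 s0 !mulr0 !mul0r !addr0.
Qed.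

Section TacnodePlane.
Variables (K : numFieldType) (A : 'I_4 -> 'M[K]_4).
Hypothesis hsym : forall k, (A k)^T = A k.
Variables (p y1 y2 : 'rV[K]_4).
Hypotheses (hy1 : basepoint A y1) (hy2 : basepoint A y2).
Hypothesis fy : row_free (rows 2 [:: y1; y2]).
Hypotheses (p1 : y1 *m web_mx A p = 0) (p2 : y2 *m web_mx A p = 0).
Hypothesis tp : tacnode (sym_poly A) p.
Hypothesis rp : \rank (web_mx A p) = 2.
Implicit Types (x d r z v u : 'rV[K]_4).
Local Notation lam := (wf A y1 y2).

Lemma bf_arc2 (y z d u : 'rV[K]_4) :
  bf (web_arc A (arc2 p d u)) (map_mx polyC y) (map_mx polyC z) =
  (wf A y z p)%:P + wf A y z d *: 'X + wf A y z u *: 'X^2.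
Proof.
have -> : web_arc A (arc2 p d u) = map_mx polyC (web_mx A p) +
    'X *: map_mx polyC (web_mx A d) + 'X^2 *: map_mx polyC (web_mx A u).
  apply/matrixP=> i j; rewrite !mxE !summxE !rmorph_sum !mulr_sumr -!big_split.
  by apply: eq_bigr => k _; rewrite !mxE !rmorphM /= !mulrDl -!mul_polyC; ring.
have E (M : 'M[K]_4) : bf (map_mx polyC M) (map_mx polyC y) (map_mx polyC z) = (bf M y z)%:P.
  by rewrite /bf map_trmx -!map_mxM mxE.
by rewrite !bfD !bfZ !E -!mul_polyC ![_%:P * _]mulrC.
Qed.

(** If [r] were isotropic for [A(p)], then along the arcs with tangent [d] the
    determinant would have the coefficients of orders four and five that
    [tacnode_arcs] excludes. *)
Lemma tacnode_transversal d r : lam d = 0 -> pt d != pt p -> d != 0 ->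
    wf A y1 r d = 0 -> wf A y2 r d = 0 -> row_free (rows 3 [:: y1; y2; r]) ->
  wf A r r p != 0.
Proof.
move=> ld dp d0 r1 r2 fr; apply/eqP => rr.
have [i [e [w [pi e0 wD _ [h012 h45]]]]] := tacnode_arcs tp.
have [kap /(_ rp) kap0 hk] := node_expansion hsym fy p1 p2.
have lw v : v 0 i = 0 -> - kap * lam v ^+ 2 = e * w v ^+ 2.
  move=> vi; have [_ _ <-] := h012 v vi; have [G -> hG] := hk v.
  rewrite coefXnM /= -horner_coef0 hG.
  by rewrite (wf_basepoint _ hy1) (wf_basepoint _ hy2); ring.
have lw0 v : v 0 i = 0 -> lam v = 0 -> w v = 0.
  move=> vi lv; have := lw v vi; rewrite lv expr0n /= mulr0 => /esym/eqP.
  by rewrite mulf_eq0 (negbTE e0) sqrf_eq0 => /eqP.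
have wl0 v : v 0 i = 0 -> w v = 0 -> lam v = 0.
  move=> vi wv; have := lw v vi; rewrite wv expr0n /= mulr0 => /eqP.
  by rewrite mulf_eq0 oppr_eq0 (negbTE kap0) sqrf_eq0 => /eqP.
pose d' := d + (- (d 0 i / p 0 i)) *: p.
have di : d' 0 i = 0 by rewrite !mxE; field.
have d'0 : d' != 0.
  apply: contraNneq dp; rewrite /d' scaleNr => /eqP; rewrite subr_eq0 => /eqP e'.
  rewrite {1}e' pt_scale //; apply: contraNneq d0 => c0.
  by rewrite e' c0 scale0r.
have kp1 z : wf A y1 z p = 0 by exact: bf_ker.
have kp2 z : wf A y2 z p = 0 by exact: bf_ker.
have ld' : lam d' = 0 by rewrite wfD wfZ kp1 mulr0 addr0.
have r1' : wf A y1 r d' = 0 by rewrite wfD wfZ kp1 mulr0 addr0.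
have r2' : wf A y2 r d' = 0 by rewrite wfD wfZ kp2 mulr0 addr0.
have [z zU] := ex_rows_complement3 fr.
have V0 : \det (rows 4 [:: y1; y2; r; z]) != 0 by rewrite -unitfE -unitmxE.
set V := \det _ in V0; pose mp (y : 'rV[K]_4) := map_mx polyC y.
have detV : \det (rows 4 [:: mp y1; mp y2; mp r; mp z]) = V%:P.
  rewrite /V -det_map_mx; congr (\det _); apply/matrixP => j k; rewrite !mxE.
  by case: j => [[|[|[|[|//]]]] hj]; rewrite /= mxE.
(* The determinant along the arc, without the forced powers of the parameter. *)
have key u : exists P, [/\ (restr (arc2 p d' u) (sym_poly A)) * V%:P ^+ 2 = 'X^4 * P,
    P.[0] = (wf A r z p * lam u) ^+ 2 & lam u = 0 -> exists N, P = 'X^2 * N].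
  have := gram4 (web_arc A (arc2 p d' u)) (mp y1) (mp y2) (mp r) (mp z). cbv zeta.
  rewrite detV -restr_sym /d3 /= !bf_arc2 !(wfC hsym y2 y1) !(wfC hsym r y1)
    !(wfC hsym r y2) !(wfC hsym z y1) !(wfC hsym z y2) !(wfC hsym z r).
  rewrite !(wf_basepoint _ hy1) !(wf_basepoint _ hy2) ld' r1' r2' rr !kp1 !kp2.
  rewrite !(scale0r, polyC0, add0r, addr0) -!mul_polyC => ->.
  move: (lam u) (wf A y1 r u) (wf A y2 r u) (wf A y1 z d') (wf A y1 z u)
    (wf A y2 z d') (wf A y2 z u) (wf A r r d') (wf A r r u) (wf A r z p)
    (wf A r z d') (wf A r z u) (wf A z z p) (wf A z z d') (wf A z z u).
  move=> l s1 s2 b1 b1' b2 b2' g1 g2 c0 c1 c2 f0 f1 f2.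
  pose B1 := b1%:P + b1'%:P * 'X; pose B2 := b2%:P + b2'%:P * 'X.
  pose G := g1%:P + g2%:P * 'X; pose c := c0%:P + c1%:P * 'X + c2%:P * 'X^2.
  pose f := f0%:P + f1%:P * 'X + f2%:P * 'X^2.
  exists (l%:P ^+ 2 * (c ^+ 2 - 'X * G * f) + 2 * l%:P * ('X * G * B1 * B2
    - 'X * c * (s1%:P * B2 + s2%:P * B1) + 'X^2 * s1%:P * s2%:P * f)
    + ('X * (s1%:P * B2 - s2%:P * B1)) ^+ 2).
  rewrite /B1 /B2 /G /c /f; split; first by ring.
    by rewrite !hornerE /=; ring.
  move=> ->; exists ((s1%:P * B2 - s2%:P * B1) ^+ 2); rewrite polyC0 /B1 /B2; ring.
have V20 : V ^+ 2 != 0 by rewrite expf_neq0.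
have cV (q : {poly K}) j : (q * V%:P ^+ 2)`_j = q`_j * V ^+ 2.
  by rewrite -rmorphXn /= coefMC.
apply: (h45 d' (- (wf A r z p ^+ 2) * e / (V ^+ 2 * kap)) di d'0).
- exact: lw0.
- move=> u ui; have [P [hP P0 _]] := key u; apply: (mulIf V20).
  rewrite -cV hP coefXnM /= -horner_coef0 P0 exprMn.
  apply: (mulIf kap0); transitivity (- wf A r z p ^+ 2 * (- kap * lam u ^+ 2)); first by ring.
  by rewrite lw //; field; rewrite kap0 V0.
- move=> u ui wu; have [P [hP _ hN]] := key u; apply: (mulIf V20).
  have [N eN] := hN (wl0 _ ui wu).
  by rewrite -cV hP coefXnM /= eN coefXnM mul0r.
Qed.

Hypothesis closed : forall a b c : K, exists s t,
  ((s != 0) || (t != 0)) /\ a * s ^+ 2 + b * (s * t) + c * t ^+ 2 = 0.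
Variables (n : nat) (e : 'rV[K]_4).
Hypothesis nodes : nb_points (isolated_node A) n.
Hypothesis cover : forall x, singular_point (sym_poly A) x ->
  pt x = pt p \/ isolated_node A x.
Hypothesis np : ~ isolated_node A p.
Hypothesis p0 : p != 0.
Hypothesis le : lam e != 0.

Let kp1 z : wf A y1 z p = 0. Proof. exact: bf_ker. Qed.
Let kp2 z : wf A y2 z p = 0. Proof. exact: bf_ker. Qed.

Lemma low_rank_node x : x != 0 -> pt x != pt p -> (\rank (web_mx A x) <= 2)%N ->
  isolated_node A x.
Proof.
move=> x0 xp rx; case: (cover (singular_of_rank hsym x0 rx)) => // e'.
by move: xp; rewrite e' eqxx.
Qed.

(** Otherwise the line through [x] and [p] has rank at most two, and its
    points other than [p] are nodes. *)
Lemma kernel_line x : x != 0 -> pt x != pt p ->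
  y1 *m web_mx A x = 0 -> y2 *m web_mx A x = 0 -> False.
Proof.
move=> x0 xp h1 h2; have fxp := free2_pt x0 p0 xp.
have [T hT] := generic_line nodes fxp; have [t /hT] := ex_notin T; apply.
have [n0 np0 npt] : [/\ x + t *: p != 0, p != 0 & pt (x + t *: p) != pt p].
  split=> //; first exact: free2_nz.
  apply/eqP => /(pt_eqP (free2_nz t fxp))[c _ ec].
  move: fxp => /free2P/(_ 1 (t - c)); rewrite scale1r scalerBl addrA ec subrr.
  by move=> /(_ erefl)[/eqP]; rewrite oner_eq0.
apply: low_rank_node => //; apply: (corank2_of fy); rewrite webD webZ mulmxDr -scalemxAr.
  by rewrite h1 p1 scaler0 addr0.
by rewrite h2 p2 scaler0 addr0.
Qed.

(** On the line through [p] and [d] the quadrics restrict to the plane of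
    [y1], [y2], [r] as multiples of a square. The factor is the value at [r];
    it vanishes at one point of the line, where the quadric contains the
    plane. *)
Lemma ray_node d r : lam d = 0 -> pt d != pt p -> d != 0 ->
    wf A y1 r d = 0 -> wf A y2 r d = 0 -> row_free (rows 3 [:: y1; y2; r]) ->
  exists2 t, isolated_node A (d + t *: p) & wf A r r (d + t *: p) = 0.
Proof.
move=> ld dp d0 r1 r2 fr; have rr := tacnode_transversal ld dp d0 r1 r2 fr.
exists (- (wf A r r d / wf A r r p)); last by rewrite wfD wfZ mulNr divfK ?subrr.
have fdp := free2_pt d0 p0 dp; set t := - _; set x := d + t *: p.
have xr : wf A r r x = 0 by rewrite wfD wfZ mulNr divfK ?subrr.
apply: low_rank_node; first exact: free2_nz.
  apply/eqP => /(pt_eqP (free2_nz t fdp))[c _ ec].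
  move: fdp => /free2P/(_ 1 (t - c)); rewrite scale1r scalerBl addrA ec subrr.
  by move=> /(_ erefl)[/eqP]; rewrite oner_eq0.
have lx : lam x = 0 by rewrite wfD wfZ ld kp1 mulr0 addr0.
have xr1 : wf A y1 r x = 0 by rewrite wfD wfZ r1 kp1 mulr0 addr0.
have xr2 : wf A y2 r x = 0 by rewrite wfD wfZ r2 kp2 mulr0 addr0.
apply: (isotropic3_rank fr); apply/matrixP => i j; rewrite bfE !row_rows [RHS]mxE -/(wf A _ _ x).
case: i => [[|[|[|//]]] hi]; case: j => [[|[|[|//]]] hj] /=;
  by rewrite ?(wf_basepoint _ hy1) ?(wf_basepoint _ hy2) // ?(wfC hsym y2 y1)
    ?(wfC hsym r y1) ?(wfC hsym r y2).
Qed.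

(** Rank two makes [r] isotropic, which determines the point on the line
    through [p]. *)
Lemma ray_unique x x' r a b : isolated_node A x -> lam x' = 0 -> x' != 0 ->
    pt x' != pt p -> wf A y1 r x' = 0 -> wf A y2 r x' = 0 ->
    row_free (rows 3 [:: y1; y2; r]) -> wf A r r x' = 0 ->
    x = a *: p + b *: x' -> b != 0 -> pt x = pt x'.
Proof.
move=> nx lx' x'0 xp r1 r2 fr rr ex b0.
have rx : (\rank (web_mx A x) <= 2)%N by case: nx => _ [_ ->].
have [z zU] := ex_rows_complement3 fr.
have lx : lam x = 0 by rewrite ex wfD !wfZ lx' kp1 !mulr0 addr0.
have xr1 : wf A y1 r x = 0 by rewrite ex wfD !wfZ r1 kp1 !mulr0 addr0.
have xr2 : wf A y2 r x = 0 by rewrite ex wfD !wfZ r2 kp2 !mulr0 addr0.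
have step y : basepoint A y -> wf A y r x = 0 -> wf A y z x' != 0 -> y *m web_mx A p = 0 ->
    wf A r r x = 0.
  move=> hy yr yz yp; have ez : wf A y z x = b * wf A y z x'.
    by rewrite ex wfD !wfZ [wf A y z p]bf_ker // mulr0 add0r.
  have := rank_le2_minor (rows 3 [:: y; r; z]) (rows 3 [:: y; r; z])^T rx.
  rewrite gram3 -!/(wf A _ _ x) (wf_basepoint _ hy) (wfC hsym r y) (wfC hsym z y) yr ez => h.
  have : (b * wf A y z x') ^+ 2 * wf A r r x = 0.
    by rewrite -[LHS]opprK -[RHS]oppr0 -[in RHS]h; ring.
  by move/eqP; rewrite mulf_eq0 sqrf_eq0 mulf_eq0 (negbTE b0) (negbTE yz) => /eqP.
have xrr : wf A r r x = 0.
  have [z1|z1] := eqVneq (wf A y1 z x') 0; last exact: (step y1).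
  have [z2|z2] := eqVneq (wf A y2 z x') 0; last exact: (step y2).
  exfalso; apply: (kernel_line x'0 xp); apply: (ker_of_unit zU);
    rewrite -/(wf A _ _ x') ?(wf_basepoint _ hy1) ?(wf_basepoint _ hy2) //.
  by rewrite wfC.
have rp0 := tacnode_transversal lx' xp x'0 r1 r2 fr.
have a0 : a = 0.
  move: xrr; rewrite ex wfD !wfZ rr mulr0 addr0 => /eqP.
  by rewrite mulf_eq0 (negbTE rp0) orbF => /eqP.
by rewrite ex a0 scale0r add0r pt_scale.
Qed.

(** The plane [lam = 0] cuts the symmetroid in a double pair of lines through
    the tacnode. Each line carries exactly one further point of rank two. The
    two lines are distinct, since otherwise two of the three forms of the node
    would be proportional. *)
Lemma tacnode_two_nodes : nb_points (fun x => isolated_node A x /\ lam x = 0) 2.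
Proof.
have wcn y z (x : 'rV_4) : wf A y z x = 0 -> x *m wcol A y z = 0.
  by move=> h; rewrite wcolE h raddf0.
have wcn0 y z (x : 'rV_4) : wf A y z x != 0 -> x *m wcol A y z != 0.
  by apply: contraNneq; rewrite wcolE => /matrixP/(_ 0 0); rewrite !mxE mulr1n => ->.
have wc0 y z (x : 'rV_4) : x *m wcol A y z = 0 -> wf A y z x = 0.
  by rewrite wcolE => /matrixP/(_ 0 0); rewrite !mxE mulr1n.
(* A basis [p], [d], [d'] of the plane, with [d] on one of the two lines. *)
have [z1 [z2 zU]] := ex_rows_complement fy.
pose D0 x := wf A y1 z1 x * wf A y2 z2 x - wf A y1 z2 x * wf A y2 z1 x.
have [d [d' [ld ld' fpd D0d]]] : exists d d', [/\ lam d = 0, lam d' = 0,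
    row_free (rows 3 [:: p; d; d']) & D0 d = 0].
  have [i pi] : exists i, p 0 i != 0.
    apply/existsP; apply: contraNT p0; rewrite negb_exists => /forallP h.
    by apply/eqP/rowP => j; have := h j; rewrite negbK mxE => /eqP.
  have [d1 [d2 [fd l1 i1 l2 i2]]] := common_zero2 (wcol A y1 y2) (delta_mx i 0).
  have di (x : 'rV[K]_4) : x *m (delta_mx i 0 : 'cV_4) = 0 -> x 0 i = 0.
    by move=> /matrixP/(_ 0 0); rewrite -colE !mxE.
  have {}i1 := di _ i1; have {}i2 := di _ i2; have {}l1 := wc0 _ _ _ l1; have {}l2 := wc0 _ _ _ l2.
  have fp d3 d4 : d3 0 i = 0 -> d4 0 i = 0 -> row_free (rows 2 [:: d3; d4]) ->
      row_free (rows 3 [:: p; d3; d4]).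
    move=> e3 e4 /free2P f34; apply/free3P => a b c rel.
    have a0 : a = 0.
      have /rowP/(_ i) := rel; rewrite !mxE e3 e4 !mulr0 !addr0 => /eqP.
      by rewrite mulf_eq0 (negbTE pi) orbF => /eqP.
    by move: rel; rewrite a0 scale0r add0r => /f34[-> ->].
  have [s [t [st q0]]] := closed (D0 d1) (wf A y1 z1 d1 * wf A y2 z2 d2 + wf A y1 z1 d2 * wf A y2 z2 d1
    - wf A y1 z2 d1 * wf A y2 z1 d2 - wf A y1 z2 d2 * wf A y2 z1 d1) (D0 d2).
  have D0st : D0 (s *: d1 + t *: d2) = 0.
    by rewrite -[RHS]q0 /D0 !wfD !wfZ; ring.
  have lst : lam (s *: d1 + t *: d2) = 0 by rewrite wfD !wfZ l1 l2 !mulr0 addr0.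
  have ist : (s *: d1 + t *: d2) 0 i = 0 by rewrite !mxE i1 i2 !mulr0 addr0.
  have [s0|s0] := eqVneq s 0.
    have t0 : t != 0 by move: st; rewrite s0 eqxx.
    exists (s *: d1 + t *: d2), d1; split=> //; apply: fp => //; apply/free2P => a b.
    rewrite s0 scale0r add0r scalerA addrC => /((free2P _ _).1 fd)[-> /eqP].
    by rewrite mulf_eq0 (negbTE t0) orbF => /eqP.
  exists (s *: d1 + t *: d2), d2; split=> //; apply: fp => //; apply/free2P => a b.
  rewrite scalerDr !scalerA -addrA -scalerDl => /((free2P _ _).1 fd)[/eqP].
  by rewrite mulf_eq0 (negbTE s0) orbF => /eqP ->; rewrite mul0r add0r.
have notp x a b c : x = a *: p + b *: d + c *: d' -> (b != 0) || (c != 0) ->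
    x != 0 /\ pt x != pt p.
  move=> ex bc; have x0 : x != 0.
    apply: contraTneq bc => x0; move: ex; rewrite x0 => /esym/((free3P _ _ _).1 fpd)[_ -> ->].
    by rewrite eqxx.
  split=> //; apply: contraTneq bc => /(pt_eqP x0)[k k0 ek].
  have rel : (a - k) *: p + b *: d + c *: d' = 0.
    by rewrite scalerBl -ek ex; apply/rowP => j; rewrite !mxE; ring.
  by have [_ -> ->] := (free3P _ _ _).1 fpd _ _ _ rel; rewrite eqxx.
have ker_r x : D0 x = 0 -> exists r, [/\ row_free (rows 3 [:: y1; y2; r]),
    wf A y1 r x = 0 & wf A y2 r x = 0].
  move=> /right_kernel[c1 [c2 [c12 h1 h2]]]; exists (c1 *: z1 + c2 *: z2); split.
  - apply/free3P => a b c; rewrite scalerDr !scalerA addrA => rel.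
    have /free4P fr : row_free (rows 4 [:: y1; y2; z1; z2]) by rewrite row_free_unit.
    have [-> -> h3 h4] := fr _ _ _ _ rel; split=> //; apply/eqP; move: c12.
    by apply: contraLR => c0; move/eqP: h3; move/eqP: h4; rewrite !mulf_eq0 (negbTE c0) /= => -> ->.
  - by rewrite wfDr !wfZr -[RHS]h1; ring.
  - by rewrite wfDr !wfZr -[RHS]h2; ring.
have [r [fr r1 r2]] := ker_r _ D0d.
have [d0 dp] : d != 0 /\ pt d != pt p.
  by apply: (notp d 0 1 0); rewrite ?oner_eq0 // !scale0r scale1r add0r addr0.
have [t1 n1 rr1] := ray_node ld dp d0 r1 r2 fr.
set x1 := d + t1 *: p in n1 rr1.
have [z zU'] := ex_rows_complement3 fr.
have lx1 : lam x1 = 0 by rewrite wfD wfZ ld kp1 mulr0 addr0.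
have xr1 : wf A y1 r x1 = 0 by rewrite wfD wfZ r1 kp1 mulr0 addr0.
have xr2 : wf A y2 r x1 = 0 by rewrite wfD wfZ r2 kp2 mulr0 addr0.
have rx1 : (\rank (web_mx A x1) <= 2)%N by case: n1 => _ [_ ->].
have [x10 x1p] : x1 != 0 /\ pt x1 != pt p.
  by apply: (notp x1 t1 1 0); rewrite ?oner_eq0 // scale1r scale0r addr0 addrC.
have H x : lam x = 0 -> exists a b c, x = a *: p + b *: x1 + c *: d'.
  move=> lx; have [a [b [c ->]]] := common_zero1_span fpd (wcn _ _ _ (kp1 y2)) (wcn _ _ _ ld)
    (wcn _ _ _ ld') (wcn0 _ _ _ le) (wcn _ _ _ lx).
  exists (a - b * t1), b, c; rewrite /x1.
  by apply/rowP => j; rewrite !mxE; ring.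
have ex1 : x1 = d + t1 *: p by [].
clearbody x1.
pose D x := wf A y1 r x * wf A y2 z x - wf A y1 z x * wf A y2 r x.
have Dnode x : isolated_node A x -> lam x = 0 -> D x = 0.
  move=> nx lx; have rx : \rank (web_mx A x) = 2 by case: nx => _ [].
  have dx : \det (web_mx A x) = 0.
    apply/eqP/negPn; rewrite -unitfE -unitmxE -row_free_unit; apply/negP => /eqP.
    by rewrite rx.
  have := gram4 (web_mx A x) y1 y2 r z; cbv zeta; rewrite dx mul0r /d3 /= -!/(wf A _ _ x).
  rewrite !(wf_basepoint _ hy1) !(wf_basepoint _ hy2) !(wfC hsym y2 y1) lx.
  rewrite !(wfC hsym r y1) !(wfC hsym r y2) !(wfC hsym z y1) !(wfC hsym z y2) => h.
  apply/eqP; rewrite -sqrf_eq0; apply/eqP; rewrite [RHS]h /D; ring.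
pose m := wf A y2 z x1 * wf A y1 r d' - wf A y1 z x1 * wf A y2 r d'.
have Dst a s t : D (a *: p + s *: x1 + t *: d') = t * (s * m + t * D d').
  by rewrite /D /m !wfD !wfZ xr1 xr2 !kp1 !kp2; ring.
have m0 : m != 0.
  apply/eqP => m0; pose k := wf A y2 z x1 *: y1 + - wf A y1 z x1 *: y2.
  have kM : k *m web_mx A x1 = 0.
    apply: (ker_of_unit zU'); rewrite -/(wf A _ _ x1) /k wfDl !wfZl ?(wf_basepoint _ hy1)
      ?(wf_basepoint _ hy2) ?(wfC hsym y2 y1) ?lx1 ?xr1 ?xr2; by [rewrite !mulr0 addr0 | ring].
  have k0 : k != 0.
    apply/eqP => k0; have [h1 h2] := (free2P _ _).1 fy _ _ k0.
    apply: (kernel_line x10 x1p); apply: (ker_of_unit zU');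
      rewrite -/(wf A _ _ x1) ?(wf_basepoint _ hy1) ?(wf_basepoint _ hy2) //.
      by apply/eqP; rewrite -oppr_eq0 h2.
    by rewrite wfC.
  have [k' fk k'M] := ker_complete rx1 k0 kM.
  have [a [b [c [g ek']]]] := rows4_comb k' zU'.
  have g0 : g = 0.
    have z12 : (wf A y1 z x1 != 0) || (wf A y2 z x1 != 0).
      apply: contraNT k0; rewrite negb_or !negbK => /andP[/eqP h1 /eqP h2].
      by rewrite /k h1 h2 oppr0 !scale0r addr0.
    have e1 : g * wf A y1 z x1 = 0.
      have : wf A k' y1 x1 = 0 by exact: bf_ker.
      rewrite ek' !wfDl !wfZl (wf_basepoint _ hy1) (wfC hsym y2 y1) lx1 (wfC hsym r y1) xr1.
      by rewrite (wfC hsym z y1) !mulr0 !add0r.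
    have e2 : g * wf A y2 z x1 = 0.
      have : wf A k' y2 x1 = 0 by exact: bf_ker.
      rewrite ek' !wfDl !wfZl (wf_basepoint _ hy2) lx1 (wfC hsym r y2) xr2.
      by rewrite (wfC hsym z y2) !mulr0 !add0r.
    apply/eqP; apply: contraLR z12 => gn; move/eqP: e1; move/eqP: e2.
    by rewrite !mulf_eq0 (negbTE gn) /= => -> ->.
  have kk v : wf A k k v = - (2 * (wf A y2 z x1 * wf A y1 z x1)) * lam v.
    rewrite /k wfDl !wfDr !wfZl !wfZr (wf_basepoint _ hy1) (wf_basepoint _ hy2).
    by rewrite (wfC hsym y2 y1); ring.
  have kk' v : lam v = 0 -> wf A k k' v = 0.
    move=> lv; have -> : wf A k k' v = c * wf A k r v.
      rewrite ek' g0 scale0r addr0 /k !wfDl !wfDr !wfZl !wfZr (wf_basepoint _ hy1).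
      by rewrite (wf_basepoint _ hy2) (wfC hsym y2 y1) lv; ring.
    have [a' [b' [c' ->]]] := H _ lv.
    rewrite !wfD !wfZ /k !wfDl !wfZl xr1 xr2 !kp1 !kp2.
    have : wf A y2 z x1 * wf A y1 r d' + - wf A y1 z x1 * wf A y2 r d' = 0.
      by rewrite -[RHS]m0 /m; ring.
    by move=> ->; ring.
  exact: (node_two_forms hsym n1 fk kM k'M kk (form_prop kk' le)).
pose d2 := - D d' *: x1 + m *: d'.
have ld2 : lam d2 = 0 by rewrite wfD !wfZ lx1 ld' !mulr0 addr0.
have ed2 : d2 = - D d' * t1 *: p + - D d' *: d + m *: d'.
  by rewrite /d2 ex1; apply/rowP => j; rewrite !mxE; ring.
have [d20 d2p] : d2 != 0 /\ pt d2 != pt p.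
  by apply: notp ed2 _; rewrite m0 orbT.
have Dd2 : D d2 = 0.
  have := Dst 0 (- D d') m; rewrite scale0r add0r -/d2 => ->; ring.
have [r' [fr' r1' r2']] : exists r', [/\ row_free (rows 3 [:: y1; y2; r']),
    wf A y1 r' d2 = 0 & wf A y2 r' d2 = 0].
  have [c1 [c2 [c12 h1 h2]]] := right_kernel Dd2; exists (c1 *: r + c2 *: z); split.
  - apply/free3P => a b c; rewrite scalerDr !scalerA addrA => rel.
    have /free4P fr4 : row_free (rows 4 [:: y1; y2; r; z]) by rewrite row_free_unit.
    have [-> -> h3 h4] := fr4 _ _ _ _ rel; split=> //; apply/eqP; move: c12.
    by apply: contraLR => c0; move/eqP: h3; move/eqP: h4; rewrite !mulf_eq0 (negbTE c0) /= => -> ->.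
  - by rewrite wfDr !wfZr -[RHS]h1; ring.
  - by rewrite wfDr !wfZr -[RHS]h2; ring.
have [t2 n2 rr2] := ray_node ld2 d2p d20 r1' r2' fr'.
set x2 := d2 + t2 *: p in n2 rr2.
have lx2 : lam x2 = 0 by rewrite wfD wfZ ld2 kp1 mulr0 addr0.
have ex2 : x2 = (- D d' * t1 + t2) *: p + - D d' *: d + m *: d'.
  by rewrite /x2 ed2; apply/rowP => j; rewrite !mxE; ring.
have [x20 x2p] : x2 != 0 /\ pt x2 != pt p by apply: notp ex2 _; rewrite m0 orbT.
have x12 : pt x1 != pt x2.
  apply/eqP => /(pt_eqP x10)[k k0 ek]; move: ek; rewrite ex2 ex1 => ek.
  move: fpd => /free3P/(_ (t1 - k * (- D d' * t1 + t2)) (1 + k * D d') (- (k * m))).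
  case.
    apply/rowP => j; have := congr1 (fun M : 'rV_4 => M 0 j) ek; rewrite !mxE => ekj.
    transitivity (d 0 j + t1 * p 0 j - k * ((- D d' * t1 + t2) * p 0 j +
      - D d' * d 0 j + m * d' 0 j)); first by ring.
    by rewrite ekj subrr.
  by move=> _ _ /eqP; rewrite oppr_eq0 mulf_eq0 (negbTE k0) (negbTE m0).
have [mm [kk [_ h2 _]]] := nb_split nodes (@wf_scale_eq0 _ A y1 y2).
suff e2 : mm = 2%N by rewrite e2 in h2.
apply/eqP; rewrite eqn_leq (nb_two h2 x10 x20 x12 (conj n1 lx1) (conj n2 lx2)) andbT.
apply: (nb_le_seq (t := [:: x1; x2]) h2) => x x0 [nx lx].
have [a [b [c ex]]] := H x lx; have := Dnode x nx lx; rewrite ex Dst => /eqP.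
rewrite mulf_eq0 -ex !inE => /orP[/eqP c0|/eqP bm].
  apply/orP; left; apply/eqP; apply: (ray_unique nx lx1 x10 x1p xr1 xr2 fr rr1 (a := a) (b := b)).
    by rewrite ex c0 scale0r addr0.
  apply: contraPneq nx => b0; have a0 : a != 0.
    by apply: contraNneq x0 => a0; rewrite ex a0 b0 c0 !scale0r !addr0.
  rewrite ex b0 c0 !scale0r !addr0 => nap; apply: np.
  have := nb_scale nodes (x := a *: p) (c := a^-1); rewrite scalerA mulVf // scale1r.
  by apply=> //; rewrite ?invr_eq0 // scaler_eq0 negb_or a0.
have c0 : c != 0.
  apply: contraPneq nx => c0; have b0 : b = 0.
    by move: bm; rewrite c0 mul0r addr0 => /eqP; rewrite mulf_eq0 (negbTE m0) orbF => /eqP.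
  have a0 : a != 0 by apply: contraNneq x0 => a0; rewrite ex a0 b0 c0 !scale0r !addr0.
  rewrite ex b0 c0 !scale0r !addr0 => nap; apply: np.
  have := nb_scale nodes (x := a *: p) (c := a^-1); rewrite scalerA mulVf // scale1r.
  by apply=> //; rewrite ?invr_eq0 // scaler_eq0 negb_or a0.
apply/orP; right; apply/eqP.
have x2r1 : wf A y1 r' x2 = 0 by rewrite wfD wfZ r1' kp1 mulr0 addr0.
have x2r2 : wf A y2 r' x2 = 0 by rewrite wfD wfZ r2' kp2 mulr0 addr0.
apply: (ray_unique nx lx2 x20 x2p x2r1 x2r2 fr' rr2 (a := a - c / m * t2) (b := c / m)); last first.
  by rewrite mulf_neq0 ?invr_eq0.
have eb : b = - (c / m) * D d'.
  by apply: (mulIf m0); apply: (addIr (c * D d')); rewrite bm; field.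
by rewrite ex eb /x2 /d2; apply/rowP => j; rewrite !mxE; field.
Qed.

End TacnodePlane.

(** * Symmetroids with a tacnode *)

Lemma complex_quadratic (R : realType) (a b c : R[i]) : exists s t,
  ((s != 0) || (t != 0)) /\ a * s ^+ 2 + b * (s * t) + c * t ^+ 2 = 0.
Proof.
have [a0|a0] := eqVneq a 0.
  by exists 1, 0; rewrite oner_eq0 a0; split=> //; ring.
pose q := sqrtc (b ^+ 2 - 4 * a * c); have qq : q ^+ 2 = b ^+ 2 - 4 * a * c by exact: sqr_sqrtc.
exists (q - b), (2 * a); rewrite mulf_neq0 ?pnatr_eq0 // orbT; split=> //.
transitivity (a * (q ^+ 2 - b ^+ 2 + 4 * a * c)); first by ring.
by rewrite qq; ring.
Qed.

(** Subtract the multiple of the definite form that has the same polar pairing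
    with it: the rest is apolar to the definite form and, by the hypothesis,
    degenerate, hence zero. *)
Lemma degenerate_pencil (R : realFieldType) (a b c a0 b0 c0 : R) :
    0 < a0 * c0 - b0 ^+ 2 ->
    (a * c0 + c * a0 - 2 * b * b0) ^+ 2 = 4 * (a * c - b ^+ 2) * (a0 * c0 - b0 ^+ 2) ->
  exists s, [/\ a = s * a0, b = s * b0 & c = s * c0].
Proof.
set D := a0 * c0 - b0 ^+ 2 => D0 h; have Dn : D != 0 by rewrite gt_eqF.
pose M := a * c0 + c * a0 - 2 * b * b0; pose s := M / (2 * D); exists s.
pose x := a - s * a0; pose y := b - s * b0; pose z := c - s * c0.
have sD : 2 * s * D = M by rewrite /s; field.
have polar : x * c0 + z * a0 = 2 * y * b0.
  apply/eqP; rewrite -subr_eq0; apply/eqP; transitivity (M - 2 * s * D).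
    by rewrite /x /y /z /M /D; ring.
  by rewrite sD subrr.
have disc : x * z = y ^+ 2.
  apply: (mulfI (_ : 4 * D != 0)); first by rewrite mulf_neq0 // pnatr_eq0.
  apply/eqP; rewrite -subr_eq0; apply/eqP.
  transitivity (4 * (a * c - b ^+ 2) * D - 2 * (2 * s * D) * M + (2 * s * D) ^+ 2).
    by rewrite /x /y /z /M /D; ring.
  by rewrite sD -h -/M; ring.
have sq : (x * c0 - z * a0) ^+ 2 + 4 * (y ^+ 2 * D) = 0.
  transitivity ((x * c0 + z * a0) ^+ 2 - 4 * (x * z) * (a0 * c0) + 4 * (y ^+ 2 * D)); first by ring.
  by rewrite polar disc /D; ring.
have /andP[/eqP yD xz] : (y ^+ 2 * D == 0) && (x * c0 - z * a0 == 0).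
  have p1 : 0 <= (x * c0 - z * a0) ^+ 2 by exact: sqr_ge0.
  have p2 : 0 <= y ^+ 2 * D by rewrite mulr_ge0 ?sqr_ge0 // ltW.
  have e1 : (x * c0 - z * a0) ^+ 2 = 0 by lra.
  have e2 : y ^+ 2 * D = 0 by lra.
  by rewrite e2 eqxx -sqrf_eq0 e1 eqxx.
have y0 : y = 0 by move/eqP: yD; rewrite mulf_eq0 (negbTE Dn) orbF sqrf_eq0 => /eqP.
have xz' : x * c0 = z * a0 by apply/eqP; rewrite -subr_eq0.
have : x * c0 + z * a0 = 0 by rewrite polar y0 mulr0 mul0r.
rewrite -xz' => xc2; have xc : x * c0 = 0 by lra.
have ac0 : a0 * c0 != 0.
  by apply: contraTneq D0 => e; rewrite /D e sub0r oppr_gt0 -leNgt sqr_ge0.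
move: ac0; rewrite mulf_eq0 negb_or => /andP[an cn].
have x0 : x = 0 by move/eqP: xc; rewrite mulf_eq0 (negbTE cn) orbF => /eqP.
have z0 : z = 0 by move/eqP: xz'; rewrite xc eq_sym mulf_eq0 (negbTE an) orbF => /eqP.
by split; apply/eqP; rewrite -subr_eq0; apply/eqP.
Qed.

Section TypeB.
Variables (R : realType) (A : 'I_4 -> 'M[R]_4).
Hypothesis hsym : forall k, (A k)^T = A k.
Local Notation C := R[i].
Local Notation AC := (cplx_web A).
Local Notation f := (sym_poly AC).

Lemma definite_disc e k1 k2 : definite (web_mx A e) -> row_free (rows 2 [:: k1; k2]) ->
  0 < wf A k1 k1 e * wf A k2 k2 e - wf A k1 k2 e ^+ 2.
Proof.
move=> de fk; have [n1 _ _] := pt_free2 fk.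
set a := wf A k1 k1 e; set b := wf A k1 k2 e; set c := wf A k2 k2 e.
have nz s t : (s != 0) || (t != 0) -> s *: k1 + t *: k2 != 0.
  by apply: contraTneq => /((free2P _ _).1 fk)[-> ->]; rewrite eqxx.
have val s t : bf (web_mx A e) (s *: k1 + t *: k2) (s *: k1 + t *: k2) =
    s ^+ 2 * a + 2 * s * t * b + t ^+ 2 * c.
  rewrite -/(wf A _ _ e) wfDl !wfDr !wfZl !wfZr (wfC hsym k2 k1) -/a -/b -/c; ring.
have a0 : a != 0 by exact: definite_neq0.
have nz' : - b *: k1 + a *: k2 != 0 by apply: nz; rewrite a0 orbT.
have e1 : bf (web_mx A e) (- b *: k1 + a *: k2) (- b *: k1 + a *: k2) = a * (a * c - b ^+ 2).
  by rewrite val; ring.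
case: de => de; have := de _ nz'; have := de _ n1; rewrite -!/(bf _ _ _) -/(wf A k1 k1 e) -/a e1.
  by move=> ap; rewrite pmulr_rgt0.
by move=> an; rewrite nmulr_rlt0.
Qed.

(** At a real tacnode the tangent cone is a double plane, so the quadrics of the
    web restrict to multiples of a single definite form on the real kernel; the
    zeros of this form are conjugate basepoints. *)
Lemma tacnode_kernel e x : definite (web_mx A e) -> tacnode f (cplx x) ->
  \rank (web_mx A x) = 2 /\
  exists y, [/\ basepoint AC y & y *m web_mx AC (cplx x) = 0].
Proof.
move=> de tx; have [i [e0 [w [xi en wD [v0 v0i wv0] [h012 _]]]]] := tacnode_arcs tx.
have xi' : x 0 i != 0 by move: xi; rewrite mxE fmorph_eq0.
have rx : \rank (web_mx A x) = 2.
  have [v [vi hv]] := corank_direction hsym de xi'.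
  have [|c0 c1 _] := h012 (cplx v); first by rewrite mxE vi.
  have r2 : (\rank (web_mx A x) <= 2)%N.
    move: hv; have := rank_leq_row (web_mx A x).
    case: (\rank _) => [|[|[|[|[|//]]]]] //= _; rewrite ?c0 ?c1 eqxx //.
  apply/eqP; rewrite eqn_leq r2 /= ltnNge; apply/negP => r1.
  have : (3 <= \rank (kermx (web_mx AC (cplx x))))%N.
    by rewrite mxrank_ker cplx_rank; move: r1; clear; lia.
  move=> /ex_sub_basis[B fB /sub_kermxP BM].
  have [kap _ /(_ (web_mx AC v0))[G hG _]] :=
    @det_pencil_kernel _ 3 1 _ B (web_sym (csym hsym) (cplx x)) fB BM.
  have [_ _] := h012 v0 v0i; rewrite line_pencil hG coefXnM /= => /esym/eqP.
  by rewrite mulf_eq0 (negbTE en) sqrf_eq0 (negbTE wv0).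
split=> //; have [|k1 [k2 [fk h1 h2]]] := @ker_plane _ _ (web_mx A x); first by rewrite rx.
have [kap /(_ rx) kap0 hk] := node_expansion hsym fk h1 h2.
pose D (v : 'rV[R]_4) := wf A k1 k1 v * wf A k2 k2 v - wf A k1 k2 v ^+ 2.
have Dw (v : 'rV[R]_4) : v 0 i = 0 -> (kap * D v)%:C%C = e0 * w (cplx v) ^+ 2.
  move=> vi; have [|_ _ <-] := h012 (cplx v); first by rewrite mxE vi.
  by rewrite restr_real; have [G -> hG] := hk v; rewrite coefXnM /= -horner_coef0 hG.
have kx k z : k *m web_mx A x = 0 -> wf A k z x = 0 by move=> kM; exact: bf_ker.
pose nrm (v : 'rV[R]_4) : 'rV[R]_4 := v + (- (v 0 i / x 0 i)) *: x.
have nrmi v : nrm v 0 i = 0 by rewrite !mxE; field.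
have nrmw k z v : k *m web_mx A x = 0 -> wf A k z (nrm v) = wf A k z v.
  by move=> kM; rewrite wfD wfZ kx // mulr0 addr0.
clearbody nrm; have De := definite_disc de fk.
set a0 := wf A k1 k1 e in De; set b0 := wf A k1 k2 e in De; set c0 := wf A k2 k2 e in De.
have prop (v : 'rV[R]_4) : exists s, [/\ wf A k1 k1 v = s * a0, wf A k1 k2 v = s * b0 & wf A k2 k2 v = s * c0].
  apply: degenerate_pencil De _.
  set a := wf A k1 k1 v; set b := wf A k1 k2 v; set c := wf A k2 k2 v.
  have Dv : D (nrm v) = a * c - b ^+ 2 by rewrite /D !nrmw.
  have Dee : D (nrm e) = a0 * c0 - b0 ^+ 2 by rewrite /D !nrmw.
  have Dve : D (nrm v + nrm e) = (a + a0) * (c + c0) - (b + b0) ^+ 2.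
    by rewrite /D !wfD !nrmw.
  have := Dw _ (nrmi v); have := Dw _ (nrmi e); have := Dw (nrm v + nrm e).
  rewrite mxE !nrmi addr0 => /(_ erefl).
  have -> : cplx (nrm v + nrm e) = cplx (nrm v) + cplx (nrm e).
    by apply/rowP => j; rewrite !mxE rmorphD.
  rewrite wD Dv Dee Dve => q1 q2 q3.
  apply: (mulfI (_ : kap ^+ 2 != 0)); first by rewrite expf_neq0.
  apply: (@complexI R); set wv := w _ in q1 q3; set we := w _ in q1 q2.
  have pol : (kap * (a * c0 + c * a0 - 2 * b * b0))%:C%C = 2 * e0 * wv * we.
    transitivity ((kap * ((a + a0) * (c + c0) - (b + b0) ^+ 2))%:C%C
      - (kap * (a * c - b ^+ 2))%:C%C - (kap * (a0 * c0 - b0 ^+ 2))%:C%C).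
      by rewrite -!rmorphB /=; congr (_%:C%C); ring.
    by rewrite q1 q2 q3; ring.
  transitivity ((kap * (a * c0 + c * a0 - 2 * b * b0))%:C%C ^+ 2).
    by rewrite -rmorphXn /=; congr (_%:C%C); ring.
  transitivity (4 * ((kap * (a * c - b ^+ 2))%:C%C * (kap * (a0 * c0 - b0 ^+ 2))%:C%C)).
    by rewrite pol q2 q3; ring.
  by rewrite -rmorphM /= -(rmorph_nat (real_complex R) 4) -rmorphM /=; congr (_%:C%C); ring.
have [s [t [st q0]]] := complex_quadratic a0%:C%C (2 * b0)%:C%C c0%:C%C.
pose y := s *: cplx k1 + t *: cplx k2.
have kC k : k *m web_mx A x = 0 -> cplx k *m web_mx AC (cplx x) = 0.
  by move=> kM; rewrite cplx_webE /cplx -(map_mxM (real_complex R)) kM map_mx0.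
exists y; split; last by rewrite /y mulmxDl -!scalemxAl !kC // !scaler0 addr0.
have yv (v : 'rV[R]_4) : wf AC y y (cplx v) = 0.
  have [l [e1 e2 e3]] := prop v.
  rewrite /y wfDl !wfDr !wfZl !wfZr !cplx_wf (wfC hsym k2 k1) e1 e2 e3.
  transitivity (l%:C%C * (a0%:C%C * s ^+ 2 + (2 * b0)%:C%C * (s * t) + c0%:C%C * t ^+ 2)).
    by rewrite !rmorphM /= rmorph_nat; ring.
  by rewrite q0 mulr0.
split.
  apply: contraTneq st => y0; have fkc : row_free (rows 2 [:: cplx k1; cplx k2]).
    have -> : rows 2 [:: cplx k1; cplx k2] = cplx (rows 2 [:: k1; k2]).
      by apply/matrixP => j l; rewrite !mxE; case: j => [[|[|//]] hj]; rewrite /= !mxE.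
    by rewrite /row_free (mxrank_map (real_complex R)).
  by have [-> ->] := (free2P _ _).1 fkc _ _ y0; rewrite eqxx.
move=> z; apply/matrixP => j l; rewrite !ord1 [RHS]mxE -/(bf _ y y) -/(wf AC y y z).
by rewrite (re_im z) wfD wfZ !yv mulr0 addr0.
Qed.

(** The tacnode is unique, hence real. The form [y A(x) y^*] of the basepoint
    [y] of [tacnode_kernel] vanishes at exactly two nodes, which are not
    semidefinite; the other real nodes are on the boundary. *)
Theorem typeB_spectrahedron a b : spectrahedral A ->
    nb_points (real_node A) a -> nb_points (boundary_node A) b -> typeB AC ->
  ((exists x : 'rV[R]_4, tacnode f (cplx x) /\ on_boundary A x) \/
   (exists x : 'rV[R]_4, tacnode f (cplx x) /\ ~ in_spectrahedron A x)) /\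
  [/\ (b <= a)%N, (a <= b + 2)%N, (b + 2 <= 6)%N, ~~ odd a & ~~ odd b].
Proof.
move=> [e de] ha hb [[p [tp h6 hp]] _].
have csy := csym hsym.
have [i [e0 [w [pi en wD [v0 v0i wv0] [h012 _]]]]] := tacnode_arcs tp.
have p0 : p != 0 by apply: contraNneq pi => ->; rewrite mxE.
have sp : singular_point f p.
  by apply: singular_of_order pi _ => v vi; have [-> ->] := h012 v vi.
have npn : ~ isolated_node AC p.
  by move=> np; apply: (node_cone csy np pi wD) => v vi; have [_ _ ->] := h012 v vi.
have [z [c [z0 c0 zp]]] := real_special_point p0 sp npn hp.
have tz : tacnode f (cplx z) by rewrite zp; exact: tacnode_scale.
have [rz [y [hy yz]]] := tacnode_kernel de tz.
have hcy := conj_basepoint hy.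
split.
  have [sz|nsz] := pselect (semidefinite (web_mx A z)); [left | right]; exists z; split=> //.
    by apply/boundaryE => //; rewrite rz.
  by case.
have cyz : conj_mx y *m web_mx AC (cplx z) = 0.
  apply/(can_inj (@conj_mxK R 1 4)); rewrite /conj_mx map_mx0 map_mxM -!/(conj_mx _) conj_mxK.
  by rewrite -conj_web conj_cplx.
have fy : row_free (rows 2 [:: y; conj_mx y]).
  apply: free2_pt; [by case: hy | by case: hcy |].
  by rewrite eq_sym (no_real_basepoint hsym de).
have pz : pt (cplx z) = pt p by rewrite zp pt_scale.
have cov x : singular_point f x -> pt x = pt (cplx z) \/ isolated_node AC x.
  by move=> /hp[|]; [rewrite ptE pz => /eqP; left | right].
have npz : ~ isolated_node AC (cplx z).
  move=> nz; apply: npn; have -> : p = c^-1 *: cplx z by rewrite zp scalerA mulVf // scale1r.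
  by apply: (nb_scale h6); rewrite ?invr_eq0 ?cplx_eq0.
have rzC : \rank (web_mx AC (cplx z)) = 2 by rewrite cplx_rank.
have z0C : cplx z != 0 by rewrite cplx_eq0.
have h2 := tacnode_two_nodes csy hy hcy fy yz cyz tz rzC (@complex_quadratic R) h6 cov npz z0C
  (basepoint_definite hsym de hy).
apply: (count_boundary hsym hy h6 h2) => // x nx w0 sx.
have [k1 kc1] := semidefinite_isotropic hsym hy sx w0.
have [x0 rx] := real_node_rank nx.
have x0C : cplx x != 0 by rewrite cplx_eq0.
apply: (kernel_line csy fy yz cyz h6 cov z0C x0C _ k1 kc1).
apply/eqP => /(pt_eqP x0C)[k kn ek]; apply: npz.
have -> : cplx z = k^-1 *: cplx x by rewrite ek scalerA mulVf // scale1r.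
by apply: (nb_scale h6); rewrite ?invr_eq0.
Qed.

End TypeB.

(** * Smooth conics *)

Lemma poly_all0 (K : numFieldType) (p : {poly K}) : (forall t, p.[t] = 0) -> p = 0.
Proof.
move=> h; apply/eqP/negPn/negP => p0; pose s := [seq k%:R : K | k <- iota 0 (size p)].
have us : uniq s by rewrite map_inj_uniq ?iota_uniq // => i j /eqP; rewrite eqr_nat => /eqP.
have rs : all (root p) s by apply/allP => t _; rewrite /root h.
by have := max_poly_roots p0 rs us; rewrite size_map size_iota ltnn.
Qed.

(** A nondegenerate ternary form is the sum of a hyperbolic plane, with
    isotropic basis [N], [W], and a line spanned by [Z]; the conic is then
    parametrized by [N + t Z - (k / 2) t^2 W]. *)
Lemma conic_coordinates (K : numFieldType) (E : 'M[K]_(3, 4)) (Q : 'M[K]_3) :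
    (forall a b c : K, exists s t,
      ((s != 0) || (t != 0)) /\ a * s ^+ 2 + b * (s * t) + c * t ^+ 2 = 0) ->
    smooth_conic E Q ->
  exists N Z W k, [/\ row_free (rows 3 [:: N; Z; W]), k != 0,
    forall x, (x <= E)%MS -> exists a b c, x = a *: N + b *: Z + c *: W,
    forall a b c, ((a *: N + b *: Z + c *: W)%R <= E)%MS &
    forall a b c, a *: N + b *: Z + c *: W != 0 ->
      (on_conic E Q (a *: N + b *: Z + c *: W) <-> k * b ^+ 2 + 2 * (a * c) = 0)].
Proof.
move=> closed [fE sQ uQ].
pose q (u v : 'rV[K]_3) := (u *m Q *m v^T) 0 0.
have qDl u u' v : q (u + u') v = q u v + q u' v by rewrite /q !mulmxDl mxE.
have qZl a u v : q (a *: u) v = a * q u v by rewrite /q -!scalemxAl mxE.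
have qC u v : q u v = q v u.
  by rewrite /q -[u *m Q *m v^T]trmxK mxE !trmx_mul trmxK sQ mulmxA.
have qDr u u' v : q v (u + u') = q v u + q v u' by rewrite qC qDl !(qC v).
have qZr a u v : q v (a *: u) = a * q v u by rewrite qC qZl (qC v).
have qM (u : 'rV_3) : u *m Q *m u^T = (q u u)%:M.
  by apply/matrixP => i j; rewrite !ord1 [RHS]mxE eqxx mulr1n.
have [n n0 qn] : exists2 n, n != 0 & q n n = 0.
  pose d0 : 'rV[K]_3 := delta_mx 0 0; pose d1 : 'rV[K]_3 := delta_mx 0 1.
  have [s [t [st e]]] := closed (q d0 d0) (2 * q d0 d1) (q d1 d1).
  exists (s *: d0 + t *: d1).
    apply: contraTneq st => /rowP e'; have := e' 0; have := e' 1; rewrite !mxE /=.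
    by rewrite mulr0 mulr1 add0r mulr0 addr0 mulr1 => -> ->; rewrite eqxx.
  by rewrite !qDl !qDr !qZl !qZr (qC d1 d0) -[RHS]e; ring.
have [w [nw qw]] : exists w, q n w = 1 /\ q w w = 0.
  have nQ : n *m Q != 0 by apply: contraNneq n0 => e; rewrite -(mulmxK uQ n) e mul0mx.
  have [j nj] : exists j, (n *m Q) 0 j != 0.
    by apply: contrapT => no; case/eqP: nQ; apply/rowP => j; rewrite [RHS]mxE;
      apply/eqP/negPn/negP => h; apply: no; exists j.
  pose w0 : 'rV[K]_3 := ((n *m Q) 0 j)^-1 *: delta_mx 0 j.
  have nd : q n (delta_mx 0 j) = (n *m Q) 0 j.
    rewrite /q trmx_delta mxE (bigD1 j) //= big1 => [|l lj].
      by rewrite [X in _ * X + _]mxE !eqxx mulr1 addr0.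
    by rewrite [X in _ * X]mxE (negbTE lj) mulr0.
  have nw0 : q n w0 = 1 by rewrite qZr nd mulVf.
  clearbody w0.
  exists (w0 + (- (q w0 w0 / 2)) *: n); rewrite !qDl !qDr !qZl !qZr qn nw0 (qC w0 n) nw0.
  by split; field.
have [z z0 [zn zw]] : exists2 z, z != 0 & q z n = 0 /\ q z w = 0.
  pose C : 'M[K]_(3, 1 + 1) := row_mx (Q *m n^T) (Q *m w^T).
  have : (0 < \rank (kermx C))%N.
    by rewrite mxrank_ker subn_gt0; exact: leq_ltn_trans (rank_leq_col _) _.
  rewrite lt0n mxrank_eq0 => /rowV0Pn[z /sub_kermxP]; rewrite mul_mx_row => e z0.
  exists z => //; have /eq_row_mx[e1 e2] : row_mx (z *m (Q *m n^T)) (z *m (Q *m w^T)) = row_mx 0 0.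
    by rewrite e row_mx0.
  by rewrite /q -!mulmxA e1 e2 !mxE.
pose M : 'M[K]_3 := \matrix_(i < 3) nth 0 [:: n; z; w] i.
have mulM (u : 'rV_3) : u *m M = u 0 0 *: n + u 0 1 *: z + u 0 (inord 2) *: w.
  rewrite mulmx_sum_row !big_ord_recl big_ord0 addr0 !rowK /= addrA.
  by congr (u 0 _ *: _ + u 0 _ *: _ + u 0 _ *: _); apply/val_inj; rewrite /= ?inordK.
have uM : M \in unitmx.
  rewrite -row_free_unit; apply/row_free_kerP => u; rewrite mulM => e.
  have e0 v : q (u 0 0 *: n + u 0 1 *: z + u 0 (inord 2) *: w) v = 0.
    by rewrite e /q !mul0mx mxE.
  have h2 := e0 n; rewrite !qDl !qZl qn zn (qC w n) nw !mulr0 !add0r mulr1 in h2.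
  have h0 := e0 w; rewrite !qDl !qZl zw qw nw !mulr0 !addr0 mulr1 in h0.
  move: e; rewrite h0 h2 !scale0r add0r addr0 => /eqP.
  rewrite scaler_eq0 (negbTE z0) orbF => /eqP h1; apply/rowP => j; rewrite [RHS]mxE.
  by case: j => [[|[|[|//]]] hj]; [rewrite -[RHS]h0 | rewrite -[RHS]h1 | rewrite -[RHS]h2];
    congr (u 0 _); apply/val_inj; rewrite /= ?inordK.
have k0 : q z z != 0.
  apply: contraNneq z0 => zz; suff zM : z *m Q *m M^T = 0.
    have uMT : M^T \in unitmx by rewrite unitmx_tr.
    by rewrite -(mulmxK uQ z) -(mulmxK uMT (z *m Q)) zM !mul0mx.
  apply/rowP => j; rewrite [RHS]mxE; transitivity (q z (row j M)).
    by rewrite /q tr_row !mxE; apply: eq_bigr => l _; rewrite !mxE.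
  by rewrite rowK; case: j => [[|[|[|//]]] hj].
pose N := n *m E; pose Z := z *m E; pose W := w *m E.
have comb a b c : a *: N + b *: Z + c *: W = (a *: n + b *: z + c *: w) *m E.
  by rewrite !mulmxDl -!scalemxAl.
have solve (u : 'rV_3) : exists a b c, u = a *: n + b *: z + c *: w.
  by exists ((u *m invmx M) 0 0), ((u *m invmx M) 0 1), ((u *m invmx M) 0 (inord 2));
    rewrite -mulM mulmxKV.
exists N, Z, W, (q z z); split=> //.
- apply/free3P => a b c; rewrite comb => e.
  have /row_free_kerP/(_ _ e) e' := fE.
  have /row_free_kerP/(_ (\row_i nth 0 [:: a; b; c] i)) : row_free M by rewrite row_free_unit.
  rewrite mulM !mxE /= inordK //= => /(_ e')/rowP h.
  by split; [have := h 0 | have := h 1 | have := h (inord 2)]; rewrite !mxE /= ?inordK.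
- by move=> x /submxP[u ->]; have [a [b [c ->]]] := solve u; exists a, b, c; rewrite comb.
- by move=> a b c; rewrite comb submxMl.
- move=> a b c x0; have qE : q (a *: n + b *: z + c *: w) (a *: n + b *: z + c *: w) =
      q z z * b ^+ 2 + 2 * (a * c).
    rewrite !qDl !qDr !qZl !qZr qn qw zn zw nw (qC n z) zn (qC w z) zw (qC w n) nw; ring.
  split=> [[_ [u [e uQu]]]|e].
    have eu : u = a *: n + b *: z + c *: w.
      apply/eqP; rewrite -subr_eq0; apply/eqP; have /row_free_kerP := fE; apply.
      by rewrite mulmxBl -e comb subrr.
    by move: uQu; rewrite eu qM qE => /matrixP/(_ 0 0); rewrite !mxE mulr1n.
  split=> //; exists (a *: n + b *: z + c *: w); split; first by rewrite comb.
  by rewrite qM qE e raddf0.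
Qed.

(** Along the parametrization linear forms become polynomials of degree at
    most two. If their product is zero then so is a factor, and its three
    coefficients are the values of the form at a basis of the plane, up to
    nonzero constants. *)
Lemma conic_forms (K : numFieldType) (A : 'I_4 -> 'M[K]_4) (E : 'M[K]_(3, 4)) (Q : 'M[K]_3)
    y1 z1 y2 z2 y3 z3 :
    (forall a b c : K, exists s t,
      ((s != 0) || (t != 0)) /\ a * s ^+ 2 + b * (s * t) + c * t ^+ 2 = 0) ->
    smooth_conic E Q ->
    (forall x, on_conic E Q x -> [\/ wf A y1 z1 x = 0, wf A y2 z2 x = 0 | wf A y3 z3 x = 0]) ->
  [\/ forall x, (x <= E)%MS -> wf A y1 z1 x = 0, forall x, (x <= E)%MS -> wf A y2 z2 x = 0 |
      forall x, (x <= E)%MS -> wf A y3 z3 x = 0].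
Proof.
move=> closed sm h; have [N [Z [W [k [f3 k0 comb _ con]]]]] := conic_coordinates closed sm.
pose pol y z := (wf A y z N)%:P + wf A y z Z *: 'X + (- (k / 2) * wf A y z W) *: 'X^2.
have polE y z t : (pol y z).[t] = wf A y z (1 *: N + t *: Z + (- (k / 2) * t ^+ 2) *: W).
  by rewrite !wfD !wfZ !hornerD !hornerZ hornerC hornerX hornerXn; ring.
have vanish y z : pol y z = 0 -> forall x, (x <= E)%MS -> wf A y z x = 0.
  move=> p0; have c i : (pol y z)`_i = 0 by rewrite p0 coef0.
  have e0 := c 0%N; have e1 := c 1%N; have e2 := c 2%N.
  rewrite /pol !coefE /= ?(mulr0, mulr1, addr0, add0r) in e0 e1 e2.
  have w0 : wf A y z W = 0.
    by move/eqP: e2; rewrite mulf_eq0 oppr_eq0 mulf_eq0 invr_eq0 pnatr_eq0 (negbTE k0) => /eqP.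
  by move=> x /comb[a [b [c' ->]]]; rewrite !wfD !wfZ e0 e1 w0 !mulr0 !addr0.
have : pol y1 z1 * pol y2 z2 * pol y3 z3 = 0.
  apply: poly_all0 => t; rewrite !hornerM !polE.
  set x := 1 *: N + _ + _; have x0 : x != 0.
    by apply/eqP => /((free3P _ _ _).1 f3)[/eqP]; rewrite oner_eq0.
  have /h[] : on_conic E Q x by apply/con => //; field.
  - by move=> ->; rewrite !mul0r.
  - by move=> ->; rewrite mulr0 mul0r.
  - by move=> ->; rewrite mulr0.
by move/eqP; rewrite !mulf_eq0 => /orP[/orP[]|] /eqP /vanish v; [constructor 1 | constructor 2 | constructor 3].
Qed.

(** * Four independent basepoints *)

Lemma independent_span (K : fieldType) (f g : 'cV[K]_4) (x1 : 'rV[K]_4) :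
    (forall a b, a *: f + b *: g = 0 -> a = 0 /\ b = 0) ->
    x1 != 0 -> x1 *m f = 0 -> x1 *m g = 0 ->
  exists d, [/\ row_free (rows 2 [:: x1; d]), d *m f = 0, d *m g = 0 &
    forall x, x *m f = 0 -> x *m g = 0 -> exists s t, x = s *: x1 + t *: d].
Proof.
move=> ind x0 xf xg; have [d [fxd df dg]] : exists d,
    [/\ row_free (rows 2 [:: x1; d]), d *m f = 0 & d *m g = 0].
  have [l1 [l2 [fl a1 b1 a2 b2]]] := common_zero2 f g; have [n1 n2 n12] := pt_free2 fl.
  have [e|ne] := eqVneq (pt x1) (pt l1); last by exists l1; split=> //; exact: free2_pt.
  by exists l2; split=> //; apply: free2_pt => //; rewrite e.
exists d; split=> // x hf hg; pose M := row_mx f g.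
have sub (z : 'rV[K]_4) : z *m f = 0 -> z *m g = 0 -> (z <= kermx M)%MS.
  by move=> h1 h2; apply/sub_kermxP; rewrite mul_mx_row h1 h2 row_mx0.
have rM : \rank M = 2%N.
  rewrite -mxrank_tr; apply/eqP; rewrite -[_ == _]/(row_free _).
  apply/row_free_kerP => u uM; have : M *m u^T = 0 by rewrite -[LHS]trmxK trmx_mul trmxK uM trmx0.
  rewrite -(hsubmxK u) tr_row_mx mul_row_col.
  set a := lsubmx u; set b := rsubmx u => e.
  have [|a0 b0] := ind (a 0 0) (b 0 0).
    rewrite -[RHS]e; apply/matrixP => i j; rewrite !mxE !big_ord1 !ord1 !mxE.
    by rewrite [_ * f _ _]mulrC [_ * g _ _]mulrC.
  have -> : a = 0 by apply/matrixP => i j; rewrite !ord1 a0 mxE.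
  have -> : b = 0 by apply/matrixP => i j; rewrite !ord1 b0 mxE.
  by rewrite row_mx0.
have subr : (rows 2 [:: x1; d] <= kermx M)%MS.
  apply/sub_kermxP/rows_mul0 => -[|[|//]] _; exact/sub_kermxP/sub.
have /submxP[u ->] : (x <= rows 2 [:: x1; d])%MS.
  apply: submx_trans (sub _ hf hg) _; rewrite -(geq_leqif (mxrank_leqif_sup subr)).
  by rewrite mxrank_ker rM (eqP fxd).
by exists (u 0 (inord 0)), (u 0 (inord 1)); rewrite mul_rows_inord !big_ord_recl big_ord0 addr0.
Qed.

Section Frame.
Variables (K : numFieldType) (A : 'I_4 -> 'M[K]_4).
Hypothesis hsym : forall k, (A k)^T = A k.
Implicit Types (x v : 'rV[K]_4).

(** In such a basis the quadrics of the web have zero diagonal. *)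
Definition frame (ya yb yc yd : 'rV[K]_4) :=
  [/\ basepoint A ya, basepoint A yb, basepoint A yc, basepoint A yd &
      row_free (rows 4 [:: ya; yb; yc; yd])].

Lemma frame_swap23 ya yb yc yd : frame ya yb yc yd -> frame ya yc yb yd.
Proof.
case=> ha hb hc hd /free4P f; split=> //; apply/free4P => a b c d e.
have [|-> -> -> ->//] := f a c b d.
by rewrite (addrAC (a *: ya)).
Qed.

Lemma frame_swap34 ya yb yc yd : frame ya yb yc yd -> frame ya yb yd yc.
Proof.
case=> ha hb hc hd /free4P f; split=> //; apply/free4P => a b c d e.
have [|-> -> -> ->//] := f a b d c.
by rewrite addrAC.
Qed.

(** The Gram determinant of three isotropic vectors is twice the product of
    the three off-diagonal entries. *)
Lemma frame_minor y1 y2 y3 x : basepoint A y1 -> basepoint A y2 -> basepoint A y3 ->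
    (\rank (web_mx A x) <= 2)%N ->
  [\/ wf A y1 y2 x = 0, wf A y1 y3 x = 0 | wf A y2 y3 x = 0].
Proof.
move=> h1 h2 h3 rx.
have := rank_le2_minor (rows 3 [:: y1; y2; y3]) (rows 3 [:: y1; y2; y3])^T rx.
rewrite gram3 -!/(wf A _ _ x) (wf_basepoint _ h1) (wf_basepoint _ h2) (wf_basepoint _ h3).
by rewrite (wfC hsym y2 y1) (wfC hsym y3 y1) (wfC hsym y3 y2) => /det0_three.
Qed.

Section Pair.
Variables (ya yb yc yd : 'rV[K]_4).
Hypothesis fr : frame ya yb yc yd.

Lemma frame_ker x k : bf (web_mx A x) k ya = 0 -> bf (web_mx A x) k yb = 0 ->
  bf (web_mx A x) k yc = 0 -> bf (web_mx A x) k yd = 0 -> k *m web_mx A x = 0.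
Proof. by case: fr => _ _ _ _; rewrite row_free_unit => U; exact: ker_of_unit U. Qed.

Lemma pair_det x : wf A ya yb x = 0 -> wf A yc yd x = 0 -> (\rank (web_mx A x) <= 2)%N ->
  wf A ya yc x * wf A yb yd x = wf A ya yd x * wf A yb yc x.
Proof.
move=> l0 m0 rx; have [ha hb hc hd _] := fr.
have d0 : \det (web_mx A x) = 0.
  apply/eqP/negPn; rewrite -unitfE -unitmxE -row_free_unit /row_free.
  by rewrite neq_ltn (leq_ltn_trans rx).
have := gram4 (web_mx A x) ya yb yc yd; cbv zeta; rewrite d0 mul0r /d3 /= -!/(wf A _ _ x).
rewrite (wf_basepoint _ ha) (wf_basepoint _ hb) (wf_basepoint _ hc) (wf_basepoint _ hd).
rewrite (wfC hsym yb ya) (wfC hsym yc ya) (wfC hsym yc yb) (wfC hsym yd ya) (wfC hsym yd yb).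
rewrite (wfC hsym yd yc) l0 m0 => h.
by apply/eqP; rewrite -subr_eq0 -sqrf_eq0; apply/eqP; rewrite [RHS]h; ring.
Qed.

(** When both forms of a pairing vanish, the quadric has a kernel vector on each of
    the two lines joining the paired basepoints. *)
Lemma pair_kernel x : wf A ya yb x = 0 -> wf A yc yd x = 0 ->
    wf A ya yc x * wf A yb yd x = wf A ya yd x * wf A yb yc x ->
  exists u1 u2 v1 v2 : K, [/\ row_free (rows 2 [:: u1 *: ya + u2 *: yb; v1 *: yc + v2 *: yd]),
    (u1 *: ya + u2 *: yb) *m web_mx A x = 0 & (v1 *: yc + v2 *: yd) *m web_mx A x = 0].
Proof.
move=> l0 m0 d0; have [ha hb hc hd f4] := fr; move/free4P: f4 => f4.
have [u1 [u2 [u0 uc ud]]] := @right_kernel _ (wf A ya yc x) (wf A yb yc x) (wf A ya yd x) (wf A yb yd x)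
  ltac:(by rewrite d0 mulrC subrr).
have [v1 [v2 [v0 va vb]]] := @right_kernel _ (wf A ya yc x) (wf A ya yd x) (wf A yb yc x) (wf A yb yd x)
  ltac:(by rewrite d0 subrr).
exists u1, u2, v1, v2; split.
- apply/free2P => a b e; have [|e1 e2 e3 e4] := f4 (a * u1) (a * u2) (b * v1) (b * v2).
    by rewrite -[RHS]e !scalerDr !scalerA !addrA.
  split; apply/eqP.
    by move/eqP: e1; move/eqP: e2; rewrite !mulf_eq0; case: eqP => //= _; move: u0 => /orP[] /negbTE->.
  by move/eqP: e3; move/eqP: e4; rewrite !mulf_eq0; case: eqP => //= _; move: v0 => /orP[] /negbTE->.
- apply: frame_ker; rewrite -/(wf A _ _ x) wfDl !wfZl.
  + by rewrite (wf_basepoint _ ha) (wfC hsym yb ya) l0 !mulr0 addr0.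
  + by rewrite (wf_basepoint _ hb) l0 !mulr0 addr0.
  + by rewrite -[RHS]uc; ring.
  + by rewrite -[RHS]ud; ring.
- apply: frame_ker; rewrite -/(wf A _ _ x) wfDl !wfZl.
  + by rewrite (wfC hsym yc ya) (wfC hsym yd ya) -[RHS]va; ring.
  + by rewrite (wfC hsym yc yb) (wfC hsym yd yb) -[RHS]vb; ring.
  + by rewrite (wf_basepoint _ hc) (wfC hsym yd yc) m0 !mulr0 addr0.
  + by rewrite (wf_basepoint _ hd) m0 !mulr0 addr0.
Qed.

Lemma pair_rank x : wf A ya yb x = 0 -> wf A yc yd x = 0 ->
    wf A ya yc x * wf A yb yd x = wf A ya yd x * wf A yb yc x ->
  (\rank (web_mx A x) <= 2)%N.
Proof.
move=> l0 m0 d0; have [u1 [u2 [v1 [v2 [f k1 k2]]]]] := pair_kernel l0 m0 d0.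
exact: corank2_of f k1 k2.
Qed.

(** The two kernel vectors of [pair_kernel] see only the forms of the pairing, so
    at a node these forms are independent. *)
Lemma pair_node x (a b : K) : isolated_node A x -> wf A ya yb x = 0 -> wf A yc yd x = 0 ->
  (forall v, a * wf A ya yb v + b * wf A yc yd v = 0) -> a = 0 /\ b = 0.
Proof.
move=> np l0 m0 rel; have rx : (\rank (web_mx A x) <= 2)%N by case: np => _ [_ ->].
have [u1 [u2 [v1 [v2 [f k1 k2]]]]] := pair_kernel l0 m0 (pair_det l0 m0 rx).
have [ha hb hc hd _] := fr; have ind := node_independent hsym np f k1 k2.
have ww y z s t v : basepoint A y -> basepoint A z ->
    wf A (s *: y + t *: z) (s *: y + t *: z) v = 2 * (s * t) * wf A y z v.
  move=> hy hz; rewrite wfDl !wfDr !wfZl !wfZr (wf_basepoint _ hy) (wf_basepoint _ hz).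
  by rewrite (wfC hsym z y); ring.
have u0 : 2 * (u1 * u2) != 0.
  apply/eqP => e; have [v|/eqP] := ind 1 0 0; last by rewrite oner_eq0.
  by rewrite ww // e !mul0r mulr0 !addr0.
have v0 : 2 * (v1 * v2) != 0.
  apply/eqP => e; have [v|_ _ /eqP] := ind 0 0 1; last by rewrite oner_eq0.
  by rewrite (ww yc yd) // e !mul0r mulr0 !addr0.
have [v|ea _ eb] := ind (a / (2 * (u1 * u2))) 0 (b / (2 * (v1 * v2))).
  have canc (c d l : K) : d != 0 -> c / d * (d * l) = c * l by move=> d0; field.
  by rewrite !ww // mul0r addr0 !canc.
split; apply/eqP; [move/eqP: ea | move/eqP: eb]; rewrite mulf_eq0 invr_eq0.
  by rewrite (negbTE u0) orbF.
by rewrite (negbTE v0) orbF.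
Qed.
End Pair.

End Frame.

(** * Double conics *)

Lemma nb_add (K : fieldType) (P : 'rV[K]_4 -> Prop) n x : x != 0 -> ~ P x -> nb_points P n ->
  nb_points (fun y => P y \/ pt y = pt x) n.+1.
Proof.
move=> x0 Px /nb_pointsP[s [sn s0 us Ps]]; apply/nb_pointsP; exists (x :: s).
rewrite /= sn x0 s0 us !andbT; split=> // [|y y0]; first by apply/negP => h; apply: Px; apply/(Ps _ x0).
rewrite inE; split=> [[/(Ps _ y0)->|->]|/orP[/eqP->|/(Ps _ y0)]]; rewrite ?orbT ?eqxx //.
  by right.
by left.
Qed.

Section DoubleConic.
Variables (K : numFieldType) (A : 'I_4 -> 'M[K]_4).
Hypothesis hsym : forall k, (A k)^T = A k.
Hypothesis closed : forall a b c : K, exists s t,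
  ((s != 0) || (t != 0)) /\ a * s ^+ 2 + b * (s * t) + c * t ^+ 2 = 0.
Local Notation f := (sym_poly A).
Variables (E : 'M[K]_(3, 4)) (Q : 'M[K]_3) (n : nat).
Hypothesis smooth : smooth_conic E Q.
Hypothesis rank2 : rank_along A 2 (on_conic E Q).
Hypothesis nodes : nb_points (isolated_node A) 4.
Hypothesis cover : forall x, singular_point f x -> on_conic E Q x \/ isolated_node A x.
Hypothesis bpts : nb_points (basepoint A) n.
Implicit Types (x v : 'rV[K]_4).

Let vanishes y z := forall x, (x <= E)%MS -> wf A y z x = 0.

Lemma conic_plane x : on_conic E Q x -> (x <= E)%MS.
Proof. by case=> _ [u [-> _]]; rewrite submxMl. Qed.

Lemma conic_or_node x : x != 0 -> (\rank (web_mx A x) <= 2)%N ->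
  on_conic E Q x \/ isolated_node A x.
Proof. by move=> x0 rx; apply: cover; exact: singular_of_rank. Qed.

(** The points of the plane off the conic would be nodes. *)
Lemma not_plane_rank2 : ~ forall x, (x <= E)%MS -> (\rank (web_mx A x) <= 2)%N.
Proof.
move=> rk; have [N [Z [W [k [f3 k0 _ NZE con]]]]] := conic_coordinates closed smooth.
have fNZ : row_free (rows 2 [:: N; Z]).
  apply/free2P => a b e; have [|-> -> _//] := (free3P _ _ _).1 f3 a b 0.
  by rewrite scale0r addr0.
have [T hT] := generic_line nodes fNZ; have [t] := ex_notin (0 :: T).
rewrite inE negb_or => /andP[t0 /hT]; apply.
have e : N + t *: Z = 1 *: N + t *: Z + 0 *: W by rewrite scale1r scale0r addr0.
have x0 := free2_nz t fNZ.
have rx : (\rank (web_mx A (N + t *: Z)) <= 2)%N by apply: rk; rewrite e; exact: NZE.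
have [|//] := conic_or_node x0 rx; rewrite e in x0 *; move=> /(con _ _ _ x0)/eqP.
by rewrite !mulr0 addr0 mulf_eq0 sqrf_eq0 (negbTE k0) (negbTE t0).
Qed.

Lemma triangle_not_vanishing y1 y2 y3 :
  basepoint A y1 -> basepoint A y2 -> basepoint A y3 -> row_free (rows 3 [:: y1; y2; y3]) ->
  vanishes y1 y2 -> vanishes y1 y3 -> vanishes y2 y3 -> False.
Proof.
move=> h1 h2 h3 fr v12 v13 v23; apply: not_plane_rank2 => x xE.
apply: (isotropic3_rank fr); apply/matrixP => i j; rewrite bfE !row_rows [RHS]mxE -/(wf A _ _ x).
case: i => [[|[|[|//]]] hi]; case: j => [[|[|[|//]]] hj] /=;
  by rewrite ?(wf_basepoint _ h1) ?(wf_basepoint _ h2) ?(wf_basepoint _ h3) //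
    ?(wfC hsym y2 y1) ?(wfC hsym y3 y1) ?(wfC hsym y3 y2) ?v12 ?v13 ?v23.
Qed.

(** Along the conic each principal minor on three basepoints vanishes, so the edges
    of the tetrahedron of basepoints whose forms vanish on the plane of the conic
    meet every face. They contain two opposite edges or a whole face, and a face
    would make every quadric of the plane singular. *)
Lemma conic_pairing ya yb yc yd : frame A ya yb yc yd ->
  [\/ vanishes ya yb /\ vanishes yc yd, vanishes ya yc /\ vanishes yb yd |
      vanishes ya yd /\ vanishes yb yc].
Proof.
case=> ha hb hc hd /free4P f4.
have f3 : [/\ row_free (rows 3 [:: ya; yb; yc]), row_free (rows 3 [:: ya; yb; yd]),
    row_free (rows 3 [:: ya; yc; yd]) & row_free (rows 3 [:: yb; yc; yd])].
  split; apply/free3P => a b c e.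
  - by have [|-> -> ->//] := f4 a b c 0; rewrite scale0r addr0.
  - by have [|-> -> _ ->//] := f4 a b 0 c; rewrite scale0r addr0.
  - by have [|-> _ -> ->//] := f4 a 0 b c; rewrite scale0r addr0.
  - by have [|_ -> -> ->//] := f4 0 a b c; rewrite scale0r add0r.
have [fabc fabd facd fbcd] := f3.
have face y1 y2 y3 : basepoint A y1 -> basepoint A y2 -> basepoint A y3 ->
    [\/ vanishes y1 y2, vanishes y1 y3 | vanishes y2 y3].
  move=> h1 h2 h3; apply: (conic_forms closed smooth) => x /rank2[_ rx].
  by apply: frame_minor => //; rewrite rx.
have tri := triangle_not_vanishing.
have := tri _ _ _ ha hb hc fabc; have := tri _ _ _ ha hb hd fabd.
have := tri _ _ _ ha hc hd facd; have := tri _ _ _ hb hc hd fbcd.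
have := face _ _ _ ha hb hc; have := face _ _ _ ha hb hd.
have := face _ _ _ ha hc hd; have := face _ _ _ hb hc hd.
clear; move=> [] h1 [] h2 [] h3 [] h4 t1 t2 t3 t4;
  solve [by constructor 1 | by constructor 2 | by constructor 3 | by exfalso; tauto].
Qed.

Section Pairing.
Variables (ya yb yc yd : 'rV[K]_4).
Hypothesis fr : frame A ya yb yc yd.
Hypotheses (vl : vanishes ya yb) (vm : vanishes yc yd).
Local Notation l := (wf A ya yb).
Local Notation m := (wf A yc yd).
Local Notation p := (wf A ya yc).
Local Notation s := (wf A yb yd).
Local Notation q := (wf A ya yd).
Local Notation r := (wf A yb yc).

Lemma edge_neq0 y z : basepoint A y -> basepoint A z -> row_free (rows 2 [:: y; z]) ->
  exists e, wf A y z e != 0.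
Proof.
move=> hy hz fyz; apply: contrapT => no; apply: (no_line_of_basepoints hsym bpts hy hz fyz).
by move=> x; apply/eqP/negPn/negP => h; apply: no; exists x.
Qed.

(** The zero set of a nonzero form has dimension three, as the plane does. *)
Lemma plane_form y z x : vanishes y z -> (exists e, wf A y z e != 0) -> wf A y z x = 0 ->
  (x <= E)%MS.
Proof.
move=> v [e e0] x0; have [N [Z [W [k [f3 _ _ NZE _]]]]] := conic_coordinates closed smooth.
have col0 (t : 'rV_4) : wf A y z t = 0 -> t *m wcol A y z = 0.
  by move=> h; rewrite wcolE h raddf0.
have vN a b c : wf A y z (a *: N + b *: Z + c *: W) = 0 by exact: v.
have [|||||a [b [c ->]]] := @common_zero1_span _ (wcol A y z) N Z W x e f3; last exact: NZE.
- by apply: col0; have := vN 1 0 0; rewrite scale1r !scale0r !addr0.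
- by apply: col0; have := vN 0 1 0; rewrite scale1r !scale0r addr0 add0r.
- by apply: col0; have := vN 0 0 1; rewrite scale1r !scale0r !add0r.
- by apply: contraNneq e0; rewrite wcolE => /matrixP/(_ 0 0); rewrite !mxE mulr1n => ->.
- exact: col0.
Qed.

Lemma frame_edges : (exists e, l e != 0) /\ (exists e, m e != 0).
Proof.
have [ha hb hc hd /free4P f4] := fr; split; apply: edge_neq0 => //; apply/free2P => a b e.
  by have [|-> -> //] := f4 a b 0 0; rewrite !scale0r !addr0.
by have [|_ _ -> ->//] := f4 0 0 a b; rewrite !scale0r !add0r.
Qed.

(** Both forms of the pairing define the plane of the conic. *)
Lemma pairing_prop : exists2 c, c != 0 & forall v, m v = c * l v.
Proof.
have [le [e' me]] := frame_edges; have [e l0] := le.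
have prop v : m v = m e / l e * l v.
  by apply: form_prop l0 _ => t lt; apply: vm; exact: plane_form lt.
exists (m e / l e) => //; rewrite mulf_neq0 ?invr_eq0 //.
by apply: contraNneq me => z; rewrite prop z !mul0r.
Qed.

Lemma on_conicE x : on_conic E Q x <-> [/\ x != 0, l x = 0 & p x * s x = q x * r x].
Proof.
have [c _ prop] := pairing_prop; split=> [cx|[x0 l0 d0]].
  have xE := conic_plane cx; have [x0 rx] := rank2 cx; have l0 := vl xE.
  by split=> //; apply: (pair_det hsym fr) => //; rewrite ?prop ?l0 ?mulr0 ?rx.
have m0 : m x = 0 by rewrite prop l0 mulr0.
have [//|nx] := conic_or_node x0 (pair_rank hsym fr l0 m0 d0); exfalso.
have [v|_ /eqP] := @pair_node _ _ hsym _ _ _ _ fr x c (-1) nx l0 m0.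
  by rewrite prop; ring.
by rewrite oppr_eq0 oner_eq0.
Qed.

(** On the plane the proportional forms of the pairing vanish together,
    against [pair_node]. *)
Lemma node_off_plane x : isolated_node A x -> l x != 0.
Proof.
move=> nx; have [c _ prop] := pairing_prop; apply/eqP => l0.
have m0 : m x = 0 by rewrite prop l0 mulr0.
have [v|_ /eqP] := @pair_node _ _ hsym _ _ _ _ fr x c (-1) nx l0 m0.
  by rewrite prop; ring.
by rewrite oppr_eq0 oner_eq0.
Qed.

Lemma node_of_rank x : l x != 0 -> (\rank (web_mx A x) <= 2)%N -> isolated_node A x.
Proof.
move=> lx rx; have x0 : x != 0.
  by apply: contraNneq lx => ->; rewrite -(scale0r (0 : 'rV_4)) wfZ mul0r.
by have [/on_conicE[_ l0]|//] := conic_or_node x0 rx; rewrite l0 eqxx in lx.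
Qed.

(** The forms [p] and [s] are independent by [pair_node], so they vanish on a
    line of the parameter space, which the quadric [l m = q r] meets in two
    points unless the line consists of nodes. *)
Lemma nodes_pair P k x1 : nb_points P k -> isolated_node A x1 -> p x1 = 0 -> s x1 = 0 ->
  (forall x, P x -> [/\ p x = 0, s x = 0 & l x * m x = q x * r x]) -> (k <= 2)%N.
Proof.
move=> nP n1 p1 s1 hP; have fr' := frame_swap23 fr; have x10 : x1 != 0 by case: n1 => _ [].
have det1 : l x1 * m x1 - q x1 * r x1 = 0.
  have rx : (\rank (web_mx A x1) <= 2)%N by case: n1 => _ [_ ->].
  by apply/eqP; rewrite subr_eq0 (pair_det hsym fr' p1 s1 rx) (wfC hsym yc yb).
have col0 y z (t : 'rV_4) : wf A y z t = 0 -> t *m wcol A y z = 0.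
  by move=> h; rewrite wcolE h raddf0.
have wf0 y z (t : 'rV_4) : t *m wcol A y z = 0 -> wf A y z t = 0.
  by rewrite wcolE => /matrixP/(_ 0 0); rewrite !mxE mulr1n.
have [|d [fd /wf0 pd /wf0 sd span]] :=
    @independent_span _ (wcol A ya yc) (wcol A yb yd) x1 _ x10 (col0 _ _ _ p1) (col0 _ _ _ s1).
  move=> a b e; apply: (pair_node hsym fr' n1 p1 s1) => v.
  have : v *m (a *: wcol A ya yc + b *: wcol A yb yd) = 0 by rewrite e mulmx0.
  by rewrite mulmxDr -!scalemxAr !wcolE => /matrixP/(_ 0 0); rewrite !mxE !mulr1n.
pose D v := l v * m v - q v * r v.
pose B := l x1 * m d + l d * m x1 - q x1 * r d - q d * r x1.
have Dst a b : D (a *: x1 + b *: d) = a * b * B + b ^+ 2 * D d.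
  rewrite -[RHS]addr0 -(mulr0 (a ^+ 2)) -det1 /D /B !wfD !wfZ; ring.
have [Bz|/norP[/negPn/eqP B0 /negPn/eqP D0]] := boolP ((B != 0) || (D d != 0)).
  apply: (two_zeros nP Bz (x1 := x1) (d := d)) => x _ /hP[px sx dx].
  have [a [b ex]] := span x (col0 _ _ _ px) (col0 _ _ _ sx); exists a, b; split=> //.
  by rewrite -Dst -ex /D dx subrr.
have [T hT] := generic_line nodes fd.
have [t] := ex_notin (- (l x1 / l d) :: T); rewrite inE negb_or => /andP[tl /hT tn].
exfalso; apply: tn; apply: node_of_rank.
  have l1 := node_off_plane n1; rewrite wfD wfZ; have [ld|ld] := eqVneq (l d) 0.
    by rewrite ld mulr0 addr0.
  by apply: contraNneq tl => e; rewrite -[t](mulfK ld) -mulNr; apply/eqP; congr (_ / _);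
    apply/eqP; rewrite -addr_eq0 addrC e.
apply: (pair_rank hsym fr'); rewrite ?wfD ?wfZ ?p1 ?pd ?s1 ?sd ?mulr0 ?addr0 //.
by apply/eqP; rewrite -!wfZ -!wfD (wfC hsym yc yb) -subr_eq0 -[_ - _]/(D _) -[x1]scale1r Dst B0 D0 !mulr0 addr0.
Qed.

Lemma node_types x : isolated_node A x ->
  (p x = 0 /\ s x = 0) \/ (q x = 0 /\ r x = 0).
Proof.
move=> nx; have l0 := node_off_plane nx; have [c c0 prop] := pairing_prop.
have m0 : m x != 0 by rewrite prop mulf_neq0.
have rx : (\rank (web_mx A x) <= 2)%N by case: nx => _ [_ ->].
have [ha hb hc hd _] := fr.
have := frame_minor hsym ha hb hc rx; have := frame_minor hsym ha hb hd rx.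
have := frame_minor hsym ha hc hd rx; have := frame_minor hsym hb hc hd rx.
move/eqP: l0; move/eqP: m0; clear; move=> ml ll [] h1 [] h2 [] h3 [] h4; tauto.
Qed.

End Pairing.

(** The nodes of a surface with a double conic, in terms of the pairing of the
    basepoints whose forms cut out the plane of the conic: every other pairing
    accounts for two nodes. *)
Lemma double_conic_nodes ya yb yc yd (l := wf A ya yb) (m := wf A yc yd)
    (p := wf A ya yc) (s := wf A yb yd) (q := wf A ya yd) (r := wf A yb yc) :
    frame A ya yb yc yd -> vanishes ya yb -> vanishes yc yd ->
  [/\ exists2 c, c != 0 & forall v, m v = c * l v,
      forall x, on_conic E Q x <-> [/\ x != 0, l x = 0 & p x * s x = q x * r x],
      forall x, isolated_node A x <-> l x != 0 /\
        ([/\ p x = 0, s x = 0 & l x * m x = q x * r x] \/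
         [/\ q x = 0, r x = 0 & l x * m x = p x * s x]) &
      nb_points (fun x => isolated_node A x /\ p x = 0) 2 /\
      nb_points (fun x => isolated_node A x /\ p x <> 0) 2 /\
      forall x, x != 0 -> q x = 0 -> r x = 0 -> l x * m x = p x * s x -> isolated_node A x].
Proof.
move=> fr vl vm; have fr1 := frame_swap23 fr; have fr2 := frame_swap34 fr.
have fr3 := frame_swap23 fr2.
have vm' : vanishes yd yc by move=> x /vm; rewrite wfC.
have [c c0 prop] := pairing_prop fr vl vm.
have off := node_off_plane fr vl vm.
have m0 x : l x != 0 -> m x != 0 by move=> lx; rewrite /m prop mulf_neq0.
have nodeE x : isolated_node A x <-> l x != 0 /\
    ([/\ p x = 0, s x = 0 & l x * m x = q x * r x] \/
     [/\ q x = 0, r x = 0 & l x * m x = p x * s x]).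
  split=> [nx|[lx h]].
    split; first exact: off.
    have rx : (\rank (web_mx A x) <= 2)%N by case: nx => _ [_ ->].
    have [[p0 s0]|[q0 r0]] := node_types fr vl vm nx; [left | right]; split=> //.
      by rewrite /l /m (pair_det hsym fr1 p0 s0 rx) (wfC hsym yc yb).
    have := pair_det hsym fr3 q0 r0 rx.
    by rewrite (wfC hsym yd yc) (wfC hsym yd yb).
  apply: (node_of_rank fr vl vm lx); case: h => [[p0 s0 d0]|[q0 r0 d0]].
    by apply: (pair_rank hsym fr1 p0 s0); rewrite (wfC hsym yc yb).
  apply: (pair_rank hsym fr3 q0 r0).
  by rewrite (wfC hsym yd yc) (wfC hsym yd yb).
split=> //; [by exists c | exact: on_conicE |].
have scale k x : x != 0 -> k != 0 -> p x = 0 -> p (k *: x) = 0.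
  by move=> _ _ e; rewrite /p wfZ -/(p x) e mulr0.
have [i [j [ij hi hj]]] := nb_split nodes scale.
have typeI x : isolated_node A x /\ p x = 0 ->
    [/\ isolated_node A x, p x = 0, s x = 0 & l x * m x = q x * r x].
  move=> [nx p0]; have [lx [[]//|[_ _ d0]]] := (nodeE x).1 nx.
  have : l x * m x != 0 by rewrite mulf_neq0 ?m0.
  by rewrite d0 p0 mul0r eqxx.
have typeII x : isolated_node A x /\ p x <> 0 ->
    [/\ isolated_node A x, q x = 0, r x = 0 & l x * m x = p x * s x].
  by move=> [nx p0]; have [lx [[/p0]|[q0 r0 d0]]] := (nodeE x).1 nx.
have pairII P k x1 : nb_points P k -> isolated_node A x1 /\ p x1 <> 0 ->
    (forall x, P x -> [/\ q x = 0, r x = 0 & l x * m x = p x * s x]) -> (k <= 2)%N.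
  move=> nP /typeII[n1 q1 r1 _] hP; apply: (nodes_pair fr2 vl vm' nP n1 q1 r1) => x /hP[q0 r0 d0].
  by split=> //; rewrite (wfC hsym yd yc).
have i2 : (i <= 2)%N.
  have [->//|i0] := posnP i; have [x1 x10 /typeI[n1 p1 s1 _]] := nb_ex hi i0.
  by apply: (nodes_pair fr vl vm hi n1 p1 s1) => x /typeI[].
have j2 : (j <= 2)%N.
  have [->//|j0] := posnP j; have [x1 x10 n1] := nb_ex hj j0.
  by apply: (pairII _ _ _ hj n1) => x /typeII[].
have [ei ej] : i = 2%N /\ j = 2%N by move: ij i2 j2; clear; lia.
rewrite ei ej in hi hj; split=> //; split=> // x x0 q0 r0 d0.
apply: contrapT => nx; have h3 := nb_add x0 (fun h => nx (proj1 h)) hj.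
have [x1 _ n1] := nb_ex hj isT; suff : (3 <= 2)%N by [].
apply: (pairII _ _ _ h3 n1) => y [/typeII[]//|e].
have [k k0 ex] := pt_eqP x0 (esym e).
have -> : y = k^-1 *: x by rewrite ex scalerA mulVf // scale1r.
have Z y' z' : wf A y' z' (k^-1 *: x) = k^-1 * wf A y' z' x by exact: wfZ.
rewrite /q /r /l /m /p /s !Z -/(q x) -/(r x) q0 r0 !mulr0; split=> //.
by rewrite mulrACA [RHS]mulrACA -/(l x) -/(m x) -/(p x) -/(s x) d0.
Qed.

(** A quadric containing all the joins of the basepoints is zero, and no point of
    the surface has rank zero. *)
Lemma frame_separates ya yb yc yd x : frame A ya yb yc yd ->
    wf A ya yb x = 0 -> wf A yc yd x = 0 -> wf A ya yc x = 0 -> wf A yb yd x = 0 ->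
    wf A ya yd x = 0 -> wf A yb yc x = 0 ->
  x = 0.
Proof.
move=> fr l0 m0 p0 s0 q0 r0; apply/eqP/negPn/negP => x0; have [ha hb hc hd U] := fr.
have kx y : basepoint A y -> wf A y ya x = 0 -> wf A y yb x = 0 -> wf A y yc x = 0 ->
    wf A y yd x = 0 -> y *m web_mx A x = 0.
  by move=> hy h1 h2 h3 h4; apply: (frame_ker fr).
have : rows 4 [:: ya; yb; yc; yd] *m web_mx A x = 0.
  apply: rows_mul0 => -[|[|[|[|//]]]] _ /=; apply: kx => //;
    by rewrite ?(wf_basepoint _ ha) ?(wf_basepoint _ hb) ?(wf_basepoint _ hc) ?(wf_basepoint _ hd) //
      1?wfC.
move=> /mulmx0_rank_max; rewrite (eqP U) => r0'.
have rk : \rank (web_mx A x) = 0 by move: r0'; clear; lia.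
by have [/rank2[_]|[_ [_]]] := conic_or_node x0 (leq_trans (eq_leq rk) isT); rewrite rk.
Qed.

End DoubleConic.

(** * Real forms and complex moduli *)

Section Modulus.
Variable R : realType.
Local Notation C := R[i].

Lemma conjM (z w : C) : conjc (z * w) = conjc z * conjc w. Proof. exact: rmorphM. Qed.
Lemma conjD (z w : C) : conjc (z + w) = conjc z + conjc w. Proof. exact: rmorphD. Qed.
Lemma conjN (z : C) : conjc (- z) = - conjc z. Proof. exact: rmorphN. Qed.

Definition modulus (z : C) : R := complex.Re `|z|.

Lemma modulusE z : `|z| = (modulus z)%:C%C.
Proof. by rewrite /modulus normc_def. Qed.

Lemma modulus_ge0 z : 0 <= modulus z.
Proof. by rewrite /modulus normc_def /= sqrtr_ge0. Qed.

Lemma modulus_sqr z : modulus z ^+ 2 = complex.Re z ^+ 2 + complex.Im z ^+ 2.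
Proof. by rewrite /modulus normc_def /= sqr_sqrtr // addr_ge0 ?sqr_ge0. Qed.

Lemma mul_conj z : z * conjc z = (modulus z ^+ 2)%:C%C.
Proof. by rewrite -sqr_normc modulusE rmorphXn. Qed.

Lemma modulusD z w : modulus (z + w) <= modulus z + modulus w.
Proof. by rewrite -lecR rmorphD /= -!modulusE ler_normD. Qed.

Lemma modulusM z w : modulus (z * w) = modulus z * modulus w.
Proof. by apply: (@complexI R); rewrite rmorphM /= -!modulusE normrM. Qed.

Lemma modulus_real (t : R) : modulus t%:C%C = `|t|.
Proof. by rewrite /modulus normc_def /= expr0n addr0 sqrtr_sqr. Qed.

Lemma modulus_eq0 z : (modulus z == 0) = (z == 0).
Proof. by rewrite -(fmorph_eq0 (real_complex R)) /= -modulusE normr_eq0. Qed.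

Lemma unit_phase (z : C) : exists u, u * conjc u = 1 /\ u * z = - (modulus z)%:C%C.
Proof.
have [->|z0] := eqVneq z 0.
  by exists 1; rewrite conjc1 mulr1 mulr0 /modulus normr0 oppr0.
have m0 : (modulus z)%:C%C != 0 :> C by rewrite (fmorph_eq0 (real_complex R)) modulus_eq0.
exists (- (modulus z)%:C%C / z); split; last by rewrite divfK.
rewrite conjM conjN conjc_real conjc_inv.
have c0 : conjc z != 0 by rewrite conjc_eq0.
transitivity ((modulus z)%:C%C ^+ 2 / (z * conjc z)); first by field; rewrite z0 c0.
by rewrite mul_conj rmorphXn divff // expf_neq0.
Qed.

(** The phases of the coordinates of two conjugate pairs can be chosen so as to
    rotate two complex numbers independently. *)
Lemma two_phases (z w : C) : exists u v, [/\ u * conjc u = 1, v * conjc v = 1,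
  u * v * z = - (modulus z)%:C%C & u * conjc v * w = - (modulus w)%:C%C].
Proof.
have [a [a1 az]] := unit_phase z; have [b [b1 bw]] := unit_phase w.
pose u := sqrtc (a * b); have uu : u ^+ 2 = a * b by exact: sqr_sqrtc.
have u1 : u * conjc u = 1.
  rewrite mul_conj; congr (_%:C%C); apply/eqP; rewrite -(eqrXn2 (n := 2)) // ?expr1n ?ler01 ?sqr_ge0 //.
  apply/eqP/(@complexI R); rewrite rmorphXn /= -mul_conj rmorph1.
  transitivity (u ^+ 2 * conjc (u ^+ 2)); first by rewrite expr2 conjM; ring.
  by rewrite uu conjM mulrACA a1 b1 mulr1.
exists u, (a * conjc u); split=> //.
- by rewrite conjM conjcK mulrACA a1 mul1r mulrC.
- by rewrite mulrCA u1 mulr1.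
- rewrite conjM conjcK.
  transitivity (u ^+ 2 * conjc a * w); first by ring.
  by rewrite uu -[RHS]bw -[RHS]mul1r -a1; ring.
Qed.

End Modulus.

Lemma real_quadratic (R : rcfType) (a b c : R) : a * c <= b ^+ 2 -> exists s t,
  ((s != 0) || (t != 0)) /\ a * s ^+ 2 + 2 * b * (s * t) + c * t ^+ 2 = 0.
Proof.
move=> d; have [a0|a0] := eqVneq a 0.
  by exists 1, 0; rewrite oner_eq0 a0; split=> //; ring.
have qq : Num.sqrt (b ^+ 2 - a * c) ^+ 2 = b ^+ 2 - a * c by rewrite sqr_sqrtr // subr_ge0.
set q := Num.sqrt _ in qq; exists (q - b), a; rewrite a0 orbT; split=> //.
transitivity (a * (q ^+ 2 - b ^+ 2 + a * c)); first by ring.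
by rewrite qq; ring.
Qed.

Lemma abs_le (R : realDomainType) (a b : R) : 0 <= b -> a ^+ 2 <= b ^+ 2 -> `|a| <= b.
Proof. by move=> b0 h; rewrite -(@ler_pXn2r _ 2) ?nnegrE // real_normK ?num_real. Qed.

Section RealForms.
Variable R : realType.
Local Notation V := 'rV[R]_4.
Implicit Types (x y z : V) (f g h : V -> R).

(** Linear and quadratic forms on [R^4] as plain functions, because they arise
    as real and imaginary parts of complex forms. *)
Definition linf f := forall s t x y, f (s *: x + t *: y) = s * f x + t * f y.
Definition quadf f := forall x y, exists b, forall s t,
  f (s *: x + t *: y) = f x * s ^+ 2 + 2 * b * (s * t) + f y * t ^+ 2.

Lemma linf0 f : linf f -> f 0 = 0.
Proof. by move=> /(_ 0 0 0 0); rewrite !scale0r addr0 !mul0r addr0. Qed.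

Lemma linfD f : linf f -> {morph f : x y / x + y}.
Proof. by move=> lf x y; have := lf 1 1 x y; rewrite !scale1r !mul1r. Qed.

Lemma linf_mul f g : linf f -> linf g -> quadf (fun x => f x * g x).
Proof.
move=> lf lg x y; exists ((f x * g y + f y * g x) / 2) => s t.
by rewrite lf lg; field.
Qed.

Lemma quadfB f g : quadf f -> quadf g -> quadf (fun x => f x - g x).
Proof.
move=> hf hg x y; have [b hb] := hf x y; have [c hc] := hg x y.
by exists (b - c) => s t; rewrite hb hc; ring.
Qed.

Lemma quadfD f g : quadf f -> quadf g -> quadf (fun x => f x + g x).
Proof.
move=> hf hg x y; have [b hb] := hf x y; have [c hc] := hg x y.
by exists (b + c) => s t; rewrite hb hc; ring.
Qed.

(** On the span of [x] and [y] the form is binary with nonnegative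
    discriminant. *)
Lemma quad_zero f x y : quadf f -> x != 0 -> y != 0 -> f x <= 0 -> 0 <= f y ->
  exists s t, s *: x + t *: y != 0 /\ f (s *: x + t *: y) = 0.
Proof.
move=> hf x0 y0 fx fy; have [fx0|fx0] := eqVneq (f x) 0.
  by exists 1, 0; rewrite scale1r scale0r addr0.
have [b hb] := hf x y; have [|s [t [st e]]] := @real_quadratic _ (f x) b (f y).
  by apply: (le_trans _ (sqr_ge0 b)); exact: mulr_le0_ge0.
exists s, t; split; last by rewrite hb.
have fx1 : f x < 0 by rewrite lt_neqAle fx0.
apply/eqP => z; have [s0|s0] := eqVneq s 0.
  move: st z; rewrite s0 eqxx scale0r add0r /= => t0 /eqP.
  by rewrite scaler_eq0 (negbTE t0) (negbTE y0).
have ex : x = (- (t / s)) *: y.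
  apply: (scalerI s0); rewrite scalerA mulrN mulrC divfK //.
  by apply/eqP; rewrite scaleNr -addr_eq0 z.
have [c hc] := hf y y; have := hc (- (t / s)) 0; rewrite scale0r addr0 -ex.
rewrite mulr0 mulr0 expr0n /= mulr0 !addr0 => e'.
by move: fx1; rewrite e' ltNge mulr_ge0 // sqr_ge0.
Qed.

Definition fcol f : 'cV[R]_4 := \col_k f (delta_mx 0 k).

Lemma fcolE f x : linf f -> x *m fcol f = (f x)%:M.
Proof.
move=> lf; apply/matrixP => i j; rewrite !ord1 [RHS]mxE mulr1n mxE [in RHS](row_sum_delta x).
rewrite (big_morph f (linfD lf) (linf0 lf)); apply: eq_bigr => k _; rewrite mxE.
by have := lf (x 0 k) 0 (delta_mx 0 k) 0; rewrite scale0r addr0 mul0r addr0.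
Qed.

Lemma fcol0 f x : linf f -> x *m fcol f = 0 -> f x = 0.
Proof. by move=> lf; rewrite fcolE // => /matrixP/(_ 0 0); rewrite !mxE mulr1n. Qed.

Lemma linf_zero3 f g h : linf f -> linf g -> linf h ->
  exists2 x, x != 0 & [/\ f x = 0, g x = 0 & h x = 0].
Proof.
move=> lf lg lh; have [x x0 [h1 h2 h3]] := common_zero3 (fcol f) (fcol g) (fcol h).
by exists x => //; split; exact: fcol0.
Qed.

(** The hypothesis makes the four forms coordinates of [R^4]. *)
Lemma linf_split f f' g g' e : linf f -> linf f' -> linf g -> linf g' ->
    (forall x, f x = 0 -> f' x = 0 -> g x = 0 -> g' x = 0 -> x = 0) ->
  exists x y, [/\ e = x + y, f x = 0, f' x = 0, g y = 0 & g' y = 0].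
Proof.
move=> lf lf' lg lg' sep; pose M := cols 4 [:: fcol f; fcol f'; fcol g; fcol g'].
have valM (x : V) j : (x *m M) 0 j = nth 0 [:: f x; f' x; g x; g' x] j.
  have -> : (x *m M) 0 j = (x *m nth 0 [:: fcol f; fcol f'; fcol g; fcol g'] j) 0 0.
    by rewrite !mxE; apply: eq_bigr => k _; rewrite mxE.
  by case: j => [[|[|[|[|//]]]] hj] /=; rewrite fcolE // mxE mulr1n.
have uM : M \in unitmx.
  rewrite -row_free_unit; apply/row_free_kerP => x xM.
  have h j : nth 0 [:: f x; f' x; g x; g' x] (inord j : 'I_4) = 0 by rewrite -valM xM mxE.
  by apply: sep; [have := h 0%N | have := h 1%N | have := h 2%N | have := h 3%N]; rewrite inordK.
pose w : V := \row_(j < 4) nth 0 [:: 0; 0; g e; g' e] j; pose x := w *m invmx M.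
have xM : x *m M = w by rewrite mulmxKV.
have vx j : (j < 4)%N -> nth 0 [:: f x; f' x; g x; g' x] j = nth 0 [:: 0; 0; g e; g' e] j.
  by move=> j4; have := valM x (Ordinal j4); rewrite xM mxE.
have sub (k : V -> R) : linf k -> k (e - x) = k e - k x.
  by move=> lk; have := lk 1 (-1) e x; rewrite scale1r scaleN1r mul1r mulN1r.
exists x, (e - x); split; first by rewrite addrC subrK.
- exact: (vx 0%N).
- exact: (vx 1%N).
- by rewrite sub // (vx 2%N isT : g x = g e) subrr.
- by rewrite sub // (vx 3%N isT : g' x = g' e) subrr.
Qed.

End RealForms.

Lemma phase_form (R : realType) (lam mu a b : R) (P S u v : R[i]) :
    u * conjc u = 1 -> v * conjc v = 1 -> u * v * P = - (modulus P)%:C%C ->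
    u * conjc v * S = - (modulus S)%:C%C ->
    lam * a ^+ 2 + 2 * - (modulus P + modulus S) * (a * b) + mu * b ^+ 2 = 0 ->
  let al := a%:C%C * u in let be := b%:C%C * v in
  lam%:C%C * (al * conjc al) + mu%:C%C * (be * conjc be) + (al * be * P + conjc (al * be * P))
  + (al * conjc be * S + conjc (al * conjc be * S)) = 0.
Proof.
move=> u1 v1 uP uS e al be.
have c (t : R) : conjc t%:C%C = t%:C%C by exact: conjc_real.
have aa : al * conjc al = (a ^+ 2)%:C%C.
  by rewrite /al conjM c mulrACA u1 mulr1 -rmorphM.
have bb : be * conjc be = (b ^+ 2)%:C%C.
  by rewrite /be conjM c mulrACA v1 mulr1 -rmorphM.
have aP : al * be * P = (- (a * b * modulus P))%:C%C.
  transitivity (a%:C%C * b%:C%C * (u * v * P)); first by rewrite /al /be; ring.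
  by rewrite uP mulrN rmorphN !rmorphM.
have aS : al * conjc be * S = (- (a * b * modulus S))%:C%C.
  transitivity (a%:C%C * b%:C%C * (u * conjc v * S)); first by rewrite /al /be conjM c; ring.
  by rewrite uS mulrN rmorphN !rmorphM.
rewrite aP aS !c aa bb; move: (modulus P) (modulus S) e => n n' e.
by rewrite -!rmorphM -!rmorphD /= -[RHS](rmorph0 (real_complex R)) -e; congr (_%:C%C); ring.
Qed.

Section RealFrame.
Variables (R : realType) (A : 'I_4 -> 'M[R]_4).
Hypothesis hsym : forall k, (A k)^T = A k.
Local Notation C := R[i].
Local Notation AC := (cplx_web A).
Implicit Types (x : 'rV[R]_4) (y z : 'rV[C]_4).

Definition ref y z x : R := complex.Re (wf AC y z (cplx x)).
Definition imf y z x : R := complex.Im (wf AC y z (cplx x)).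

Lemma wf_real y z s t x x' : wf AC y z (cplx (s *: x + t *: x')) =
  s%:C%C * wf AC y z (cplx x) + t%:C%C * wf AC y z (cplx x').
Proof.
have -> : cplx (s *: x + t *: x') = s%:C%C *: cplx x + t%:C%C *: cplx x'.
  by apply/rowP => j; rewrite !mxE rmorphD !rmorphM.
by rewrite wfD !wfZ.
Qed.

Lemma ref_linf y z : linf (ref y z).
Proof. by move=> s t x x'; rewrite /ref wf_real; case: (wf _ _ _ (cplx x)) => a b; case: (wf _ _ _ (cplx x')) => c d; simpc. Qed.

Lemma imf_linf y z : linf (imf y z).
Proof. by move=> s t x x'; rewrite /imf wf_real; case: (wf _ _ _ (cplx x)) => a b; case: (wf _ _ _ (cplx x')) => c d; simpc. Qed.

Lemma ref_basepoint y x : basepoint AC y ->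
  wf AC y (conj_mx y) (cplx x) = (ref y (conj_mx y) x)%:C%C.
Proof. by rewrite /ref => /(basepoint_parts hsym x)[_ _ ->]. Qed.

Lemma wf_conj y z x : wf AC (conj_mx y) (conj_mx z) (cplx x) = conjc (wf AC y z (cplx x)).
Proof. by rewrite -conj_wf conj_cplx. Qed.

(** With suitable phases of the coordinates the quadric takes the value [2
    (lam s^2 - 2 (|P| + |S|) s t + mu t^2)] at a real vector, so this binary
    form has no real zero. *)
Lemma definite_frame e y1 y2 : definite (web_mx A e) ->
    frame AC y1 (conj_mx y1) y2 (conj_mx y2) ->
  (modulus (wf AC y1 y2 (cplx e)) + modulus (wf AC y1 (conj_mx y2) (cplx e))) ^+ 2 <
    ref y1 (conj_mx y1) e * ref y2 (conj_mx y2) e.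
Proof.
move=> de [h1 hc1 h2 hc2 /free4P f4].
have csy := csym hsym; have lamE := ref_basepoint e h1; have muE := ref_basepoint e h2.
set lam := ref _ _ e in lamE *; set mu := ref y2 _ e in muE *.
set P := wf AC y1 y2 _; set S := wf AC y1 (conj_mx y2) _; set n := _ + _.
rewrite ltNge; apply/negP => dn.
have [|a [b [ab e0]]] := @real_quadratic _ lam (- n) mu; first by rewrite sqrrN.
have [u [v [u1 v1 uP uS]]] := two_phases P S.
pose w := (a%:C%C * u) *: y1 + conjc (a%:C%C * u) *: conj_mx y1
  + (b%:C%C * v) *: y2 + conjc (b%:C%C * v) *: conj_mx y2.
have [N wN] : exists N, w = cplx N.
  apply: conj_eq_real; rewrite /w; apply/rowP => j; rewrite !mxE !(conjD, conjM) !conjcK !conjc_real; ring.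
have wf0 : wf AC w w (cplx e) = 0.
  have Pc : wf AC (conj_mx y1) (conj_mx y2) (cplx e) = conjc P by exact: wf_conj.
  have Sc : wf AC (conj_mx y1) y2 (cplx e) = conjc S by rewrite -wf_conj conj_mxK.
  have := phase_form u1 v1 uP uS e0; rewrite /w; move: (a%:C%C * u) (b%:C%C * v) => al be ph.
  rewrite !wfDl !wfDr !wfZl !wfZr.
  rewrite (wf_basepoint _ h1) (wf_basepoint _ hc1) (wf_basepoint _ h2) (wf_basepoint _ hc2).
  rewrite (wfC csy (conj_mx y1) y1) (wfC csy y2 y1) (wfC csy y2 (conj_mx y1)).
  rewrite (wfC csy (conj_mx y2) y1) (wfC csy (conj_mx y2) (conj_mx y1)) (wfC csy (conj_mx y2) y2).
  rewrite lamE muE Pc Sc -/P -/S; clear dn e0 uP uS Pc Sc; clear n; clearbody P S.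
  rewrite !conjM !conjcK in ph.
  move: (conjc al) (conjc be) (conjc P) (conjc S) lam%:C%C mu%:C%C ph => al' be' P' S' L M ph.
  by rewrite -[RHS](mulr0 2) -[X in _ = 2 * X]ph; ring.
have N0 : N != 0.
  apply: contraTneq ab => N0; have w0 : w = 0 by rewrite wN N0 /cplx map_mx0.
  have nz (c : R) (z : C) : z * conjc z = 1 -> c%:C%C * z = 0 -> c = 0.
    move=> z1 e'; apply: (@complexI R); rewrite -[LHS]mulr1 -z1 mulrA e' mul0r; exact: erefl.
  have [au _ bv _] := f4 _ _ _ _ w0.
  by rewrite (nz _ _ u1 au) (nz _ _ v1 bv) eqxx.
have := definite_neq0 de N0; rewrite -/(wf A N N e).
by rewrite -(fmorph_eq0 (real_complex R)) /= -cplx_wf -wN wf0 eqxx.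
Qed.

End RealFrame.

(** * Real forms on two conjugate pairs of basepoints *)

(** A complex form on R^4 proportional to its conjugate is a real form up to a
    constant phase. *)
Lemma real_up_to_phase (R : realType) (P : 'rV[R]_4 -> R[i]) c :
    linf (fun x => complex.Re (P x)) -> linf (fun x => complex.Im (P x)) ->
    (forall x, conjc (P x) = c * P x) ->
  exists pi, linf pi /\ forall x, `|pi x| = modulus (P x).
Proof.
move=> lr li prop; have [[x0 p0]|no] := pselect (exists x, P x != 0); last first.
  exists (fun=> 0); split=> [s t x y|x]; first by rewrite !mulr0 addr0.
  have -> : P x = 0 by apply/eqP/negPn/negP => h; apply: no; exists x.
  by rewrite normr0; apply/esym/eqP; rewrite modulus_eq0.
have c0 : c != 0.
  by apply: contraNneq p0 => z; rewrite -conjc_eq0 prop z mul0r.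
pose w := (modulus (P x0))%:C%C / P x0.
have w1 : modulus w = 1.
  have m0 : modulus (P x0) != 0 by rewrite modulus_eq0.
  apply: (mulIf m0); rewrite -modulusM divfK // modulus_real mul1r.
  by rewrite ger0_norm ?modulus_ge0.
exists (fun x => complex.Re (P x * w)); split=> [s t x y|x].
  have := lr s t x y; have := li s t x y; rewrite /=.
  case: (P x) (P y) (P (s *: x + t *: y)) (w) => a b [a' b'] [u v] [u' v'] /= -> ->; ring.
have im0 : complex.Im (P x * w) = 0.
  have : conjc (P x * w) = P x * w.
    by rewrite /w !conjM conjc_inv conjc_real !prop; field; rewrite c0 p0.
  case: (P x * w) => u v /= [/eqP]; rewrite eqNr => /eqP //.
rewrite -[RHS]mulr1 -w1 -modulusM; case: (P x * w) im0 => u v /= ->.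
by rewrite -modulus_real.
Qed.

Section RealPairing.
Variable R : realType.
Local Notation C := R[i].
Local Notation V := 'rV[R]_4.
Variables (lam mu : V -> R) (P S : V -> C) (e : V).
Hypotheses (llam : linf lam) (lmu : linf mu).
Hypotheses (lP : linf (fun x => complex.Re (P x)) /\ linf (fun x => complex.Im (P x))).
Hypotheses (lS : linf (fun x => complex.Re (S x)) /\ linf (fun x => complex.Im (S x))).
Hypothesis sep : forall x, lam x = 0 -> mu x = 0 -> P x = 0 -> S x = 0 -> x = 0.
Hypothesis gram : (modulus (P e) + modulus (S e)) ^+ 2 < lam e * mu e.
Local Notation nP x := (modulus (P x)).
Local Notation nS x := (modulus (S x)).

Lemma parts_eq0 (z : C) : complex.Re z = 0 -> complex.Im z = 0 -> z = 0.
Proof. by case: z => a b /= -> ->. Qed.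

Lemma modulus_quad (F : V -> C) :
  linf (fun x => complex.Re (F x)) /\ linf (fun x => complex.Im (F x)) ->
  quadf (fun x => modulus (F x) ^+ 2).
Proof.
move=> [lr li]; have -> : (fun x => modulus (F x) ^+ 2) =
    fun x => complex.Re (F x) * complex.Re (F x) + complex.Im (F x) * complex.Im (F x).
  by apply/funext => x; rewrite modulus_sqr; ring.
by apply: quadfD; exact: linf_mul.
Qed.

Lemma linc_zero (F : V -> C) s t x y :
  linf (fun x => complex.Re (F x)) /\ linf (fun x => complex.Im (F x)) ->
  F x = 0 -> F y = 0 -> F (s *: x + t *: y) = 0.
Proof.
move=> [lr li] fx fy; apply: parts_eq0.
  by rewrite (lr s t x y) fx fy /= !mulr0 addr0.
by rewrite (li s t x y) fx fy /= !mulr0 addr0.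
Qed.

Lemma linc_add (F : V -> C) x y :
  linf (fun x => complex.Re (F x)) /\ linf (fun x => complex.Im (F x)) ->
  F (x + y) = F x + F y.
Proof.
move=> [lr li]; have := linfD lr x y; have := linfD li x y; rewrite /=.
by case: (F x) (F y) (F (x + y)) => a b [c d] [u v] /= -> ->.
Qed.

Let lin_zero (f : V -> R) s t x y : linf f -> f x = 0 -> f y = 0 -> f (s *: x + t *: y) = 0.
Proof. by move=> lf fx fy; rewrite lf fx fy !mulr0 addr0. Qed.

Let lam_e : lam e != 0.
Proof. by apply: contraTneq gram => ->; rewrite mul0r -leNgt sqr_ge0. Qed.

Let S0 : linf (fun x => complex.Re (S x)) := proj1 lS.
Let S1 : linf (fun x => complex.Im (S x)) := proj2 lS.
Let P0 : linf (fun x => complex.Re (P x)) := proj1 lP.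
Let P1 : linf (fun x => complex.Im (P x)) := proj2 lP.

Let prod_quad : quadf (fun x => lam x * mu x) := linf_mul llam lmu.

Let mod_zero (z : C) : modulus z = 0 -> z = 0.
Proof. by move/eqP; rewrite modulus_eq0 => /eqP. Qed.

Let mod0 : modulus (0 : C) = 0.
Proof. by apply/eqP; rewrite modulus_eq0. Qed.

Section Proportional.
Variable k : R.
Hypothesis muk : forall x, mu x = k * lam x.

(** The form [|P|^2 - |S|^2] changes sign on the plane [lam = 0], since [P]
    and [S] have zeros there. *)
Lemma proportional_conic : exists x, [/\ x != 0, lam x = 0 & nP x ^+ 2 = nS x ^+ 2].
Proof.
have [x x0 [xl xr xi]] := linf_zero3 llam P0 P1; have Px := parts_eq0 xr xi.
have [y y0 [yl yr yi]] := linf_zero3 llam S0 S1; have Sy := parts_eq0 yr yi.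
have [||s [t [z0 fz]]] := quad_zero (quadfB (modulus_quad lP) (modulus_quad lS)) x0 y0.
- by rewrite /= Px mod0 expr0n sub0r oppr_le0 sqr_ge0.
- by rewrite /= Sy mod0 expr0n subr0 sqr_ge0.
exists (s *: x + t *: y); split=> //; first exact: lin_zero.
by apply/eqP; rewrite -subr_eq0 fz.
Qed.

Let k0 : 0 < k.
Proof.
have : 0 < lam e * mu e by apply: le_lt_trans gram; exact: sqr_ge0.
by rewrite muk mulrCA pmulr_lgt0 // -expr2 exprn_even_gt0.
Qed.

(** The form [lam mu - |G|^2] is nonpositive at the point of the plane [F = 0]
    with [lam = 0]; without zeros it cannot become positive. *)
Let dominated (F G : V -> C) :
    linf (fun x => complex.Re (F x)) /\ linf (fun x => complex.Im (F x)) ->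
    linf (fun x => complex.Re (G x)) /\ linf (fun x => complex.Im (G x)) ->
    (forall x, lam x = 0 -> F x = 0 -> G x = 0 -> x = 0) ->
    ~ (exists x, [/\ lam x != 0, F x = 0 & lam x * mu x = modulus (G x) ^+ 2]) ->
  forall x, F x = 0 -> k * lam x ^+ 2 <= modulus (G x) ^+ 2.
Proof.
move=> lF lG sepFG no x Fx; rewrite leNgt; apply/negP => lt.
have x0 : x != 0.
  apply: contraTneq lt => ->; rewrite (linf0 llam) expr0n mulr0 -leNgt; exact: sqr_ge0.
have [y y0 [yl yr yi]] := linf_zero3 llam lF.1 lF.2; have Fy := parts_eq0 yr yi.
have [||s [t [z0 fz]]] := quad_zero (quadfB prod_quad (modulus_quad lG)) y0 x0.
- by rewrite /= yl mul0r sub0r oppr_le0 sqr_ge0.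
- by rewrite /= muk mulrCA -expr2 subr_ge0 ltW.
have Fz : F (s *: y + t *: x) = 0 by exact: linc_zero.
have e1 : lam (s *: y + t *: x) * mu (s *: y + t *: x) = modulus (G (s *: y + t *: x)) ^+ 2.
  by apply/eqP; rewrite -subr_eq0 fz.
apply: no; exists (s *: y + t *: x); split=> //; apply: contraNneq z0 => lz.
apply/eqP/sepFG => //; apply: mod_zero; apply/eqP; rewrite -sqrf_eq0 -e1 lz mul0r; exact: eqxx.
Qed.

(** If there were no such point, then [lam mu <= |S|^2] where [P = 0], and
    [lam mu <= |P|^2] where [S = 0]. These two planes span [R^4]; as [lam mu =
    k lam^2], adding the components of [e] gives [lam mu <= (|P| + |S|)^2] at
    [e]. *)
Lemma proportional_node : exists x, lam x != 0 /\
  ((P x = 0 /\ lam x * mu x = nS x ^+ 2) \/ (S x = 0 /\ lam x * mu x = nP x ^+ 2)).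
Proof.
apply: contrapT => no.
have sepL x : lam x = 0 -> P x = 0 -> S x = 0 -> x = 0.
  by move=> l0; apply: sep; rewrite // muk l0 mulr0.
have dP : forall x, P x = 0 -> k * lam x ^+ 2 <= nS x ^+ 2.
  by apply: dominated => // -[x [? ? ?]]; apply: no; exists x; split=> //; left.
have dS : forall x, S x = 0 -> k * lam x ^+ 2 <= nP x ^+ 2.
  apply: dominated => // [x ? ? ?|[x [? ? ?]]]; first exact: sepL.
  by apply: no; exists x; split=> //; right.
have [|x [y [exy xr xi yr yi]]] := linf_split e S0 S1 P0 P1.
  move=> x sr si pr pi; have Sx := parts_eq0 sr si; have Px := parts_eq0 pr pi.
  apply: sepL => //; have := dP _ Px; rewrite Sx mod0 expr0n pmulr_rle0 // => h.
  by apply/eqP; rewrite -sqrf_eq0 eq_le h sqr_ge0.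
have Sx := parts_eq0 xr xi; have Py := parts_eq0 yr yi.
pose q := Num.sqrt k; have qq : q ^+ 2 = k by rewrite sqr_sqrtr // ltW.
have b1 : `|q * lam x| <= nP x by apply: abs_le (modulus_ge0 _) _; rewrite exprMn qq dS.
have b2 : `|q * lam y| <= nS y by apply: abs_le (modulus_ge0 _) _; rewrite exprMn qq dP.
have := gram; rewrite ltNge => /negP; apply; rewrite muk mulrCA -expr2 -qq -exprMn.
have -> : nP e = nP x by rewrite exy linc_add // Py addr0.
have -> : nS e = nS y by rewrite exy linc_add // Sx add0r.
rewrite -[(q * _) ^+ 2]real_normK ?num_real // ler_sqr ?nnegrE ?addr_ge0 ?modulus_ge0 //.
by rewrite exy linfD // mulrDr (le_trans (ler_normD _ _)) // lerD.
Qed.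

End Proportional.

Section RealForm.
Variable pi : V -> R.
Hypotheses (lpi : linf pi) (piP : forall x, `|pi x| = nP x).

Let pi0 x : pi x = 0 -> P x = 0.
Proof. by move=> h; apply: mod_zero; rewrite -piP h normr0. Qed.

Let sq_pi : quadf (fun x => pi x ^+ 2).
Proof.
have -> : (fun x => pi x ^+ 2) = fun x => pi x * pi x by apply/funext => x; rewrite expr2.
exact: linf_mul.
Qed.

(** If there were no such point, then [pi^2 <= |S|^2] where [lam = mu = 0],
    and [lam mu <= pi^2] where [S = 0]. Splitting [e] along these two planes
    gives [lam mu <= (|P| + |S|)^2] at [e]. *)
Lemma real_form_zero : (exists x, [/\ pi x != 0, lam x = 0, mu x = 0 & pi x ^+ 2 = nS x ^+ 2]) \/
  (exists x, [/\ x != 0, S x = 0 & lam x * mu x = pi x ^+ 2]).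
Proof.
apply: contrapT => no.
have dlm x : lam x = 0 -> mu x = 0 -> pi x ^+ 2 <= nS x ^+ 2.
  move=> xl xm; rewrite leNgt; apply/negP => lt.
  have x0 : x != 0.
    by apply: contraTneq lt => ->; rewrite (linf0 lpi) expr0n -leNgt sqr_ge0.
  have [y y0 [yl ym yp]] := linf_zero3 llam lmu lpi.
  have [||s [t [z0 fz]]] := quad_zero (quadfB sq_pi (modulus_quad lS)) y0 x0.
  - by rewrite /= yp expr0n sub0r oppr_le0 sqr_ge0.
  - by rewrite /= subr_ge0 ltW.
  have zl : lam (s *: y + t *: x) = 0 by exact: lin_zero.
  have zm : mu (s *: y + t *: x) = 0 by exact: lin_zero.
  have fz' : pi (s *: y + t *: x) ^+ 2 = nS (s *: y + t *: x) ^+ 2.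
    by apply/eqP; rewrite -subr_eq0 fz.
  apply: no; left; exists (s *: y + t *: x); split=> //.
  apply: contraNneq z0 => zp; apply/eqP/sep => //; first exact: pi0.
  apply: mod_zero; apply/eqP; rewrite -sqrf_eq0 -fz' zp expr0n; exact: eqxx.
have dS x : S x = 0 -> lam x * mu x <= pi x ^+ 2.
  move=> Sx; rewrite leNgt; apply/negP => lt.
  have x0 : x != 0.
    by apply: contraTneq lt => ->; rewrite (linf0 llam) mul0r -leNgt sqr_ge0.
  have [y y0 [yl yr yi]] := linf_zero3 llam S0 S1; have Sy := parts_eq0 yr yi.
  have [||s [t [z0 fz]]] := quad_zero (quadfB prod_quad sq_pi) y0 x0.
  - by rewrite /= yl mul0r sub0r oppr_le0 sqr_ge0.
  - by rewrite /= subr_ge0 ltW.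
  apply: no; right; exists (s *: y + t *: x); split=> //; first exact: linc_zero.
  by apply/eqP; rewrite -subr_eq0 fz.
have [|x [y [exy xl xm yr yi]]] := linf_split e llam lmu S0 S1.
  move=> x xl xm sr si; have Sx := parts_eq0 sr si; apply: sep => //; apply: pi0.
  by apply/eqP; rewrite -sqrf_eq0 eq_le sqr_ge0 (le_trans (dlm _ xl xm)) // Sx mod0 expr0n.
have Sy := parts_eq0 yr yi.
have b1 : `|pi x| <= nS x by apply: abs_le (modulus_ge0 _) _; exact: dlm.
have eS : nS e = nS x by rewrite exy linc_add // Sy addr0.
have el : lam e * mu e = lam y * mu y by rewrite exy !linfD // xl xm !add0r.
have b2 : `|pi y| <= nP e + nS e.
  have -> : pi y = pi e - pi x by rewrite exy (linfD lpi) addrC addKr.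
  by rewrite -piP eS (le_trans (ler_normB _ _)) // lerD2l.
have := gram; rewrite ltNge => /negP; apply; rewrite el (le_trans (dS _ Sy)) //.
rewrite -[pi y ^+ 2]real_normK ?num_real // ler_sqr ?nnegrE ?addr_ge0 ?modulus_ge0 //.
Qed.

(** Let [x] have [lam = mu = 0] and [pi^2 = |S|^2 <> 0]. Subtracting a
    multiple of it from [e] leads into the plane [pi = 0], without changing
    [lam] and [mu] and with [|S|] at most [|P(e)| + |S(e)|]; so [lam mu -
    |S|^2] would change sign on that plane. *)
Lemma real_form_conic : (forall x, x != 0 -> pi x = 0 -> lam x * mu x <> nS x ^+ 2) ->
  forall x, lam x = 0 -> mu x = 0 -> pi x ^+ 2 = nS x ^+ 2 -> pi x = 0.
Proof.
move=> no x xl xm xp; apply/eqP/negPn/negP => px.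
pose t := - (pi e / pi x); pose z := 1 *: e + t *: x.
have zp : pi z = 0 by rewrite lpi /t; field.
have zl : lam z = lam e by rewrite llam xl mulr0 addr0 mul1r.
have zm : mu z = mu e by rewrite lmu xm mulr0 addr0 mul1r.
have zS : nS z <= nP e + nS e.
  have -> : S z = S e + t%:C%C * S x.
    have := S0 1 t e x; have := S1 1 t e x; rewrite -/z /=.
    case: (S z) (S e) (S x) => u v [u1 v1] [u2 v2] /= -> ->; rewrite !mul1r.
    by simpc.
  rewrite (le_trans (modulusD _ _)) // addrC lerD2r modulusM modulus_real.
  have -> : nS x = `|pi x| by apply/eqP; rewrite -(@eqrXn2 _ 2) ?modulus_ge0 // real_normK ?num_real // xp.
  by rewrite /t normrN normrM normfV divfK ?normr_eq0 // piP.
have dz : lam z * mu z <= nS z ^+ 2.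
  rewrite leNgt; apply/negP => lt; have z0 : z != 0.
    by apply: contra_eq_neq zl => ->; rewrite (linf0 llam) eq_sym.
  have [y y0 [yl yp _]] := linf_zero3 llam lpi lpi.
  have [||s [s' [w0 fw]]] := quad_zero (quadfB prod_quad (modulus_quad lS)) y0 z0.
  - by rewrite /= yl mul0r sub0r oppr_le0 sqr_ge0.
  - by rewrite /= subr_ge0 ltW.
  apply: (no _ w0); first exact: lin_zero.
  by apply/eqP; rewrite -subr_eq0 fw.
have := gram; rewrite ltNge => /negP; apply; rewrite -zl -zm (le_trans dz) //.
by rewrite ler_sqr ?nnegrE ?addr_ge0 ?modulus_ge0.
Qed.

End RealForm.

End RealPairing.

(** * Symmetroids with a double conic *)

Lemma nb_rows (K : fieldType) (P : 'rV[K]_4 -> Prop) (Y : 'M[K]_4) : Y \in unitmx ->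
  (forall y, y != 0 -> (P y <-> exists i, (y == row i Y)%MS)) -> nb_points P 4.
Proof.
rewrite -row_free_unit => fY hP; apply/nb_pointsP; exists [seq row i Y | i <- enum 'I_4].
have rE i : row i Y = delta_mx 0 i *m Y by rewrite rowE.
have d0 (i : 'I_4) : delta_mx 0 i != 0 :> 'rV[K]_4.
  by apply/eqP => /rowP/(_ i)/eqP; rewrite !mxE !eqxx oner_eq0.
have r0 i : row i Y != 0 by rewrite rE mulmx_free_eq0.
split=> [| | |y y0]; first by rewrite size_map size_enum_ord.
- by apply/allP => _ /mapP[i _ ->].
- rewrite -map_comp map_inj_in_uniq ?enum_uniq // => i j _ _ /= /(pt_eqP (r0 i))[c _].
  rewrite !rE scalemxAl => /eqP; rewrite -subr_eq0 -mulmxBl mulmx_free_eq0 // subr_eq0.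
  move=> /eqP/rowP/(_ i); rewrite !mxE !eqxx /=.
  by have [//|_ /eqP] := eqVneq i j; rewrite mulr0 oner_eq0.
- rewrite (hP _ y0) -map_comp; split=> [[k ]|/mapP[i _ e]].
    by rewrite ptE => /eqP ->; apply/mapP; exists k => //; rewrite mem_enum.
  by exists i; rewrite ptE e.
Qed.

Lemma nb_pos (K : fieldType) (P : 'rV[K]_4 -> Prop) n x : nb_points P n -> x != 0 -> P x ->
  (0 < n)%N.
Proof. by move=> /nb_pointsP[[|y s] [<- _ _ Ps]] x0 // /(Ps _ x0). Qed.

Section RealValues.
Variable R : realType.
Local Notation C := R[i].

Let real_eq (r r' : R) : (r%:C%C = r'%:C%C) = (r = r').
Proof. by apply/propext; split=> [[]|->]. Qed.
Let realM (r r' : R) : r%:C%C * r'%:C%C = (r * r')%:C%C.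
Proof. by rewrite rmorphM. Qed.
Let conj_z (z : C) : (conjc z = 0) = (z = 0).
Proof. by apply/propext; split=> [/eqP|->]; [rewrite conjc_eq0 => /eqP | rewrite conjc0]. Qed.

Lemma real_conic_values (lam : R) (L P P' S S' : C) (X : bool) :
    L = lam%:C%C -> P' = conjc P -> S' = conjc S ->
  [/\ X, L = 0 & P * P' = S * S'] <-> [/\ X, lam = 0 & modulus P ^+ 2 = modulus S ^+ 2].
Proof. by move=> -> -> ->; rewrite !mul_conj !real_eq. Qed.

Lemma real_node_values (lam mu : R) (L M P P' S S' : C) :
    L = lam%:C%C -> M = mu%:C%C -> P' = conjc P -> S' = conjc S ->
  (L != 0 /\ ([/\ P = 0, P' = 0 & L * M = S * S'] \/ [/\ S = 0, S' = 0 & L * M = P * P'])) <->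
  (lam != 0 /\ ((P = 0 /\ lam * mu = modulus S ^+ 2) \/ (S = 0 /\ lam * mu = modulus P ^+ 2))).
Proof.
move=> -> -> -> ->; rewrite (fmorph_eq0 (real_complex R)) realM !mul_conj !real_eq !conj_z.
by split=> -[l0 [[]|[]]]; split=> //; [left | right | left | right].
Qed.

Lemma real_conic_values' (lam mu : R) (L M P S S' : C) (X : bool) :
    L = lam%:C%C -> M = mu%:C%C -> S' = conjc S ->
  [/\ X, P = 0 & L * M = S * S'] <-> [/\ X, P = 0 & lam * mu = modulus S ^+ 2].
Proof. by move=> -> -> ->; rewrite realM !mul_conj real_eq. Qed.

Lemma real_node_values' (lam mu : R) (L M P P' S S' : C) :
    L = lam%:C%C -> M = mu%:C%C -> P' = conjc P -> S' = conjc S ->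
  (P != 0 /\ ([/\ L = 0, M = 0 & P * P' = S * S'] \/ [/\ S = 0, S' = 0 & P * P' = L * M])) <->
  (P != 0 /\ ([/\ lam = 0, mu = 0 & modulus P ^+ 2 = modulus S ^+ 2] \/
              (S = 0 /\ modulus P ^+ 2 = lam * mu))).
Proof.
move=> -> -> -> ->; rewrite realM !mul_conj !real_eq !conj_z.
by split=> -[l0 [[]|[]]]; split=> //; [left | right | left | right].
Qed.

Lemma real_product (lam mu : R) (L M P P' : C) : L = lam%:C%C -> M = mu%:C%C -> P' = conjc P ->
  lam * mu = modulus P ^+ 2 -> P * P' = L * M.
Proof. by move=> -> -> -> e; rewrite realM mul_conj e. Qed.

Lemma real_ratio (c : C) (l m l' m' : R) : l' != 0 -> m%:C%C = c * l%:C%C ->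
  m'%:C%C = c * l'%:C%C -> m = m' / l' * l.
Proof.
move=> l0 e e'; apply: (mulIf l0); rewrite mulrAC divfK //.
by apply: (@complexI R); rewrite -!realM e e' mulrAC.
Qed.

(** At a node the two forms of a pairing vanish together. *)
Lemma node_opposite (K : fieldType) (c l m p s q r : K) : m = c * l -> c != 0 ->
    l != 0 /\ ([/\ p = 0, s = 0 & l * m = q * r] \/ [/\ q = 0, r = 0 & l * m = p * s]) ->
  s = 0 <-> p = 0.
Proof.
move=> -> c0 [l0 [[-> ->]|[_ _ d]]] //.
have : p * s != 0 by rewrite -d !mulf_neq0.
by rewrite mulf_eq0 negb_or => /andP[/eqP p0 /eqP s0].
Qed.

End RealValues.

Section TypeC.
Variables (R : realType) (A : 'I_4 -> 'M[R]_4).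
Hypothesis hsym : forall k, (A k)^T = A k.
Local Notation C := R[i].
Local Notation AC := (cplx_web A).
Local Notation f := (sym_poly AC).
Let csy := csym hsym.

Lemma conj_frame e (Y : 'M[C]_4) : definite (web_mx A e) -> Y \in unitmx ->
    (forall y, y != 0 -> (basepoint AC y <-> exists i, (y == row i Y)%MS)) ->
  exists y1 y2, frame AC y1 (conj_mx y1) y2 (conj_mx y2).
Proof.
move=> de uY hY; have nb4 := nb_rows uY hY.
have [y1 y10 hy1] := nb_ex nb4 isT; have hc1 := conj_basepoint hy1.
have [y2 [hy2 n21 n2c1 nc21 nc2c1]] := second_pair de nb4 isT hy1.
have hc2 := conj_basepoint hy2; exists y1, y2. split; [exact: hy1 | exact: hc1 | exact: hy2 | exact: hc2 |].
pose t := [seq pt i | i <- [:: y1; conj_mx y1; y2; conj_mx y2]].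
have ut : uniq t.
  have q (M M' : 'M[C]_4) : M != M' -> M' != M by rewrite eq_sym.
  have n1 := q _ _ (no_real_basepoint hsym de hy1); have n2 := q _ _ (no_real_basepoint hsym de hy2).
  by rewrite /= !inE !negb_or n1 n2 (q _ _ n21) (q _ _ nc21) (q _ _ n2c1) (q _ _ nc2c1).
have [s [ss s0 us Ps]] := (nb_pointsP _ _).1 nb4.
have ts : {subset t <= [seq pt i | i <- s]}.
  move=> M; rewrite !inE => /or4P[] /eqP ->.
  - by apply/Ps => //; case: hy1.
  - by apply/Ps => //; case: hc1.
  - by apply/Ps => //; case: hy2.
  - by apply/Ps => //; case: hc2.
have st : (size [seq pt i | i <- s] <= size t)%N by rewrite size_map ss.
have [_ st'] := uniq_min_size ut ts st.
rewrite row_free_unit -row_full_unit -sub1mx.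
apply: (submx_trans (B := Y)); first by rewrite sub1mx row_full_unit.
apply/row_subP => i; have r0 : row i Y != 0.
  rewrite rowE mulmx_free_eq0 ?row_free_unit //.
  by apply/eqP => /rowP/(_ i)/eqP; rewrite !mxE !eqxx oner_eq0.
have : pt (row i Y) \in t.
  by rewrite st'; apply/(Ps _ r0)/(hY _ r0); exists i; rewrite ptE.
set M := rows 4 _; have sub j : (j < 4)%N ->
    pt (row i Y) = pt (nth 0 [:: y1; conj_mx y1; y2; conj_mx y2] j) -> (row i Y <= M)%MS.
  move=> j4 /(pt_eqP r0)[c _ ->]; apply: scalemx_sub.
  have <- : row (Ordinal j4) M = nth 0 [:: y1; conj_mx y1; y2; conj_mx y2] j by rewrite row_rows.
  exact: row_sub.
rewrite !inE => /or4P[] /eqP e'.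
- exact: (sub 0%N).
- exact: (sub 1%N).
- exact: (sub 2%N).
- exact: (sub 3%N).
Qed.

Variables (E : 'M[C]_(3, 4)) (Q : 'M[C]_3) (e : 'rV[R]_4) (a b : nat).
Hypothesis smooth : smooth_conic E Q.
Hypothesis sing : singular_along f (on_conic E Q).
Hypothesis rank2 : rank_along AC 2 (on_conic E Q).
Hypothesis nodes : nb_points (isolated_node AC) 4.
Hypothesis cover : forall x, singular_point f x -> on_conic E Q x \/ isolated_node AC x.
Hypothesis bpts : nb_points (basepoint AC) 4.
Hypothesis de : definite (web_mx A e).
Hypotheses (ha : nb_points (real_node A) a) (hb : nb_points (boundary_node A) b).
Implicit Types (x : 'rV[R]_4).

Let vanishes (y z : 'rV[C]_4) := forall x : 'rV[C]_4, (x <= E)%MS -> wf AC y z x = 0.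

(** Each of the two classes of nodes is a conjugation-invariant pair. *)
Lemma split_real_nodes (y z : 'rV[C]_4) :
    nb_points (fun x : 'rV[C]_4 => isolated_node AC x /\ wf AC y z x = 0) 2 ->
    nb_points (fun x : 'rV[C]_4 => isolated_node AC x /\ wf AC y z x <> 0) 2 ->
    (forall x : 'rV[C]_4, isolated_node AC x -> (wf AC y z (conj_mx x) = 0 <-> wf AC y z x = 0)) ->
  exists a1 a2, [/\ a = (a1 + a2)%N, (a1 == 0%N) || (a1 == 2%N), (a2 == 0%N) || (a2 == 2%N),
    nb_points (fun x => real_node A x /\ wf AC y z (cplx x) = 0) a1 &
    nb_points (fun x => real_node A x /\ wf AC y z (cplx x) <> 0) a2].
Proof.
move=> h1 h2 cj; have [|a1 [a2 [aa n1 n2]]] := nb_split (Q := fun x => wf AC y z (cplx x) = 0) ha.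
  move=> k x _ _ e0; have -> : cplx (k *: x) = k%:C%C *: cplx x.
    by apply/rowP => j; rewrite !mxE rmorphM.
  by rewrite wfZ e0 mulr0.
exists a1, a2; have [l1 p1] : (a1 <= 2)%N /\ odd a1 = odd 2.
  apply: nb_real h1 n1 _ => x [nx w0]; split; first exact: conj_isolated_node.
  exact/cj.
have [l2 p2] : (a2 <= 2)%N /\ odd a2 = odd 2.
  apply: nb_real h2 n2 _ => x [nx w0]; split; first exact: conj_isolated_node.
  by move/(cj _ nx).
have even2 k : (k <= 2)%N -> odd k = odd 2 -> (k == 0%N) || (k == 2%N) by case: k => [|[|[|]]].
by split=> //; exact: even2.
Qed.

Lemma conj_zeroE (y z x : 'rV[C]_4) :
  wf AC y z (conj_mx x) = 0 <-> wf AC (conj_mx y) (conj_mx z) x = 0.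
Proof.
rewrite -{2}(conj_mxK x) conj_wf.
by split=> [->|/eqP]; rewrite ?conjc0 // conjc_eq0 => /eqP.
Qed.

Section ConjugatePairs.
Variables (y1 y2 : 'rV[C]_4).
Hypothesis fr : frame AC y1 (conj_mx y1) y2 (conj_mx y2).
Local Notation lam := (ref A y1 (conj_mx y1)).
Local Notation mu := (ref A y2 (conj_mx y2)).
Let P x := wf AC y1 y2 (cplx x).
Let S x := wf AC y1 (conj_mx y2) (cplx x).

Let h1 : basepoint AC y1. Proof. case: fr => h _ _ _ _; exact: h. Qed.
Let h2 : basepoint AC y2. Proof. case: fr => _ _ h _ _; exact: h. Qed.
Let lamE x : wf AC y1 (conj_mx y1) (cplx x) = (lam x)%:C%C.
Proof. exact: ref_basepoint. Qed.
Let muE x : wf AC y2 (conj_mx y2) (cplx x) = (mu x)%:C%C.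
Proof. exact: ref_basepoint. Qed.
Let Pc x : wf AC (conj_mx y1) (conj_mx y2) (cplx x) = conjc (P x).
Proof. exact: wf_conj. Qed.
Let Sc x : wf AC (conj_mx y1) y2 (cplx x) = conjc (S x).
Proof. by rewrite -wf_conj conj_mxK. Qed.
Let llam : linf lam := @ref_linf R A y1 (conj_mx y1).
Let lmu : linf mu := @ref_linf R A y2 (conj_mx y2).
Let lP : linf (fun x => complex.Re (P x)) /\ linf (fun x => complex.Im (P x)).
Proof. split; [exact: ref_linf | exact: imf_linf]. Qed.
Let lS : linf (fun x => complex.Re (S x)) /\ linf (fun x => complex.Im (S x)).
Proof. split; [exact: ref_linf | exact: imf_linf]. Qed.
Let gram := definite_frame hsym de fr.

Let sep x : lam x = 0 -> mu x = 0 -> P x = 0 -> S x = 0 -> x = 0.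
Proof.
move=> l0 m0 p0 s0; apply/eqP; rewrite -(cplx_eq0 x); apply/eqP.
have c0 (z : C) : z = 0 -> conjc z = 0 by move->; rewrite conjc0.
have r0 (r : R) : r = 0 -> r%:C%C = 0 by move->.
exact: (frame_separates csy rank2 cover fr (etrans (lamE x) (r0 _ l0)) (etrans (muE x) (r0 _ m0))
  p0 (etrans (Pc x) (c0 _ p0)) s0 (etrans (Sc x) (c0 _ s0))).
Qed.

Let not_semidefinite x : x != 0 -> lam x = 0 -> mu x = 0 -> ~ semidefinite (web_mx A x).
Proof.
move=> x0 l0 m0 sx; case/eqP: x0.
have [k1 c1] := semidefinite_isotropic hsym h1 sx (etrans (lamE x) (congr1 _ l0)).
by apply: sep => //; exact: bf_ker.
Qed.

Let semidefinite_lam x : (\rank (web_mx A x) <= 2)%N -> lam x != 0 -> semidefinite (web_mx A x).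
Proof.
move=> rx l0; apply: (semidefinite_basepoint hsym h1) => //.
by rewrite lamE (fmorph_eq0 (real_complex R)).
Qed.

Let semidefinite_mu x : (\rank (web_mx A x) <= 2)%N -> mu x != 0 -> semidefinite (web_mx A x).
Proof.
move=> rx l0; apply: (semidefinite_basepoint hsym h2) => //.
by rewrite muE (fmorph_eq0 (real_complex R)).
Qed.

Let real_node_boundary x : real_node A x -> lam x != 0 -> boundary_node A x.
Proof.
move=> nx l0; apply: boundary_node_of => //; apply: semidefinite_lam => //.
by have [_ ->] := real_node_rank nx.
Qed.

(** The conjugation-invariant pairing cuts out the plane of the conic, where
    [lam] and [mu] vanish: no real point of it is semidefinite, and all real
    nodes are. *)
Lemma proportional_real_conic : vanishes y1 (conj_mx y1) -> vanishes y2 (conj_mx y2) ->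
  [/\ exists x, on_conic E Q (cplx x),
      forall x, on_conic E Q (cplx x) -> ~ in_spectrahedron A x &
      (a = 2%N /\ b = 2%N) \/ (a = 4%N /\ b = 4%N)].
Proof.
move=> v1 v2; have [[c c0 prop] conE nodeE [nb1 [nb2 _]]] :=
  double_conic_nodes csy (@complex_quadratic R) smooth rank2 nodes cover bpts fr v1 v2.
have conR x : on_conic E Q (cplx x) <->
    [/\ x != 0, lam x = 0 & modulus (P x) ^+ 2 = modulus (S x) ^+ 2].
  by rewrite -(cplx_eq0 x); exact: iff_trans (conE _) (real_conic_values _ (lamE x) (Pc x) (Sc x)).
have nodeR x : real_node A x <-> lam x != 0 /\ ((P x = 0 /\ lam x * mu x = modulus (S x) ^+ 2) \/
    (S x = 0 /\ lam x * mu x = modulus (P x) ^+ 2)).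
  exact: iff_trans (nodeE _) (real_node_values (lamE x) (muE x) (Pc x) (Sc x)).
have le0 : lam e != 0 by apply: contraTneq gram => ->; rewrite mul0r -leNgt sqr_ge0.
have muk x : mu x = mu e / lam e * lam x.
  apply: (real_ratio (c := c)) => //.
    by rewrite -muE -lamE; exact: prop.
  by rewrite -muE -lamE; exact: prop.
have [a1 [a2 [ea e1 e2 n1 n2]]] : exists a1 a2, [/\ a = (a1 + a2)%N,
    (a1 == 0%N) || (a1 == 2%N), (a2 == 0%N) || (a2 == 2%N),
    nb_points (fun x => real_node A x /\ P x = 0) a1 &
    nb_points (fun x => real_node A x /\ P x <> 0) a2].
  apply: (split_real_nodes nb1 nb2) => x nx.
  apply: iff_trans (conj_zeroE _ _ _) _; exact: node_opposite (prop x) c0 ((nodeE x).1 nx).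
have a12 : ((0 < a1) || (0 < a2))%N.
  have [x nx] := proportional_node llam lmu lP lS sep gram muk.
  have x0 : x != 0 by apply: contraTneq nx.1 => ->; rewrite (linf0 llam) eqxx.
  have rn := (nodeR x).2 nx; have [p0|p0] := pselect (P x = 0).
    by rewrite (nb_pos n1 x0).
  by rewrite orbC (nb_pos n2 x0).
have ab : b = a.
  apply: nb_uniq hb ha _ => x x0; split=> [[]//|nx].
  by have [l0 _] := (nodeR x).1 nx; exact: (real_node_boundary nx l0).
split.
- have [x [x0 l0 ps]] := proportional_conic llam lP lS; exists x.
  exact: (conR x).2 (And3 x0 l0 ps).
- move=> x /conR[x0 l0 _] [_ sx]; apply: (not_semidefinite x0 l0) sx.
  by rewrite muk l0 mulr0.
- rewrite ab; move: ea e1 e2 a12; clear => ->.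
    by move=> /orP[]/eqP-> /orP[]/eqP-> // _; [left | left | right].
Qed.

(** The forms [P] and [P^*] cut out the plane of the conic. Its real points
    satisfy [lam mu = |S|^2] and are semidefinite since not both [lam] and
    [mu] vanish; of the two pairs of nodes, the one on [lam = mu = 0] is not
    semidefinite and the one on [S = 0] is. If the conic has no real point,
    [real_form_conic] excludes the first pair. *)
Lemma conjugate_real_conic : vanishes y1 y2 -> vanishes (conj_mx y1) (conj_mx y2) ->
  ([/\ exists x, on_conic E Q (cplx x) & forall x, on_conic E Q (cplx x) -> on_boundary A x] /\
   [/\ (b <= a)%N, (a <= b + 2)%N, (b + 2 <= 4)%N, ~~ odd a /\ ~~ odd b & (2 <= a)%N]) \/
  ((forall x, ~ on_conic E Q (cplx x)) /\ (a = 2%N /\ b = 2%N)).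
Proof.
move=> v1 v2; have [[c c0 prop] conE nodeE [nb1 [nb2 allII]]] := double_conic_nodes csy
  (@complex_quadratic R) smooth rank2 nodes cover bpts (frame_swap23 fr) v1 v2.
have Sc' x : wf AC y2 (conj_mx y1) (cplx x) = conjc (S x).
  by rewrite (wfC csy y2); exact: Sc.
have conR x : on_conic E Q (cplx x) <->
    [/\ x != 0, P x = 0 & lam x * mu x = modulus (S x) ^+ 2].
  rewrite -(cplx_eq0 x).
  exact: iff_trans (conE _) (real_conic_values' _ _ (lamE x) (muE x) (Sc' x)).
have nodeR x : real_node A x <-> P x != 0 /\ ([/\ lam x = 0, mu x = 0 &
      modulus (P x) ^+ 2 = modulus (S x) ^+ 2] \/ (S x = 0 /\ modulus (P x) ^+ 2 = lam x * mu x)).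
  exact: iff_trans (nodeE _) (real_node_values' (lamE x) (muE x) (Pc x) (Sc' x)).
have typeII x : x != 0 -> S x = 0 -> lam x * mu x = modulus (P x) ^+ 2 -> real_node A x.
  move=> x0 s0 d; apply: allII; first by rewrite cplx_eq0.
  - exact: s0.
  - by rewrite Sc' s0 conjc0.
  - exact: (real_product (lamE x) (muE x) (Pc x) d).
have [pi [lpi piP]] : exists pi, linf pi /\ forall x, `|pi x| = modulus (P x).
  by apply: (real_up_to_phase (c := c) lP.1 lP.2) => x; rewrite -Pc; exact: prop.
have pisq x : pi x ^+ 2 = modulus (P x) ^+ 2 by rewrite -piP real_normK ?num_real.
have pi0 x : pi x = 0 -> P x = 0.
  by move=> h; apply/eqP; rewrite -modulus_eq0 -piP h normr0.
have [a1 [a2 [ea e1 e2 n1 n2]]] : exists a1 a2, [/\ a = (a1 + a2)%N,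
    (a1 == 0%N) || (a1 == 2%N), (a2 == 0%N) || (a2 == 2%N),
    nb_points (fun x => real_node A x /\ wf AC y1 (conj_mx y1) (cplx x) = 0) a1 &
    nb_points (fun x => real_node A x /\ wf AC y1 (conj_mx y1) (cplx x) <> 0) a2].
  apply: (split_real_nodes nb1 nb2) => x nx.
  by split=> /eqP h; apply/eqP; move: h; rewrite wf_conj_eq0.
have lamC x : wf AC y1 (conj_mx y1) (cplx x) = 0 <-> lam x = 0.
  by rewrite lamE; split=> [[]|->].
have a12 : ((0 < a1) || (0 < a2))%N.
  suff [x x0 rn] : exists2 x, x != 0 & real_node A x.
    have [p0|p0] := pselect (wf AC y1 (conj_mx y1) (cplx x) = 0).
      by rewrite (nb_pos n1 x0).
    by rewrite orbC (nb_pos n2 x0).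
  have [[x [px l0 m0 ps]]|[x [x0 s0 d]]] := real_form_zero llam lmu lS sep gram lpi piP.
    exists x; first by apply: contraNneq px => ->; rewrite (linf0 lpi).
    apply/nodeR; rewrite -pisq; split; last by left.
    by rewrite -modulus_eq0 -piP normr_eq0.
  by exists x => //; apply: typeII => //; rewrite -pisq.
have ba : b = a2.
  apply: nb_uniq hb n2 _ => x x0; split=> [[nx [_ [_ sx]]]|[nx l0]].
    split=> // /lamC l0; have [px [[_ m0 _]|[s0 d]]] := (nodeR x).1 nx.
      exact: (not_semidefinite x0 l0 m0) sx.
    by move: px; rewrite -modulus_eq0 -sqrf_eq0 d l0 mul0r eqxx.
  by apply: (real_node_boundary nx); apply/eqP => /lamC.
have [ex|no] := pselect (exists x, on_conic E Q (cplx x)); [left | right].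
  split.
    split=> // x cx; have [x0 p0 d] := (conR x).1 cx; have [_ rx] := rank2 cx.
    rewrite cplx_rank in rx; apply/boundaryE => //; first by rewrite rx.
    have [l0|l0] := eqVneq (lam x) 0; last by apply: semidefinite_lam; rewrite ?rx.
    have [m0|m0] := eqVneq (mu x) 0; last by apply: semidefinite_mu; rewrite ?rx.
    case/eqP: x0; apply: sep => //; apply/eqP; rewrite -modulus_eq0 -sqrf_eq0 -d l0 mul0r.
    exact: eqxx.
  by rewrite ba ea; move: e1 e2 a12; clear; move=> /orP[]/eqP-> /orP[]/eqP->.
have no' x : ~ on_conic E Q (cplx x) by move=> cx; apply: no; exists x.
have a10 : a1 = 0%N.
  have [//|pos] := posnP a1; have [x x0 [nx /lamC l0]] := nb_ex n1 pos.
  have [px h] := (nodeR x).1 nx; case/eqP: px; apply: (pi0 x).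
  case: h => [[_ m0 ps]|[s0 d]].
    apply: (real_form_conic llam lmu lS gram lpi piP) l0 m0 _; last by rewrite pisq.
    by move=> z z0 /pi0 pz d; apply: (no' z); apply/conR.
  by apply/eqP; rewrite -sqrf_eq0 pisq d l0 mul0r.
split=> //; rewrite ba ea a10 add0n; move: e2 a12; rewrite a10; clear.
by move=> /orP[]/eqP->.
Qed.

End ConjugatePairs.
End TypeC.

(** Conjugation fixes both forms of one of the three pairings of the
    basepoints, and exchanges the two forms of each of the other pairings;
    replacing [y2] by its conjugate identifies the last two cases. *)
Theorem typeC_spectrahedron (R : realType) (A : 'I_4 -> 'M[R]_4) (a b : nat)
    (AC := cplx_web A) (f := sym_poly AC) :
    (forall k, (A k)^T = A k) -> spectrahedral A ->
    nb_points (real_node A) a -> nb_points (boundary_node A) b -> typeC AC ->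
  [\/ (exists (E : 'M[R[i]]_(3, 4)) (Q : 'M[R[i]]_3),
        [/\ smooth_conic E Q, singular_along f (on_conic E Q),
            (exists x : 'rV[R]_4, on_conic E Q (cplx x)) &
            (forall x : 'rV[R]_4, on_conic E Q (cplx x) -> on_boundary A x)]) /\
      [/\ (b <= a)%N, (a <= b + 2)%N, (b + 2 <= 4)%N, ~~ odd a /\ ~~ odd b & (2 <= a)%N],
      (exists (E : 'M[R[i]]_(3, 4)) (Q : 'M[R[i]]_3),
        [/\ smooth_conic E Q, singular_along f (on_conic E Q),
            (exists x : 'rV[R]_4, on_conic E Q (cplx x)) &
            (forall x : 'rV[R]_4, on_conic E Q (cplx x) -> ~ in_spectrahedron A x)]) /\
      ((a = 2%N /\ b = 2%N) \/ (a = 4%N /\ b = 4%N)) |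
      (exists (E : 'M[R[i]]_(3, 4)) (Q : 'M[R[i]]_3),
        [/\ smooth_conic E Q, singular_along f (on_conic E Q) &
            forall x : 'rV[R]_4, ~ on_conic E Q (cplx x)]) /\
      (a = 2%N /\ b = 2%N)].
Proof.
move=> hsym [e de] ha hb [[E [Q [smooth sing rank2 nodes cover]]] [Y [uY hY]]].
have csy := csym hsym; have bpts := nb_rows uY hY.
have [y1 [y2 fr]] := conj_frame hsym de uY hY.
have conj_case := conjugate_real_conic hsym smooth rank2 nodes cover bpts de ha hb.
have [[v1 v2]|v|v] := conic_pairing csy (@complex_quadratic R) smooth rank2 nodes cover fr.
- have [h1 h2 h3] := proportional_real_conic hsym smooth rank2 nodes cover bpts de ha hb fr v1 v2.
  by constructor 2; split=> //; exists E, Q.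
- case: v => v1 v2; case: (conj_case _ _ fr v1 v2) => [[[h1 h2] h3]|[h1 h2]].
    by constructor 1; split=> //; exists E, Q.
  by constructor 3; split=> //; exists E, Q.
- case: v => v1 v2.
  have fr' : frame AC y1 (conj_mx y1) (conj_mx y2) (conj_mx (conj_mx y2)).
    by rewrite conj_mxK; exact: frame_swap34.
  rewrite -{1}(conj_mxK y2) in v2; case: (conj_case _ _ fr' v1 v2) => [[[h1 h2] h3]|[h1 h2]].
    by constructor 1; split=> //; exists E, Q.
  by constructor 3; split=> //; exists E, Q.
Qed.
Theorem theorem1p7 (R : realType) (A : 'I_4 -> 'M[R]_4)
    (hsym : forall k, (A k)^T = A k)
    (hspec : spectrahedral A)
    (hrat : rational_surface (sym_poly (cplx_web A)))
    (a b : nat)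
    (ha : nb_points (real_node A) a)
    (hb : nb_points (boundary_node A) b) :
  let AC := cplx_web A in
  let f := sym_poly AC in
  [/\ (* A *)
      (typeA AC ->
        (exists x : 'rV[R]_4, triple_point f (cplx x) /\ on_boundary A x) /\
        [/\ (b <= a)%N, (a <= 6)%N & ~~ odd a]),
      (* B *)
      (typeB AC ->
        ((exists x : 'rV[R]_4, tacnode f (cplx x) /\ on_boundary A x) \/
         (exists x : 'rV[R]_4, tacnode f (cplx x) /\ ~ in_spectrahedron A x)) /\
        [/\ (b <= a)%N, (a <= b + 2)%N, (b + 2 <= 6)%N, ~~ odd a & ~~ odd b]),
      (* C *)
      (typeC AC ->
        [\/ (exists (E : 'M[R[i]]_(3, 4)) (Q : 'M[R[i]]_3),
              [/\ smooth_conic E Q,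
                  singular_along f (on_conic E Q),
                  (exists x : 'rV[R]_4, on_conic E Q (cplx x)) &
                  (forall x : 'rV[R]_4, on_conic E Q (cplx x) ->
                     on_boundary A x)]) /\
            [/\ (b <= a)%N, (a <= b + 2)%N, (b + 2 <= 4)%N,
                ~~ odd a /\ ~~ odd b & (2 <= a)%N],
            (exists (E : 'M[R[i]]_(3, 4)) (Q : 'M[R[i]]_3),
              [/\ smooth_conic E Q,
                  singular_along f (on_conic E Q),
                  (exists x : 'rV[R]_4, on_conic E Q (cplx x)) &
                  (forall x : 'rV[R]_4, on_conic E Q (cplx x) ->
                     ~ in_spectrahedron A x)]) /\
            ((a = 2%N /\ b = 2%N) \/ (a = 4%N /\ b = 4%N)) |
            (exists (E : 'M[R[i]]_(3, 4)) (Q : 'M[R[i]]_3),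
              [/\ smooth_conic E Q,
                  singular_along f (on_conic E Q) &
                  forall x : 'rV[R]_4, ~ on_conic E Q (cplx x)]) /\
            (a = 2%N /\ b = 2%N)]),
      (* D *)
      (typeD AC ->
        (exists E : 'M[R[i]]_(2, 4),
          [/\ row_free E,
              rank_along AC 2 (on_line E) &
              forall x : 'rV[R]_4, on_line E (cplx x) -> ~ on_boundary A x]) /\
        [/\ (b <= a)%N, (a <= b + 2)%N, (b + 2 <= 6)%N, ~~ odd a & ~~ odd b]) &
      (* F *)
      (typeF AC ->
        ((exists (E : 'M[R[i]]_(2, 4)) (x : 'rV[R]_4),
            conj_double_lines A E x /\ on_boundary A x) \/
         (exists (E : 'M[R[i]]_(2, 4)) (x : 'rV[R]_4),
            conj_double_lines A E x /\ ~ in_spectrahedron A x)) /\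
        [/\ a = b, (a <= 2)%N & ~~ odd a])].
Proof.
have [irr _] := hrat; split=> h.
- exact: (typeA_spectrahedron hsym hspec ha hb h).
- exact: (typeB_spectrahedron hsym hspec ha hb h).
- exact: (typeC_spectrahedron hsym hspec ha hb h).
- exact: (typeD_spectrahedron hsym hspec ha hb h).
- exact: (typeF_spectrahedron hsym hspec irr ha hb h).
Qed.
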